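(* Let $n\ge1$ and, for $0<\beta<n$, let $K(x)=\frac{x}{|x|^{n+1-\beta}}$ for $x\in\mathbb{R}^n\setminus\{0\}$. Let $\chi\in C_0^\infty(\mathbb{R})$ be a fixed cut-off function with $\chi(r)=1$ for $|r|\le1$, $\chi(r)=0$ for $|r|\ge2$ and $|\chi'|\le2$, and put $\chi_\beta(r)=\chi(\beta r)$. Define the convolution operators $$T_1f=K_1*f,\quad K_1(x)=K(x)\chi_\beta(|x|),\qquad T_2f=K_2*f,\quad K_2(x)=K(x)\bigl(1-\chi_\beta(|x|)\bigr).$$ Then there exists a constant $C=C(n,s)$ independent of $\beta$ (and of $f$) such that $$\|T_1f\|_{H^s(\mathbb{R}^n)}\le C\|f\|_{H^s(\mathbb{R}^n)},\qquad s>0,\ 0<\beta<n;$$ $$\|T_2f\|_{L^2(\mathbb{R}^n)}\le C\,\frac{\beta^{n/2}}{\sqrt{n-2\beta}}\,\|f\|_{L^1(\mathbb{R}^n)},\qquad 0<\beta<\tfrac n2;$$ $$\|T_2f\|_{\dot H^s(\mathbb{R}^n)}\le C\left(\frac{\beta}{1-\beta}+\frac{2^\beta-1}{\beta}\,\beta^{-\beta}\right)\|f\|_{\dot H^{s-1}(\mathbb{R}^n)},\qquad s\ge1,\ 0<\beta<1,$$ each inequality holding for all $f$ for which the norm on its right-hand side is finite and the convolution is defined (as an a.e. absolutely convergent integral).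
   Context: $\|f\|_{H^s}=\|(I-\Delta)^{s/2}f\|_{L^2}$ and $\|f\|_{\dot H^s}=\|\Lambda^sf\|_{L^2}$, where $\Lambda^s=(-\Delta)^{s/2}$ is the Fourier multiplier with symbol $|\xi|^s$. The kernels are $\mathbb{R}^n$-valued, so $T_1f,T_2f$ are vector valued and norms are taken of the vector-valued functions. *)

(* Defs.v *)
From HB Require Import structures.
From mathcomp Require Import all_boot all_order all_algebra.
From mathcomp Require Import all_classical all_reals all_analysis.
From mathcomp Require Import complex.

Set Implicit Arguments.
Unset Strict Implicit.
Unset Printing Implicit Defensive.

Import Order.TTheory GRing.Theory Num.Theory.
Import numFieldNormedType.Exports.
Import ComplexField.Normc.

Local Open Scope classical_set_scope.
Local Open Scope ring_scope.

Fact rV_display : measure_display.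
Proof. exact: default_measure_display. Qed.

Section measurable_rV.
Context (R : realType) (n : nat).

Let coords (i : 'I_n) (x : 'rV[R]_n) : measurableTypeR R := x ord0 i.

Let rV_set0 : g_sigma_preimage coords set0.
Proof. exact: sigma_algebra0. Qed.

Let rV_setC A : g_sigma_preimage coords A -> g_sigma_preimage coords (~` A).
Proof. exact: sigma_algebraC. Qed.

Let rV_bigcup (F : (set 'rV[R]_n)^nat) :
  (forall i, g_sigma_preimage coords (F i)) ->
  g_sigma_preimage coords (\bigcup_i F i).
Proof. exact: sigma_algebra_bigcup. Qed.

HB.instance Definition _ := @isMeasurable.Build rV_display
  'rV[R]_n (g_sigma_preimage coords) rV_set0 rV_setC rV_bigcup.

Lemma measurable_coord (i : 'I_n) :
  measurable_fun [set: 'rV[R]_n] (fun x : 'rV[R]_n => x ord0 i).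
Proof.
move=> _ Y mY; rewrite setTI; apply: sub_sigma_algebra => /=.
rewrite -bigcup_seq/=; exists i => /=; first by rewrite mem_index_enum.
by exists Y => //; rewrite setTI.
Qed.

End measurable_rV.

Lemma measurable_fun_coordP (R : realType) d (T : measurableType d) n
    (f : T -> 'rV[R]_n) :
  (forall i, measurable_fun [set: T] (fun x => f x ord0 i)) ->
  measurable_fun [set: T] f.
Proof.
move=> mf _ A mA; rewrite setTI.
pose G : set (set 'rV[R]_n) := [set B | measurable (f @^-1` B)].
suff : measurable `<=` G by apply.
apply: smallest_sub.
  split=> [|B GB|F GF]; rewrite /G /=.
  - by rewrite preimage_set0; exact: measurable0.
  - by rewrite setTD preimage_setC; exact: measurableC.
  - by rewrite preimage_bigcup; exact: bigcupT_measurable.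
rewrite -bigcup_seq/= => B [i _] [C mC <-].
by rewrite /G /= setTI -[X in measurable X]setTI; exact: mf.
Qed.

Definition rV_cons (R : realType) n (p : R * 'rV[R]_n) : 'rV[R]_n.+1 :=
  row_mx (const_mx p.1 : 'rV_1) p.2.

Lemma measurable_rV_cons (R : realType) n :
  measurable_fun [set: measurableTypeR R * 'rV[R]_n] (@rV_cons R n).
Proof.
apply: measurable_fun_coordP => i; rewrite /rV_cons.
case: (@splitP 1 n i) => j ij.
- rewrite (_ : (fun _ => _) = fst); first exact: measurable_fst.
  apply/funext => x /=; rewrite (_ : i = lshift n j); last exact: val_inj.
  by rewrite (@row_mxEl R 1 1 n) mxE.
- rewrite (_ : (fun _ => _) = (fun y : 'rV[R]_n => y ord0 j) \o snd).
    by apply: measurableT_comp; [exact: measurable_coord|exact: measurable_snd].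
  apply/funext => x /=; rewrite (_ : i = rshift 1 j); last exact: val_inj.
  by rewrite (@row_mxEr R 1 1 n).
Qed.

Lemma measurable_head (R : realType) n :
  measurable_fun [set: 'rV[R]_n.+1]
    (fun x : 'rV[R]_n.+1 => x ord0 ord0 : measurableTypeR R).
Proof. exact: measurable_coord. Qed.

Lemma measurable_tail (R : realType) n :
  measurable_fun [set: 'rV[R]_n.+1]
    (fun x : 'rV[R]_n.+1 => (@rsubmx R 1 1 n x) : 'rV[R]_n).
Proof.
apply: measurable_fun_coordP => i.
rewrite (_ : (fun _ => _) = fun x : 'rV[R]_n.+1 => x ord0 (lift ord0 i)).
  exact: measurable_coord.
apply/funext => x; rewrite mxE; congr (x _ _); exact: val_inj.
Qed.

Section lebesgue_step.
Context (R : realType) (n : nat).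
Variable mu : {sigma_finite_measure set 'rV[R]_n -> \bar R}.

Definition lebesgue_step : set 'rV[R]_n.+1 -> \bar R :=
  pushforward (@lebesgue_measure R \x mu)%E (@rV_cons R n).

Let mcons := @measurable_rV_cons R n.

Let step0 : lebesgue_step set0 = 0%E.
Proof. by have := mcons; rewrite /lebesgue_step => mf; apply: measure0. Qed.

Let step_ge0 A : (0 <= lebesgue_step A)%E.
Proof. by have := mcons; rewrite /lebesgue_step => mf; apply: measure_ge0. Qed.

Let step_sigma_additive : semi_sigma_additive lebesgue_step.
Proof. by have := mcons; rewrite /lebesgue_step => mf; apply: measure_semi_sigma_additive. Qed.

HB.instance Definition _ := isMeasure.Build _ _ _ lebesgue_step
  step0 step_ge0 step_sigma_additive.

Lemma lebesgue_stepE (A : set (measurableTypeR R)) (B : set 'rV[R]_n) :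
  measurable A -> measurable B ->
  lebesgue_step [set x : 'rV[R]_(1 + n) | A (x ord0 ord0) /\ B (rsubmx x)]
  = (lebesgue_measure A * mu B)%E.
Proof.
move=> mA mB; rewrite -product_measure1E// /lebesgue_step /pushforward.
congr (_ _); apply/seteqP; split=> -[x y] /=;
  rewrite /rV_cons row_mxKr (_ : ord0 = @lshift 1 n ord0) ?row_mxEl ?mxE//;
  exact: val_inj.
Qed.

Let step_sigma_finite : sigma_finite setT lebesgue_step.
Proof.
have /sigma_finiteP[F [TF ndF Foo]] := sigma_finiteT (@lebesgue_measure R).
have /sigma_finiteP[G [TG ndG Goo]] := sigma_finiteT mu.
exists (fun k => [set x : 'rV[R]_(1 + n) | F k (x ord0 ord0) /\ G k (rsubmx x)]).
  apply/seteqP; split=> // x _.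
  have [k _ Fk] : (\bigcup_i F i) (x ord0 ord0) by rewrite -TF.
  have [l _ Gl] : (\bigcup_i G i) (@rsubmx R 1 1 n x) by rewrite -TG.
  exists (maxn k l) => //; split.
    by move: Fk; exact/subsetPset/ndF/leq_maxl.
  by move: Gl; exact/subsetPset/ndG/leq_maxr.
move=> k; have [mF Fk] := Foo k; have [mG Gk] := Goo k; split.
  apply: measurableI.
    by rewrite -[X in measurable X]setTI; exact: measurable_head.
  by rewrite -[X in measurable X]setTI; exact: measurable_tail.
by rewrite lebesgue_stepE// lte_mul_pinfty// ge0_fin_numE.
Qed.

HB.instance Definition _ := Measure_isSigmaFinite.Build _ _ _ lebesgue_step
  step_sigma_finite.

End lebesgue_step.

Fixpoint lebesgue_rV (R : realType) n :
    {sigma_finite_measure set 'rV[R]_n -> \bar R} :=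
  match n with
  | 0%N => [the {sigma_finite_measure set _ -> \bar R} of dirac (0 : 'rV[R]_0)]
  | m.+1 => [the {sigma_finite_measure set _ -> \bar R}
             of lebesgue_step (lebesgue_rV R m)]
  end.

Lemma lebesgue_rV_box (R : realType) n (A : 'I_n -> set (measurableTypeR R)) :
  (forall i, measurable (A i)) ->
  lebesgue_rV R n [set x : 'rV[R]_n | forall i, A i (x ord0 i)] =
  (\prod_(i < n) lebesgue_measure (A i))%E.
Proof.
elim: n A => [|n IH] A mA /=.
  by rewrite big_ord0 diracE mem_set// => -[].
have mB : measurable [set x : 'rV[R]_n | forall i, A (lift ord0 i) (x ord0 i)].
  rewrite (_ : [set x | _] = \bigcap_(i in [set: 'I_n])
      ((fun x : 'rV[R]_n => x ord0 i) @^-1` A (lift ord0 i))).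
    apply: fin_bigcap_measurable; first exact: finite_finset.
    move=> i _; rewrite -[X in measurable X]setTI.
    by apply: (@measurable_coord R n i) => //; exact: mA.
  by apply/seteqP; split=> x /= h i; [move=> _|]; exact: h.
rewrite big_ord_recl -IH// -lebesgue_stepE//.
have e (x : 'rV[R]_(1 + n)) i : rsubmx x ord0 i = x ord0 (lift ord0 i).
  by rewrite mxE; congr (x _ _); exact: val_inj.
congr (_ _); apply/seteqP; split=> x /=.
  by move=> h; split=> [|i]; [exact: h|rewrite e; exact: h].
move=> [h0 h] i; case: (unliftP ord0 i) => [j|] -> //.
by have := h j; rewrite e.
Qed.

Section analysis.
Context (R : realType).
Local Notation C := R[i].
Local Notation leb n := (lebesgue_rV R n).

Definition dotp n (x y : 'rV[R]_n) : R := \sum_i x ord0 i * y ord0 i.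

(* The library norm of ['rV[R]_n] is the sup norm; this is the Euclidean one. *)
Definition enorm n (x : 'rV[R]_n) : R := Num.sqrt (dotp x x).

Definition cvnorm d (z : 'rV[C]_d) : R :=
  Num.sqrt (\sum_i normc (z ord0 i) ^+ 2).

Definition cmeasurable n (f : 'rV[R]_n -> C) : Prop :=
  measurable_fun [set: 'rV[R]_n] (fun x => complex.Re (f x)) /\
  measurable_fun [set: 'rV[R]_n] (fun x => complex.Im (f x)).

Definition cintegral n (f : 'rV[R]_n -> C) : C :=
  ((\int[leb n]_x complex.Re (f x)) +i* (\int[leb n]_x complex.Im (f x)))%C.

Definition vL2norm n d (F : 'rV[R]_n -> 'rV[C]_d) : \bar R :=
  ('N[leb n]_2%:E[EFin \o (@cvnorm d \o F)])%E.

Definition L1norm n (f : 'rV[R]_n -> C) : \bar R :=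
  ('N[leb n]_1%:E[EFin \o (@normc R \o f)])%E.

(* [Ck k f]: the iterated partial derivatives of [f] of order at most [k]
   exist and are continuous. *)
Fixpoint Ck n (k : nat) (f : 'rV[R]_n -> R) : Prop :=
  continuous f /\
  match k with
  | 0%N => True
  | l.+1 => forall i : 'I_n,
      (forall x, derivable f x (delta_mx ord0 i)) /\
      Ck l (fun x => 'D_(delta_mx ord0 i) f x)
  end.

Definition test_fun n (U : set 'rV[R]_n) (phi : 'rV[R]_n -> R) : Prop :=
  [/\ forall k, Ck k phi,
      compact (closure [set x | phi x != 0]) &
      closure [set x | phi x != 0] `<=` U].

(* Convention: \hat\phi(\xi) = \int \phi(x) e^{-i x.\xi} dx, so that Lambda^s
   has symbol |\xi|^s. *)
Definition fourier n (phi : 'rV[R]_n -> R) (xi : 'rV[R]_n) : C :=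
  cintegral (fun x =>
    ((phi x * cos (dotp x xi)) -i* (phi x * sin (dotp x xi)))%C).

(* Functions of polynomial growth in the mean: the pairing of such an [f] with
   Schwartz functions is absolutely convergent. *)
Definition tempered n (f : 'rV[R]_n -> C) : Prop :=
  cmeasurable f /\ exists N : nat,
  (leb n).-integrable setT (fun x => (normc (f x) / (1 + enorm x) ^+ N)%:E).

(* [is_multiplier U m f g]: g = m(D) f for the Fourier multiplier with symbol
   [m], as tempered distributions; i.e. \hat g = m \hat f on the open set [U] on
   which [m] is smooth, where \hat f is defined by duality,
   <\hat f, phi> = <f, \hat phi>.  Real test functions suffice by
   C-linearity. *)
Definition is_multiplier n (U : set 'rV[R]_n) (m : 'rV[R]_n -> R)
    (f g : 'rV[R]_n -> C) : Prop :=
  [/\ tempered f, tempered g &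
      forall phi, test_fun U phi ->
        cintegral (fun xi => g xi * fourier phi xi) =
        cintegral (fun xi => f xi * fourier (fun x => m x * phi x) xi)].

(* The L^2 norm of m(D) F, computed componentwise.  There is at most one square
   integrable function among the candidates [G] (up to a.e. equality); the
   infimum is its norm, and is +oo when there is none. *)
Definition multiplier_norm n d (U : set 'rV[R]_n) (m : 'rV[R]_n -> R)
    (F : 'rV[R]_n -> 'rV[C]_d) : \bar R :=
  ereal_inf [set vL2norm G | G in [set G : 'rV[R]_n -> 'rV[C]_d |
    forall i, is_multiplier U m (fun x => F x ord0 i) (fun x => G x ord0 i)]].

Definition Hs_norm n d (s : R) (F : 'rV[R]_n -> 'rV[C]_d) : \bar R :=
  multiplier_norm setT (fun xi => (1 + enorm xi ^+ 2) `^ (s / 2)) F.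

(* The symbol |\xi|^s is not smooth at the origin, so Lambda^s F is tested away
   from the frequency 0, i.e. defined modulo polynomials (none of which but 0 is
   square integrable). *)
Definition dHs_norm n d (s : R) (F : 'rV[R]_n -> 'rV[C]_d) : \bar R :=
  multiplier_norm [set~ 0] (fun xi => enorm xi `^ s) F.

Definition scalar_fun n (f : 'rV[R]_n -> C) : 'rV[R]_n -> 'rV[C]_1 :=
  fun x => const_mx (f x).

Definition conv_defined n d (k : 'rV[R]_n -> 'rV[R]_d) (f : 'rV[R]_n -> C)
    : Prop :=
  {ae leb n, forall x,
    (\int[leb n]_y (enorm (k (x - y)) * normc (f y))%:E < +oo)%E}.

Definition conv n d (k : 'rV[R]_n -> 'rV[R]_d) (f : 'rV[R]_n -> C)
    (x : 'rV[R]_n) : 'rV[C]_d :=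
  \row_i cintegral (fun y => (k (x - y) ord0 i)%:C%C * f y).

Definition cutoff (chi : R -> R) : Prop :=
  [/\ forall k x, derivable (derive1n k chi) x 1,
      forall r, `|r| <= 1 -> chi r = 1,
      forall r, 2 <= `|r| -> chi r = 0 &
      forall r, `|derive1 chi r| <= 2].

(* The value at 0 is 0. *)
Definition kerK n (beta : R) (x : 'rV[R]_n) : 'rV[R]_n :=
  (enorm x `^ (n%:R + 1 - beta))^-1 *: x.

Definition kerK1 n (chi : R -> R) (beta : R) (x : 'rV[R]_n) : 'rV[R]_n :=
  chi (beta * enorm x) *: kerK beta x.

Definition kerK2 n (chi : R -> R) (beta : R) (x : 'rV[R]_n) : 'rV[R]_n :=
  (1 - chi (beta * enorm x)) *: kerK beta x.

Definition T1 n (chi : R -> R) (beta : R) (f : 'rV[R]_n -> C) :=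
  conv (kerK1 chi beta) f.

Definition T2 n (chi : R -> R) (beta : R) (f : 'rV[R]_n -> C) :=
  conv (kerK2 chi beta) f.

End analysis.

(* Main.v *)
(* The kernels are odd, so that their Fourier transforms are sine transforms,
   and the two Sobolev bounds amount to pointwise bounds on these symbols.
   For a radial profile k with a singularity at 0, comparing the sine transform
   with its translate by the half-period z = pi xi / |xi|^2 gives
   2 N(xi) = \int (k(x) - k(x + z)) sin(x.xi) dx, where the difference gains a
   factor |z| / |x| away from the origin; near the origin |sin t| <= |t| is
   enough. The symbol of K_2, which is not integrable, is the limit of the
   symbols of its truncations to annuli.

   A bound on the symbol m becomes a bound on norms defined by duality with
   test functions as follows: the functional psi |-> <g, (m psi)^> is bounded on
   the space of transforms of test functions, by Plancherel's identity (proved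
   by Abel summation with the weight \prod_i exp(- |x_i|)), and the Riesz
   representation theorem provides the square-integrable function that
   represents T f. Since m psi is only continuous, the relation defining g is
   first extended from test functions by mollification.

   The L^1 to L^2 bound is Young's inequality, K_2 being square-integrable. *)

Require Import Defs.
From HB Require Import structures.
From mathcomp Require Import all_boot all_order all_algebra.
From mathcomp Require Import all_classical all_reals all_analysis.
From mathcomp Require Import measurable_realfun complex ring lra.

Set Implicit Arguments.
Unset Strict Implicit.
Unset Printing Implicit Defensive.

Import Order.TTheory GRing.Theory Num.Theory.
Import numFieldNormedType.Exports.

Local Open Scope classical_set_scope.
Local Open Scope ring_scope.

(** Since [f] is only tempered, its transform cannot be multiplied by a symbol [m]: the symbol is
    moved onto the test functions [psi], and [m psi] is neither smooth nor has a transform of known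
    decay. The pairing of [f] with the transform of [m psi] converges absolutely for another reason,
    Fubini's theorem for the convolution. Mollifying [m psi] multiplies its transform by a real
    factor in [-1, 1] tending to 1, so this absolute convergence alone supplies the majorant with
    which the relation between [f] and [g] passes to the limit.

    Uniformity in [beta] rests on the boundedness of [(2/beta)^beta] and [beta^(-beta)]. The symbol
    of [K_1] has three regimes: [beta >= 1/2], where the [L^1] norm of the kernel suffices;
    [|xi| <= beta], where [|sin t| <= |t|] is used on the whole support; and [|xi| >= beta] with
    [beta <= 1/2], which needs the half-period translation. For [K_2] the bound on annuli must not
    depend on the outer radius. That [K_2 * f] is tempered follows from absolute convergence at a
    single point, which bounds [f] against [(1 + |y|)^(beta - n)]. *)

Lemma quadratic_ge0_discr (R : realFieldType) (a b c : R) : 0 <= a ->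
  (forall t, 0 <= c + 2 * t * b + t ^+ 2 * a) -> b ^+ 2 <= c * a.
Proof.
rewrite le_eqVlt => /predU1P[<- h|a0 h].
  have [->|b0] := eqVneq b 0; first by rewrite mulr0 expr0n.
  (* With [a = 0] the polynomial is affine, and at this point it equals -1. *)
  have := h (- (c + 1) / (2 * b)).
  rewrite (_ : _ + _ = -1); last by field.
  lra.
have := h (- b / a); rewrite (_ : _ + _ = c - b ^+ 2 / a); last first.
  by field; rewrite gt_eqF.
by rewrite subr_ge0 ler_pdivrMr.
Qed.

(** * Real-valued integrals and square-integrable functions *)

Section real_integral.
Context d (T : measurableType d) (R : realType).
Variable mu : {measure set T -> \bar R}.
Implicit Types f g : T -> R.

Definition intg f := mu.-integrable setT (EFin \o f).
Definition rint f := \int[mu]_x f x.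

Lemma intg_measurable f : intg f -> measurable_fun setT f.
Proof. by move=> /integrableP[/measurable_EFinP]. Qed.

Lemma intg_ge0 f : measurable_fun setT f -> (forall x, 0 <= f x) ->
  (\int[mu]_x (f x)%:E < +oo)%E -> intg f.
Proof.
move=> mf f0 foo; apply/integrableP; split; first exact/measurable_EFinP.
by under eq_integral do rewrite /= ger0_norm//.
Qed.

Lemma intg_dom g f : measurable_fun setT f -> (forall x, `|f x| <= g x) ->
  intg g -> intg f.
Proof.
move=> mf fg; apply: le_integrable => //; first exact/measurable_EFinP.
by move=> x _ /=; rewrite lee_fin (le_trans (fg x))// ler_norm.
Qed.

Lemma rintE f : intg f -> (\int[mu]_x (f x)%:E)%E = (rint f)%:E.
Proof. by move=> fi; rewrite /rint /Rintegral fineK//; exact: integrable_fin_num. Qed.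

Lemma intgD f g : intg f -> intg g -> intg (fun x => f x + g x).
Proof. by move=> fi gi; apply: eq_integrable (integrableD _ fi gi). Qed.

Lemma intgB f g : intg f -> intg g -> intg (fun x => f x - g x).
Proof. by move=> fi gi; apply: eq_integrable (integrableB _ fi gi). Qed.

Lemma intgZ k f : intg f -> intg (fun x => k * f x).
Proof. by move=> fi; apply: eq_integrable (integrableZl _ k fi). Qed.

Lemma intg_norm f : intg f -> intg (fun x => `|f x|).
Proof. by move=> fi; apply: integrable_norm. Qed.

Lemma intg0 : intg (fun=> 0).
Proof. exact: integrable0. Qed.

Lemma intgM_bounded (b f : T -> R) C : measurable_fun setT b ->
  (forall x, `|b x| <= C) -> intg f -> intg (fun x => b x * f x).
Proof.
move=> mb bC fi; apply: (@intg_dom (fun x => C * `|f x|)).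
- by apply: measurable_funM => //; exact: intg_measurable.
- by move=> x; rewrite normrM ler_wpM2r.
- exact/intgZ/intg_norm.
Qed.

Lemma rintD f g : intg f -> intg g ->
  rint (fun x => f x + g x) = rint f + rint g.
Proof. by move=> fi gi; rewrite /rint RintegralD. Qed.

Lemma rintB f g : intg f -> intg g ->
  rint (fun x => f x - g x) = rint f - rint g.
Proof. by move=> fi gi; rewrite /rint RintegralB. Qed.

Lemma rintZ k f : intg f -> rint (fun x => k * f x) = k * rint f.
Proof. by move=> fi; rewrite /rint RintegralZl. Qed.

Lemma rintN f : intg f -> rint (fun x => - f x) = - rint f.
Proof.
move=> fi; rewrite -mulN1r -rintZ//; apply: eq_Rintegral => x _.
by rewrite mulN1r.
Qed.

Lemma rint0 : rint (fun=> 0) = 0.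
Proof. by rewrite /rint /Rintegral integral0. Qed.

Lemma rint_ge0 f : (forall x, 0 <= f x) -> 0 <= rint f.
Proof. by move=> f0; exact: Rintegral_ge0. Qed.

Lemma rint_le f g : intg f -> intg g -> (forall x, f x <= g x) ->
  rint f <= rint g.
Proof. by move=> fi gi fg; exact: le_Rintegral. Qed.

Lemma rint_norm f : intg f -> `|rint f| <= rint (fun x => `|f x|).
Proof. by move=> fi; exact: le_normr_Rintegral. Qed.

Lemma rint_norm_le f g : intg f -> intg g -> (forall x, `|f x| <= g x) ->
  `|rint f| <= rint g.
Proof.
move=> fi gi fg; apply: le_trans (rint_norm fi) _.
by apply: rint_le => //; exact: intg_norm.
Qed.

Lemma eq_rint f g : f =1 g -> rint f = rint g.
Proof. by move=> fg; congr rint; exact/funext. Qed.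

Lemma rint_dct (f_ : nat -> T -> R) f g :
  (forall n, measurable_fun setT (f_ n)) ->
  (forall x, f_ ^~ x @ \oo --> f x) -> intg g ->
  (forall n x, `|f_ n x| <= g x) ->
  intg f /\ rint (f_ n) @[n --> \oo] --> rint f.
Proof.
move=> mf_ f_f gi f_g.
have mf : measurable_fun setT f.
  exact: (@measurable_fun_cvg _ _ _ setT f_).
have [|||||fi _ cf] := @dominated_convergence _ _ _ mu setT measurableT
    (fun n => EFin \o f_ n) (EFin \o f) (EFin \o g).
- by move=> n; exact/measurable_EFinP.
- exact/measurable_EFinP.
- by apply: aeW => x _; apply/cvg_EFin; [exact: nearW|exact: f_f].
- exact: gi.
- by apply: aeW => x n _ /=; rewrite lee_fin f_g.
split=> //; rewrite /rint /Rintegral; apply: fine_cvg.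
by rewrite fineK//; exact: integrable_fin_num.
Qed.

Definition sqintg f := measurable_fun setT f /\ intg (fun x => f x ^+ 2).

Lemma sqintgM f g : sqintg f -> sqintg g -> intg (fun x => f x * g x).
Proof.
move=> [mf fi] [mg gi].
apply: (@intg_dom (fun x => f x ^+ 2 + g x ^+ 2)).
- exact: measurable_funM.
- move=> x; have := sqr_ge0 (f x - g x); have := sqr_ge0 (f x + g x).
  have := sqr_ge0 (f x); have := sqr_ge0 (g x).
  by rewrite ler_norml => *; apply/andP; split; nra.
- exact: intgD.
Qed.

Lemma sqintgD f g : sqintg f -> sqintg g -> sqintg (fun x => f x + g x).
Proof.
move=> [mf fi] [mg gi]; split; first exact: measurable_funD.
apply: (@intg_dom (fun x => 2 * f x ^+ 2 + 2 * g x ^+ 2)).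
- exact/measurable_funX/measurable_funD.
- by move=> x; rewrite ger0_norm ?sqr_ge0//; have := sqr_ge0 (f x - g x); nra.
- by apply: intgD; exact: intgZ.
Qed.

Lemma sqintgZ k f : sqintg f -> sqintg (fun x => k * f x).
Proof.
move=> [mf fi]; split; first exact: measurable_funM.
by under eq_fun do rewrite exprMn; exact: intgZ.
Qed.

Lemma sqintgB f g : sqintg f -> sqintg g -> sqintg (fun x => f x - g x).
Proof.
move=> fi gi; under eq_fun do rewrite -mulN1r.
by apply: sqintgD => //; exact: sqintgZ.
Qed.

(** The integral of [(f + t g)^2] is a nonnegative quadratic polynomial in [t]. *)
Lemma cauchy_schwarz f g : sqintg f -> sqintg g ->
  rint (fun x => f x * g x) ^+ 2 <=
  rint (fun x => f x ^+ 2) * rint (fun x => g x ^+ 2).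
Proof.
move=> fi gi; have fgi := sqintgM fi gi.
apply: quadratic_ge0_discr => [|t]; first by apply: rint_ge0 => x; exact: sqr_ge0.
rewrite -!rintZ//; [|exact: gi.2].
rewrite -!rintD//; [| |exact/intgZ/gi.2|exact: fi.2|exact/intgZ].
  by apply: rint_ge0 => x; rewrite (_ : _ + _ = (f x + t * g x) ^+ 2) ?sqr_ge0//; ring.
by apply: intgD; [exact: fi.2|exact/intgZ].
Qed.

End real_integral.

(** * Parameter integrals and Fubini's theorem *)

Section param_integral.
Context d1 d2 (T1 : measurableType d1) (T2 : measurableType d2) (R : realType).
Variable m2 : {sigma_finite_measure set T2 -> \bar R}.

Lemma measurable_tonelli (F : T1 * T2 -> \bar R) :
  measurable_fun setT F -> (forall z, (0 <= F z)%E) ->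
  measurable_fun setT (fun x => \int[m2]_y F (x, y))%E.
Proof.
move=> mF F0.
have := @measurable_fun_fubini_tonelli_F _ _ T1 T2 R m2 F mF F0.
exact.
Qed.

Lemma measurable_rint (F : T1 * T2 -> R) : measurable_fun setT F ->
  measurable_fun setT (fun x => rint m2 (fun y => F (x, y))).
Proof.
move=> mF; rewrite /rint /Rintegral.
apply: (measurableT_comp (fine_measurable measurableT)).
have mF' : measurable_fun setT (EFin \o F) by exact/measurable_EFinP.
rewrite (_ : (fun _ => _) = (fun x => \int[m2]_y (EFin \o F)^\+ (x, y) -
    \int[m2]_y (EFin \o F)^\- (x, y))%E); last first.
  apply/funext => x; rewrite integralE.
  by congr (_ - _)%E; apply: eq_integral => y _; rewrite ?funeposE ?funenegE.
apply: emeasurable_funB.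
- by apply: measurable_tonelli; [exact: measurable_funepos|move=> z; exact: funepos_ge0].
- by apply: measurable_tonelli; [exact: measurable_funeneg|move=> z; exact: funeneg_ge0].
Qed.

End param_integral.

Section real_fubini.
Context d1 d2 (T1 : measurableType d1) (T2 : measurableType d2) (R : realType).
Variable m1 : {sigma_finite_measure set T1 -> \bar R}.
Variable m2 : {sigma_finite_measure set T2 -> \bar R}.

Lemma tonelli_swap (G : T1 * T2 -> \bar R) : measurable_fun setT G ->
  (forall z, (0 <= G z)%E) ->
  (\int[m1]_x \int[m2]_y G (x, y) = \int[m2]_y \int[m1]_x G (x, y))%E.
Proof. by move=> mG G0; exact: fubini_tonelli. Qed.

Lemma measurable_swap (F : T1 * T2 -> R) : measurable_fun setT F ->
  measurable_fun setT (fun z : T2 * T1 => F (z.2, z.1)).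
Proof.
move=> mF; apply: measurableT_comp => //.
by apply/measurable_fun_pairP; split => //=; [exact: measurable_snd|exact: measurable_fst].
Qed.

Lemma intg_rint (F : T1 * T2 -> R) : measurable_fun setT F ->
  (\int[m1]_x \int[m2]_y `|F (x, y)|%:E < +oo)%E ->
  intg m1 (fun x => rint m2 (fun y => F (x, y))).
Proof.
move=> mF Foo; have iF : (m1 \x m2)%E.-integrable setT (EFin \o F).
  by apply/integrable12ltyP => //; exact/measurable_EFinP.
apply: (le_integrable _ _ _ (integrable_fubini_F iF)) => //.
  exact/measurable_EFinP/measurable_rint.
(* Where the inner integral is infinite, [rint] takes the value 0, so the comparison holds at every
   [x] and not just almost everywhere. *)
move=> x _ /=; rewrite /rint /Rintegral /fubini_F.
by case: (integral _ _ _) => [r| |] //=; rewrite ?normr0 ?leey// lexx.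
Qed.

(** The real inner integrals agree with the extended ones of Fubini's theorem at almost every point
    only, which the outer integrals do not see. *)
Lemma rint_swap (F : T1 * T2 -> R) : measurable_fun setT F ->
  (\int[m1]_x \int[m2]_y `|F (x, y)|%:E < +oo)%E ->
  rint m1 (fun x => rint m2 (fun y => F (x, y))) =
  rint m2 (fun y => rint m1 (fun x => F (x, y))).
Proof.
move=> mF Foo; have iF : (m1 \x m2)%E.-integrable setT (EFin \o F).
  by apply/integrable12ltyP => //; exact/measurable_EFinP.
rewrite [LHS]/rint [RHS]/rint /Rintegral; congr fine.
transitivity (\int[m1]_x \int[m2]_y (EFin \o F) (x, y))%E.
  apply: ae_eq_integral => //.
  - exact/measurable_EFinP/measurable_rint.
  - exact: (measurable_fubini_F iF).
  - by apply: filterS (ae_integrable1 iF) => x ix _; rewrite -rintE.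
rewrite (Fubini iF); apply: ae_eq_integral => //.
- exact: (measurable_fubini_G iF).
- exact/measurable_EFinP/(measurable_rint m1 (measurable_swap mF)).
- by apply: filterS (ae_integrable2 iF) => y iy _; rewrite -rintE.
Qed.

Lemma product_dom (F : T1 * T2 -> R) (a : T1 -> R) (b : T2 -> R) :
  measurable_fun setT F -> intg m1 a -> intg m2 b ->
  (forall x y, `|F (x, y)| <= a x * b y) ->
  (\int[m1]_x \int[m2]_y `|F (x, y)|%:E < +oo)%E.
Proof.
move=> mF ai bi Fab.
have a0 x y : 0 <= a x * b y by exact: le_trans (normr_ge0 _) (Fab x y).
have mF1 : measurable_fun setT (fun z => `|F z|%:E).
  by apply/measurable_EFinP/measurableT_comp.
have inner x : (\int[m2]_y `|F (x, y)|%:E <= (a x * rint m2 b)%:E)%E.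
  have mab : measurable_fun setT (fun y => (a x * b y)%:E).
    by apply/measurable_EFinP; exact: intg_measurable (intgZ (a x) bi).
  have mFx : measurable_fun setT (fun y => `|F (x, y)|%:E).
    exact: (measurableT_comp mF1 (measurable_pair1 x)).
  rewrite -rintZ// -rintE; last exact: intgZ.
  by apply: ge0_le_integral => // y _; rewrite lee_fin.
have aBi : intg m1 (fun x => a x * rint m2 b).
  by rewrite (_ : (fun x => _) = (fun x => rint m2 b * a x)); [exact: intgZ|apply/funext => x; rewrite mulrC].
have maB : measurable_fun setT (fun x => (a x * rint m2 b)%:E).
  by apply/measurable_EFinP; exact: intg_measurable aBi.
have in0 x : (0 <= \int[m2]_y `|F (x, y)|%:E)%E.
  by apply: integral_ge0 => y _; rewrite lee_fin.
have mFi : measurable_fun setT (fun x => \int[m2]_y `|F (x, y)|%:E)%E.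
  by apply: (@measurable_tonelli _ _ _ _ R m2 (fun z => `|F z|%:E)) => // z; rewrite lee_fin.
apply: (@le_lt_trans _ _ (\int[m1]_x (a x * rint m2 b)%:E)%E); last by rewrite rintE// ltry.
by apply: ge0_le_integral => // x _; exact: le_trans (inner x).
Qed.

Lemma rint_swap_dom (F : T1 * T2 -> R) (a : T1 -> R) (b : T2 -> R) :
  measurable_fun setT F -> intg m1 a -> intg m2 b ->
  (forall x y, `|F (x, y)| <= a x * b y) ->
  rint m1 (fun x => rint m2 (fun y => F (x, y))) =
  rint m2 (fun y => rint m1 (fun x => F (x, y))).
Proof. by move=> mF ai bi Fab; apply: rint_swap => //; exact: product_dom mF ai bi Fab. Qed.

End real_fubini.

(** * Completeness of [L^2] for rapidly converging sequences *)

Lemma geometric_eseries (R : realType) (a z : R) : 0 <= z < 1 ->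
  (\sum_(k <oo) (a * z ^+ k)%:E = (a / (1 - z))%:E)%E.
Proof.
move=> /andP[z0 z1]; apply/cvg_lim => //.
rewrite (_ : (fun n => _) = EFin \o series (geometric a z)); last first.
  by apply/funext => n; rewrite /= sumEFin seriesEnat.
by apply: cvg_EFin; [exact: nearW|apply: cvg_geometric_series; rewrite ger0_norm].
Qed.

Section riesz_fischer.
Context d (T : measurableType d) (R : realType).
Variable mu : {measure set T -> \bar R}.

(** Fatou's lemma for a pointwise limit: it applies where no majorant is known, both here and in the
    first half of Plancherel's identity. *)
Lemma fatou_bound (f_ : nat -> T -> R) (f : T -> R) (M : R) :
  (forall n, measurable_fun setT (f_ n)) -> (forall n x, 0 <= f_ n x) ->
  (forall x, f_ ^~ x @ \oo --> f x) ->
  (forall n, (\int[mu]_x (f_ n x)%:E <= M%:E)%E) ->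
  (\int[mu]_x (f x)%:E <= M%:E)%E.
Proof.
move=> mf_ f_0 f_f f_M.
have -> : (\int[mu]_x (f x)%:E = \int[mu]_x limn_einf (fun n => (f_ n x)%:E))%E.
  apply: eq_integral => x _; apply/esym.
  have /cvg_limn_einf_sup[] : (fun n => (f_ n x)%:E) @ \oo --> (f x)%:E.
    by apply: cvg_EFin; [exact: nearW|exact: f_f].
  by [].
apply: le_trans (fatou _ _ _ _) _ => //.
- by move=> n; exact/measurable_EFinP.
- by move=> n x _; rewrite lee_fin.
rewrite limn_einf_lim; apply: lime_le; first exact: is_cvg_einfs.
apply: nearW => n; apply: le_trans (f_M n).
by apply: ereal_inf_lbound; exists n => /=.
Qed.

(** With [d_ k] the successive differences, [|d_ k| <= 2^-k + 2^k d_k^2], and the sum of the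
    [2^k d_k^2] has integral at most the sum of the [8^-k]. Hence the telescoping series converges
    absolutely almost everywhere. Only integrals of squares occur, and Minkowski's inequality is
    bypassed. *)
Lemma riesz_fischer (v : nat -> T -> R) : (forall k, sqintg mu (v k)) ->
  (forall j k, (k <= j)%N ->
    rint mu (fun x => (v j x - v k x) ^+ 2) <= (16 ^- k)) ->
  exists2 G, sqintg mu G &
    forall k, rint mu (fun x => (G x - v k x) ^+ 2) <= 16 ^- k.
Proof.
move=> v2 v_cauchy.
pose d_ k x := v k.+1 x - v k x.
pose D x := (\sum_(k <oo) (2 ^+ k * d_ k x ^+ 2)%:E)%E.
have md k : measurable_fun setT (d_ k).
  by apply: measurable_funB; exact: (v2 _).1.
have mdk k : measurable_fun setT (fun x => (2 ^+ k * d_ k x ^+ 2)).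
  by apply: measurable_funM => //; exact: measurable_funX.
have d0 k x : (0 <= (2 ^+ k * d_ k x ^+ 2)%:E)%E.
  by rewrite lee_fin mulr_ge0// sqr_ge0.
have mD : measurable_fun setT D.
  by apply: ge0_emeasurable_sum => // k _; exact/measurable_EFinP.
have D0 x : (0 <= D x)%E by apply: nneseries_ge0 => k _ _; exact: d0.
have iD : (\int[mu]_x D x < +oo)%E.
  rewrite /D integral_nneseries//; last by move=> k; exact/measurable_EFinP.
  apply: (@le_lt_trans _ _ (\sum_(k <oo) (1 * (8^-1) ^+ k)%:E)%E).
    apply: lee_nneseries => [k _ _|k _].
      by apply: integral_ge0 => x _; exact: d0.
    rewrite rintE; last by apply: intgZ; exact: (sqintgB (v2 _) (v2 _)).2.
    rewrite lee_fin rintZ; last exact: (sqintgB (v2 _) (v2 _)).2.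
    have := v_cauchy k.+1 k (leqnSn _).
    move=> /(ler_wpM2l (exprn_ge0 k (ler0n R 2))) /le_trans; apply.
    rewrite -exprVn -exprMn mul1r (_ : 2 * 16^-1 = 8^-1)//; by field.
  rewrite geometric_eseries ?ltry//; lra.
pose A := [set x | (D x < +oo)%E].
have mA : measurable A.
  by have := emeasurable_fun_infty_o measurableT mD +oo%E; rewrite setTI.
have muA : mu.-negligible (~` A).
  have : mu.-integrable setT D.
    apply/integrableP; split=> //; under eq_integral do rewrite gee0_abs ?D0//.
    exact: iD.
  move=> /integrable_ae => /(_ measurableT); apply: negligibleS.
  move=> x /= nA /(_ I); apply: contra_not nA => Dx.
  by rewrite /A /= -ge0_fin_numE ?D0.
(* Cutting off the null set makes the sequence converge everywhere, so that its limit is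
   measurable. *)
pose v' k x := v k x * \1_A x.
have mA1 : measurable_fun setT (\1_A : T -> R) by exact: measurable_indic.
have mv' k : measurable_fun setT (v' k).
  by apply: measurable_funM => //; exact: (v2 _).1.
have cv' x : cvgn (v' ^~ x).
  have [Ax|nAx] := pselect (A x); last first.
    rewrite (_ : v' ^~ x = fun=> 0); first exact: is_cvg_cst.
    by apply/funext => k; rewrite /v' indicE memNset// mulr0.
  rewrite (_ : v' ^~ x = v ^~ x); last first.
    by apply/funext => k; rewrite /v' indicE mem_set// mulr1.
  rewrite (_ : v ^~ x = (cst (v 0%N x) + series (d_ ^~ x))); last first.
    by apply/funext => n; exact: (eq_sum_telescope (v ^~ x) n).
  apply: is_cvgD; first exact: is_cvg_cst.
  apply: normed_cvg.
  apply: (@series_le_cvg _ _ (geometric 1 2^-1 + (fun k => 2 ^+ k * d_ k x ^+ 2))).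
  - by move=> n; exact: normr_ge0.
  - move=> n; have h1 : 0 <= 1 * 2^-1 ^+ n :> R by rewrite mul1r exprn_ge0.
    have h2 : 0 <= 2 ^+ n * d_ n x ^+ 2 by rewrite mulr_ge0 ?sqr_ge0 ?exprn_ge0.
    exact: addr_ge0 h1 h2.
  - move=> n; rewrite fctE /= mul1r exprVn.
    set q : R := 2 ^+ n; set y := d_ n x.
    have q0 : 0 < q by rewrite exprn_gt0.
    rewrite -(ler_pM2l q0) mulrDr mulfV ?gt_eqF//.
    have : `|q * y| <= 1 + (q * y) ^+ 2.
      have := sqr_ge0 (q * y - 1); have := sqr_ge0 (q * y + 1).
      by rewrite ler_norml => *; apply/andP; split; nra.
    by rewrite normrM (gtr0_norm q0) => /le_trans; apply; rewrite le_eqVlt; apply/orP; left; apply/eqP; ring.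
  - apply: is_cvg_seriesD; first by apply: is_cvg_geometric_series; rewrite ger0_norm; lra.
    apply: nondecreasing_is_cvgn.
      by apply: nondecreasing_series => n _ _; rewrite mulr_ge0// sqr_ge0.
    exists (fine (D x)) => _ [n _ <-].
    rewrite -lee_fin fineK; last by rewrite ge0_fin_numE ?D0.
    rewrite seriesEnat /= -sumEFin.
    exact: nneseries_lim_ge.
pose G x := limn (v' ^~ x).
have mG : measurable_fun setT G.
  by apply: (@measurable_fun_cvg _ _ _ setT v') => // x _; exact: cv'.
(* Fatou's lemma along the tail [j + k], on which the Cauchy hypothesis applies with [k] fixed. *)
have bound k : (\int[mu]_x ((G x - v k x) ^+ 2)%:E <= (16 ^- k)%:E)%E.
  rewrite (@ge0_ae_eq_integral _ _ _ mu setT _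
      (fun x => ((G x - v' k x) ^+ 2 * \1_A x)%:E))//; last first.
  - apply: negligibleS muA => x /=; apply: contra_not => Ax _.
    by rewrite /v' indicE mem_set// !mulr1.
  - by move=> x _; rewrite lee_fin mulr_ge0// sqr_ge0.
  - by move=> x _; rewrite lee_fin sqr_ge0.
  - apply/measurable_EFinP/measurable_funM => //.
    exact/measurable_funX/measurable_funB.
  - apply/measurable_EFinP/measurable_funX/measurable_funB => //.
    exact: (v2 _).1.
  apply: (@fatou_bound (fun j x => (v' (j + k)%N x - v' k x) ^+ 2 * \1_A x)).
  - move=> n; apply: measurable_funM => //.
    exact/measurable_funX/measurable_funB.
  - by move=> n x; rewrite mulr_ge0// sqr_ge0.
  - move=> x; apply: cvgMr_tmp.
    rewrite (_ : (fun j => _) = (fun j => (v' j x - v' k x) ^+ 2) \o addn^~ k)//.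
    have h : (v' j x - v' k x) @[j --> \oo] --> G x - v' k x.
      by apply: cvgB; [exact: cv'|exact: cvg_cst].
    have h2 : (v' j x - v' k x) ^+ 2 @[j --> \oo] --> (G x - v' k x) ^+ 2.
      by rewrite expr2; under eq_fun do rewrite expr2; exact: cvgM.
    by move: h2; rewrite -(cvg_shiftn k).
  - move=> n; have := v_cauchy (n + k)%N k (leq_addl _ _).
    rewrite -lee_fin -rintE; last exact: (sqintgB (v2 _) (v2 _)).2.
    apply: le_trans; apply: ge0_le_integral => //.
    + by move=> x _; rewrite lee_fin mulr_ge0// sqr_ge0.
    + apply/measurable_EFinP/measurable_funM => //.
      exact/measurable_funX/measurable_funB.
    + apply/measurable_EFinP/measurable_funX/measurable_funB => //.
      exact: (v2 _).1.
      exact: (v2 _).1.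
    + move=> x _; rewrite lee_fin /v' indicE.
      by case: (_ \in _); rewrite !(mulr1, mulr0)// sqr_ge0.
have iG k : intg mu (fun x => (G x - v k x) ^+ 2).
  apply: intg_ge0.
  - apply/measurable_funX/measurable_funB => //; exact: (v2 _).1.
  - by move=> x; exact: sqr_ge0.
  - by apply: le_lt_trans (bound k) _; rewrite ltry.
exists G.
  have : sqintg mu (fun x => (G x - v 0%N x) + v 0%N x).
    apply: sqintgD => //; split => //.
    by apply: measurable_funB => //; exact: (v2 _).1.
  by under eq_fun do rewrite subrK.
by move=> k; rewrite -lee_fin -rintE.
Qed.

End riesz_fischer.

(** * Riesz representation on a space of pairs *)

Section riesz_representation.
Context d (T : measurableType d) (R : realType).
Variable mu : {measure set T -> \bar R}.
Implicit Types p q r : (T -> R) * (T -> R).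

Definition sqpair p := sqintg mu p.1 /\ sqintg mu p.2.

(** A pair stands for the complex function [p.1 + i p.2]; this is the real part of the Hermitian
    product. *)
Definition dotpair p q :=
  rint mu (fun x => p.1 x * q.1 x) + rint mu (fun x => p.2 x * q.2 x).

(** The single operation [a p + q] encodes linearity; [linpair (-1) p q] is the difference
    [q - p]. *)
Definition linpair (a : R) p q : (T -> R) * (T -> R) :=
  (fun x => a * p.1 x + q.1 x, fun x => a * p.2 x + q.2 x).

Lemma sqpair_lin a p q : sqpair p -> sqpair q -> sqpair (linpair a p q).
Proof.
by move=> [p1 p2] [q1 q2]; split; apply: sqintgD => //; exact: sqintgZ.
Qed.

Lemma dotpairC p q : dotpair p q = dotpair q p.
Proof. by congr (_ + _); apply: eq_rint => x; rewrite mulrC. Qed.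

Lemma dotpair_linl a p q r : sqpair p -> sqpair q -> sqpair r ->
  dotpair (linpair a p q) r = a * dotpair p r + dotpair q r.
Proof.
move=> [p1 p2] [q1 q2] [r1 r2].
have e (f g h : T -> R) : sqintg mu f -> sqintg mu g -> sqintg mu h ->
    rint mu (fun x => (a * f x + g x) * h x) =
    a * rint mu (fun x => f x * h x) + rint mu (fun x => g x * h x).
  move=> fi gi hi; rewrite -rintZ; last exact: sqintgM.
  rewrite -rintD; [|exact/intgZ/sqintgM|exact: sqintgM].
  by apply: eq_rint => x; ring.
by rewrite /dotpair !e//; ring.
Qed.

Lemma dotpair_linr a p q r : sqpair p -> sqpair q -> sqpair r ->
  dotpair r (linpair a p q) = a * dotpair r p + dotpair r q.
Proof. by move=> pi qi ri; rewrite dotpairC dotpair_linl// !(dotpairC r). Qed.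

Lemma dotpair_ge0 p : 0 <= dotpair p p.
Proof. by rewrite addr_ge0// rint_ge0// => x; rewrite -expr2 sqr_ge0. Qed.

Lemma dotpair_cs p q : sqpair p -> sqpair q ->
  dotpair p q ^+ 2 <= dotpair p p * dotpair q q.
Proof.
move=> pi qi; apply: quadratic_ge0_discr => [|t]; first exact: dotpair_ge0.
have := dotpair_ge0 (linpair t q p).
rewrite dotpair_linl ?dotpair_linr//; last exact: sqpair_lin.
rewrite (dotpairC q p) => /le_trans; apply; rewrite le_eqVlt; apply/orP; left.
by apply/eqP; ring.
Qed.

Context (W : lmodType R) (S : set W) (v : W -> (T -> R) * (T -> R)).
Variables (l : W -> R) (B : R).
Hypothesis S0 : S 0.
Hypothesis SL : forall a u w, S u -> S w -> S (a *: u + w).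
Hypothesis vi : forall u, S u -> sqpair (v u).
Hypothesis vL : forall a u w, S u -> S w -> v (a *: u + w) = linpair a (v u) (v w).
Hypothesis lL : forall a u w, S u -> S w -> l (a *: u + w) = a * l u + l w.
Hypothesis lB : forall u, S u -> l u ^+ 2 <= B ^+ 2 * dotpair (v u) (v u).

(** Half the derivative of [J] at [u] in the direction [w] is [dotpair (v u) (v w) - l w], so a
    minimizer represents [l]. *)
Let J u := dotpair (v u) (v u) - 2 * l u.

Let J_lin a u w : S u -> S w ->
  J (a *: u + w) = J w + 2 * a * (dotpair (v w) (v u) - l u)
    + a ^+ 2 * dotpair (v u) (v u).
Proof.
move=> Su Sw; rewrite /J vL// lL//.
have ui := vi Su; have wi := vi Sw.
rewrite dotpair_linl ?dotpair_linr//; last exact: sqpair_lin.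
by rewrite (dotpairC (v u) (v w)); ring.
Qed.

(** This is [|v u|^2 - 2 B |v u| >= - B^2], freed from square roots: for [a = |v u|^2], [b = B^2]
    and [c = l u], one has [(a + b)^2 >= 4 a b >= 4 c^2]. *)
Let JB u : S u -> - B ^+ 2 <= J u.
Proof.
move=> Su; rewrite /J; have := lB Su; have := dotpair_ge0 (v u).
set a := dotpair _ _; set c := l u; set b := B ^+ 2 => a0 cb.
have b0 : 0 <= b by exact: sqr_ge0.
have [c0|c0] := leP (a + b) (2 * c); last by lra.
have : 0 <= (a + b) ^+ 2 - 4 * c ^+ 2 by have := sqr_ge0 (a - b); nra.
rewrite (_ : _ - _ = (a + b - 2 * c) * (a + b + 2 * c)); last by ring.
have [|] := ltP 0 (a + b + 2 * c); first by move=> h; rewrite pmulr_lge0//; lra.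
lra.
Qed.

(* [G] is the limit of the values of [v] along a minimizing sequence of
   [|v u|^2 - 2 l u]. *)
Lemma riesz_representation : exists2 G, sqpair G &
  dotpair G G <= B ^+ 2 /\ forall u, S u -> dotpair G (v u) = l u.
Proof.
pose E := [set J u | u in S].
have Ei : has_inf E.
  by split; [exists (J 0), 0|exists (- B ^+ 2) => _ [u Su <-]; exact: JB].
set m := inf E.
have mJ u : S u -> m <= J u by move=> Su; apply: ge_inf; [exact: Ei.2|exists u].
(* The defect is a quarter of the rate that [riesz_fischer] asks for, because the parallelogram
   identity doubles each of two defects. *)
have /choice[u Hu] k : exists u, S u /\ J u < m + 16 ^- k / 4.
  have e0 : 0 < 16 ^- k / 4 :> R by rewrite divr_gt0// invr_gt0 exprn_gt0.
  by have [_ [u Su <-] h] := inf_adherent e0 Ei; exists u.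
have Su k : S (u k) by have [] := Hu k.
have mono j k : (k <= j)%N -> 16 ^- j <= 16 ^- k :> R.
  by move=> kj; rewrite lef_pV2 ?posrE ?exprn_gt0// ler_eXn2l//; lra.
have cauchy j k : (k <= j)%N ->
    dotpair (linpair (-1) (v (u k)) (v (u j))) (linpair (-1) (v (u k)) (v (u j)))
    <= 16 ^- k.
  move=> kj; have := mJ _ (SL (-1) (SL (-1) S0 S0) S0).
  (* The midpoint of [u j] and [u k], written with the operation [a u + w]. By the parallelogram
     identity, [|v (u j) - v (u k)|^2 = 2 J (u j) + 2 J (u k) - 4 J] at the midpoint. *)
  have := mJ _ (SL (1/2) (Su k) (SL (-1/2) (Su j) (Su j))).
  rewrite J_lin//; last exact: SL.
  rewrite vL// J_lin//.
  have := (Hu k).2; have := (Hu j).2; have := mono _ _ kj.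
  have ki := vi (Su k); have ji := vi (Su j).
  rewrite !(dotpair_linl, dotpair_linr)//; try exact: sqpair_lin.
  rewrite /J (dotpairC (v (u k)) (v (u j))).
  set a := dotpair (v (u j)) (v (u j)); set b := dotpair (v (u k)) (v (u k)).
  set c := dotpair (v (u j)) (v (u k)).
  lra.
have norm2 p q : dotpair (linpair (-1) p q) (linpair (-1) p q) =
    rint mu (fun x => (q.1 x - p.1 x) ^+ 2) + rint mu (fun x => (q.2 x - p.2 x) ^+ 2).
  by congr (_ + _); apply: eq_rint => x /=; ring.
have nn (p q : (T -> R)) : 0 <= rint mu (fun x => (q x - p x) ^+ 2).
  by apply: rint_ge0 => x; exact: sqr_ge0.
have [G1 G1i G1v] : exists2 G, sqintg mu G &
    forall k, rint mu (fun x => (G x - (v (u k)).1 x) ^+ 2) <= 16 ^- k.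
  apply: riesz_fischer => [k|j k kj]; first by have [] := vi (Su k).
  by apply: le_trans (cauchy _ _ kj); rewrite norm2 lerDl nn.
have [G2 G2i G2v] : exists2 G, sqintg mu G &
    forall k, rint mu (fun x => (G x - (v (u k)).2 x) ^+ 2) <= 16 ^- k.
  apply: riesz_fischer => [k|j k kj]; first by have [] := vi (Su k).
  by apply: le_trans (cauchy _ _ kj); rewrite norm2 lerDr nn.
pose G := (G1, G2).
have Gi : sqpair G by [].
have GG k : dotpair (linpair (-1) (v (u k)) G) (linpair (-1) (v (u k)) G) <= 2 * 16 ^- k.
  by rewrite norm2; have := G1v k; have := G2v k; rewrite /G /=; lra.
have small (x C : R) : (forall k : nat, x <= C * 16 ^- k) -> x <= 0.
  move=> h; have : C * 16 ^- k @[k --> \oo] --> C * 0.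
    apply: cvgMl_tmp; rewrite (_ : (fun k => _) = geometric 1 (16^-1)).
      by apply: cvg_geometric; rewrite ger0_norm; lra.
    by apply/funext => k; rewrite /= mul1r exprVn.
  rewrite mulr0 => hc; rewrite -(cvg_lim _ hc)//; apply: limr_ge.
    exact: (cvgP _ hc).
  exact: nearW.
have rep w : S w -> dotpair G (v w) = l w.
  move=> Sw; apply/eqP; rewrite -subr_eq0 -sqrf_eq0 eq_le sqr_ge0 andbT.
  have wi := vi Sw.
  apply: (small _ (10 * dotpair (v w) (v w))) => k.
  have ki := vi (Su k).
  (* [J (u k + t w) - m] is nonnegative for all [t], and its value at [t = 0] is below [16^-k]: the
     discriminant bounds the linear coefficient. *)
  have c1 : (dotpair (v (u k)) (v w) - l w) ^+ 2 <= 16 ^- k * dotpair (v w) (v w).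
    apply: quadratic_ge0_discr => [|t]; first exact: dotpair_ge0.
    have := mJ _ (SL t Sw (Su k)); rewrite J_lin//.
    have := (Hu k).2; have : 0 <= 16 ^- k :> R by rewrite invr_ge0 exprn_ge0.
    lra.
  have c2 := dotpair_cs (sqpair_lin (-1) ki Gi) wi.
  have := GG k; rewrite dotpair_linl// in c2.
  move: c1 c2; set a := dotpair G (v w); set b := dotpair (v (u k)) (v w).
  set q := dotpair (v w) (v w) => c1 c2 c3.
  have q0 : 0 <= q by exact: dotpair_ge0.
  have c4 := ler_wpM2r q0 c3.
  have c5 : (-1 * b + a) ^+ 2 <= 2 * 16 ^- k * q by apply: le_trans c2 c4.
  rewrite (_ : a - l w = (-1 * b + a) + (b - l w)); last by ring.
  have := sqr_ge0 ((-1 * b + a) - (b - l w)).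
  set s1 := -1 * b + a in c5 *; set s2 := b - l w in c1 *.
  nra.
exists G => //; split=> //.
(* Since [dotpair G (v (u k)) = l (u k)], one has [|G - v (u k)|^2 = |G|^2 + J (u k)], which is at
   least [|G|^2 - B^2]. *)
rewrite -subr_le0; apply: (small _ 2) => k.
have := GG k; have ki := vi (Su k); have := rep _ (Su k); have := JB (Su k).
rewrite !(dotpair_linl, dotpair_linr)//; try exact: sqpair_lin.
rewrite /J (dotpairC (v (u k)) G); lra.
Qed.

End riesz_representation.

(** * Continuity and measurability on row vectors *)

Section continuous_arithmetic.
Context (R : realType) (T : topologicalType).
Implicit Types f g : T -> R.

Lemma continuous_add f g : continuous f -> continuous g ->
  continuous (fun x => f x + g x).
Proof. by move=> cf cg x; apply: cvgD; [exact: cf|exact: cg]. Qed.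

Lemma continuous_mul f g : continuous f -> continuous g ->
  continuous (fun x => f x * g x).
Proof. by move=> cf cg x; apply: cvgM; [exact: cf|exact: cg]. Qed.

Lemma continuous_cstM a f : continuous f -> continuous (fun x => a * f x).
Proof. by move=> cf; apply: continuous_mul => //; exact: cst_continuous. Qed.

End continuous_arithmetic.

Notation leb := lebesgue_rV.

Section measurability.
Context (R : realType) (n : nat).
Implicit Types x y : 'rV[R]_n.

Lemma measurable_ball_rV x e : measurable (ball x e).
Proof.
have [e0|e0] := ltP 0 e; last first.
  rewrite (_ : ball x e = set0)// -subset0 => y [e1].
  by move: e0; rewrite leNgt e1.
rewrite (_ : ball x e = \bigcap_(i in [set: 'I_n])
    ((fun y : 'rV[R]_n => y ord0 i) @^-1` ball (x ord0 i) e)).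
  apply: fin_bigcap_measurable; first exact: finite_finset.
  move=> i _; rewrite -[X in measurable X]setTI.
  by apply: (@measurable_coord R n i) => //; exact: measurable_ball.
apply/seteqP; split=> y /=; first by move=> [_ h] i _; exact: h.
by move=> h; split=> // i j; rewrite (ord1 i); exact: h.
Qed.

(** The sigma-algebra is generated by the coordinates and the topology by the sup norm. Sup-norm
    balls are finite intersections of coordinate conditions, and an open set is a countable union of
    balls with rational centres and radii [1 / (k + 1)]. *)
Lemma open_measurable_rV (U : set 'rV[R]_n) : open U -> measurable U.
Proof.
move=> oU.
pose F (p : 'rV[rat]_n * nat) : set 'rV[R]_n :=
  if `[< ball (map_mx ratr p.1 : 'rV[R]_n) (p.2.+1%:R^-1) `<=` U >]
  then ball (map_mx ratr p.1 : 'rV[R]_n) (p.2.+1%:R^-1) else set0.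
rewrite (_ : U = \bigcup_p F p); last first.
  apply/seteqP; split=> [x Ux|x [p _]]; last first.
    by rewrite /F; case: asboolP => // h; exact: h.
  have /nbhs_ballP[e /= e0 eU] : nbhs x U by exact: open_nbhs_nbhs.
  have [k ke] : exists k : nat, k.+1%:R^-1 < e / 2.
    have e2 : 0 < e / 2 by rewrite divr_gt0.
    by have [k _ /(_ k (leqnn _))] := near_infty_natSinv_lt (PosNum e2); exists k.
  have k0 : 0 < k.+1%:R^-1 :> R by rewrite invr_gt0.
  have /choice[q xq] (i : 'I_n) : exists q : rat, ball (x ord0 i) k.+1%:R^-1 (ratr q : R).
    have [q] : exists q : rat, (ratr q : R) \in `](x ord0 i), (x ord0 i + k.+1%:R^-1)[.
      by apply: rat_in_itvoo; rewrite ltrDl.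
    rewrite in_itv/= => /andP[xq qx]; exists q.
    rewrite -ball_normE /= ltr_norml.
    by move: (x ord0 i) (ratr q) (k.+1%:R^-1) xq qx k0 => a b c; lra.
  exists (\row_i q i, k) => //.
  have xb : ball (map_mx ratr (\row_i q i) : 'rV[R]_n) k.+1%:R^-1 x.
    by split=> // i j; rewrite !mxE (ord1 i); apply: ball_sym; exact: xq.
  rewrite /F /=; case: asboolP => // -[] y yb; apply: eU.
  apply: (@le_ball _ _ x (k.+1%:R^-1 + k.+1%:R^-1)).
    by move: (k.+1%:R^-1) ke => a; lra.
  by apply: ball_triangle yb; apply: ball_sym.
apply: countable_bigcupT_measurable; first exact: countableP.
move=> p; rewrite /F; case: ifP => _; [exact: measurable_ball_rV|exact: measurable0].
Qed.

Lemma continuous_measurable_rV (f : 'rV[R]_n -> R) : continuous f ->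
  measurable_fun setT f.
Proof.
move=> /continuousP cf.
apply: (measurability _ (RGenOpens.measurableE R)) => _ [_ [a [b ->] <-]].
rewrite setTI; apply: open_measurable_rV; apply: cf; exact: interval_open.
Qed.

Lemma measurable_dotpl (d : measure_display) (T : measurableType d)
  (f g : T -> 'rV[R]_n) : measurable_fun setT f -> measurable_fun setT g ->
  measurable_fun setT (fun t => dotp (f t) (g t)).
Proof.
move=> mf mg; apply: measurable_sum => i; apply: measurable_funM.
  by apply: (measurableT_comp (@measurable_coord R n i)).
by apply: (measurableT_comp (@measurable_coord R n i)).
Qed.

Lemma measurable_sqrt : measurable_fun setT (@Num.sqrt R).
Proof. by apply: continuous_measurable_fun => x; exact: sqrt_continuous. Qed.

Lemma measurable_enorm (d : measure_display) (T : measurableType d)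
  (f : T -> 'rV[R]_n) : measurable_fun setT f ->
  measurable_fun setT (fun t => enorm (f t)).
Proof.
by move=> mf; apply: (measurableT_comp measurable_sqrt); exact: measurable_dotpl.
Qed.

Lemma measurable_rVD (d : measure_display) (T : measurableType d)
  (f g : T -> 'rV[R]_n) : measurable_fun setT f -> measurable_fun setT g ->
  measurable_fun setT (fun t => f t + g t).
Proof.
move=> mf mg; apply: measurable_fun_coordP => i.
under eq_fun do rewrite mxE.
by apply: measurable_funD; apply: (measurableT_comp (@measurable_coord R n i)).
Qed.

Lemma measurable_rVZ (d : measure_display) (T : measurableType d) c
  (f : T -> 'rV[R]_n) : measurable_fun setT f ->
  measurable_fun setT (fun t => c *: f t).
Proof.
move=> mf; apply: measurable_fun_coordP => i.
under eq_fun do rewrite mxE.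
by apply: measurable_funM => //; apply: (measurableT_comp (@measurable_coord R n i)).
Qed.

Lemma measurable_rVB (d : measure_display) (T : measurableType d)
  (f g : T -> 'rV[R]_n) : measurable_fun setT f -> measurable_fun setT g ->
  measurable_fun setT (fun t => f t - g t).
Proof.
move=> mf mg; under eq_fun do rewrite -scaleN1r.
by apply: measurable_rVD => //; exact: measurable_rVZ.
Qed.

Lemma measurable_affine c (a : 'rV[R]_n) :
  measurable_fun setT (fun x : 'rV[R]_n => c *: x + a).
Proof. by apply: measurable_rVD => //; exact: measurable_rVZ. Qed.

End measurability.

(** * Affine changes of variables *)

Section affine_change_of_variables.
Context (R : realType).
Implicit Types c : R.

(** By uniqueness of Lebesgue measure: the image measure under the affine map, scaled by [|c|], has
    the right value on half-open intervals. *)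
Lemma lebesgue_affine1 c a (H : R -> \bar R) : c != 0 ->
  measurable_fun setT H -> (forall t, (0 <= H t)%E) ->
  (\int[@lebesgue_measure R]_t H (c * t + a)%R =
   (`|c|^-1)%R%:E * \int[@lebesgue_measure R]_t H t)%E.
Proof.
move=> c0 mH H0.
pose phi (t : measurableTypeR R) : measurableTypeR R := c * t + a.
have mphi : measurable_fun setT phi.
  by apply: measurable_funD => //; exact: measurable_funM.
have nc0 : 0 <= `|c| by [].
pose nu : {measure set (measurableTypeR R) -> \bar R} :=
  mscale (NngNum nc0) (measure_function_pushforward__canonical__measure_function_Measure (@lebesgue_measure R) mphi).
have key A : measurable A -> @lebesgue_measure R A = nu A.
  apply: (@lebesgue_measure_unique R nu) => _ [[x y] _ <-].
  rewrite lebesgue_measure_itv /nu /= /mscale /= /pushforward.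
  have [cp|cn] := ltP 0 c.
    rewrite (_ : _ @^-1` _ = [set` `](x - a) / c, (y - a) / c]]); last first.
      apply/seteqP; split=> t /=; rewrite !in_itv/= /phi ltr_pdivrMr// ler_pdivlMr//;
        by rewrite ltrBlDr lerBrDr (mulrC t).
    rewrite lebesgue_measure_itv/= !lte_fin ltr_pM2r ?invr_gt0// ltrD2r.
    case: ifPn => _; last by rewrite mule0.
    by rewrite -!EFinD -EFinM gtr0_norm//; congr EFin; field; rewrite gt_eqF.
  (* For negative [c] the preimage of a half-open interval is closed at the other end, with the same
     length formula. *)
  have {}cn : c < 0 by rewrite lt_neqAle c0.
  rewrite (_ : _ @^-1` _ = [set` `[(y - a) / c, (x - a) / c[]); last first.
    apply/seteqP; split=> t /=; rewrite !in_itv/= /phi ler_ndivrMr// ltr_ndivlMr//;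
      by rewrite ltrBlDr lerBrDr (mulrC t) andbC.
  rewrite lebesgue_measure_itv/= !lte_fin ltr_nM2r ?invr_lt0// ltrD2r.
  case: ifPn => _; last by rewrite mule0.
  by rewrite -!EFinD -EFinM ltr0_norm//; congr EFin; field.
have -> : (\int[@lebesgue_measure R]_t H t = \int[nu]_t H t)%E.
  by apply: eq_measure_integral => A mA _; exact: key.
rewrite ge0_integral_mscale//=.
rewrite muleA -EFinM mulVf ?normr_eq0// mul1e.
by rewrite ge0_integral_pushforward.
Qed.

Lemma rV_cons0 n (p : R * 'rV[R]_n) : rV_cons p ord0 ord0 = p.1.
Proof.
transitivity (rV_cons p ord0 (@lshift 1 n ord0)).
  by congr (rV_cons p _ _); exact: val_inj.
by rewrite /rV_cons (@row_mxEl R 1 1 n) mxE.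
Qed.

Lemma rV_consS n (p : R * 'rV[R]_n) i : rV_cons p ord0 (lift ord0 i) = p.2 ord0 i.
Proof.
transitivity (rV_cons p ord0 (@rshift 1 n i)).
  by congr (rV_cons p _ _); exact: val_inj.
by rewrite /rV_cons (@row_mxEr R 1 1 n).
Qed.

Lemma integral_rVS n (F : 'rV[R]_n.+1 -> \bar R) :
  measurable_fun setT F -> (forall x, (0 <= F x)%E) ->
  (\int[leb R n.+1]_x F x =
   \int[@lebesgue_measure R]_t \int[leb R n]_y F (rV_cons (t, y)))%E.
Proof.
move=> mF F0.
transitivity (\int[pushforward (@lebesgue_measure R \x leb R n)%E (@rV_cons R n)]_x F x)%E.
  by [].
rewrite ge0_integral_pushforward//; last exact: measurable_rV_cons.
rewrite preimage_setT fubini_tonelli1//.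
  exact: measurableT_comp (@measurable_rV_cons R n).
by move=> z; exact: F0.
Qed.

Lemma measurable_rV_consl n (F : 'rV[R]_n.+1 -> \bar R) (t : R) :
  measurable_fun setT F -> measurable_fun setT (fun y => F (rV_cons (t, y))).
Proof.
move=> mF; apply: (measurableT_comp mF).
apply: (measurableT_comp (@measurable_rV_cons R n)).
exact: measurable_pair1.
Qed.

(** Induction on the dimension: Tonelli's theorem splits off the first coordinate, and each
    coordinate contributes one factor [|c|^-1]. *)
Lemma lebesgue_affine n c (a : 'rV[R]_n) (F : 'rV[R]_n -> \bar R) : c != 0 ->
  measurable_fun setT F -> (forall x, (0 <= F x)%E) ->
  (\int[leb R n]_x F (c *: x + a)%R =
   (`|c| ^- n)%R%:E * \int[leb R n]_x F x)%E.
Proof.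
move=> c0; elim: n a F => [a F mF F0|n IH a F mF F0].
  (* In dimension 0 the measure is the Dirac mass at the only point. *)
  rewrite /= !integral_dirac//; last first.
    by apply: measurableT_comp => //; exact: measurable_affine.
  by rewrite expr0 invr1 mul1e; congr (_ * F _)%E; apply/rowP => -[].
have mG : measurable_fun setT (fun x : 'rV[R]_n.+1 => F (c *: x + a)).
  by apply: measurableT_comp => //; exact: measurable_affine.
rewrite !integral_rVS//.
pose H t := (\int[leb R n]_y F (rV_cons (t, y)))%E.
have mH : measurable_fun setT H.
  apply: (@measurable_tonelli _ _ _ _ R (leb R n) (fun z => F (rV_cons z))).
    exact: measurableT_comp (@measurable_rV_cons R n).
  by move=> z; exact: F0.
transitivity (\int[@lebesgue_measure R]_t ((`|c| ^- n)%R%:E * H (c * t + a ord0 ord0)%R))%E.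
  apply: eq_integral => t _; rewrite /H.
  rewrite -(IH (@rsubmx R 1 1 n a))//; last exact: measurable_rV_consl.
  apply: eq_integral => y _; congr F.
  apply/rowP => i; case: (unliftP ord0 i) => [j|] ->.
    rewrite [LHS]mxE [X in X + _]mxE !rV_consS /= !mxE.
    by congr (_ + a _ _); exact: val_inj.
  by rewrite [LHS]mxE [X in X + _]mxE !rV_cons0.
have mHc : measurable_fun setT (fun t => H (c * t + a ord0 ord0)).
  apply: (measurableT_comp mH).
  by apply: measurable_funD => //; exact: measurable_funM.
have Hc0 (t : R) : (0 <= H (c * t + a ord0 ord0)%R)%E.
  by apply: integral_ge0 => y _; exact: F0.
have cn0 : (0 <= (`|c| ^- n)%R%:E)%E by rewrite lee_fin invr_ge0 exprn_ge0.
rewrite (@ge0_integralZl _ _ _ (@lebesgue_measure R) setT measurableT _ mHc _ (fun t _ => Hc0 t) cn0).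
rewrite lebesgue_affine1//; last by move=> t; apply: integral_ge0 => y _; exact: F0.
by rewrite muleA -EFinM -invfM -exprSr.
Qed.

Lemma intg_affine n c (a : 'rV[R]_n) (f : 'rV[R]_n -> R) : c != 0 ->
  intg (leb R n) f -> intg (leb R n) (fun x => f (c *: x + a)).
Proof.
move=> c0 fi; have mf := intg_measurable fi.
apply/integrableP; split.
  by apply/measurable_EFinP/(measurableT_comp mf); exact: measurable_affine.
have /integrableP[_] := fi.
rewrite (@lebesgue_affine n c a (fun x => `|(EFin \o f) x|)%E c0)//; last first.
  by apply: measurableT_comp => //; exact/measurable_EFinP.
have : (0 <= \int[leb R n]_x `|(EFin \o f) x|)%E by exact: integral_ge0.
by case: (integral _ _ _) => // r _ _; rewrite -EFinM ltry.
Qed.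

Lemma rint_affine n c (a : 'rV[R]_n) (f : 'rV[R]_n -> R) : c != 0 ->
  intg (leb R n) f ->
  rint (leb R n) (fun x => f (c *: x + a)) = `|c| ^- n * rint (leb R n) f.
Proof.
move=> c0 fi; have mf := intg_measurable fi.
have pos (g : 'rV[R]_n -> R) : intg (leb R n) g -> (forall x, 0 <= g x) ->
    rint (leb R n) (fun x => g (c *: x + a)) = `|c| ^- n * rint (leb R n) g.
  move=> gi g0; apply: EFin_inj; rewrite EFinM -!rintE//; last exact: intg_affine.
  rewrite (@lebesgue_affine n c a (EFin \o g) c0)//.
  apply/measurable_EFinP; exact: (intg_measurable gi).
pose p x := Num.max (f x) 0; pose q x := Num.max (- f x) 0.
have fpq x : f x = p x - q x.
  rewrite /p /q; case: (leP (f x) 0) => h.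
    by rewrite max_l ?oppr_ge0// opprK add0r.
  by rewrite max_r ?subr0// oppr_le0 ltW.
have pi : intg (leb R n) p.
  apply: intg_dom (intg_norm fi) => [|x]; first exact: measurable_maxr.
  by rewrite /p; case: (leP (f x) 0) => h; rewrite ?normr0.
have qi : intg (leb R n) q.
  apply: intg_dom (intg_norm fi) => [|x].
    by apply: measurable_maxr => //; exact: measurable_funN.
  by rewrite /q; case: (leP (- f x) 0) => h; rewrite ?normr0 ?normrN.
rewrite (_ : (fun x => f (c *: x + a)) =
  (fun x => p (c *: x + a) - q (c *: x + a))); last exact/funext.
rewrite rintB; [|exact: (intg_affine a c0 pi)|exact: (intg_affine a c0 qi)].
have p0 x : 0 <= p x by rewrite /p le_max lexx orbT.
have q0 x : 0 <= q x by rewrite /q le_max lexx orbT.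
have -> : rint (leb R n) f = rint (leb R n) p - rint (leb R n) q.
  by rewrite -rintB//; exact: eq_rint.
by rewrite mulrBr (pos _ pi p0) (pos _ qi q0).
Qed.

Lemma intg_shift n (a : 'rV[R]_n) (f : 'rV[R]_n -> R) :
  intg (leb R n) f -> intg (leb R n) (fun x => f (x + a)).
Proof.
move=> /(intg_affine a (oner_neq0 R)).
by under eq_fun do rewrite scale1r.
Qed.

Lemma rint_shift n (a : 'rV[R]_n) (f : 'rV[R]_n -> R) :
  intg (leb R n) f -> rint (leb R n) (fun x => f (x + a)) = rint (leb R n) f.
Proof.
move=> /(rint_affine a (oner_neq0 R)).
rewrite normr1 expr1n invr1 mul1r => <-.
by apply: eq_rint => x; rewrite scale1r.
Qed.

Lemma rint_reflect n (a : 'rV[R]_n) (f : 'rV[R]_n -> R) :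
  intg (leb R n) f -> rint (leb R n) (fun x => f (a - x)) = rint (leb R n) f.
Proof.
have m0 : -1 != 0 :> R by rewrite oppr_eq0 oner_neq0.
move=> /(rint_affine a m0).
rewrite normrN normr1 expr1n invr1 mul1r => <-.
by apply: eq_rint => x; rewrite scaleN1r addrC.
Qed.

End affine_change_of_variables.

(** * The Euclidean norm *)

Section euclidean_norm.
Context (R : realType) (n : nat).
Implicit Types x y z : 'rV[R]_n.

Lemma dotpC x y : dotp x y = dotp y x.
Proof. by apply: eq_bigr => i _; rewrite mulrC. Qed.

Lemma dotpDl x y z : dotp (x + y) z = dotp x z + dotp y z.
Proof. by rewrite -big_split; apply: eq_bigr => i _ /=; rewrite mxE mulrDl. Qed.

Lemma dotpZl c x y : dotp (c *: x) y = c * dotp x y.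
Proof. by rewrite mulr_sumr; apply: eq_bigr => i _; rewrite mxE mulrA. Qed.

Lemma dotpDr x y z : dotp x (y + z) = dotp x y + dotp x z.
Proof. by rewrite dotpC dotpDl !(dotpC x). Qed.

Lemma dotpZr c x y : dotp x (c *: y) = c * dotp x y.
Proof. by rewrite dotpC dotpZl (dotpC x). Qed.

Lemma dotpNl x y : dotp (- x) y = - dotp x y.
Proof. by rewrite -scaleN1r dotpZl mulN1r. Qed.

Lemma dotpNr x y : dotp x (- y) = - dotp x y.
Proof. by rewrite dotpC dotpNl dotpC. Qed.

Lemma dotp_ge0 x : 0 <= dotp x x.
Proof. by apply: sumr_ge0 => i _; rewrite -expr2 sqr_ge0. Qed.

Lemma enorm_ge0 x : 0 <= enorm x.
Proof. exact: sqrtr_ge0. Qed.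

Lemma sqr_enorm x : enorm x ^+ 2 = dotp x x.
Proof. by rewrite sqr_sqrtr// dotp_ge0. Qed.

Lemma enorm0 : enorm (0 : 'rV[R]_n) = 0.
Proof. by rewrite /enorm /dotp big1 ?sqrtr0// => i _; rewrite mxE mul0r. Qed.

Lemma enormZ c x : enorm (c *: x) = `|c| * enorm x.
Proof. by rewrite /enorm dotpZl dotpZr mulrA -expr2 sqrtrM ?sqr_ge0// sqrtr_sqr. Qed.

Lemma enormN x : enorm (- x) = enorm x.
Proof. by rewrite -scaleN1r enormZ normrN1 mul1r. Qed.

Lemma enormB x y : enorm (x - y) = enorm (y - x).
Proof. by rewrite -enormN opprB. Qed.

Lemma coord_le_enorm x i : `|x ord0 i| <= enorm x.
Proof.
rewrite -sqrtr_sqr; apply: ler_wsqrtr.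
rewrite /dotp (bigD1 i)//= -expr2 lerDl.
by apply: sumr_ge0 => j _; rewrite -expr2 sqr_ge0.
Qed.

Lemma enorm_eq0 x : (enorm x == 0) = (x == 0).
Proof.
apply/idP/idP => [/eqP x0|/eqP ->]; last by rewrite enorm0.
apply/eqP/rowP => i; rewrite mxE; apply/eqP.
by rewrite -normr_eq0 eq_le normr_ge0 andbT -x0 coord_le_enorm.
Qed.

Lemma enorm_gt0 x : (0 < enorm x) = (x != 0).
Proof. by rewrite lt_neqAle enorm_ge0 andbT eq_sym enorm_eq0. Qed.

Lemma dotp_cs x y : `|dotp x y| <= enorm x * enorm y.
Proof.
rewrite -(@ler_pXn2r _ 2)// ?nnegrE ?mulr_ge0 ?enorm_ge0//.
rewrite exprMn !sqr_enorm real_normK ?num_real//.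
apply: quadratic_ge0_discr => [|t]; first exact: dotp_ge0.
have := dotp_ge0 (x + t *: y).
rewrite !(dotpDl, dotpDr, dotpZl, dotpZr) (dotpC y x) => /le_trans; apply.
by rewrite le_eqVlt; apply/orP; left; apply/eqP; ring.
Qed.

Lemma enormD x y : enorm (x + y) <= enorm x + enorm y.
Proof.
rewrite -(@ler_pXn2r _ 2)// ?nnegrE ?addr_ge0 ?enorm_ge0//.
rewrite sqrrD !sqr_enorm !(dotpDl, dotpDr) (dotpC y x).
have := dotp_cs x y; have := ler_norm (dotp x y).
by rewrite mulr2n; lra.
Qed.

Lemma ler_enorm_dist x y : `|enorm x - enorm y| <= enorm (x - y).
Proof.
rewrite ler_norml; have := enormD (x - y) y; have := enormD (y - x) x.
by rewrite !subrK (enormB y x) => h1 h2; apply/andP; split; lra.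
Qed.

Lemma enorm_le_sum x : enorm x <= \sum_i `|x ord0 i|.
Proof.
have s0 : 0 <= \sum_i `|x ord0 i| by apply: sumr_ge0.
rewrite -(@ler_pXn2r _ 2)// ?nnegrE ?enorm_ge0//.
rewrite sqr_enorm expr2 mulr_suml /dotp; apply: ler_sum => i _.
apply: le_trans (ler_norm _) _; rewrite normrM ler_wpM2l//.
by rewrite (bigD1 i)//= lerDl sumr_ge0.
Qed.

Lemma continuous_sumr (T : topologicalType) (I : Type) (s : seq I)
  (F : I -> T -> R) : (forall i, continuous (F i)) ->
  continuous (fun t : T => \sum_(i <- s) F i t).
Proof.
move=> cF; elim: s => [|i s IH]; first by under eq_fun do rewrite big_nil; exact: cst_continuous.
under eq_fun do rewrite big_cons.
by move=> x; apply: continuousD; [exact: cF|exact: IH].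
Qed.

Lemma continuous_dotp x : continuous (dotp x).
Proof.
apply: continuous_sumr => i y.
by apply: continuousM; [exact: cst_continuous|exact: coord_continuous].
Qed.

Lemma continuous_enorm : continuous (@enorm R n).
Proof.
move=> x; apply: (@continuous_comp _ _ _ (fun x => dotp x x) Num.sqrt); last exact: sqrt_continuous.
apply: continuous_sumr => i y.
by apply: continuousM; exact: coord_continuous.
Qed.

(** Compactness bounds the sup norm; the Euclidean norm is at most [n] times as large. *)
Lemma compact_enorm_bound (A : set 'rV[R]_n) : compact A ->
  exists2 r, 0 < r & forall x, A x -> enorm x <= r.
Proof.
move=> /compact_bounded[M [_ MA]]; exists (n%:R * (`|M| + 1) + 1).
  by rewrite ltr_pwDr// mulr_ge0// addr_ge0.
move=> x Ax; apply: le_trans (enorm_le_sum x) _.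
have /(_ x Ax)/= xM := MA (`|M| + 1) (le_lt_trans (ler_norm _) (ltr_pwDr ltr01 (lexx _))).
apply: (@le_trans _ _ (\sum_(i < n) (`|M| + 1))); last first.
  by rewrite sumr_const card_ord mulr_natl lerDl.
apply: ler_sum => i _; apply: le_trans xM.
rewrite [leRHS]/Num.norm /= mx_normrE; apply/bigmax_geP; right => /=.
by exists (ord0, i).
Qed.

End euclidean_norm.

(** * Integrals of powers of the norm *)

Section radial_integrals.
Context (R : realType) (n : nat).
Implicit Types x y z : 'rV[R]_n.

Lemma measurable_eball r : measurable [set x : 'rV[R]_n | enorm x <= r].
Proof.
rewrite (_ : [set x | _] = (@enorm R n) @^-1` [set` `]-oo, r]]).
  by rewrite -[X in measurable X]setTI; apply: measurable_enorm.
by apply/seteqP; split => x; rewrite /= in_itv.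
Qed.

Lemma measurable_enorm_powR (p : R) :
  measurable_fun setT (fun x : 'rV[R]_n => enorm x `^ p).
Proof.
have mid : measurable_fun setT (fun x : 'rV[R]_n => x) by exact: measurable_id.
exact: (measurableT_comp (@measurable_powR R p) (measurable_enorm mid)).
Qed.

(** The ball lies in a cube of side [2 r]; the exact volume would only change the constants. *)
Lemma lebesgue_eball r : 0 <= r ->
  (leb R n [set x : 'rV[R]_n | (enorm x <= r)%R] <= ((2 * r) ^+ n)%:E)%E.
Proof.
move=> r0; pose A (i : 'I_n) : set (measurableTypeR R) := `[(- r), r]%classic.
have mA i : measurable (A i) by exact: measurable_itv.
apply: (@le_trans _ _ (leb R n [set x : 'rV[R]_n | forall i, A i (x ord0 i)])).
  apply: le_measure; rewrite ?inE; first exact: measurable_eball.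
    rewrite (_ : [set x | _] = \bigcap_(i in [set: 'I_n])
        ((fun x : 'rV[R]_n => x ord0 i) @^-1` A i)).
      apply: fin_bigcap_measurable; first exact: finite_finset.
      move=> i _; rewrite -[X in measurable X]setTI.
      by apply: (@measurable_coord R n i) => //; exact: mA.
    by apply/seteqP; split=> x /= h i; [move=> _|]; exact: h.
  move=> x /= xr i; rewrite /A /= in_itv/= -ler_norml.
  exact: le_trans (coord_le_enorm x i) xr.
rewrite lebesgue_rV_box//.
under eq_bigr do rewrite /A lebesgue_measure_itv /= lte_fin -EFinD opprK.
rewrite (eq_bigr (fun=> (2 * r)%:E)); last first.
  move=> i _; case: ltP => h; first by congr EFin; ring.
  by congr EFin; lra.
by rewrite prodEFin prodr_const card_ord.
Qed.

(** A substitute for polar coordinates: [f] is dominated by the sum of the constants [w k] on the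
    balls of radius [r k], so it is enough that each point of the support falls under one of
    them. *)
Lemma integral_le_shells (f : 'rV[R]_n -> R) (w r : nat -> R) :
  measurable_fun setT f -> (forall x, 0 <= f x) ->
  (forall k, 0 <= w k) -> (forall k, 0 <= r k) ->
  (forall x, f x != 0 -> exists2 k, f x <= w k & enorm x <= r k) ->
  (\int[leb R n]_x (f x)%:E <= \sum_(k <oo) (w k * (2 * r k) ^+ n)%:E)%E.
Proof.
move=> mf f0 w0 r0 fw.
pose B k := [set x : 'rV[R]_n | enorm x <= r k].
have mB k : measurable (B k) by exact: measurable_eball.
have mw k : measurable_fun setT (fun x : 'rV[R]_n => (w k * \1_(B k) x)%:E).
  by apply/measurable_EFinP/measurable_funM => //; exact: measurable_indic.
have wB0 k x : (0 <= (w k * \1_(B k) x)%:E)%E by rewrite lee_fin mulr_ge0.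
apply: (@le_trans _ _ (\int[leb R n]_x \sum_(k <oo) (w k * \1_(B k) x)%:E)%E).
  apply: ge0_le_integral => //.
  - by move=> x _; rewrite lee_fin.
  - exact/measurable_EFinP.
  - by apply: ge0_emeasurable_sum.
  - move=> x _; have [->|/fw[k fk xk]] := eqVneq (f x) 0; first exact: nneseries_ge0.
    apply: (@le_trans _ _ (w k * \1_(B k) x)%:E).
      by rewrite indicE mem_set// mulr1 lee_fin.
    apply: le_trans (nneseries_lim_ge k.+1 _); last by move=> i _ _; exact: wB0.
    rewrite big_nat_recr//= leeDr//.
    by apply: sume_ge0 => i _; exact: wB0.
rewrite integral_nneseries//; apply: lee_nneseries => [k _ _|k _].
  by apply: integral_ge0 => x _; exact: wB0.
under eq_integral do rewrite EFinM.
have m1 : measurable_fun setT (fun x => (\1_(B k) x)%:E : \bar R).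
  by apply/measurable_EFinP; exact: measurable_indic.
have w0' : (0 <= (w k)%:E)%E by rewrite lee_fin.
rewrite (@ge0_integralZl _ _ _ (leb R n) setT measurableT _ m1 _ _ w0')//.
rewrite integral_indic// setIT EFinM.
by apply: lee_wpmul2l; rewrite ?lee_fin//; exact: lebesgue_eball.
Qed.

(** The left-hand side is [2^a / (2^a - 1)] and [2^a - 1 >= a ln 2 >= a / 2]. The factor [1 / a] is
    the source of the denominators [1 - beta] and [n - 2 beta] of the final estimates. *)
Lemma powR2_sub1 (a A : R) : 0 < a <= A -> (1 - 2 `^ (- a))^-1 <= 2 * 2 `^ A / a.
Proof.
move=> /andP[a0 aA].
(* From [ln (1 + x) <= x] at [x = - 1 / 2]. *)
have l2 : 1 / 2 <= ln 2 :> R.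
  have := @le_ln1Dx R (- (1 / 2)); rewrite (_ : 1 + _ = 2^-1); last by field.
  by rewrite lnV ?posrE//; lra.
have h : a / 2 <= 2 `^ a - 1.
  rewrite /powR pnatr_eq0 /=.
  have := expR_ge1Dx (a * ln 2); have : a / 2 <= a * ln 2 by rewrite ler_pM2l; lra.
  lra.
have p0 : 2 `^ a != 0 :> R by rewrite gt_eqF// powR_gt0.
have e : 1 - 2 `^ (- a) = (2 `^ a - 1) / 2 `^ a.
  by rewrite powRN mulrBl mulfV// mul1r.
have aA' : 2 `^ a <= 2 `^ A :> R by apply: ler_powR => //; lra.
rewrite e invf_div ler_pdivrMr; last by lra.
apply: le_trans aA' _; have := powR_gt0 A (ltr0n R 2) => A0.
rewrite mulrAC ler_pdivlMr//.
set p := 2 `^ A in A0 *; set q := 2 `^ a - 1 in h *.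
nra.
Qed.

Lemma powR2_lt1 (a : R) : 0 < a -> (0 : R) <= 2 `^ (- a) < 1.
Proof.
move=> a0; rewrite powR_ge0/= powRN invf_lt1 ?powR_gt0//.
rewrite /powR pnatr_eq0 /= expR_gt1 mulr_gt0// ln_gt0//; lra.
Qed.

(** The factor [4^n] collects the losses on a dyadic shell (cube instead of ball, ratio 2 between
    the radii); the rest is the bound of [powR2_sub1] without its [1 / a]. *)
Definition radC (A : R) : R := 4 ^+ n * (2 * 2 `^ A).

Lemma radC_gt0 A : 0 < radC A.
Proof. by rewrite !mulr_gt0 ?exprn_gt0 ?powR_gt0. Qed.

Lemma shell_sum (a A b : R) : 0 < a <= A -> 0 <= b ->
  (\sum_(k <oo) (4 ^+ n * b * (2 `^ (- a)) ^+ k)%:E <= (radC A * (b / a))%:E)%E.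
Proof.
move=> aA b0; have /andP[a0 _] := aA; rewrite geometric_eseries ?powR2_lt1//.
rewrite lee_fin /radC -!mulrA ler_pM2l ?exprn_gt0//.
rewrite [leLHS]mulrC [leRHS](_ : _ = 2 * 2 `^ A / a * b); last by ring.
by rewrite ler_wpM2r//; exact: powR2_sub1.
Qed.

Lemma powR_subn (x a : R) k : 0 < x -> x `^ (a - k%:R) = x `^ a / x ^+ k.
Proof. move=> x0; rewrite powRB ?powR_mulrn ?(ltW x0)//.
by apply/implyP => _; rewrite gt_eqF. Qed.

Lemma powRXn (x a : R) k : 0 <= x -> (x ^+ k) `^ a = (x `^ a) ^+ k.
Proof.
by move=> x0; rewrite -powR_mulrn// -powRrM mulrC powRrM powR_mulrn// powR_ge0.
Qed.

(** On the shell between [2^k rho] and [2^(k+1) rho] the integrand is at most its value at the inner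
    radius. The shells contribute a geometric series of ratio [2^-a]. *)
Lemma integral_outside (a A rho : R) : 0 < a <= A -> 0 < rho ->
  (\int[leb R n]_x (if (rho <= enorm x)%R then enorm x `^ (- a - n%:R) else 0)%:E
   <= (radC A * (rho `^ (- a) / a))%:E)%E.
Proof.
move=> aA rho0; have /andP[a0 _] := aA.
pose r k : R := 2 ^+ k.+1 * rho.
have pr k : 0 < 2 ^+ k * rho by rewrite mulr_gt0// exprn_gt0.
have mf : measurable_fun setT (fun x : 'rV[R]_n =>
    if rho <= enorm x then enorm x `^ (- a - n%:R) else 0).
  apply: measurable_fun_ifT => //.
    by apply: measurable_fun_ler => //; exact: measurable_enorm.
  exact: measurable_enorm_powR.
apply: le_trans (@integral_le_shells _
    (fun k => (2 ^+ k * rho) `^ (- a - n%:R)) r mf _ _ _ _) _.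
- by move=> x; case: ifP => // _; exact: powR_ge0.
- by move=> k; exact: powR_ge0.
- by move=> k; rewrite /r ltW.
- move=> x; case: ifPn => [rx _|_]; last by rewrite eqxx.
  (* Such a [k] exists because [2^m > m]; the least one is the index of the shell containing [x]. *)
  have ex : exists k, enorm x <= r k.
    pose m := Num.truncn (enorm x / rho).
    exists m; rewrite /r -ler_pdivrMr//.
    apply: (@le_trans _ _ m.+1%:R); first exact/ltW/truncnS_gt.
    by rewrite -natrX ler_nat ltnW// ltn_expl.
  case: (ex_minnP ex) => k kx kmin; exists k => //.
  have rkx : 2 ^+ k * rho <= enorm x.
    case: k kx kmin => [|k] kx kmin; first by rewrite expr0 mul1r.
    by rewrite leNgt; apply/negP => /ltW /kmin; rewrite ltnn.
  have x0 : 0 < enorm x by exact: lt_le_trans (pr k) rkx.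
  rewrite -opprD !powRN lef_pV2 ?posrE ?powR_gt0//.
  by rewrite ge0_ler_powR// ?nnegrE ?(ltW x0) ?(ltW (pr k))// addr_ge0// ltW.
apply: le_trans (shell_sum aA (powR_ge0 rho (- a))).
rewrite le_eqVlt; apply/orP; left; apply/eqP; apply: eq_eseriesr => k _; congr EFin.
rewrite /r (_ : 2 * (2 ^+ k.+1 * rho) = 4 * (2 ^+ k * rho)); last by rewrite exprS; ring.
rewrite powR_subn// !exprMn powRM ?exprn_ge0 ?(ltW rho0)// powRXn//.
by field; rewrite expf_neq0 ?gt_eqF.
Qed.

(** Shells shrinking to the origin. With [|x| = t r] and [1/2 < t <= 1], the factor [t^(a - n)] is
    at most [2^n] whatever the sign of [a - n], since [t^a <= 1] and [t^-n <= 2^n]. *)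
Lemma integral_inside (a A rho : R) : 0 < a <= A -> 0 < rho ->
  (\int[leb R n]_x (if (enorm x <= rho)%R then enorm x `^ (a - n%:R) else 0)%:E
   <= (radC A * (rho `^ a / a))%:E)%E.
Proof.
move=> aA rho0; have /andP[a0 _] := aA.
pose r k : R := 2 ^- k * rho.
have pr k : 0 < r k by rewrite mulr_gt0// invr_gt0 exprn_gt0.
have mf : measurable_fun setT (fun x : 'rV[R]_n =>
    if enorm x <= rho then enorm x `^ (a - n%:R) else 0).
  apply: measurable_fun_ifT => //.
    by apply: measurable_fun_ler => //; exact: measurable_enorm.
  exact: measurable_enorm_powR.
have w0 k : 0 <= 2 ^+ n * (r k) `^ (a - n%:R) by rewrite mulr_ge0 ?exprn_ge0 ?powR_ge0.
have two_n : 1 <= 2 ^+ n :> R by rewrite exprn_ege1//; lra.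
apply: le_trans (@integral_le_shells _
    (fun k => 2 ^+ n * (r k) `^ (a - n%:R)) r mf _ _ _ _) _ => //.
- by move=> x; case: ifP => // _; exact: powR_ge0.
- by move=> k; rewrite ltW.
- move=> x; case: ifPn => [rx|_]; last by rewrite eqxx.
  have [x0|x0] := eqVneq (enorm x) 0.
    rewrite x0 => h; exists 0%N; rewrite ?(ltW (pr 0%N))//.
    (* At the origin the power is 0, except for [a = n], where the exponent vanishes and the value
       is 1. *)
    have [an0|an0] := eqVneq (a - n%:R) 0; first by rewrite an0 !powRr0 mulr1.
    by rewrite powR0// mulr_ge0 ?exprn_ge0 ?powR_ge0.
  move=> _; have {}x0 : 0 < enorm x by rewrite lt_neqAle eq_sym x0 enorm_ge0.
  have ex : exists k, r k.+1 < enorm x.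
    pose m := Num.truncn (rho / enorm x).
    exists m; rewrite /r mulrC ltr_pdivrMr ?exprn_gt0// mulrC -ltr_pdivrMr//.
    apply: (@lt_le_trans _ _ m.+1%:R); first exact: truncnS_gt.
    by rewrite -natrX ler_nat ltnW// ltn_expl.
  case: (ex_minnP ex) => k kx kmin.
  have xrk : enorm x <= r k.
    case: k kx kmin => [|k] kx kmin; first by rewrite /r expr0 invr1 mul1r.
    by rewrite leNgt; apply/negP => /kmin; rewrite ltnn.
  exists k => //; have rk0 := pr k.
  have xk : enorm x = r k * (enorm x / r k) by field; rewrite gt_eqF.
  have t1 : enorm x / r k <= 1 by rewrite ler_pdivrMr// mul1r.
  have t2 : 2^-1 < enorm x / r k.
    rewrite ltr_pdivlMr//; apply: le_lt_trans kx.
    by rewrite /r exprS invfM mulrA.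
  move: t1 t2 xk; set t := enorm x / r k => t1 t2 ->.
  have t0 : 0 < t by lra.
  rewrite powRM ?(ltW t0) ?(ltW rk0)// mulrC ler_wpM2r ?powR_ge0//.
  rewrite powR_subn// ler_pdivrMr ?exprn_gt0//.
  apply: (@le_trans _ _ 1).
    have := @ge0_ler_powR _ a (ltW a0) t 1; rewrite powR1; apply => //.
      by rewrite nnegrE ltW.
    by rewrite nnegrE.
  by rewrite -exprMn exprn_ege1//; lra.
apply: le_trans (shell_sum aA _); last exact: (powR_ge0 rho a).
rewrite le_eqVlt; apply/orP; left; apply/eqP; apply: eq_eseriesr => k _; congr EFin.
rewrite powR_subn// !exprMn /r powRM ?(ltW rho0) ?invr_ge0 ?exprn_ge0//.
rewrite -exprVn powRXn ?invr_ge0// -powR_inv1// -powRrM mulN1r.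
rewrite (_ : 4 = 2 * 2); last by ring.
by rewrite [in RHS]exprMn; field; rewrite !expf_neq0 ?gt_eqF ?powR_gt0.
Qed.

Lemma lebesgue_eball_lty r : (leb R n [set x : 'rV[R]_n | (enorm x <= r)%R] < +oo)%E.
Proof.
have [r0|r0] := leP 0 r; first by apply: le_lt_trans (lebesgue_eball r0) _; rewrite ltry.
rewrite (_ : [set x | _] = set0) ?measure0//.
rewrite -subset0 => x /= xr; have := le_lt_trans xr r0.
by rewrite ltNge enorm_ge0.
Qed.

Lemma intg_indic_eball r :
  intg (leb R n) (\1_[set x : 'rV[R]_n | enorm x <= r]).
Proof.
apply/integrableP; split.
  by apply/measurable_EFinP; apply: measurable_indic; exact: measurable_eball.
under eq_integral do rewrite gee0_abs ?lee_fin//=.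
by rewrite integral_indic ?setIT ?lebesgue_eball_lty//; exact: measurable_eball.
Qed.

Lemma intg_bounded_support (f : 'rV[R]_n -> R) M r : measurable_fun setT f ->
  (forall x, `|f x| <= M) -> (forall x, f x != 0 -> enorm x <= r) ->
  intg (leb R n) f.
Proof.
move=> mf fM fr; apply: (intg_dom mf _ (intgZ M (intg_indic_eball r))) => x.
rewrite indicE; have [xr|xr] := leP (enorm x) r.
  by rewrite mem_set// mulr1.
rewrite memNset/= ?mulr0; last by apply/negP; rewrite -ltNge.
have [->|/fr] := eqVneq (f x) 0; first by rewrite normr0.
by rewrite leNgt xr.
Qed.

Lemma intg_outside (a rho : R) : 0 < a -> 0 < rho ->
  intg (leb R n) (fun x => if rho <= enorm x then enorm x `^ (- a - n%:R) else 0).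
Proof.
move=> a0 rho0; apply: intg_ge0.
- apply: measurable_fun_ifT => //.
    by apply: measurable_fun_ler => //; exact: measurable_enorm.
  exact: measurable_enorm_powR.
- by move=> x; case: ifP => // _; exact: powR_ge0.
- have aa : 0 < a <= a by rewrite a0 lexx.
  by apply: le_lt_trans (integral_outside aa rho0) _; rewrite ltry.
Qed.

Lemma intg_inside (a rho : R) : 0 < a -> 0 < rho ->
  intg (leb R n) (fun x => if enorm x <= rho then enorm x `^ (a - n%:R) else 0).
Proof.
move=> a0 rho0; apply: intg_ge0.
- apply: measurable_fun_ifT => //.
    by apply: measurable_fun_ler => //; exact: measurable_enorm.
  exact: measurable_enorm_powR.
- by move=> x; case: ifP => // _; exact: powR_ge0.
- have aa : 0 < a <= a by rewrite a0 lexx.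
  by apply: le_lt_trans (integral_inside aa rho0) _; rewrite ltry.
Qed.

Lemma rint_outside (a A rho : R) : 0 < a <= A -> 0 < rho ->
  rint (leb R n) (fun x => if rho <= enorm x then enorm x `^ (- a - n%:R) else 0)
  <= radC A * (rho `^ (- a) / a).
Proof.
move=> aA rho0; have /andP[a0 _] := aA; have := integral_outside aA rho0.
by rewrite rintE ?lee_fin//; exact: intg_outside.
Qed.

Lemma rint_inside (a A rho : R) : 0 < a <= A -> 0 < rho ->
  rint (leb R n) (fun x => if enorm x <= rho then enorm x `^ (a - n%:R) else 0)
  <= radC A * (rho `^ a / a).
Proof.
move=> aA rho0; have /andP[a0 _] := aA; have := integral_inside aA rho0.
by rewrite rintE ?lee_fin//; exact: intg_inside.
Qed.

Lemma measurable_weight N :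
  measurable_fun setT (fun x : 'rV[R]_n => (1 + enorm x) ^- N).
Proof.
have e : (fun x : 'rV[R]_n => (1 + enorm x) ^- N) = (fun x => (1 + enorm x) `^ (- N%:R)).
  by apply/funext => x; rewrite powR_invn// addr_ge0// enorm_ge0.
rewrite e; have mid : measurable_fun setT (fun x : 'rV[R]_n => x) by exact: measurable_id.
have m1 : measurable_fun setT (fun x : 'rV[R]_n => 1 + enorm x).
  by apply: measurable_funD => //; exact: measurable_enorm.
exact: (measurableT_comp (@measurable_powR R (- N%:R)) m1).
Qed.

Lemma intg_weight N : (n < N)%N -> intg (leb R n) (fun x => (1 + enorm x) ^- N).
Proof.
move=> nN.
have := intgD (intg_indic_eball 1) (intg_outside ltr01 ltr01).
apply: intg_dom.
  exact: measurable_weight.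
move=> x; have e0 := enorm_ge0 x.
have x1 : 1 <= 1 + enorm x by rewrite lerDl.
rewrite ger0_norm ?invr_ge0 ?exprn_ge0 ?addr_ge0// indicE.
have [h|h] := leP (enorm x) 1.
  rewrite mem_set//; apply: (@le_trans _ _ 1); last first.
    by rewrite lerDl; case: ifP => // _; exact: powR_ge0.
  by rewrite invf_le1 ?exprn_gt0 ?exprn_ege1// ltr_pwDl.
rewrite memNset/= ?add0r; last by apply/negP; rewrite -ltNge.
rewrite (ltW h) -opprD powRN nat1r powR_mulrn// lef_pV2 ?posrE ?exprn_gt0//; last 2 first.
- by rewrite ltr_pwDl.
- exact: lt_trans h.
apply: (@le_trans _ _ ((1 + enorm x) ^+ n.+1)).
  by apply: lerXn2r; rewrite ?nnegrE ?addr_ge0// lerDr.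
by rewrite ler_weXn2l.
Qed.

End radial_integrals.

(** * The one-dimensional Abel weight and its transform *)

Section exponential_kernel.
Context (R : realType).
Notation mu := (@lebesgue_measure R).
Implicit Types x t : R.

Definition abel_weight t : R := expR (- `|t|).

(** The Fourier transform [2 / (1 + x^2)] of [exp(- |t|)], as [rint_abel_cos] shows. *)
Definition abel_kernel x : R := 2 * (oneDsqr x)^-1.

(** An antiderivative of [exp(-t) (1 + cos(x t))]. The summand 1 makes the integrand nonnegative,
    which the fundamental theorem of calculus on a half-line requires. *)
Let F x t : R := expR (- t) * ((x * sin (x * t) - cos (x * t)) / oneDsqr x - 1).

Let dF x t : is_derive t (1 : R) (F x) (expR (- t) * (1 + cos (x * t))).
Proof.
have dx : is_derive t (1 : R) (fun t => x * t) x.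
  have h : is_derive t (1 : R) (x \*: (id : R -> R)) (x *: 1) by exact: is_deriveZ.
  by move: h; rewrite /GRing.scale /= mulr1.
have dc : is_derive t (1 : R) (fun t => cos (x * t)) (- sin (x * t) * x).
  exact: (@is_derive1_comp _ cos (fun t => x * t)).
have ds : is_derive t (1 : R) (fun t => sin (x * t)) (cos (x * t) * x).
  exact: (@is_derive1_comp _ sin (fun t => x * t)).
have de : is_derive t (1 : R) (fun t => expR (- t)) (expR (- t) * -1).
  apply: (@is_derive1_comp _ expR (fun t => - t)).
rewrite /F; apply: is_derive_eq; rewrite /GRing.scale /=.
by rewrite /oneDsqr; field; rewrite gt_eqF// (lt_le_trans ltr01)// oneDsqr_ge1.
Qed.

Lemma continuous_cosM x : continuous (fun t => cos (x * t)).
Proof.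
by move=> t; apply: continuous_comp; [exact: mulrl_continuous|exact: continuous_cos].
Qed.

Lemma continuous_sinM x : continuous (fun t => sin (x * t)).
Proof.
by move=> t; apply: continuous_comp; [exact: mulrl_continuous|exact: continuous_sin].
Qed.

Let cos1_ge0 (a : R) : 0 <= 1 + cos a.
Proof. by have := cos_geN1 a; lra. Qed.

Let integral_half x :
  (\int[mu]_(t in `[0%R, +oo[) (expR (- t) * (1 + cos (x * t)))%:E =
   (1 + (oneDsqr x)^-1)%:E)%E.
Proof.
have cf : continuous (fun t => expR (- t) * (1 + cos (x * t))).
  move=> t; apply: cvgM.
    by apply: continuous_comp; [exact: oppr_continuous|exact: continuous_expR].
  by apply: cvgD; [exact: cvg_cst|exact: continuous_cosM].
have cF : continuous (F x).
  move=> t; apply/differentiable_continuous/derivable1_diffP; exact: ex_derive.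
rewrite (@ge0_continuous_FTC2y _ _ (F x) 0 0).
- congr EFin; rewrite /F oppr0 expR0 mulr0 sin0 cos0; ring.
- by move=> t _; exact: mulr_ge0 (expR_ge0 _) (cos1_ge0 _).
- by apply: continuous_subspaceT.
- apply: (@squeeze_cvgr _ _ _ _ (fun t => - (expR (- t) * (`|x| + 2))) (fun t => expR (- t) * (`|x| + 2))).
  + apply: nearW => t; rewrite -ler_norml /F normrM ger0_norm ?expR_ge0// ler_wpM2l ?expR_ge0//.
    have o1 : 1 <= oneDsqr x by exact: oneDsqr_ge1.
    have o0 : 0 < oneDsqr x by lra.
    rewrite (_ : `|x| + 2 = (`|x| + 1) + 1); last by ring.
    apply: le_trans (ler_normB _ _) _; rewrite normr1 lerD2r normrM.
    have oV : 0 <= (oneDsqr x)^-1 by rewrite invr_ge0 ltW.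
    rewrite (ger0_norm oV) ler_pdivrMr//.
    apply: (@le_trans _ _ (`|x| + 1)); last by rewrite ler_peMr// addr_ge0.
    apply: le_trans (ler_normB _ _) _; rewrite lerD ?cos_max// normrM.
    by rewrite ler_piMr// sin_max.
  + rewrite -oppr0; apply: cvgN; rewrite -[X in _ --> X](mul0r (`|x| + 2)).
    by apply: cvgM; [exact: cvgr_expR|exact: cvg_cst].
  + rewrite -[X in _ --> X](mul0r (`|x| + 2)).
    by apply: cvgM; [exact: cvgr_expR|exact: cvg_cst].
- by move=> t _; exact: ex_derive.
- by apply: cvg_at_right_filter; exact: cF.
- by move=> t _; rewrite derive1E; exact: (@derive_val _ _ _ _ _ _ _ (dF x t)).
Qed.

Lemma continuous_abel_weight : continuous abel_weight.
Proof.
move=> t; apply: continuous_comp; last exact: continuous_expR.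
by apply: continuousN; exact: norm_continuous.
Qed.

Let integral_full x :
  (\int[mu]_t (abel_weight t * (1 + cos (x * t)))%:E = (2 + abel_kernel x)%:E)%E.
Proof.
rewrite (@ge0_symfun_integralT R (fun t => abel_weight t * (1 + cos (x * t)))).
- rewrite (_ : [set t | _] = `[0%R, +oo[%classic); last first.
    by apply/seteqP; split=> t /=; rewrite in_itv /= andbT.
  under eq_integral.
    move=> t; rewrite inE /= in_itv /= andbT => t0.
    rewrite /abel_weight ger0_norm//; over.
  by rewrite integral_half -EFinM; congr EFin; rewrite /abel_kernel; ring.
- by move=> t; exact: mulr_ge0 (expR_ge0 _) (cos1_ge0 _).
- move=> t; apply: cvgM; first exact: continuous_abel_weight.
  by apply: cvgD; [exact: cvg_cst|exact: continuous_cosM].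
- by move=> t /=; rewrite /abel_weight normrN mulrN cosN.
Qed.

Lemma measurable_cosM x :
  measurable_fun [set: measurableTypeR R] (fun t : measurableTypeR R => cos (x * t)).
Proof. exact: (continuous_measurable_fun (continuous_cosM (x := x))). Qed.

Lemma measurable_sinM x :
  measurable_fun [set: measurableTypeR R] (fun t : measurableTypeR R => sin (x * t)).
Proof. exact: (continuous_measurable_fun (continuous_sinM (x := x))). Qed.

Lemma measurable_abel_weight :
  measurable_fun [set: measurableTypeR R] (abel_weight : measurableTypeR R -> R).
Proof. exact: (continuous_measurable_fun continuous_abel_weight). Qed.

Lemma abel_weight_ge0 t : 0 <= abel_weight t.
Proof. exact: expR_ge0. Qed.

Let intg_full x : intg mu (fun t => abel_weight t * (1 + cos (x * t))).
Proof.
apply: intg_ge0.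
- apply: measurable_funM; first exact: measurable_abel_weight.
  by apply: measurable_funD => //; exact: measurable_cosM.
- by move=> t; exact: mulr_ge0 (expR_ge0 _) (cos1_ge0 _).
- by rewrite integral_full ltry.
Qed.

Lemma intg_abel_weight : intg mu abel_weight.
Proof.
have := intgZ (1 / 2) (intg_full 0); congr (intg _ _); apply/funext => t.
by rewrite mul0r cos0; field.
Qed.

Lemma intg_abel_weightM (b : R -> R) :
  measurable_fun [set: measurableTypeR R] (b : measurableTypeR R -> R) ->
  (forall t, `|b t| <= 1) -> intg mu (fun t => abel_weight t * b t).
Proof.
move=> mb b1; have := intgM_bounded mb b1 intg_abel_weight.
by under eq_fun do rewrite mulrC.
Qed.

(** The case [x = 0] of the integral with [1 + cos] gives the mass 2 of the weight, which is then
    subtracted. *)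
Lemma rint_abel_cos x :
  rint mu (fun t => abel_weight t * cos (x * t)) = abel_kernel x.
Proof.
have full y : rint mu (fun t => abel_weight t * (1 + cos (y * t))) = 2 + abel_kernel y.
  by apply: EFin_inj; rewrite -rintE; [exact: integral_full|exact: intg_full].
have ci y : intg mu (fun t => abel_weight t * cos (y * t)).
  apply: intg_abel_weightM; [exact: measurable_cosM|by move=> t; exact: cos_max].
have w2 : rint mu abel_weight = 2.
  have := full 0; rewrite (_ : (fun t => _) = (fun t => 2 * abel_weight t)).
    rewrite rintZ; last exact: intg_abel_weight.
    by rewrite /abel_kernel /oneDsqr expr0n /= addr0 invr1; lra.
  by apply/funext => t; rewrite mul0r cos0; ring.
have := full x; rewrite (_ : (fun t => _) = (fun t => abel_weight t + abel_weight t * cos (x * t))).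
  by rewrite rintD//; [lra|exact: intg_abel_weight].
by apply/funext => t; rewrite mulrDr mulr1.
Qed.

Lemma abel_kernel_gt0 x : 0 < abel_kernel x.
Proof. by rewrite mulr_gt0// invr_gt0 (lt_le_trans ltr01)// oneDsqr_ge1. Qed.

Let continuous_abel_kernel : continuous abel_kernel.
Proof. by move=> x; apply: cvgM; [exact: cvg_cst|exact: continuous_oneDsqrV]. Qed.

Lemma measurable_abel_kernel :
  measurable_fun [set: measurableTypeR R] (abel_kernel : measurableTypeR R -> R).
Proof. exact: (continuous_measurable_fun continuous_abel_kernel). Qed.

Let integral_abel_kernel : (\int[mu]_x (abel_kernel x)%:E = (2 * pi)%:E)%E.
Proof.
rewrite (@ge0_symfun_integralT R abel_kernel).
- rewrite (_ : [set t | _] = `[0%R, +oo[%classic); last first.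
    by apply/seteqP; split=> t /=; rewrite in_itv /= andbT.
  rewrite /abel_kernel; under eq_integral do rewrite EFinM.
  have mV : measurable_fun [set: measurableTypeR R] (fun x : measurableTypeR R => (oneDsqr x)^-1).
    exact: (continuous_measurable_fun (@continuous_oneDsqrV R)).
  have V0 (x : R) : (0 <= ((oneDsqr x)^-1)%:E)%E by rewrite lee_fin invr_ge0.
  have two0 : (0 <= (2 : R)%:E)%E by rewrite lee_fin.
  rewrite (@ge0_integralZl _ _ _ mu `[0%R, +oo[%classic _ (fun x => ((oneDsqr x)^-1)%:E)
    _ 2%:E (fun x _ => V0 x) two0)//; last first.
    by apply/measurable_EFinP; exact: measurable_funTS.
  by rewrite integral0y_oneDsqr -!EFinM; congr EFin; field.
- by move=> x; exact/ltW/abel_kernel_gt0.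
- exact: continuous_abel_kernel.
- by move=> x /=; rewrite /abel_kernel /oneDsqr sqrrN.
Qed.

Lemma intg_abel_kernel : intg mu abel_kernel.
Proof.
apply: intg_ge0; first exact: measurable_abel_kernel.
  by move=> x; exact/ltW/abel_kernel_gt0.
by rewrite integral_abel_kernel ltry.
Qed.

Lemma rint_abel_kernel : rint mu abel_kernel = 2 * pi.
Proof. by apply: EFin_inj; rewrite -rintE ?integral_abel_kernel//; exact: intg_abel_kernel. Qed.

End exponential_kernel.

(** * The weight and its transform in several variables *)

Section product_functions.
Context (R : realType).

Lemma intg_rVS_prod n (F : 'rV[R]_n.+1 -> R) (a : R -> R) (b : 'rV[R]_n -> R) :
  measurable_fun setT F -> (forall t y, F (rV_cons (t, y)) = a t * b y) ->
  intg (@lebesgue_measure R) a -> intg (leb R n) b -> intg (leb R n.+1) F.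
Proof.
move=> mF Fab ai bi; apply/integrableP; split; first exact/measurable_EFinP.
have mF' : measurable_fun setT (fun x => `|(F x)%:E|%E).
  by apply: measurableT_comp => //; exact/measurable_EFinP.
rewrite (@integral_rVS R n (fun x => `|(F x)%:E|%E))//.
rewrite (_ : (fun t => _) = (fun t => (`|a t| * rint (leb R n) (fun y => `|b y|))%:E)).
  rewrite rintE ?ltry//; under [X in intg _ X]eq_fun do rewrite mulrC.
  exact/intgZ/intg_norm.
apply/funext => t; rewrite -rintZ; last exact: intg_norm.
rewrite -rintE; last exact/intgZ/intg_norm.
by apply: eq_integral => y _; rewrite Fab /= normrM.
Qed.

Lemma rint_rVS n (F : 'rV[R]_n.+1 -> R) : intg (leb R n.+1) F ->
  rint (leb R n.+1) F =
  rint (@lebesgue_measure R) (fun t => rint (leb R n) (fun y => F (rV_cons (t, y)))).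
Proof.
move=> Fi; have mF := intg_measurable Fi.
pose G z := F (rV_cons z).
have mG : measurable_fun setT G := measurableT_comp mF (@measurable_rV_cons R n).
have Goo : (\int[@lebesgue_measure R]_x \int[leb R n]_y `|G (x, y)|%:E < +oo)%E.
  have /integrableP[_] := Fi.
  rewrite (@integral_rVS R n (fun x => `|(F x)%:E|%E))//.
  by apply: measurableT_comp => //; exact/measurable_EFinP.
have Gi : (@lebesgue_measure R \x leb R n)%E.-integrable setT (EFin \o G).
  by apply/integrable12ltyP => //; exact/measurable_EFinP.
rewrite [LHS]/rint [RHS]/rint /Rintegral; congr fine.
transitivity (\int[pushforward (@lebesgue_measure R \x leb R n)%E (@rV_cons R n)]_x (F x)%:E)%E.
  by [].
rewrite integral_pushforward//; last 2 first.
- exact: measurable_rV_cons.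
- exact/measurable_EFinP.
rewrite preimage_setT -(integral12_prod_meas1 Gi).
apply: ae_eq_integral => //.
- exact: (measurable_fubini_F Gi).
- by apply/measurable_EFinP; exact: (measurable_rint (leb R n) mG).
- by apply: filterS (ae_integrable1 Gi) => x ix _; rewrite /fubini_F -rintE.
Qed.

Lemma rint_rVS_prod n (F : 'rV[R]_n.+1 -> R) (a : R -> R) (b : 'rV[R]_n -> R) :
  measurable_fun setT F -> (forall t y, F (rV_cons (t, y)) = a t * b y) ->
  intg (@lebesgue_measure R) a -> intg (leb R n) b ->
  rint (leb R n.+1) F = rint (@lebesgue_measure R) a * rint (leb R n) b.
Proof.
move=> mF Fab ai bi; rewrite rint_rVS; last exact: intg_rVS_prod Fab ai bi.
rewrite mulrC -rintZ//; apply: eq_rint => t; rewrite mulrC -rintZ//.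
by apply: eq_rint => y; rewrite Fab.
Qed.

(** A product weight is preferred to a radial one because its transform splits into one-dimensional
    integrals with an elementary antiderivative. *)
Definition abelW n (x : 'rV[R]_n) : R := \prod_i abel_weight (x ord0 i).
Definition abelK n (x : 'rV[R]_n) : R := \prod_i abel_kernel (x ord0 i).

Lemma prod_rV_cons (h : R -> R) n (t : R) (y : 'rV[R]_n) :
  \prod_i h (rV_cons (t, y) ord0 i) = h t * \prod_i h (y ord0 i).
Proof.
rewrite big_ord_recl rV_cons0; congr (_ * _).
by apply: eq_bigr => i _; rewrite rV_consS.
Qed.

Lemma dotp_rV_cons n (t u : R) (x y : 'rV[R]_n) :
  dotp (rV_cons (t, x)) (rV_cons (u, y)) = t * u + dotp x y.
Proof.
rewrite /dotp big_ord_recl !rV_cons0; congr (_ + _).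
by apply: eq_bigr => i _; rewrite !rV_consS.
Qed.

Lemma measurable_prod_rV (h : R -> R) n : measurable_fun setT h ->
  measurable_fun setT (fun x : 'rV[R]_n => \prod_i h (x ord0 i)).
Proof.
move=> mh; apply: measurable_prod => i _.
exact: (measurableT_comp mh (@measurable_coord R n i)).
Qed.

Lemma measurable_abelW n : measurable_fun setT (@abelW n).
Proof. by apply: measurable_prod_rV; exact: measurable_abel_weight. Qed.

Lemma measurable_abelK n : measurable_fun setT (@abelK n).
Proof. by apply: measurable_prod_rV; exact: measurable_abel_kernel. Qed.

Lemma abelW_ge0 n (x : 'rV[R]_n) : 0 <= abelW x.
Proof. by apply: prodr_ge0 => i _; exact: abel_weight_ge0. Qed.

Lemma abelK_ge0 n (x : 'rV[R]_n) : 0 <= abelK x.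
Proof. by apply: prodr_ge0 => i _; exact/ltW/abel_kernel_gt0. Qed.

Lemma rint_rV0 (F : 'rV[R]_0 -> R) : measurable_fun setT F ->
  intg (leb R 0) F /\ rint (leb R 0) F = F 0.
Proof.
move=> mF; split.
  apply/integrableP; split; first exact/measurable_EFinP.
  have m : measurable_fun setT (fun x : 'rV[R]_0 => `|(F x)%:E|%E).
    by apply: measurableT_comp => //; exact/measurable_EFinP.
  rewrite /= integral_dirac//=.
  by rewrite diracT mul1e ltry.
rewrite /rint /Rintegral /= integral_dirac//; last exact/measurable_EFinP.
by rewrite diracT mul1e.
Qed.

Lemma intg_abelW n : intg (leb R n) (@abelW n).
Proof.
elim: n => [|n IH]; first exact: (rint_rV0 (@measurable_abelW 0)).1.
apply: (intg_rVS_prod (@measurable_abelW n.+1) _ (@intg_abel_weight R) IH).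
by move=> t y; exact: prod_rV_cons.
Qed.

Lemma abelK_integral n : intg (leb R n) (@abelK n) /\ 0 < rint (leb R n) (@abelK n).
Proof.
elim: n => [|n [IH1 IH2]].
  have [h1 h2] := rint_rV0 (@measurable_abelK 0); split=> //.
  by rewrite h2 /abelK big_ord0.
have h t (y : 'rV[R]_n) := prod_rV_cons (@abel_kernel R) t y.
split; first exact: (intg_rVS_prod (@measurable_abelK n.+1) h (@intg_abel_kernel R) IH1).
rewrite (rint_rVS_prod (@measurable_abelK n.+1) h (@intg_abel_kernel R) IH1).
by rewrite rint_abel_kernel !mulr_gt0// pi_gt0.
Qed.

Lemma measurable_cos_dotp n (x : 'rV[R]_n) :
  measurable_fun setT (fun y : 'rV[R]_n => cos (dotp x y)).
Proof.
apply: continuous_measurable_rV => y.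
by apply: continuous_comp; [exact: continuous_dotp|exact: continuous_cos].
Qed.

Lemma measurable_sin_dotp n (x : 'rV[R]_n) :
  measurable_fun setT (fun y : 'rV[R]_n => sin (dotp x y)).
Proof.
apply: continuous_measurable_rV => y.
by apply: continuous_comp; [exact: continuous_dotp|exact: continuous_sin].
Qed.

Lemma intg_abelW_cos n (x : 'rV[R]_n) :
  intg (leb R n) (fun y => abelW y * cos (dotp x y)).
Proof.
have := intgM_bounded (measurable_cos_dotp x) (fun y => cos_max (dotp x y)) (@intg_abelW n).
by under eq_fun do rewrite mulrC.
Qed.

Lemma intg_abelW_sin n (x : 'rV[R]_n) :
  intg (leb R n) (fun y => abelW y * sin (dotp x y)).
Proof.
have := intgM_bounded (measurable_sin_dotp x) (fun y => sin_max (dotp x y)) (@intg_abelW n).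
by under eq_fun do rewrite mulrC.
Qed.

Lemma rint_odd n (f : 'rV[R]_n -> R) : intg (leb R n) f ->
  (forall x, f (- x) = - f x) -> rint (leb R n) f = 0.
Proof.
move=> fi fodd; have := rint_reflect 0 fi.
rewrite (_ : (fun x => f (0 - x)) = (fun x => - f x)).
  by rewrite rintN//; lra.
by apply/funext => x; rewrite sub0r.
Qed.

Lemma abelWN n (x : 'rV[R]_n) : abelW (- x) = abelW x.
Proof. by apply: eq_bigr => i _; rewrite mxE /abel_weight normrN. Qed.

(** Induction on the dimension by the addition formula for the cosine; the product of sines
    integrates to 0, since the weight is even. *)
Lemma rint_abelW_cos n (x : 'rV[R]_n) :
  rint (leb R n) (fun y => abelW y * cos (dotp x y)) = abelK x.
Proof.
elim: n x => [|n IH] x.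
  have m0 : measurable_fun setT (fun y : 'rV[R]_0 => abelW y * cos (dotp x y)).
    by apply: intg_measurable (intg_abelW_cos x).
  by rewrite (rint_rV0 m0).2 /abelW /abelK /dotp !big_ord0 cos0 mulr1.
pose x0 := x ord0 ord0; pose x' : 'rV[R]_n := \row_i x ord0 (lift ord0 i).
have xE : x = rV_cons (x0, x').
  apply/rowP => i; case: (unliftP ord0 i) => [j|] ->; first by rewrite rV_consS mxE.
  by rewrite rV_cons0.
have ci : intg (@lebesgue_measure R) (fun t => abel_weight t * cos (x0 * t)).
  by apply: intg_abel_weightM; [exact: measurable_cosM|move=> t; exact: cos_max].
have si : intg (@lebesgue_measure R) (fun t => abel_weight t * sin (x0 * t)).
  by apply: intg_abel_weightM; [exact: measurable_sinM|move=> t; exact: sin_max].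
rewrite rint_rVS; last exact: intg_abelW_cos.
rewrite (_ : (fun t => _) = (fun t => abelK x' * (abel_weight t * cos (x0 * t)))).
  rewrite rintZ// rint_abel_cos xE /abelK prod_rV_cons mulrC.
  by rewrite /x'; under [in RHS]eq_bigr do rewrite -/x'.
apply/funext => t.
rewrite (_ : (fun y => _) = (fun y => (abel_weight t * cos (x0 * t)) * (abelW y * cos (dotp x' y))
   - (abel_weight t * sin (x0 * t)) * (abelW y * sin (dotp x' y)))).
  rewrite rintB; [|exact/intgZ/intg_abelW_cos|exact/intgZ/intg_abelW_sin].
  rewrite !rintZ; [|exact: intg_abelW_sin|exact: intg_abelW_cos].
  rewrite IH (rint_odd (intg_abelW_sin x')); first by rewrite mulr0 subr0 mulrC.
  by move=> y; rewrite abelWN dotpNr sinN mulrN.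
apply/funext => y; rewrite {1}xE dotp_rV_cons cosD /abelW prod_rV_cons; ring.
Qed.

End product_functions.

(** * Continuity of parameter integrals *)

Section sequential_continuity.
Context (R : realType) (V : normedModType R).

(** Dominated convergence speaks of sequences. If convergence at [p] failed, points at distance less
    than [1 / (k + 1)] from [p] would form a sequence contradicting the hypothesis. *)
Lemma seq_cvg_at (f : V -> R) (p : V) (l : R) :
  (forall u : nat -> V, u @ \oo --> p -> f (u k) @[k --> \oo] --> l) ->
  f @ p --> l.
Proof.
move=> h; apply/cvgrPdist_lt => e e0; apply: contrapT => nnear.
have /choice[u Hu] (k : nat) : exists x, `|p - x| < k.+1%:R^-1 /\ ~ `|l - f x| < e.
  apply: contrapT => /forallNP nx; apply: nnear.
  apply/nbhs_ballP; exists k.+1%:R^-1; first by rewrite /= invr_gt0.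
  move=> x; rewrite -ball_normE /= => px; apply: contrapT => nlx.
  by apply: (nx x); split.
have up : u @ \oo --> p.
  apply/cvgrPdist_lt => d d0.
  have [N _ hN] := near_infty_natSinv_lt (PosNum d0).
  by exists N => // k Nk; apply: lt_trans (Hu k).1 _; exact: hN.
have /cvgrPdist_lt/(_ _ e0)[N _ /(_ N (leqnn N))] := h u up.
by move=> /=; exact: (Hu N).2.
Qed.

Lemma continuous_rint d (T : measurableType d) (mu : {measure set T -> \bar R})
  (F : V -> T -> R) (g : T -> R) (p : V) :
  (forall v, measurable_fun setT (F v)) -> intg mu g ->
  (forall v t, `|F v t| <= g t) ->
  (forall t, F v t @[v --> p] --> F p t) ->
  rint mu (F v) @[v --> p] --> rint mu (F p).
Proof.
move=> mF gi Fg Fc; apply: seq_cvg_at => u up.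
have [] := @rint_dct _ _ _ mu (fun k => F (u k)) (F p) g (fun k => mF _) _ gi (fun k t => Fg _ _) => //.
by move=> t; exact: (cvg_comp u (fun v => F v t) up (Fc t)).
Qed.

End sequential_continuity.

(** * Cosine and sine transforms *)

Section fourier_cos_sin.
Context (R : realType) (n : nat).
Notation mu := (leb R n).
Implicit Types (x y xi : 'rV[R]_n) (phi : 'rV[R]_n -> R).

(** In the convention of [fourier], the transform of a real [phi] is [FC phi - i FS phi]; keeping
    the two parts apart keeps all integrals real. *)
Definition FC phi xi := rint mu (fun x => phi x * cos (dotp x xi)).
Definition FS phi xi := rint mu (fun x => phi x * sin (dotp x xi)).

Lemma measurable_cos_dotpl xi : measurable_fun setT (fun x : 'rV[R]_n => cos (dotp x xi)).
Proof. by under eq_fun do rewrite dotpC; exact: measurable_cos_dotp. Qed.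

Lemma measurable_sin_dotpl xi : measurable_fun setT (fun x : 'rV[R]_n => sin (dotp x xi)).
Proof. by under eq_fun do rewrite dotpC; exact: measurable_sin_dotp. Qed.

Lemma intg_cos phi xi : intg mu phi -> intg mu (fun x => phi x * cos (dotp x xi)).
Proof.
move=> /(intgM_bounded (measurable_cos_dotpl xi) (fun y => cos_max (dotp y xi))).
by under eq_fun do rewrite mulrC.
Qed.

Lemma intg_sin phi xi : intg mu phi -> intg mu (fun x => phi x * sin (dotp x xi)).
Proof.
move=> /(intgM_bounded (measurable_sin_dotpl xi) (fun y => sin_max (dotp y xi))).
by under eq_fun do rewrite mulrC.
Qed.

Lemma mulr_cos_le (a t : R) : `|a * cos t| <= `|a|.
Proof. by rewrite normrM ler_piMr// cos_max. Qed.

Lemma mulr_sin_le (a t : R) : `|a * sin t| <= `|a|.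
Proof. by rewrite normrM ler_piMr// sin_max. Qed.

Lemma FC_le phi xi : intg mu phi -> `|FC phi xi| <= rint mu (fun x => `|phi x|).
Proof.
move=> pi; apply: rint_norm_le; [exact: intg_cos|exact: intg_norm|].
by move=> x; exact: mulr_cos_le.
Qed.

Lemma FS_le phi xi : intg mu phi -> `|FS phi xi| <= rint mu (fun x => `|phi x|).
Proof.
move=> pi; apply: rint_norm_le; [exact: intg_sin|exact: intg_norm|].
by move=> x; exact: mulr_sin_le.
Qed.

Lemma FC_lin a phi psi xi : intg mu phi -> intg mu psi ->
  FC (fun x => a * phi x + psi x) xi = a * FC phi xi + FC psi xi.
Proof.
move=> pi qi; rewrite /FC -rintZ; last exact: intg_cos.
rewrite -rintD; [|exact/intgZ/intg_cos|exact: intg_cos].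
by apply: eq_rint => x; ring.
Qed.

Lemma FS_lin a phi psi xi : intg mu phi -> intg mu psi ->
  FS (fun x => a * phi x + psi x) xi = a * FS phi xi + FS psi xi.
Proof.
move=> pi qi; rewrite /FS -rintZ; last exact: intg_sin.
rewrite -rintD; [|exact/intgZ/intg_sin|exact: intg_sin].
by apply: eq_rint => x; ring.
Qed.

Lemma FCN phi xi : FC phi (- xi) = FC phi xi.
Proof. by apply: eq_rint => x; rewrite dotpNr cosN. Qed.

Lemma FSN phi xi : intg mu phi -> FS phi (- xi) = - FS phi xi.
Proof.
move=> pi; rewrite /FS -rintN; last exact: intg_sin.
by apply: eq_rint => x; rewrite dotpNr sinN mulrN.
Qed.

Lemma measurable_FC phi : measurable_fun setT phi -> measurable_fun setT (FC phi).
Proof.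
move=> mp; apply: (measurable_rint mu (F := fun z => phi z.2 * cos (dotp z.2 z.1))).
apply: measurable_funM; first exact: measurableT_comp mp measurable_snd.
apply: (measurableT_comp (continuous_measurable_fun (@continuous_cos R))).
by apply: measurable_dotpl; [exact: measurable_snd|exact: measurable_fst].
Qed.

Lemma measurable_FS phi : measurable_fun setT phi -> measurable_fun setT (FS phi).
Proof.
move=> mp; apply: (measurable_rint mu (F := fun z => phi z.2 * sin (dotp z.2 z.1))).
apply: measurable_funM; first exact: measurableT_comp mp measurable_snd.
apply: (measurableT_comp (continuous_measurable_fun (@continuous_sin R))).
by apply: measurable_dotpl; [exact: measurable_snd|exact: measurable_fst].
Qed.

(** The class for Plancherel's identity. It must contain the products of test functions with
    symbols, which are merely continuous. *)
Definition cc phi := continuous phi /\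
  exists r, forall x, phi x != 0 -> enorm x <= r.

Lemma cc_measurable phi : cc phi -> measurable_fun setT phi.
Proof. by move=> [cp _]; exact: continuous_measurable_rV. Qed.

Lemma cc_bounded phi : cc phi -> exists2 M, 0 <= M & forall x, `|phi x| <= M.
Proof.
move=> [cp [r pr]].
have cK : compact [set x : 'rV[R]_n | enorm x <= r].
  apply: bounded_closed_compact.
    exists r; split; first exact: num_real.
    move=> m rm x /= xr; rewrite /Num.norm /= mx_normrE.
    apply/bigmax_leP; split => /=.
      by apply: le_trans (ltW rm); apply: le_trans xr; exact: enorm_ge0.
    move=> [i j] _ /=; rewrite (ord1 i); apply: le_trans (coord_le_enorm x j) _.
    exact: le_trans xr (ltW rm).
  rewrite (_ : [set x | _] = (@enorm R n) @^-1` [set t | t <= r]) //.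
  apply: closed_comp; first by move=> x _; exact: continuous_enorm.
  exact: closed_le.
have /compact_bounded[M [_ MK]] : compact (phi @` [set x : 'rV[R]_n | enorm x <= r]).
  by apply: continuous_compact => //; exact: continuous_subspaceT.
exists (`|M| + 1); first by rewrite addr_ge0.
move=> x; have [->|px] := eqVneq (phi x) 0; first by rewrite normr0 addr_ge0.
apply: (MK (`|M| + 1)); first by rewrite (le_lt_trans (ler_norm _))// ltrDl.
by exists x => //=; exact: pr.
Qed.

Lemma cc_intg phi : cc phi -> intg mu phi.
Proof.
move=> pc; have [M _ pM] := cc_bounded pc; have [_ [r pr]] := pc.
by apply: (@intg_bounded_support _ _ phi M r); [exact: cc_measurable|exact: pM|exact: pr].
Qed.

Lemma cc_sqintg phi : cc phi -> sqintg mu phi.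
Proof.
move=> pc; have [M M0 pM] := cc_bounded pc; split; first exact: cc_measurable.
by under eq_fun do rewrite expr2; apply: intgM_bounded (cc_intg pc) => //; exact: cc_measurable.
Qed.

Lemma cc_lin a phi psi : cc phi -> cc psi -> cc (fun x => a * phi x + psi x).
Proof.
move=> [cp [r pr]] [cq [s qs]]; split.
  by apply: continuous_add => //; exact: continuous_cstM.
exists (Num.max r s) => x.
have [->|/pr xr _] := eqVneq (phi x) 0; last by rewrite le_max xr.
by rewrite mulr0 add0r => /qs xs; rewrite le_max xs orbT.
Qed.

End fourier_cos_sin.

(** * Plancherel's identity *)

Section plancherel.
Context (R : realType) (n : nat).
Notation mu := (leb R n).
Implicit Types (x y xi : 'rV[R]_n) (phi : 'rV[R]_n -> R).

Lemma measurable_abelWZ e : measurable_fun setT (fun xi : 'rV[R]_n => abelW (e *: xi)).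
Proof.
apply: (measurableT_comp (@measurable_abelW R n)); apply: measurable_rVZ.
exact: measurable_id.
Qed.

Lemma intg_abelWZ e : e != 0 -> intg mu (fun xi : 'rV[R]_n => abelW (e *: xi)).
Proof.
move=> e0; have := intg_affine 0 e0 (@intg_abelW R n).
by under eq_fun do rewrite addr0.
Qed.

Lemma intg_abelWZ_cos e x : e != 0 ->
  intg mu (fun xi => abelW (e *: xi) * cos (dotp x xi)).
Proof.
move=> e0; have := intgM_bounded (measurable_cos_dotp x) (fun y => cos_max (dotp x y)) (intg_abelWZ e0).
by under eq_fun do rewrite mulrC.
Qed.

Lemma rint_abelWZ_cos e x : 0 < e ->
  rint mu (fun xi => abelW (e *: xi) * cos (dotp x xi)) =
  e ^- n * abelK (e^-1 *: x).
Proof.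
move=> e0; have en0 : e != 0 by rewrite gt_eqF.
rewrite -rint_abelW_cos -(gtr0_norm e0) -(rint_affine 0 en0 (intg_abelW_cos _)).
apply: eq_rint => xi; rewrite addr0 dotpZl dotpZr mulrA (gtr0_norm e0) mulVf//.
by rewrite mul1r.
Qed.

Lemma intg_mollify K phi e x : intg mu K -> cc phi ->
  intg mu (fun u => phi (x - e *: u) * K u).
Proof.
move=> Ki pc; have [M M0 pM] := cc_bounded pc.
apply: intgM_bounded Ki => [|u]; last exact: pM.
apply: (measurableT_comp (cc_measurable pc)); apply: measurable_rVB => //.
by apply: measurable_rVZ; exact: measurable_id.
Qed.

(** The substitution is [y = x - e u]. *)
Lemma rint_mollify K phi e x : 0 < e -> intg mu K -> cc phi ->
  rint mu (fun y => phi y * (e ^- n * K (e^-1 *: (x - y)))) =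
  rint mu (fun u => phi (x - e *: u) * K u).
Proof.
move=> e0 Ki pc; have en0 : - e^-1 != 0 by rewrite oppr_eq0 invr_eq0 gt_eqF.
have fi := intg_mollify e x Ki pc.
have := rint_affine (e^-1 *: x) en0 fi.
rewrite normrN normfV (gtr0_norm e0) => h.
have en : e ^+ n != 0 by rewrite expf_neq0// gt_eqF.
rewrite -[RHS]mul1r -(mulVf en) -mulrA; rewrite exprVn invrK in h; rewrite -h -rintZ.
  apply: eq_rint => y; rewrite mulrCA; congr (_ * (_ * _)).
    congr phi; rewrite scalerDr !scalerA mulrN mulfV ?gt_eqF// scaleN1r scale1r.
    by rewrite opprD opprK addrCA subrr addr0.
  by congr K; rewrite scalerBr scaleNr addrC.
exact: (intg_affine (e^-1 *: x) en0 fi).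
Qed.

Lemma cvg_mollify K phi x : intg mu K -> cc phi ->
  rint mu (fun u => phi (x - k.+1%:R^-1 *: u) * K u) @[k --> \oo] --> rint mu K * phi x.
Proof.
move=> Ki pc; have [M M0 pM] := cc_bounded pc; have [cp _] := pc.
rewrite mulrC -rintZ//.
apply: (@rint_dct _ _ _ mu _ _ (fun u => M * `|K u|) _ _ _ _).2.
- by move=> k; exact: intg_measurable (intg_mollify _ _ Ki pc).
- move=> u; apply: cvgMr_tmp.
  apply: (cvg_comp (fun k => x - k.+1%:R^-1 *: u) phi); last exact: cp.
  have : (x - k.+1%:R^-1 *: u) @[k --> \oo] --> x - 0 *: u.
    by apply: cvgB; [exact: cvg_cst|apply: cvgZr_tmp; exact: cvg_harmonic].
  by rewrite scale0r subr0.
- exact/intgZ/intg_norm.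
- by move=> k u; rewrite normrM ler_wpM2r.
Qed.

(** The squared modulus of the transform of [phi]. *)
Definition FP phi xi := FC phi xi ^+ 2 + FS phi xi ^+ 2.

Lemma FP_ge0 phi xi : 0 <= FP phi xi.
Proof. by rewrite addr_ge0// sqr_ge0. Qed.

Lemma measurable_FP phi : measurable_fun setT phi -> measurable_fun setT (FP phi).
Proof.
move=> mp; apply: measurable_funD; apply: measurable_funX.
- exact: measurable_FC.
- exact: measurable_FS.
Qed.

Lemma intg_cos_diff phi x xi : intg mu phi ->
  intg mu (fun y => phi y * cos (dotp (x - y) xi)).
Proof.
move=> pi; have := intgD (intgZ (cos (dotp x xi)) (intg_cos xi pi))
  (intgZ (sin (dotp x xi)) (intg_sin xi pi)).
congr (intg _ _); apply/funext => y.
by rewrite dotpDl dotpNl cosB; ring.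
Qed.

Lemma rint_cos_diff phi x xi : intg mu phi ->
  rint mu (fun y => phi y * cos (dotp (x - y) xi)) =
  cos (dotp x xi) * FC phi xi + sin (dotp x xi) * FS phi xi.
Proof.
move=> pi; rewrite /FC /FS -!rintZ; [|exact: intg_sin|exact: intg_cos].
rewrite -rintD; [|exact/intgZ/intg_cos|exact/intgZ/intg_sin].
by apply: eq_rint => y; rewrite dotpDl dotpNl cosB; ring.
Qed.

Lemma intg_FP_abelW phi e : cc phi -> 0 < e ->
  intg mu (fun xi => FP phi xi * abelW (e *: xi)).
Proof.
move=> pc e0; have pi := cc_intg pc.
have en0 : e != 0 by rewrite gt_eqF.
set L := rint mu (fun x => `|phi x|).
apply: (intgM_bounded (C := L ^+ 2 + L ^+ 2) _ _ (intg_abelWZ en0)).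
  exact: measurable_FP (cc_measurable pc).
have L0 : 0 <= L by exact: rint_ge0.
move=> xi; rewrite ger0_norm ?FP_ge0//.
rewrite /FP -(real_normK (num_real (FC _ _))) -(real_normK (num_real (FS _ _))).
by apply: lerD; apply: lerXn2r; rewrite ?nnegrE ?FC_le ?FS_le.
Qed.

(** Expanding [FP phi xi] as the double integral of [phi x * phi y * cos((x - y).xi)], the weight
    makes the triple integral absolutely convergent. Integrating in [xi] first produces
    [e^-n abelK ((x - y) / e)], an approximate identity up to a constant. *)
Lemma rint_FP_abelW phi e : cc phi -> 0 < e ->
  rint mu (fun xi => FP phi xi * abelW (e *: xi)) =
  rint mu (fun x => phi x * rint mu (fun u => phi (x - e *: u) * abelK u)).
Proof.
move=> pc e0; have pi := cc_intg pc; have mp := cc_measurable pc.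
have en0 : e != 0 by rewrite gt_eqF.
set L := rint mu (fun x => `|phi x|).
have L0 : 0 <= L by apply: rint_ge0.
have bnd x xi : `|cos (dotp x xi) * FC phi xi + sin (dotp x xi) * FS phi xi| <= 2 * L.
  rewrite (_ : 2 * L = L + L); last by ring.
  apply: le_trans (ler_normD _ _) _; apply: lerD; rewrite mulrC.
  - exact: le_trans (mulr_cos_le _ _) (FC_le _ pi).
  - exact: le_trans (mulr_sin_le _ _) (FS_le _ pi).
have mc : measurable_fun setT (@cos R) := continuous_measurable_fun (@continuous_cos R).
have mS : measurable_fun setT (@sin R) := continuous_measurable_fun (@continuous_sin R).
have mW1 : measurable_fun setT (fun z : 'rV[R]_n * 'rV[R]_n => abelW (e *: z.1)).
  exact: (measurableT_comp (measurable_abelWZ e) measurable_fst).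
have mp2 : measurable_fun setT (fun z : 'rV[R]_n * 'rV[R]_n => phi z.2).
  exact: (measurableT_comp mp measurable_snd).
have md : measurable_fun setT (fun z : 'rV[R]_n * 'rV[R]_n => dotp z.2 z.1).
  by apply: measurable_dotpl; [exact: measurable_snd|exact: measurable_fst].
pose F (z : 'rV[R]_n * 'rV[R]_n) :=
  phi z.2 * ((cos (dotp z.2 z.1) * FC phi z.1 + sin (dotp z.2 z.1) * FS phi z.1)
             * abelW (e *: z.1)).
have mF : measurable_fun setT F.
  apply: measurable_funM => //; apply: measurable_funM => //.
  apply: measurable_funD; apply: measurable_funM.
  - exact: (measurableT_comp mc md).
  - exact: (measurableT_comp (measurable_FC mp) measurable_fst).
  - exact: (measurableT_comp mS md).
  - exact: (measurableT_comp (measurable_FS mp) measurable_fst).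
transitivity (rint mu (fun xi => rint mu (fun x => F (xi, x)))).
  apply: eq_rint => xi; rewrite /F /=.
  rewrite (_ : (fun x => _) = (fun x => (abelW (e *: xi) * FC phi xi) * (phi x * cos (dotp x xi)) +
      (abelW (e *: xi) * FS phi xi) * (phi x * sin (dotp x xi)))); last first.
    by apply/funext => x; ring.
  rewrite rintD; [|exact/intgZ/intg_cos|exact/intgZ/intg_sin].
  rewrite !rintZ; [|exact: intg_sin|exact: intg_cos].
  by rewrite -/(FC phi xi) -/(FS phi xi) /FP; ring.
rewrite (@rint_swap_dom _ _ _ _ R mu mu F (fun xi => abelW (e *: xi)) (fun x => 2 * L * `|phi x|) mF).
- apply: eq_rint => x; rewrite /F /= rintZ; last first.
    apply: (intgM_bounded (C := 2 * L) _ _ (intg_abelWZ en0)); last by move=> xi; exact: bnd.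
    apply: measurable_funD; apply: measurable_funM.
    - exact: measurable_cos_dotp.
    - exact: measurable_FC.
    - exact: measurable_sin_dotp.
    - exact: measurable_FS.
  congr (_ * _).
  rewrite -(rint_mollify x e0 (abelK_integral R n).1 pc).
  pose F2 (z : 'rV[R]_n * 'rV[R]_n) := phi z.2 * cos (dotp (x - z.2) z.1) * abelW (e *: z.1).
  have mF2 : measurable_fun setT F2.
    apply: measurable_funM => //; apply: measurable_funM => //.
    apply: (measurableT_comp mc); apply: measurable_dotpl; last exact: measurable_fst.
    by apply: measurable_rVB => //; exact: measurable_snd.
  transitivity (rint mu (fun xi => rint mu (fun y => F2 (xi, y)))).
    apply: eq_rint => xi; rewrite -rint_cos_diff// mulrC -rintZ; last exact: intg_cos_diff.
    by apply: eq_rint => y; rewrite /F2 /=; ring.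
  (* This exchange puts the integral in [xi] innermost, where it is the known transform of the
     dilated weight. *)
  rewrite (@rint_swap_dom _ _ _ _ R mu mu F2 (fun xi => abelW (e *: xi)) (fun x => `|phi x|) mF2).
  + apply: eq_rint => y; rewrite -rint_abelWZ_cos//.
    rewrite -rintZ; last exact: intg_abelWZ_cos.
    by apply: eq_rint => xi; rewrite /F2 /=; ring.
  + exact: intg_abelWZ.
  + exact: intg_norm.
  + move=> xi y; rewrite /F2 /= normrM (ger0_norm (abelW_ge0 _)) mulrC.
    by rewrite ler_wpM2l ?abelW_ge0// mulr_cos_le.
- exact: intg_abelWZ.
- exact/intgZ/intg_norm.
- move=> xi x; rewrite /F /= !normrM (ger0_norm (abelW_ge0 _)).
  rewrite [leLHS](_ : _ = abelW (e *: xi) * (`|cos (dotp x xi) * FC phi xi + sin (dotp x xi) * FS phi xi| * `|phi x|)); last by ring.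
  by rewrite ler_wpM2l ?abelW_ge0// ler_wpM2r.
Qed.

(** This is [(2 pi)^n]. It occurs on both sides when two norms are compared, so its positivity
    suffices there. *)
Definition plancherelC : R := rint mu (@abelK R n).

Lemma plancherelC_gt0 : 0 < plancherelC.
Proof. exact: (abelK_integral R n).2. Qed.

Lemma cvg_prod_seq (I : Type) (s : seq I) (F : I -> nat -> R) (l : I -> R) :
  (forall i, F i @ \oo --> l i) ->
  \prod_(i <- s) F i k @[k --> \oo] --> \prod_(i <- s) l i.
Proof.
move=> h; elim: s => [|i s IH].
  by rewrite big_nil; under eq_fun do rewrite big_nil; exact: cvg_cst.
rewrite big_cons; under eq_fun do rewrite big_cons.
by apply: cvgM; [exact: h|exact: IH].
Qed.

Lemma cvg_abelW_seq xi : abelW (k.+1%:R^-1 *: xi) @[k --> \oo] --> (1 : R).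
Proof.
suff : abelW (k.+1%:R^-1 *: xi) @[k --> \oo] --> \prod_(i < n) (1 : R) by rewrite big1.
apply: cvg_prod_seq => i.
rewrite -[X in _ --> X](_ : abel_weight (0 * xi ord0 i) = 1); last first.
  by rewrite mul0r /abel_weight normr0 oppr0 expR0.
under eq_fun do rewrite mxE.
apply: (cvg_comp (fun k => k.+1%:R^-1 * xi ord0 i) (@abel_weight R)); last exact: continuous_abel_weight.
by apply: cvgMr_tmp; exact: cvg_harmonic.
Qed.

Lemma abelW_le1 xi : abelW xi <= 1.
Proof.
rewrite /abelW; elim: (index_enum _) => [|i s IH]; first by rewrite big_nil.
rewrite big_cons mulr_ile1//; first exact: abel_weight_ge0.
  by apply: prodr_ge0 => j _; exact: abel_weight_ge0.
by rewrite /abel_weight -expR0 ler_expR oppr_le0.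
Qed.

Lemma cvg_rint_mollify phi : cc phi ->
  rint mu (fun x => phi x * rint mu (fun u => phi (x - k.+1%:R^-1 *: u) * abelK u))
    @[k --> \oo] --> plancherelC * rint mu (fun x => phi x ^+ 2).
Proof.
move=> pc; have [M M0 pM] := cc_bounded pc.
have mp := cc_measurable pc; have [cp _] := pc.
have mk (e : R) : measurable_fun setT (fun x => rint mu (fun u => phi (x - e *: u) * abelK u)).
  apply: (measurable_rint mu (F := fun z : 'rV[R]_n * 'rV[R]_n => phi (z.1 - e *: z.2) * abelK z.2)).
  apply: measurable_funM; last exact: (measurableT_comp (@measurable_abelK R n) measurable_snd).
  apply: (measurableT_comp mp); apply: measurable_rVB; first exact: measurable_fst.
  by apply: measurable_rVZ; exact: measurable_snd.
have bound e x : `|rint mu (fun u => phi (x - e *: u) * abelK u)| <= M * plancherelC.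
  rewrite /plancherelC -rintZ; last exact: (abelK_integral R n).1.
  apply: rint_norm_le; [exact: (intg_mollify _ _ (abelK_integral R n).1)|exact/intgZ/(abelK_integral R n).1|].
  by move=> u; rewrite normrM (ger0_norm (abelK_ge0 _)) ler_wpM2r ?abelK_ge0.
have inner x := @cvg_mollify _ _ x (abelK_integral R n).1 pc.
rewrite -rintZ; last exact: (cc_sqintg pc).2.
rewrite (_ : (fun x => plancherelC * _) = (fun x => phi x * (plancherelC * phi x))); last first.
  by apply/funext => x; ring.
apply: (@rint_dct _ _ _ mu _ _ (fun x => M * plancherelC * `|phi x|) _ _ _ _).2.
- by move=> k; apply: measurable_funM.
- by move=> x; apply: cvgMl_tmp; exact: inner.
- exact/intgZ/intg_norm/cc_intg.
- by move=> k x; rewrite normrM mulrC ler_wpM2r.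
Qed.

(** The weighted integrals converge, hence are bounded, and Fatou's lemma gives the integrability of
    [FP phi]. As [abelW <= 1], [FP phi] is then itself a majorant, and dominated convergence
    identifies the limit. *)
Theorem plancherel phi : cc phi ->
  intg mu (FP phi) /\ rint mu (FP phi) = plancherelC * rint mu (fun x => phi x ^+ 2).
Proof.
move=> pc; have mP := measurable_FP (cc_measurable pc).
have k0 (k : nat) : 0 < k.+1%:R^-1 :> R by rewrite invr_gt0.
have lim : rint mu (fun xi => FP phi xi * abelW (k.+1%:R^-1 *: xi)) @[k --> \oo] -->
    plancherelC * rint mu (fun x => phi x ^+ 2).
  by under eq_fun do rewrite rint_FP_abelW//; exact: cvg_rint_mollify.
have [M [_ hM]] : bounded_fun (fun k : nat => rint mu (fun xi => FP phi xi * abelW (k.+1%:R^-1 *: xi))).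
  exact: cvg_seq_bounded (cvgP _ lim).
have mk k : measurable_fun setT (fun xi => FP phi xi * abelW (k.+1%:R^-1 *: xi)).
  exact: intg_measurable (intg_FP_abelW pc (k0 k)).
have pw xi : FP phi xi * abelW (k.+1%:R^-1 *: xi) @[k --> \oo] --> FP phi xi.
  by rewrite -[X in _ --> X]mulr1; apply: cvgMl_tmp; exact: cvg_abelW_seq.
have Pi : intg mu (FP phi).
  apply: intg_ge0 => //; first by move=> xi; exact: FP_ge0.
  apply: (@le_lt_trans _ _ (`|M| + 1)%:E); last by rewrite ltry.
  apply: (fatou_bound mk) => //.
    by move=> k xi; rewrite mulr_ge0 ?FP_ge0 ?abelW_ge0.
  move=> k; rewrite rintE; last exact: intg_FP_abelW.
  rewrite lee_fin (le_trans (ler_norm _))//; apply: hM => //.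
  by rewrite (le_lt_trans (ler_norm _))// ltrDl.
split=> //; have [|_] := rint_dct mk pw Pi.
  move=> k xi; rewrite normrM (ger0_norm (FP_ge0 _ _)) (ger0_norm (abelW_ge0 _)).
  by rewrite ler_piMr ?FP_ge0 ?abelW_le1.
by move=> /(cvg_unique _)/(_ lim); apply.
Qed.

End plancherel.

(** * Bounded multipliers by duality *)

Section multiplier_operator.
Context (R : realType) (n : nat).
Notation mu := (leb R n).
Notation fct := ('rV[R]_n -> R).
Implicit Types (x xi : 'rV[R]_n) (phi psi a b : fct).

Lemma sqintg_FC phi : cc phi -> sqintg mu (FC phi).
Proof.
move=> pc; have mp := measurable_FC (cc_measurable pc); split=> //.
apply: (intg_dom _ _ (plancherel pc).1); first exact: measurable_funX.
by move=> xi; rewrite ger0_norm ?sqr_ge0// lerDl sqr_ge0.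
Qed.

Lemma sqintg_FS phi : cc phi -> sqintg mu (FS phi).
Proof.
move=> pc; have mp := measurable_FS (cc_measurable pc); split=> //.
apply: (intg_dom _ _ (plancherel pc).1); first exact: measurable_funX.
by move=> xi; rewrite ger0_norm ?sqr_ge0// lerDr sqr_ge0.
Qed.

(* The transform of the complex-valued function [p.1 + i p.2], up to the
   conjugation of the variable: real and minus imaginary part. *)
Definition pairFT (p : fct * fct) : fct * fct :=
  (fun xi => FC p.1 xi - FS p.2 xi, fun xi => FS p.1 xi + FC p.2 xi).

Lemma sqpair_pairFT p : cc p.1 -> cc p.2 -> sqpair mu (pairFT p).
Proof.
move=> p1 p2; split; first by apply: sqintgB; [exact: sqintg_FC|exact: sqintg_FS].
by apply: sqintgD; [exact: sqintg_FS|exact: sqintg_FC].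
Qed.

(** Plancherel's identity for complex functions: the cross term is odd in [xi], because [FC] is even
    and [FS] is odd, and integrates to 0. *)
Lemma dotpair_pairFT p : cc p.1 -> cc p.2 ->
  dotpair mu (pairFT p) (pairFT p) = plancherelC R n *
  (rint mu (fun x => p.1 x ^+ 2) + rint mu (fun x => p.2 x ^+ 2)).
Proof.
move=> p1 p2; rewrite mulrDr -(plancherel p1).2 -(plancherel p2).2 /dotpair /=.
have [C1 S1] := (sqintg_FC p1, sqintg_FS p1).
have [C2 S2] := (sqintg_FC p2, sqintg_FS p2).
have ci := intgB (sqintgM S1 C2) (sqintgM C1 S2).
have c0 : rint mu (fun xi => FS p.1 xi * FC p.2 xi - FC p.1 xi * FS p.2 xi) = 0.
  apply: rint_odd => // xi; rewrite !FCN !FSN; [ring|exact: cc_intg|exact: cc_intg].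
have [P1 P2] := ((plancherel p1).1, (plancherel p2).1).
have pi := sqpair_pairFT p1 p2.
rewrite -(rintD (sqintgM pi.1 pi.1) (sqintgM pi.2 pi.2)) -(rintD P1 P2).
transitivity (rint mu (fun xi => (FP p.1 xi + FP p.2 xi) +
    2 * (FS p.1 xi * FC p.2 xi - FC p.1 xi * FS p.2 xi))).
  by apply: eq_rint => xi; rewrite /FP /pairFT /=; ring.
by rewrite (rintD (intgD P1 P2) (intgZ 2 ci)) (rintZ 2 ci) c0 mulr0 addr0.
Qed.

(* Real and imaginary part of the integral of [(a + i b) \hat phi]. *)
Definition pairRe a b phi := rint mu (fun xi => a xi * FC phi xi) + rint mu (fun xi => b xi * FS phi xi).
Definition pairIm a b phi := rint mu (fun xi => b xi * FC phi xi) - rint mu (fun xi => a xi * FS phi xi).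

Lemma FC0 xi : FC (fun=> 0 : R) xi = 0.
Proof. by rewrite /FC (@eq_rint _ _ _ mu _ (fun=> 0)) ?rint0// => x; rewrite mul0r. Qed.

Lemma FS0 xi : FS (fun=> 0 : R) xi = 0.
Proof. by rewrite /FS (@eq_rint _ _ _ mu _ (fun=> 0)) ?rint0// => x; rewrite mul0r. Qed.

Lemma dotpair_pairFT_l a b phi :
  dotpair mu (a, b) (pairFT (phi, fun=> 0)) = pairRe a b phi.
Proof.
by congr (_ + _); apply: eq_rint => xi; rewrite /= ?FS0 ?FC0 ?subr0 ?addr0.
Qed.

Lemma dotpair_pairFT_r a b phi : sqintg mu a -> cc phi ->
  dotpair mu (a, b) (pairFT (fun=> 0, phi)) = pairIm a b phi.
Proof.
move=> ai pc; rewrite /pairIm -rintN; last by apply: sqintgM => //; exact: sqintg_FS.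
rewrite addrC; congr (_ + _); apply: eq_rint => xi; rewrite /= ?FS0 ?FC0; ring.
Qed.

Lemma pairFT_lin c (p q : fct * fct) : cc p.1 -> cc p.2 -> cc q.1 -> cc q.2 ->
  pairFT (linpair c p q) = linpair c (pairFT p) (pairFT q).
Proof.
move=> p1 p2 q1 q2; congr (_, _); apply/funext => xi /=;
  rewrite FC_lin ?FS_lin; try exact: cc_intg; ring.
Qed.

Lemma dotpair_sqr (p : fct * fct) : dotpair mu p p =
  rint mu (fun xi => p.1 xi ^+ 2) + rint mu (fun xi => p.2 xi ^+ 2).
Proof. by congr (_ + _); apply: eq_rint => xi; rewrite expr2. Qed.

Variables (S : fct -> Prop) (M : fct) (B : R).
Hypothesis S0 : S (fun=> 0).
Hypothesis SL : forall c phi psi, S phi -> S psi -> S (fun x => c * phi x + psi x).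
Hypothesis Scc : forall phi, S phi -> cc phi.
Hypothesis SM : forall phi, S phi -> cc (fun x => M x * phi x).
Hypothesis MB : forall phi x, S phi -> `|M x * phi x| <= B * `|phi x|.
Variables g1 g2 : fct.
Hypotheses (g1i : sqintg mu g1) (g2i : sqintg mu g2).

(** The functional [p |-> dotpair (g1, g2) (pairFT (M p))] is bounded by [B |g|] times the norm of
    [pairFT p], and Riesz's theorem gives the pair [(G1, G2)] representing it. *)
Theorem multiplier_exists : exists G1 G2,
  [/\ sqintg mu G1, sqintg mu G2,
     rint mu (fun xi => G1 xi ^+ 2) + rint mu (fun xi => G2 xi ^+ 2) <=
     B ^+ 2 * (rint mu (fun xi => g1 xi ^+ 2) + rint mu (fun xi => g2 xi ^+ 2)) &
     forall phi, S phi ->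
       pairRe G1 G2 phi = pairRe g1 g2 (fun x => M x * phi x) /\
       pairIm G1 G2 phi = pairIm g1 g2 (fun x => M x * phi x)].
Proof.
(* All pairs of functions form the ambient module; [R^o] makes the scalars act on the values, and
   the admissible pairs form the subspace [SW]. *)
pose W : lmodType R := (('rV[R]_n -> R^o) * ('rV[R]_n -> R^o))%type.
pose SW : set W := [set p | S p.1 /\ S p.2].
pose Mp (p : W) : fct * fct := (fun x => M x * p.1 x, fun x => M x * p.2 x).
pose v (p : W) : fct * fct := pairFT p.
pose l (p : W) : R := dotpair mu (g1, g2) (pairFT (Mp p)).
have gi : sqpair mu (g1, g2) by [].
pose gg := dotpair mu (g1, g2) (g1, g2).
have gg0 : 0 <= gg by exact: dotpair_ge0.
have vi p : SW p -> sqpair mu (v p) by move=> [p1 p2]; apply: sqpair_pairFT; exact: Scc.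
have Mi p : SW p -> sqpair mu (pairFT (Mp p)).
  by move=> [p1 p2]; apply: sqpair_pairFT; exact: SM.
have linE c (p q : W) : (c *: p + q : W) = linpair c (p : fct * fct) q :> fct * fct.
  by [].
have [] := @riesz_representation _ _ R mu W SW v l (B * Num.sqrt gg).
- by split; exact: S0.
- by move=> c p q [p1 p2] [q1 q2]; split; exact: SL.
- exact: vi.
- by move=> c p q [p1 p2] [q1 q2]; rewrite /v linE pairFT_lin//; exact: Scc.
- move=> c p q [p1 p2] [q1 q2]; rewrite /l.
  rewrite (_ : Mp (c *: p + q) = linpair c (Mp p) (Mp q)); last first.
    by rewrite linE; congr (_, _); apply/funext => x /=; ring.
  rewrite pairFT_lin; try exact: SM.
  by rewrite dotpair_linr//; apply: Mi.
- move=> p pS; have [p1 p2] := pS.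
  apply: le_trans (dotpair_cs gi (Mi _ pS)) _.
  rewrite -/gg exprMn (sqr_sqrtr gg0) (mulrC _ gg) -mulrA; apply: (ler_wpM2l gg0).
  (* Plancherel's identity on both sides, with the same constant, reduces the bound to the pointwise
     one on [M]. *)
  rewrite /v !dotpair_pairFT; try exact: Scc; try exact: SM.
  rewrite mulrCA ler_wpM2l//; first exact/ltW/plancherelC_gt0.
  have bd phi : S phi -> rint mu (fun x => (M x * phi x) ^+ 2) <= B ^+ 2 * rint mu (fun x => phi x ^+ 2).
    move=> Sp; rewrite -rintZ; last exact: (cc_sqintg (Scc Sp)).2.
    apply: rint_le; [exact: (cc_sqintg (SM Sp)).2|exact: intgZ (cc_sqintg (Scc Sp)).2|].
    move=> x; rewrite -(real_normK (num_real (M x * phi x))) -(real_normK (num_real (phi x))).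
    rewrite -exprMn; apply: lerXn2r; rewrite ?nnegrE//; last exact: MB.
    exact: le_trans (normr_ge0 _) (MB x Sp).
  by rewrite mulrDr; apply: lerD; exact: bd.
move=> [G1 G2] [/= G1i G2i] [GB Grep]; exists G1, G2.
rewrite -(dotpair_sqr (G1, G2)) -(dotpair_sqr (g1, g2)) -/gg.
split; [exact: G1i|exact: G2i| |].
  by move: GB; rewrite exprMn sqr_sqrtr.
(* The pairs [(phi, 0)] and [(0, phi)] test the real and the imaginary part of the complex
   identity. *)
have M0 phi : Mp (phi, fun=> 0) = (fun x => M x * phi x, fun=> 0).
  by congr (_, _); apply/funext => x /=; rewrite mulr0.
have M1 phi : Mp (fun=> 0, phi) = (fun=> 0, fun x => M x * phi x).
  by congr (_, _); apply/funext => x /=; rewrite mulr0.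
move=> phi Sp; split.
  rewrite -!dotpair_pairFT_l -M0.
  exact: (Grep (phi, fun=> 0) (conj Sp S0)).
rewrite -(dotpair_pairFT_r _ G1i (Scc Sp)) -(dotpair_pairFT_r _ g1i (SM Sp)).
rewrite -M1; exact: (Grep (fun=> 0, phi) (conj S0 Sp)).
Qed.

End multiplier_operator.

(** * Differential calculus in several variables *)

Section directional_derivatives.
Context (R : realType) (V : normedModType R).
Implicit Types (f : V -> R) (x v : V).

Lemma is_derive_line f x v (h : R) : derivable f (h *: v + x) v ->
  is_derive h (1 : R) (fun t : R => f (t *: v + x)) ('D_v f (h *: v + x)).
Proof.
move=> df.
have e : (fun k : R => k^-1 *: (((fun t : R => f (t *: v + x)) \o shift h) (k *: (1 : R)) - f (h *: v + x))) =
    (fun k : R => k^-1 *: ((f \o shift (h *: v + x)) (k *: v) - f (h *: v + x))).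
  by apply/funext => k /=; rewrite [k%:A]mulr1 scalerDl addrA.
by apply: DeriveDef; rewrite /derivable /derive e.
Qed.

(** Directional derivatives are computed by one-variable calculus along the line [t v + x]. *)
Lemma is_derive_from_line f x v (df : R) :
  is_derive (0 : R) (1 : R) (fun t : R => f (t *: v + x)) df -> is_derive x v f df.
Proof.
move=> [d1 d2].
have e : (fun k : R => k^-1 *: (((fun t : R => f (t *: v + x)) \o shift 0) (k *: (1 : R)) - f (0 *: v + x))) =
    (fun k : R => k^-1 *: ((f \o shift x) (k *: v) - f x)).
  by apply/funext => k /=; rewrite [k%:A]mulr1 addr0 scale0r add0r.
apply: DeriveDef; first by move: d1; rewrite /derivable e.
by move: d2; rewrite /derive e.
Qed.

Lemma is_derive_comp f (h : R -> R) x v (df dh : R) :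
  is_derive x v f df -> is_derive (f x) (1 : R) h dh ->
  is_derive x v (fun y => h (f y)) (dh * df).
Proof.
move=> [df1 df2] dhx; apply: is_derive_from_line.
have d : is_derive (0 : R) (1 : R) (fun t : R => f (t *: v + x)) df.
  have := @is_derive_line f x v 0; rewrite scale0r add0r df2; apply.
  exact: df1.
apply: (@is_derive1_comp _ h (fun t : R => f (t *: v + x))).
by rewrite scale0r add0r.
Qed.

Lemma is_deriveM_fun f g x v (df dg : R) :
  is_derive x v f df -> is_derive x v g dg ->
  is_derive x v (fun y => f y * g y) (f x * dg + df * g x).
Proof.
move=> h1 h2; have := is_deriveM h1 h2.
by rewrite /GRing.scale /= (mulrC (g x)).
Qed.

Lemma is_deriveD_fun f g x v (df dg : R) :
  is_derive x v f df -> is_derive x v g dg ->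
  is_derive x v (fun y => f y + g y) (df + dg).
Proof. by move=> h1 h2; exact: is_deriveD. Qed.

Lemma is_derive_cst_fun (c : R) x v : is_derive x v (fun=> c) 0.
Proof. exact: is_derive_cst. Qed.

Lemma is_derive_near0 f x v : (\forall y \near x, f y = 0) -> is_derive x v f 0.
Proof.
move=> f0; have [->|v0] := eqVneq v 0.
  apply: DeriveDef; first exact: derivable0.
  exact: derive0.
have e : {near x, cst 0 =1 f} by apply: filterS f0 => y ->.
apply: DeriveDef; first by apply: (@near_eq_derivable _ _ _ (cst 0)) => //; exact: derivable_cst.
by rewrite -(@near_eq_derive _ _ _ (cst 0)) // derive_cst.
Qed.

End directional_derivatives.

Section Ck_calculus.
Context (R : realType) (n : nat).
Implicit Types (f g : 'rV[R]_n -> R) (i : 'I_n).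

Definition pd i f : 'rV[R]_n -> R := fun x => 'D_(delta_mx ord0 i) f x.

Lemma pdE i f (df : 'rV[R]_n -> R) :
  (forall x, is_derive x (delta_mx ord0 i) f (df x)) -> pd i f = df.
Proof. by move=> h; apply/funext => x; exact: derive_val. Qed.

(** The pattern of the regularity proofs below: exhibit candidates for the partial derivatives and
    apply the induction hypothesis to them. *)
Lemma CkS_intro k f (df : 'I_n -> 'rV[R]_n -> R) : continuous f ->
  (forall i x, is_derive x (delta_mx ord0 i) f (df i x)) ->
  (forall i, Ck k (df i)) -> Ck k.+1 f.
Proof.
move=> cf dfi cdf; split=> // i; split; first by move=> x; exact: ex_derive.
by have := cdf i; rewrite -(pdE (dfi i)).
Qed.

Lemma Ck_continuous k f : Ck k f -> continuous f.
Proof. by case: k => [|k] []. Qed.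

Lemma CkS_is_derive k f i x : Ck k.+1 f -> is_derive x (delta_mx ord0 i) f (pd i f x).
Proof. by move=> [_ /(_ i)[h _]]; exact: derivableP. Qed.

Lemma CkS_pd k f i : Ck k.+1 f -> Ck k (pd i f).
Proof. by move=> [_ /(_ i)[_]]. Qed.

Lemma CkW k f : Ck k.+1 f -> Ck k f.
Proof.
elim: k f => [|k IH] f fk; first by split=> //; exact: (Ck_continuous fk).
apply: (CkS_intro (df := fun i => pd i f)); first exact: (Ck_continuous fk).
  by move=> i x; exact: (CkS_is_derive i x fk).
by move=> i; apply: IH; exact: CkS_pd.
Qed.

Lemma Ck_cst k c : Ck k (fun _ : 'rV[R]_n => c).
Proof.
elim: k c => [|k IH] c; first by split=> //; exact: cst_continuous.
by apply: (CkS_intro (df := fun i => fun=> 0)) => //; exact: cst_continuous.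
Qed.

Lemma Ck_add k f g : Ck k f -> Ck k g -> Ck k (fun x => f x + g x).
Proof.
elim: k f g => [|k IH] f g fk gk.
  by split=> //; apply: continuous_add; [exact: (Ck_continuous fk)|exact: (Ck_continuous gk)].
apply: (CkS_intro (df := fun i x => pd i f x + pd i g x)).
- by apply: continuous_add; [exact: (Ck_continuous fk)|exact: (Ck_continuous gk)].
- by move=> i x; apply: is_deriveD_fun; [exact: (CkS_is_derive i x fk)|exact: (CkS_is_derive i x gk)].
- by move=> i; apply: IH; exact: CkS_pd.
Qed.

Lemma Ck_mul k f g : Ck k f -> Ck k g -> Ck k (fun x => f x * g x).
Proof.
elim: k f g => [|k IH] f g fk gk.
  by split=> //; apply: continuous_mul; [exact: (Ck_continuous fk)|exact: (Ck_continuous gk)].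
apply: (CkS_intro (df := fun i x => f x * pd i g x + pd i f x * g x)).
- by apply: continuous_mul; [exact: (Ck_continuous fk)|exact: (Ck_continuous gk)].
- by move=> i x; apply: is_deriveM_fun; [exact: (CkS_is_derive i x fk)|exact: (CkS_is_derive i x gk)].
- move=> i; apply: Ck_add; apply: IH.
  + exact: CkW.
  + exact: CkS_pd.
  + exact: CkS_pd.
  + exact: CkW.
Qed.

Lemma is_derive_mulr_const (c x : R) : is_derive x (1 : R) (fun t : R => t * c) c.
Proof.
have := is_deriveM_fun (is_derive_id x (1 : R)) (is_derive_cst_fun c x (1 : R)).
by rewrite mulr0 mul1r add0r.
Qed.

Lemma is_derive_coord i j (x : 'rV[R]_n) :
  is_derive x (delta_mx ord0 i) (fun y : 'rV[R]_n => y ord0 j) (i == j)%:R.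
Proof.
apply: is_derive_from_line.
rewrite (_ : (fun t : R => _) = (fun t : R => t * (i == j)%:R + x ord0 j)); last first.
  by apply/funext => t; rewrite !mxE eqxx (eq_sym j).
have h := is_derive_mulr_const ((i == j)%:R) 0.
by have := is_deriveD_fun h (is_derive_cst_fun (x ord0 j) (0 : R) (1 : R)); rewrite addr0.
Qed.

Lemma Ck_coord k j : Ck k (fun y : 'rV[R]_n => y ord0 j).
Proof.
case: k => [|k]; first by split=> //; exact: coord_continuous.
apply: (CkS_intro (df := fun i => fun=> (i == j)%:R)); first exact: coord_continuous.
  by move=> i x; exact: is_derive_coord.
by move=> i; exact: Ck_cst.
Qed.

Lemma Ck_sum k (I : Type) (s : seq I) (F : I -> 'rV[R]_n -> R) :
  (forall j, Ck k (F j)) -> Ck k (fun x => \sum_(j <- s) F j x).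
Proof.
move=> cF; elim: s => [|i s IH]; first by under eq_fun do rewrite big_nil; exact: Ck_cst.
by under eq_fun do rewrite big_cons; exact: Ck_add.
Qed.

Lemma Ck_dotp k (y : 'rV[R]_n) : Ck k (fun x => dotp x y).
Proof. by apply: Ck_sum => i; apply: Ck_mul; [exact: Ck_coord|exact: Ck_cst]. Qed.

Lemma Ck_dotpxx k : Ck k (fun x : 'rV[R]_n => dotp x x).
Proof. by apply: Ck_sum => i; apply: Ck_mul; exact: Ck_coord. Qed.

Lemma is_derive_dotp i (x y : 'rV[R]_n) :
  is_derive x (delta_mx ord0 i) (fun x => dotp x y) (y ord0 i).
Proof.
apply: is_derive_from_line.
rewrite (_ : (fun t : R => _) = (fun t : R => t * y ord0 i + dotp x y)); last first.
  apply/funext => t; rewrite dotpDl dotpZl; congr (t * _ + _).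
  rewrite /dotp (bigD1 i)//= big1 ?addr0 ?mxE ?eqxx ?mul1r// => j ji.
  by rewrite mxE eqxx (negbTE ji) mul0r.
have h := is_derive_mulr_const (y ord0 i) 0.
by have := is_deriveD_fun h (is_derive_cst_fun (dotp x y) (0 : R) (1 : R)); rewrite addr0.
Qed.

Lemma is_derive_dotpxx i (x : 'rV[R]_n) :
  is_derive x (delta_mx ord0 i) (fun x => dotp x x) (2 * x ord0 i).
Proof.
apply: is_derive_from_line.
rewrite (_ : (fun t : R => _) = (fun t : R => t * t + t * (2 * x ord0 i) + dotp x x)); last first.
  apply/funext => t; rewrite !(dotpDl, dotpDr, dotpZl, dotpZr).
  have e (z : 'rV[R]_n) : dotp (delta_mx ord0 i) z = z ord0 i.
    rewrite /dotp (bigD1 i)//= big1 ?addr0 ?mxE ?eqxx ?mul1r// => j ji.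
    by rewrite mxE eqxx (negbTE ji) mul0r.
  by rewrite (dotpC x) !e mxE !eqxx /= mulr1; ring.
have h := is_derive_mulr_const ((2 * x ord0 i)) 0.
have h2 : is_derive (0 : R) (1 : R) (fun t : R => t * t) 0.
  have := is_deriveM_fun (is_derive_id (0 : R) (1 : R)) (is_derive_id (0 : R) (1 : R)).
  by rewrite mul0r mulr0 addr0.
have := is_deriveD_fun (is_deriveD_fun h2 h) (is_derive_cst_fun (dotp x x) (0 : R) (1 : R)).
by rewrite addr0 add0r.
Qed.

(** The outer function comes with the whole sequence of its derivatives, so that the induction can
    pass from [H j] to [H j.+1]. *)
Lemma Ck_comp k (H : nat -> R -> R) g :
  (forall j x, is_derive x (1 : R) (H j) (H j.+1 x)) -> (forall j, Ck j g) ->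
  forall j, Ck k (fun x => H j (g x)).
Proof.
move=> dH cg.
have cH j : continuous (H j).
  by move=> x; apply/differentiable_continuous/derivable1_diffP; exact: ex_derive.
have cont j : continuous (fun x => H j (g x)).
  move=> x; apply: (@continuous_comp _ _ _ g (H j)); last exact: cH.
  exact: (Ck_continuous (cg 0%N)).
elim: k => [|k IH] j; first by split.
apply: (CkS_intro (df := fun i x => H j.+1 (g x) * pd i g x)) => //.
- by move=> i x; apply: is_derive_comp; exact: (CkS_is_derive i x (cg 1%N)).
- by move=> i; apply: Ck_mul; [exact: IH|exact: (CkS_pd i (cg k.+1))].
Qed.

End Ck_calculus.

(** * Test functions and powers of the weights *)

Section continuity_at_a_point.
Context (R : realType) (T : topologicalType).
Implicit Types (f g : T -> R) (x : T).

Lemma continuous_at_mul f g x : {for x, continuous f} -> {for x, continuous g} ->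
  {for x, continuous (fun y => f y * g y)}.
Proof. by move=> cf cg; apply: cvgM. Qed.

Lemma continuous_at_inv f x : f x != 0 -> {for x, continuous f} ->
  {for x, continuous (fun y => (f y)^-1)}.
Proof. by move=> fx0 cf; apply: cvgV. Qed.

Lemma continuous_at_comp f (h : R -> R) x : {for x, continuous f} ->
  {for f x, continuous h} -> {for x, continuous (fun y => h (f y))}.
Proof. by move=> cf ch; apply: (continuous_comp cf ch). Qed.

Lemma continuous_at_near f x (a : R) : (\forall y \near x, f y = a) ->
  {for x, continuous f}.
Proof.
move=> e; rewrite /prop_for /continuous_at; have -> : f x = a by exact: nbhs_singleton e.
apply/cvgrPdist_lt => r r0; apply: filterS e => y ->.
by rewrite subrr normr0.
Qed.

End continuity_at_a_point.

Section test_functions.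
Context (R : realType) (n : nat).
Implicit Types (f phi psi : 'rV[R]_n -> R) (i : 'I_n) (x y : 'rV[R]_n) (c d r : R).

(** One family for both norms: [(1 + |xi|^2)^(s/2)] is a power of [reg 1], and
    [|xi|^s = (|xi|^2)^(s/2)] a power of [reg 0]. *)
Definition reg c x : R := c + dotp x x.

(* [region 1] is the whole space and [region 0] the punctured space. *)
Definition region c : set 'rV[R]_n := [set x | 0 < reg c x].

(** For [d > 0] these sets exhaust the compact subsets of [region c]. The explicit bounds make it
    easy to follow supports through sums and mollification. *)
Definition supp_box c r d : set 'rV[R]_n := [set x | enorm x <= r /\ d <= reg c x].

Definition suppin c phi : Prop := exists r d,
  0 < d /\ forall x, phi x != 0 -> supp_box c r d x.

Lemma Ck_reg k c : Ck k (reg c).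
Proof. by apply: Ck_add; [exact: Ck_cst|exact: Ck_dotpxx]. Qed.

Lemma closed_supp_box c r d : closed (supp_box c r d).
Proof.
rewrite (_ : supp_box c r d = ((@enorm R n) @^-1` [set t | t <= r]) `&` (reg c @^-1` [set t | d <= t])) //.
apply: closedI.
  by apply: closed_comp; [move=> x _; exact: continuous_enorm|exact: closed_le].
apply: closed_comp; [move=> x _; exact: (Ck_continuous (Ck_reg 0 c))|exact: closed_ge].
Qed.

Lemma compact_supp_box c r d : compact (supp_box c r d).
Proof.
apply: bounded_closed_compact; last exact: closed_supp_box.
exists r; split; first exact: num_real.
move=> m rm x /= [xr _]; rewrite /Num.norm /= mx_normrE.
apply/bigmax_leP; split => /=.
  by apply: le_trans (ltW rm); apply: le_trans xr; exact: enorm_ge0.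
move=> [i j] _ /=; rewrite (ord1 i); apply: le_trans (coord_le_enorm x j) _.
exact: le_trans xr (ltW rm).
Qed.

Lemma supp_box_near0 c r d phi x : (forall y, phi y != 0 -> supp_box c r d y) ->
  ~ supp_box c r d x -> \forall y \near x, phi y = 0.
Proof.
move=> h nx; have /= := open_nbhs_nbhs (conj (closed_openC (@closed_supp_box c r d)) nx).
by apply: filterS => y ny; apply/eqP; apply: contrapT => /negP /h.
Qed.

Lemma test_funP c phi :
  test_fun (region c) phi <-> (forall k, Ck k phi) /\ suppin c phi.
Proof.
split=> [[cp K KU]|[cp [r [d [d0 h]]]]].
  split=> //.
  have [r _ hr] := compact_enorm_bound K.
  (* The reciprocal of [reg c] is continuous on the compact support, hence bounded; this bound
     provides [d]. *)
  have ci : {in closure [set x | phi x != 0], continuous (fun x => (reg c x)^-1)}.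
    move=> x /set_mem /KU x0; apply: (@continuous_at_inv _ _ (reg c)); first by rewrite gt_eqF.
    exact: (Ck_continuous (Ck_reg 0 c)).
  have /compact_bounded[M [_ MK]] :
      compact ((fun x => (reg c x)^-1) @` closure [set x | phi x != 0]).
    by apply: continuous_compact => //; exact: continuous_in_subspaceT.
  have M1 : 0 < `|M| + 1 by rewrite ltr_wpDl.
  exists r, (`|M| + 1)^-1; split; first by rewrite invr_gt0.
  move=> x px; have cx : closure [set x | phi x != 0] x by exact: subset_closure.
  split; first exact: hr.
  have q0 : 0 < reg c x := KU _ cx.
  have := MK (`|M| + 1) (le_lt_trans (ler_norm _) (ltr_pwDr ltr01 (lexx _))).
  move=> /(_ (reg c x)^-1) /=; rewrite gtr0_norm ?invr_gt0//.
  move=> /(_ (ex_intro2 _ _ x cx erefl)) h.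
  by rewrite -[leRHS]invrK lef_pV2 ?posrE ?invr_gt0.
have cK : closure [set x | phi x != 0] `<=` supp_box c r d.
  by rewrite (closure_id (supp_box c r d)).1; [exact: closure_subset h|exact: closed_supp_box].
split=> //.
  by apply: subclosed_compact cK; [exact: closed_closure|exact: compact_supp_box].
by move=> x /cK [_ dx] /=; exact: lt_le_trans dx.
Qed.

Definition tf c phi : Prop := (forall k, Ck k phi) /\ suppin c phi.

Lemma suppin_sub c phi psi : suppin c phi -> (forall x, phi x = 0 -> psi x = 0) -> suppin c psi.
Proof.
move=> [r [d [d0 h]]] pq; exists r, d; split=> // x; move=> qx; apply: h.
by apply: contra_neq qx => /pq.
Qed.

Lemma suppin_lin c a phi psi : suppin c phi -> suppin c psi ->
  suppin c (fun x => a * phi x + psi x).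
Proof.
move=> [r [d [d0 h]]] [r' [d' [d0' h']]].
exists (Num.max r r'), (Num.min d d'); split; first by rewrite lt_min d0.
move=> x; rewrite /supp_box /= le_max ge_min.
have [->|/h [-> ->] _] := eqVneq (phi x) 0; last by [].
by rewrite mulr0 add0r => /h' [-> ->]; rewrite !orbT.
Qed.

Lemma tf_lin c a phi psi : tf c phi -> tf c psi -> tf c (fun x => a * phi x + psi x).
Proof.
move=> [p1 p2] [q1 q2]; split; last exact: suppin_lin.
by move=> k; apply: Ck_add => //; apply: Ck_mul => //; exact: Ck_cst.
Qed.

Lemma tf_mul c f phi : (forall k, Ck k f) -> tf c phi -> tf c (fun x => f x * phi x).
Proof.
move=> cf [p1 p2]; split; first by move=> k; exact: Ck_mul.
by apply: suppin_sub p2 _ => x ->; rewrite mulr0.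
Qed.

Lemma tf0 c : tf c (fun=> 0).
Proof.
split; first by move=> k; exact: Ck_cst.
by exists 0, 1; split=> // x; rewrite eqxx.
Qed.

Lemma suppin_cc c phi : continuous phi -> suppin c phi -> cc phi.
Proof. by move=> cp [r [d [_ h]]]; split=> //; exists r => x /h []. Qed.

Lemma tf_cc c phi : tf c phi -> cc phi.
Proof. by move=> [p1 p2]; apply: (suppin_cc (Ck_continuous (p1 0%N))) p2. Qed.

Lemma pd_supp0 c r d phi i x : (forall k, Ck k phi) ->
  (forall y, phi y != 0 -> supp_box c r d y) -> ~ supp_box c r d x -> pd i phi x = 0.
Proof.
move=> cp h nx; have := is_derive_near0 (delta_mx ord0 i) (supp_box_near0 h nx).
by move=> D; exact: (@derive_val _ _ _ _ _ _ _ D).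
Qed.

Lemma tf_pd c phi i : tf c phi -> tf c (pd i phi).
Proof.
move=> [p1 [r [d [d0 h]]]]; split; first by move=> k; exact: CkS_pd (p1 k.+1).
exists r, d; split=> // x; move=> px; apply: contrapT => nx.
by move: px; rewrite (pd_supp0 i p1 h nx) eqxx.
Qed.

(** Outside the closed box that carries [phi] the product vanishes near the point, so the behaviour
    of [f] off [region c] is harmless. *)
Lemma continuous_supp_mul c f phi : (forall x, region c x -> {for x, continuous f}) ->
  continuous phi -> suppin c phi -> continuous (fun x => f x * phi x).
Proof.
move=> cf cp [r [d [d0 h]]] x.
have [[xr dx]|nx] := pselect (supp_box c r d x).
  apply: continuous_at_mul; last exact: cp.
  by apply: cf; exact: lt_le_trans dx.
have e : \forall y \near x, f y * phi y = 0.
  by apply: filterS (supp_box_near0 h nx) => y ->; rewrite mulr0.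
exact: continuous_at_near e.
Qed.

Lemma is_derive_powR_comp c a x i : 0 < reg c x ->
  is_derive x (delta_mx ord0 i) (fun y => reg c y `^ a)
    (a * reg c x `^ (a - 1) * (2 * x ord0 i)).
Proof.
move=> x0; have h := is_derive1_powR a x0.
apply: (is_derive_comp _ h).
have := is_deriveD_fun (is_derive_cst_fun c x (delta_mx ord0 i)) (is_derive_dotpxx i x).
by rewrite add0r.
Qed.

Lemma continuous_reg_powR c a x : region c x ->
  {for x, continuous (fun y => reg c y `^ a)}.
Proof.
move=> x0; apply: (@continuous_at_comp _ _ (reg c) (@powR R ^~ a)).
  exact: (Ck_continuous (Ck_reg 0 c)).
apply/differentiable_continuous/derivable1_diffP.
exact: (@ex_derive _ _ _ _ _ _ _ (is_derive1_powR a x0)).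
Qed.

(** Each partial derivative is a sum of two terms of the same shape, with exponents [a] and [a - 1]
    and other test functions; hence the induction is over all [a] and [phi]. *)
Lemma Ck_reg_powR k c a phi : tf c phi -> Ck k (fun x => reg c x `^ a * phi x).
Proof.
elim: k a phi => [|k IH] a phi ptf.
  split=> //; apply: (@continuous_supp_mul c); [|exact: (Ck_continuous (ptf.1 0%N))|exact: ptf.2].
  exact: continuous_reg_powR.
have [cp sp] := ptf.
apply: (CkS_intro (df := fun i x => reg c x `^ a * pd i phi x +
    reg c x `^ (a - 1) * ((2 * a * x ord0 i) * phi x))).
- apply: (@continuous_supp_mul c); [|exact: (Ck_continuous (ptf.1 0%N))|exact: ptf.2].
  exact: continuous_reg_powR.
- move=> i x; have [r [d [d0 h]]] := sp.
  have [[xr dx]|nx] := pselect (supp_box c r d x).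
    have x0 : 0 < reg c x by exact: lt_le_trans dx.
    have := is_deriveM_fun (is_derive_powR_comp a i x0) (CkS_is_derive i x (cp 1%N)).
    rewrite (_ : a * reg c x `^ (a - 1) * (2 * x ord0 i) * phi x =
      reg c x `^ (a - 1) * (2 * a * x ord0 i * phi x))//; ring.
  have p0 := nbhs_singleton (supp_box_near0 h nx).
  rewrite (pd_supp0 i cp h nx) p0 !mulr0 addr0; apply: is_derive_near0.
  by apply: filterS (supp_box_near0 h nx) => y ->; rewrite mulr0.
- move=> i; apply: Ck_add; apply: IH; first exact: tf_pd.
  by apply: tf_mul ptf => j; apply: Ck_mul; [exact: Ck_cst|exact: Ck_coord].
Qed.

Lemma tf_reg_powR c a phi : tf c phi -> tf c (fun x => reg c x `^ a * phi x).
Proof.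
move=> ptf; split; first by move=> k; exact: Ck_reg_powR.
by apply: suppin_sub ptf.2 _ => x ->; rewrite mulr0.
Qed.

End test_functions.

(** * Difference quotients and convolution with test functions *)

Lemma continuous_subr_cst (R : realType) (V : normedModType R) (t : V) :
  continuous (fun v : V => v - t).
Proof. by move=> v; apply: cvgB; [exact: cvg_id|exact: cvg_cst]. Qed.

Lemma continuous_shift_comp (R : realType) (V : normedModType R) (f : V -> R) (t : V) :
  continuous f -> continuous (fun v : V => f (v - t)).
Proof.
move=> cf v; apply: (@continuous_comp _ _ _ (fun v : V => v - t) f); last exact: cf.
exact: continuous_subr_cst.
Qed.

Section difference_quotients.
Context (R : realType) (n : nat).
Notation mu := (leb R n).
Notation e_ i := (delta_mx ord0 i : 'rV[R]_n).
Implicit Types (phi psi eta : 'rV[R]_n -> R) (i : 'I_n) (x y z : 'rV[R]_n) (h M : R).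

(** The value at [h = 0] makes the quotient continuous in [h] there, so that limits under the
    integral become instances of [continuous_rint]. *)
Definition dq i phi h z : R :=
  if h == 0 then pd i phi z else h^-1 * (phi (h *: e_ i + z) - phi z).

Lemma dq_bound i phi M h z : Ck 1 phi -> (forall x, `|pd i phi x| <= M) ->
  `|dq i phi h z| <= M.
Proof.
move=> cp pM; rewrite /dq; case: ifPn => [_|h0]; first exact: pM.
pose g t := phi (t *: e_ i + z).
have dg t : is_derive t (1 : R) g (pd i phi (t *: e_ i + z)).
  by apply: is_derive_line; exact: (cp.2 i).1.
have cg : continuous g.
  by move=> t; apply/differentiable_continuous/derivable1_diffP; exact: ex_derive.
have g0 : g 0 = phi z by rewrite /g scale0r add0r.
rewrite -g0 -/(g h) normrM normfV.
rewrite -ler_pdivlMl ?invr_gt0 ?normr_gt0// invrK.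
have [h_gt0|] := ltP 0 h; last rewrite le_eqVlt (negbTE h0) /= => h_lt0.
  have [t _ ->] := MVT_segment (ltW h_gt0) (fun t _ => dg t) (continuous_subspaceT cg).
  by rewrite subr0 normrM mulrC ler_wpM2l.
rewrite distrC.
have [t _ ->] := MVT_segment (ltW h_lt0) (fun t _ => dg t) (continuous_subspaceT cg).
by rewrite sub0r normrM normrN mulrC ler_wpM2l.
Qed.

Lemma dq_cvg i phi z : Ck 1 phi -> dq i phi h z @[h --> (0 : R)] --> dq i phi 0 z.
Proof.
move=> cp; have d : derivable phi z (e_ i) by exact: (cp.2 i).1.
apply/(@continuous_withinNx _ _ (fun h => dq i phi h z)).
rewrite {2}/dq eqxx; apply/cvgrPdist_lt => r r0.
have /cvgrPdist_lt/(_ _ r0) D : (fun h => h^-1 *: ((phi \o shift z) (h *: e_ i) - phi z)) @ (0 : R)^'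
   --> pd i phi z by exact: d.
near=> h; have h0 : h != 0 by near: h; exact: nbhs_dnbhs_neq.
by rewrite /dq (negbTE h0); near: h; exact: D.
Unshelve. all: by end_near. Qed.

Lemma measurable_dq i phi h : Ck 1 phi -> measurable_fun setT (dq i phi h).
Proof.
move=> cp; rewrite /dq; case: eqP => [_|_].
  by apply: continuous_measurable_rV; exact: (Ck_continuous (CkS_pd i cp)).
have cphi := Ck_continuous cp.
apply: measurable_funM => //; apply: measurable_funB; last exact: continuous_measurable_rV.
apply: measurableT_comp; first exact: continuous_measurable_rV.
by apply: measurable_rVD => //; exact: measurable_id.
Qed.

Lemma tf_pd_bounded c i phi : tf c phi -> exists2 M, 0 <= M & forall x, `|pd i phi x| <= M.
Proof. by move=> /(tf_pd i)/tf_cc/cc_bounded. Qed.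

Lemma enorm_delta i : enorm (e_ i) = 1.
Proof.
rewrite /enorm /dotp (bigD1 i)//= big1 ?addr0 ?mxE ?eqxx ?mul1r ?sqrtr1// => j ji.
by rewrite mxE eqxx (negbTE ji) mul0r.
Qed.

(** Difference quotients have integral 0 by translation invariance. They are bounded by the mean
    value theorem and live in one fixed ball, so dominated convergence applies. *)
Lemma rint_pd c i phi : tf c phi -> rint mu (pd i phi) = 0.
Proof.
move=> ptf; have cp := ptf.1 1%N; have pc := tf_cc ptf.
have [M M0 pM] := tf_pd_bounded i ptf.
have [_ [r pr]] := pc; have [_ [r' pr']] := tf_cc (tf_pd i ptf).
(* The ball is enlarged by 1 because the steps of the difference quotients are at most 1. *)
pose B : set 'rV[R]_n := [set x | enorm x <= Num.max r r' + 1].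
pose g x := M * \1_B x.
have gi : intg mu g by apply: intgZ; exact: intg_indic_eball.
have ep k : (0 : R) < k.+1%:R^-1 by rewrite invr_gt0.
have dqg k x : `|dq i phi k.+1%:R^-1 x| <= g x.
  rewrite /g indicE; case: (boolP (x \in B)) => [_|/negP nB].
    by rewrite mulr1; exact: dq_bound.
  have px : phi x = 0.
    apply/eqP; apply: contrapT => /negP /pr h; apply: nB; apply/mem_set.
    by rewrite /B /= (le_trans h)// -[leLHS]addr0 lerD// le_max lexx.
  suff p'x : phi (k.+1%:R^-1 *: e_ i + x) = 0.
    by rewrite mulr0 /dq (gt_eqF (ep k)) px p'x subrr mulr0 normr0.
  apply/eqP; apply: contrapT => /negP /pr h; apply: nB; apply/mem_set.
  have k1 : k.+1%:R^-1 <= (1 : R) by rewrite invf_le1 ?ler1n.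
  have e1 : enorm (k.+1%:R^-1 *: e_ i) <= 1.
    by rewrite enormZ (gtr0_norm (ep k)) enorm_delta mulr1.
  rewrite /B /=; have := enormD (k.+1%:R^-1 *: e_ i + x) (- (k.+1%:R^-1 *: e_ i)).
  rewrite enormN addrAC subrr add0r => /le_trans; apply; apply: lerD => //.
  by rewrite le_max h.
have cv x : dq i phi k.+1%:R^-1 x @[k --> \oo] --> pd i phi x.
  have := @dq_cvg i phi x cp; rewrite [X in _ --> X]/dq eqxx => D.
  apply: (cvg_comp (fun k : nat => k.+1%:R^-1 : R) (fun h => dq i phi h x) _ D).
  exact: cvg_harmonic.
have [_] := @rint_dct _ _ _ mu (fun k => dq i phi k.+1%:R^-1) (pd i phi) g
  (fun k => measurable_dq _ _ cp) cv gi dqg.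
have z k : rint mu (dq i phi k.+1%:R^-1) = 0.
  have -> : dq i phi k.+1%:R^-1 = fun x => k.+1%:R * (phi (k.+1%:R^-1 *: e_ i + x) - phi x).
    by apply/funext => x; rewrite /dq gt_eqF// invrK.
  have pi := cc_intg pc.
  have psi : intg mu (fun x => phi (k.+1%:R^-1 *: e_ i + x)).
    by under eq_fun do rewrite addrC; exact: intg_shift.
  rewrite rintZ; last exact: intgB.
  rewrite rintB//; under [X in rint mu X - _]eq_fun do rewrite addrC.
  by rewrite (@rint_shift _ _ (k.+1%:R^-1 *: e_ i) phi pi) subrr mulr0.
under eq_fun do rewrite z.
by move=> /(cvg_lim (@Rhausdorff R)); rewrite lim_cst//; exact: Rhausdorff.
Qed.

Definition convol psi eta x : R := rint mu (fun y => psi y * eta (x - y)).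

Lemma continuous_convol psi eta : intg mu psi -> cc eta -> continuous (convol psi eta).
Proof.
move=> ip ce x; have [M M0 eM] := cc_bounded ce.
have mp := intg_measurable ip.
apply: (@continuous_rint _ _ _ _ mu (fun x y => psi y * eta (x - y)) (fun y => M * `|psi y|)).
- move=> v; apply: measurable_funM => //; apply: measurableT_comp; first exact: cc_measurable.
  by apply: measurable_rVB => //; exact: measurable_id.
- by apply: intgZ; exact: intg_norm.
- by move=> v t; rewrite normrM mulrC ler_wpM2r.
- move=> t; have ct := continuous_cstM (a := psi t) (@continuous_shift_comp _ _ _ t ce.1).
  exact: ct x.
Qed.

(** The difference quotients of [eta] are uniformly bounded, so [psi] needs only to be integrable:
    all the smoothness comes from [eta]. *)
Lemma is_derive_convol c psi eta i x : intg mu psi -> tf c eta ->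
  is_derive x (e_ i) (convol psi eta) (convol psi (pd i eta) x).
Proof.
move=> ip te; have ce := te.1 1%N; have [M M0 eM] := tf_pd_bounded i te.
have mp := intg_measurable ip.
have [M' M'0 eM'] := cc_bounded (tf_cc te).
have sub_meas (f : 'rV[R]_n -> R) v : measurable_fun setT f ->
    measurable_fun setT (fun y => f (v - y)).
  move=> mf; apply: measurableT_comp => //.
  by apply: measurable_rVB => //; exact: measurable_id.
have ie v : intg mu (fun y => psi y * eta (v - y)).
  apply: (intg_dom _ _ (intgZ M' (intg_norm ip))).
    by apply: measurable_funM => //; apply: sub_meas; exact: cc_measurable (tf_cc te).
  by move=> y; rewrite normrM mulrC ler_wpM2r.
pose F h y := psi y * dq i eta h (x - y).
have cF : rint mu (F h) @[h --> (0 : R)] --> rint mu (F 0).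
  apply: (@continuous_rint _ R^o _ _ mu F (fun y => M * `|psi y|)).
  - by move=> v; apply: measurable_funM => //; apply: sub_meas; exact: measurable_dq.
  - by apply: intgZ; exact: intg_norm.
  - by move=> v t; rewrite normrM mulrC ler_wpM2r// dq_bound.
  - by move=> t; apply: cvgM; [exact: cvg_cst|exact: dq_cvg].
have F0 : rint mu (F 0) = convol psi (pd i eta) x.
  by apply: eq_rint => y; rewrite /F /dq eqxx.
have Fh h : h != 0 -> rint mu (F h) = h^-1 * (convol psi eta (h *: e_ i + x) - convol psi eta x).
  move=> h0; rewrite /convol -rintB//.
  rewrite -rintZ; last exact: intgB.
  apply: eq_rint => y; rewrite /F /dq (negbTE h0) addrA; ring.
have cv : (fun h => h^-1 *: ((convol psi eta \o shift x) (h *: e_ i) - convol psi eta x)) @ (0 : R)^'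
   --> convol psi (pd i eta) x.
  rewrite -F0; apply/cvgrPdist_lt => r r0.
  move: cF => /cvgrPdist_lt/(_ _ r0) D; rewrite /dnbhs; apply: filterS D => h hr h0.
  by have := hr; rewrite (Fh _ h0).
apply: DeriveDef; first by apply/cvg_ex; exists (convol psi (pd i eta) x).
exact: (cvg_lim (@Rhausdorff R) cv).
Qed.

Lemma Ck_convol k c psi eta : intg mu psi -> tf c eta -> Ck k (convol psi eta).
Proof.
move=> ip; elim: k eta => [|k IH] eta te.
  by split=> //; apply: continuous_convol => //; exact: tf_cc te.
apply: (CkS_intro (df := fun i => convol psi (pd i eta))).
- by apply: continuous_convol => //; exact: tf_cc te.
- by move=> i x; exact: is_derive_convol te.
- by move=> i; apply: IH; exact: tf_pd.
Qed.

End difference_quotients.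

(** * Decay of the transforms of test functions *)

Section fourier_decay.
Context (R : realType) (n : nat).
Notation mu := (leb R n).
Notation e_ i := (delta_mx ord0 i : 'rV[R]_n).
Implicit Types (phi psi : 'rV[R]_n -> R) (i : 'I_n) (x y z xi : 'rV[R]_n) (c : R).

(** Differentiating the cosine shifts its argument by [pi / 2], which gives the sequence of
    derivatives in closed form. *)
Lemma Ck_cos_dotp k xi : Ck k (fun x : 'rV[R]_n => cos (dotp x xi)).
Proof.
have dH j (t : R) : is_derive t (1 : R) (fun t => cos (t + pi / 2 *+ j)) (cos (t + pi / 2 *+ j.+1)).
  rewrite (mulrSr (pi / 2)) addrA cosDpihalf.
  have h : is_derive t (1 : R) (fun t => t + pi / 2 *+ j) 1.
    have := is_deriveD_fun (is_derive_id t (1 : R)) (is_derive_cst_fun (pi / 2 *+ j) t (1 : R)).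
    by rewrite addr0.
  have := is_derive_comp h (is_derive_cos (t + pi / 2 *+ j)).
  by rewrite mulr1.
have := @Ck_comp R n k (fun j t => cos (t + pi / 2 *+ j)) (fun x => dotp x xi) dH
  (fun j => Ck_dotp j xi) 0.
by under eq_fun do rewrite mulr0n addr0.
Qed.

Lemma Ck_sin_dotp k xi : Ck k (fun x : 'rV[R]_n => sin (dotp x xi)).
Proof.
have dH j (t : R) : is_derive t (1 : R) (fun t => sin (t + pi / 2 *+ j)) (sin (t + pi / 2 *+ j.+1)).
  rewrite (mulrSr (pi / 2)) addrA sinDpihalf.
  have h : is_derive t (1 : R) (fun t => t + pi / 2 *+ j) 1.
    have := is_deriveD_fun (is_derive_id t (1 : R)) (is_derive_cst_fun (pi / 2 *+ j) t (1 : R)).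
    by rewrite addr0.
  have := is_derive_comp h (is_derive_sin (t + pi / 2 *+ j)).
  by rewrite mulr1.
have := @Ck_comp R n k (fun j t => sin (t + pi / 2 *+ j)) (fun x => dotp x xi) dH
  (fun j => Ck_dotp j xi) 0.
by under eq_fun do rewrite mulr0n addr0.
Qed.

(** Integration by parts: the derivative of the test function [phi * cos] has integral 0. *)
Lemma FC_pd c i phi xi : tf c phi -> FC (pd i phi) xi = xi ord0 i * FS phi xi.
Proof.
move=> tp; have tF := tf_mul (fun k => Ck_cos_dotp k xi) tp.
have pi := cc_intg (tf_cc tp); have di := cc_intg (tf_cc (tf_pd i tp)).
have := rint_pd i tF.
rewrite (_ : pd i _ = fun x => pd i phi x * cos (dotp x xi) - xi ord0 i * (phi x * sin (dotp x xi))); last first.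
  apply: pdE => x.
  have := is_deriveM_fun (is_derive_comp (is_derive_dotp i x xi) (is_derive_cos (dotp x xi)))
    (CkS_is_derive i x (tp.1 1%N)).
  by rewrite (_ : cos (dotp x xi) * _ + _ = pd i phi x * cos (dotp x xi) - xi ord0 i * (phi x * sin (dotp x xi)))//; ring.
rewrite rintB; [|exact: intg_cos|by apply: intgZ; exact: intg_sin].
by rewrite rintZ; [|exact: intg_sin]; move/subr0_eq.
Qed.

Lemma FS_pd c i phi xi : tf c phi -> FS (pd i phi) xi = - (xi ord0 i * FC phi xi).
Proof.
move=> tp; have tF := tf_mul (fun k => Ck_sin_dotp k xi) tp.
have pi := cc_intg (tf_cc tp); have di := cc_intg (tf_cc (tf_pd i tp)).
have := rint_pd i tF.
rewrite (_ : pd i _ = fun x => pd i phi x * sin (dotp x xi) + xi ord0 i * (phi x * cos (dotp x xi))); last first.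
  apply: pdE => x.
  have := is_deriveM_fun (is_derive_comp (is_derive_dotp i x xi) (is_derive_sin (dotp x xi)))
    (CkS_is_derive i x (tp.1 1%N)).
  by rewrite (_ : sin (dotp x xi) * _ + _ = pd i phi x * sin (dotp x xi) + xi ord0 i * (phi x * cos (dotp x xi)))//; ring.
rewrite rintD; [|exact: intg_sin|by apply: intgZ; exact: intg_cos].
by rewrite rintZ; [|exact: intg_cos]; move/eqP; rewrite addr_eq0 => /eqP.
Qed.

(** One more factor [1 + |xi|] is at most [1] plus the sum of the [|xi_i|], and each [xi_i] is
    absorbed by replacing [phi] with a partial derivative. *)
Lemma fourier_decay c phi (N : nat) : tf c phi -> exists2 C, 0 <= C & forall xi,
  (1 + enorm xi) ^+ N * `|FC phi xi| <= C /\ (1 + enorm xi) ^+ N * `|FS phi xi| <= C.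
Proof.
elim: N phi => [|N IH] phi tp.
  have pi := cc_intg (tf_cc tp).
  exists (rint mu (fun x => `|phi x|)); first by apply: rint_ge0.
  by move=> xi; rewrite expr0 !mul1r; split; [exact: FC_le|exact: FS_le].
have [C0 C00 H0] := IH phi tp.
have /choice[C HC] (i : 'I_n) : exists C, 0 <= C /\ forall xi,
    (1 + enorm xi) ^+ N * `|FC (pd i phi) xi| <= C /\ (1 + enorm xi) ^+ N * `|FS (pd i phi) xi| <= C.
  by have [C c0 h] := IH _ (tf_pd i tp); exists C.
have key xi (a : R) : (1 + enorm xi) ^+ N * `|a| <= C0 ->
    (forall i, (1 + enorm xi) ^+ N * `|xi ord0 i * a| <= C i) ->
    (1 + enorm xi) ^+ N.+1 * `|a| <= C0 + \sum_i C i.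
  move=> h0 hi; have w0 : 0 <= (1 + enorm xi) ^+ N.
    by rewrite exprn_ge0// addr_ge0 ?enorm_ge0.
  rewrite exprSr -mulrA mulrDl mul1r mulrDr lerD//.
  apply: le_trans (_ : (1 + enorm xi) ^+ N * ((\sum_i `|xi ord0 i|) * `|a|) <= _).
    by rewrite ler_wpM2l// ler_wpM2r// enorm_le_sum.
  rewrite mulr_suml mulr_sumr; apply: ler_sum => i _.
  by rewrite -normrM.
exists (C0 + \sum_i C i).
  by rewrite addr_ge0// sumr_ge0// => i _; exact: (HC i).1.
move=> xi; split; apply: key.
- exact: (H0 xi).1.
- by move=> i; rewrite -normrN -(FS_pd i xi tp); exact: ((HC i).2 xi).2.
- exact: (H0 xi).2.
- by move=> i; rewrite -(FC_pd i xi tp); exact: ((HC i).2 xi).1.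
Qed.

End fourier_decay.

(** * Mollification *)

Section mollification.
Context (R : realType) (n : nat).
Notation mu := (leb R n).
Implicit Types (phi psi : 'rV[R]_n -> R) (i : 'I_n) (x y u z xi : 'rV[R]_n) (c d r : R).

Lemma lebesgue_box_gt0 (a : R) : 0 < a ->
  (0 < leb R n [set x : 'rV[R]_n | forall i, (`|x ord0 i| <= a)%R])%E.
Proof.
move=> a0; have := @lebesgue_rV_box R n (fun=> `[(- a)%R, a]%classic).
rewrite (_ : [set x : 'rV[R]_n | forall i, `[(- a)%R, a]%classic (x ord0 i)] =
  [set x : 'rV[R]_n | forall i, `|x ord0 i| <= a]); last first.
  by apply/seteqP; split=> x /= h i; have := h i; rewrite in_itv /= ler_norml.
move=> ->; last by move=> i; exact: measurable_itv.
rewrite lebesgue_measure_itv /= lte_fin gtrN//.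
elim/big_ind : _ => //; first by move=> x y x0 y0; exact: mule_gt0.
by move=> i _; rewrite -EFinD lte_fin opprK addr_gt0.
Qed.

Lemma measurable_box (a : R) : measurable [set x : 'rV[R]_n | forall i, `|x ord0 i| <= a].
Proof.
rewrite (_ : [set x | _] =
  \bigcap_(i in [set: 'I_n]) ((fun x : 'rV[R]_n => x ord0 i) @^-1` [set t | `|t| <= a])).
  apply: fin_bigcap_measurable; first exact: finite_finset.
  move=> i _; rewrite -[X in measurable X]setTI.
  apply: (@measurable_coord R n i) => //.
  rewrite (_ : [set t | _] = `[(- a)%R, a]%classic); first exact: measurable_itv.
  by apply/seteqP; split=> t /=; rewrite in_itv /= ler_norml.
by apply/seteqP; split=> x /= h i; [move=> _|]; exact: h.
Qed.

(** The bump is a multiple of [chi(|x|^2)^2]: squaring gives nonnegativity, as [chi] may change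
    sign, and the argument [|x|^2] gives smoothness and evenness. *)
Lemma bump_exists (chi : R -> R) : cutoff chi -> exists rho : 'rV[R]_n -> R,
  [/\ forall e, 0 < e -> tf 1 (fun x => e ^- n * rho (e^-1 *: x)),
      intg mu rho, rint mu rho = 1, forall x, 0 <= rho x &
      (forall x, rho (- x) = rho x) /\ (forall x, rho x != 0 -> enorm x <= 2)].
Proof.
move=> [dchi chi1 chi2 _].
pose bump x := chi (dotp x x) * chi (dotp x x).
have dH j t : is_derive t (1 : R) (derive1n j chi) (derive1n j.+1 chi t).
  by rewrite derive1nS derive1E; apply: derivableP; exact: dchi.
have bump_supp x : bump x != 0 -> enorm x <= 2.
  move=> b0; have : ~ 2 <= `|dotp x x|.
    by move=> /chi2 e; move: b0; rewrite /bump e mulr0 eqxx.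
  move=> /negP; rewrite -ltNge ger0_norm ?dotp_ge0// => d2.
  rewrite -(@ler_pXn2r _ 2)// ?nnegrE ?enorm_ge0// sqr_enorm.
  by apply: le_trans (ltW d2) _; rewrite expr2 ler_peMl// ler1n.
have Ckb k e : Ck k (fun x => bump (e^-1 *: x)).
  have C1 : Ck k (fun x => chi (e^-1 * e^-1 * dotp x x)).
    apply: (@Ck_comp R n k (fun j => derive1n j chi) (fun x => e^-1 * e^-1 * dotp x x) dH _ 0%N).
    by move=> j; apply: Ck_mul; [exact: Ck_cst|exact: Ck_dotpxx].
  rewrite (_ : (fun x => _) = (fun x => chi (e^-1 * e^-1 * dotp x x) * chi (e^-1 * e^-1 * dotp x x))).
    exact: Ck_mul.
  by apply/funext => x; rewrite /bump dotpZl dotpZr mulrA.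
have cbump : cc bump.
  split; last by exists 2.
  have := Ck_continuous (Ckb 0%N 1).
  by under eq_fun do rewrite invr1 scale1r.
have bi := cc_intg cbump.
have b0 x : 0 <= bump x by rewrite /bump -expr2 sqr_ge0.
have m0 : 0 < rint mu bump.
  (* The cube of half-side [1 / (n + 1)] lies in the unit ball, where the bump equals 1, and it has
     positive measure. *)
  pose a : R := n.+1%:R^-1; have a0 : 0 < a by rewrite invr_gt0.
  pose B := [set x : 'rV[R]_n | forall i, `|x ord0 i| <= a].
  have mB : measurable B by exact: measurable_box.
  have B1 x : B x -> bump x = 1.
    move=> Bx; have e1 : enorm x <= 1.
      apply: le_trans (enorm_le_sum x) _; apply: (@le_trans _ _ (\sum_(i < n) a)).
        by apply: ler_sum => i _; exact: Bx.
      rewrite sumr_const card_ord -(mulr_natr a) mulrC /a ler_pdivrMr// mul1r.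
      by rewrite ler_nat.
    rewrite /bump chi1 ?mulr1// ger0_norm ?dotp_ge0// -sqr_enorm.
    by rewrite exprn_ile1 ?enorm_ge0.
  have : (leb R n B <= \int[mu]_x (bump x)%:E)%E.
    rewrite -[X in (leb R n X <= _)%E]setIT -integral_indic//.
    apply: ge0_le_integral => //.
    - by apply/measurable_EFinP; exact: measurable_indic.
    - by apply/measurable_EFinP; exact: intg_measurable bi.
    - move=> x _; rewrite lee_fin indicE; case: (boolP (x \in B)) => [/set_mem /B1 ->//|_].
      exact: b0.
  by rewrite (rintE bi) => /(lt_le_trans (lebesgue_box_gt0 a0)); rewrite lte_fin.
have mn0 : rint mu bump != 0 by rewrite gt_eqF.
exists (fun x => (rint mu bump)^-1 * bump x); split.
- move=> e e0; split.
    by move=> k; apply: Ck_mul; [exact: Ck_cst|apply: Ck_mul; [exact: Ck_cst|exact: Ckb]].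
  exists (e * 2), 1; split=> // x; rewrite mulf_eq0 negb_or => /andP[_]; rewrite mulf_eq0 negb_or => /andP[_ /bump_supp].
  rewrite enormZ gtr0_norm ?invr_gt0// ler_pdivrMl// => xe; split=> //.
  by rewrite /reg lerDl dotp_ge0.
- exact: intgZ.
- by rewrite rintZ// mulVf.
- by move=> x; rewrite mulr_ge0// invr_ge0 ltW.
- split=> x; first by rewrite /bump dotpNl dotpNr opprK.
  by rewrite mulf_eq0 negb_or => /andP[_]; exact: bump_supp.
Qed.

(** A shift by at most [2 e] with [e <= 1/2] raises [|x|^2] by at most [2 e (2 r + 1)], hence by at
    most [d / 2]. *)
Lemma suppin_mollify c r d psi (e : R) (rho : 'rV[R]_n -> R) x : 0 <= r -> 0 < e ->
  (forall x, psi x != 0 -> supp_box c r d x) -> (forall x, rho x != 0 -> enorm x <= 2) ->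
  e <= 2^-1 -> 4 * (e * (2 * r + 1)) <= d ->
  rint mu (fun u => psi (x - e *: u) * rho u) != 0 -> supp_box c (r + 1) (d / 2) x.
Proof.
move=> r0 e0 hp hr e2 ed hx.
have [u] : exists u, psi (x - e *: u) * rho u != 0.
  apply: contrapT => /forallNP n0; move: hx.
  by rewrite (@eq_rint _ _ _ mu _ (fun=> 0)) ?rint0 ?eqxx// => u; apply/eqP; apply/negPn/negP/n0.
rewrite mulf_eq0 negb_or => /andP[/hp [xr xd] /hr u2].
have eu : enorm (e *: u) <= 2 * e by rewrite enormZ gtr0_norm// mulrC ler_wpM2r// ltW.
have xr1 : enorm x <= r + 2 * e.
  have := enormD (x - e *: u) (e *: u); rewrite subrK => /le_trans; apply.
  exact: lerD.
split; first by apply: le_trans xr1 _; lra.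
have hd := ler_enorm_dist x (x - e *: u).
rewrite opprB addrCA subrr addr0 in hd.
move: xd; rewrite /reg -!sqr_enorm.
have := enorm_ge0 x; have := enorm_ge0 (x - e *: u).
move: (enorm x) (enorm (x - e *: u)) (enorm (e *: u)) hd eu xr xr1 => X Y E hd eu xr xr1 Y0 X0.
have YX : Y <= X + 2 * e.
  by move: hd; rewrite ler_norml => /andP[]; lra.
have : Y ^+ 2 - X ^+ 2 <= (r + (r + 2 * e)) * (2 * e).
  have -> : Y ^+ 2 - X ^+ 2 = (Y + X) * (Y - X) by ring.
  have [XY|XY] := leP Y X.
    apply: (@le_trans _ _ 0); first by rewrite mulr_ge0_le0 ?addr_ge0// subr_le0.
    by rewrite mulr_ge0//; lra.
  apply: ler_pM; rewrite ?subr_ge0 ?addr_ge0//; last by lra.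
  - exact: ltW.
  - exact: lerD.
have ee : e * e <= 2^-1 * e by rewrite ler_wpM2r// ltW.
move: (X ^+ 2) (Y ^+ 2) => X2 Y2; lra.
Qed.

(** The transform of the mollified function is that of [psi] times [w_ k y = FC rho (e_k y)], a real
    number since [rho] is even. This product form gives domination by the transform of [psi] itself,
    whatever its decay. *)
Theorem mollification (chi : R -> R) c psi : cutoff chi -> continuous psi -> suppin c psi ->
  exists (psi_ w_ : nat -> 'rV[R]_n -> R) (r d M : R),
  [/\ forall k, tf c (psi_ k),
      0 < d /\ forall k x, psi_ k x != 0 -> supp_box c r d x,
      forall k x, `|psi_ k x| <= M,
      forall x, psi_ k x @[k --> \oo] --> psi x &
      [/\ forall k y, `|w_ k y| <= 1,
          forall y, w_ k y @[k --> \oo] --> (1 : R),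
          forall k y, FC (psi_ k) y = FC psi y * w_ k y &
          forall k y, FS (psi_ k) y = FS psi y * w_ k y]].
Proof.
move=> hchi cpsi spsi; have [rho [te Ki K1 K0 [Ke K2]]] := bump_exists hchi.
have pc := suppin_cc cpsi spsi; have [M M0 pM] := cc_bounded pc.
have mK := intg_measurable Ki; have mp := cc_measurable pc.
have [r' [d [d0 hp']]] := spsi.
pose r := `|r'|; have r0 : 0 <= r by exact: normr_ge0.
have hp x : psi x != 0 -> supp_box c r d x.
  by move=> /hp' [xr xd]; split=> //; apply: le_trans xr (ler_norm _).
(* The two requirements of [suppin_mollify] on the scale. *)
pose E : R := Num.min 2^-1 (d / (4 * (2 * r + 1))).
have r1 : 0 < 4 * (2 * r + 1) by lra.
have E0 : 0 < E by rewrite lt_min invr_gt0 ltr0n /= divr_gt0.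
have [N hN] : exists N : nat, forall k, (N <= k)%N -> k.+1%:R^-1 <= E.
  have [N _ hN] := near_infty_natSinv_lt (PosNum E0).
  by exists N => k Nk; apply: ltW; exact: hN.
(* Starting at [N] makes all the scales admissible, so that the supports lie in one common box. *)
pose e_ k : R := (k + N).+1%:R^-1.
have e0 k : 0 < e_ k by rewrite invr_gt0.
have eE k : e_ k <= E by apply: hN; rewrite leq_addl.
pose psi_ k := convol psi (fun x => e_ k ^- n * rho ((e_ k)^-1 *: x)).
have psiE k x : psi_ k x = rint mu (fun u => psi (x - e_ k *: u) * rho u).
  exact: rint_mollify.
have supp k x : psi_ k x != 0 -> supp_box c (r + 1) (d / 2) x.
  rewrite psiE; apply: suppin_mollify => //.
    by apply: le_trans (eE k) _; rewrite ge_min lexx.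
  have : e_ k <= d / (4 * (2 * r + 1)) by apply: le_trans (eE k) _; rewrite ge_min lexx orbT.
  by rewrite ler_pdivlMr//; lra.
(* The function [t] will be the cosine or the sine, so that one exchange of integrals serves both
   transforms. *)
pose F (t : R -> R) y k := fun z : 'rV[R]_n * 'rV[R]_n => psi (z.1 - e_ k *: z.2) * rho z.2 * t (dotp z.1 y).
have mF t y k : measurable_fun setT t -> measurable_fun setT (F t y k).
  move=> mt; apply: measurable_funM; first apply: measurable_funM.
  - apply: (measurableT_comp mp); apply: measurable_rVB; first exact: measurable_fst.
    by apply: measurable_rVZ; exact: measurable_snd.
  - exact: (measurableT_comp mK measurable_snd).
  - apply: (measurableT_comp mt); apply: measurable_dotpl; first exact: measurable_fst.
    exact: measurable_cst.
have swap (t : R -> R) y k : measurable_fun setT t -> (forall a, `|t a| <= 1) ->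
   rint mu (fun x => psi_ k x * t (dotp x y)) =
   rint mu (fun u => rho u * rint mu (fun x => psi x * t (dotp x y + dotp u (e_ k *: y)))).
  move=> mt t1.
  transitivity (rint mu (fun x => rint mu (fun u => F t y k (x, u)))).
    apply: eq_rint => x; rewrite psiE mulrC -rintZ; last exact: intg_mollify.
    by apply: eq_rint => u; rewrite /F /= mulrC.
  rewrite (@rint_swap_dom _ _ _ _ _ mu mu (F t y k)
    (fun x => M * \1_[set x : 'rV[R]_n | enorm x <= r + 1] x) rho (mF t y k mt)) //.
  - apply: eq_rint => u; rewrite -rintZ; last first.
      apply: (intg_dom _ _ (intg_norm (cc_intg pc))).
        apply: measurable_funM => //; apply: (measurableT_comp mt); apply: measurable_funD => //.
        by apply: measurable_dotpl; [exact: measurable_id|exact: measurable_cst].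
      by move=> x; rewrite normrM ler_piMr.
    have := @rint_shift R n (- (e_ k *: u)) (fun x => rho u * (psi x * t (dotp x y + dotp u (e_ k *: y)))).
    move=> <-; last first.
      apply: intgZ; apply: (intg_dom _ _ (intg_norm (cc_intg pc))).
        apply: measurable_funM => //; apply: (measurableT_comp mt); apply: measurable_funD => //.
        by apply: measurable_dotpl; [exact: measurable_id|exact: measurable_cst].
      by move=> x; rewrite normrM ler_piMr.
    apply: eq_rint => x; rewrite /F /= dotpDl dotpNl dotpZl dotpZr subrK; ring.
  - by apply: intgZ; exact: intg_indic_eball.
  - move=> x u; rewrite /F /= indicE.
    have [->|Ku] := eqVneq (rho u) 0; first by rewrite !mulr0 mul0r normr0.
    have [->|Pu] := eqVneq (psi (x - e_ k *: u)) 0.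
      by rewrite !mul0r normr0 !mulr_ge0.
    rewrite mem_set ?mulr1.
      rewrite !normrM (ger0_norm (K0 u)).
      apply: (@le_trans _ _ (`|psi (x - e_ k *: u)| * rho u)).
        by apply: ler_piMr; [rewrite mulr_ge0|exact: t1].
      by rewrite ler_wpM2r.
    have e12 : e_ k <= 2^-1 by apply: le_trans (eE k) _; rewrite ge_min lexx.
    have [xr _] := hp _ Pu; have u2 := K2 _ Ku.
    rewrite /=; have := enormD (x - e_ k *: u) (e_ k *: u); rewrite subrK => /le_trans; apply.
    apply: lerD => //; rewrite enormZ gtr0_norm//.
    apply: (@le_trans _ _ (2^-1 * 2)); last by rewrite mulVf.
    by apply: ler_pM => //; [exact: ltW|exact: enorm_ge0].
have mcos := continuous_measurable_fun (@continuous_cos R).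
have msin := continuous_measurable_fun (@continuous_sin R).
have FSK y : FS rho y = 0.
  apply: rint_odd => [|x]; first exact: intg_sin.
  by rewrite Ke dotpNl sinN mulrN.
exists psi_, (fun k y => FC rho (e_ k *: y)), (r + 1), (d / 2), M; split.
- move=> k; split; last by exists (r + 1), (d / 2); split; [rewrite divr_gt0|exact: supp].
  by move=> j; apply: Ck_convol (te _ (e0 k)); exact: cc_intg.
- by split; [rewrite divr_gt0|exact: supp].
- move=> k x; rewrite psiE -[leRHS]mulr1 -K1 -rintZ//; apply: rint_norm_le.
  + exact: intg_mollify.
  + exact: intgZ.
  + by move=> u; rewrite normrM (ger0_norm (K0 u)) ler_wpM2r.
- move=> x; under eq_fun do rewrite psiE.
  have := @cvg_mollify R n rho psi x Ki pc; rewrite K1 mul1r -(cvg_shiftn N).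
  exact.
- split.
  + move=> k y; have := FC_le (e_ k *: y) Ki.
    by under eq_rint do rewrite ger0_norm//; rewrite K1.
  + move=> y; rewrite -[X in _ --> X]K1; apply: (@rint_dct _ _ _ mu _ _ rho _ _ _ _).2.
    * by move=> k; exact: intg_measurable (intg_cos _ Ki).
    * move=> u; rewrite -[X in _ --> X]mulr1; apply: cvgMl_tmp.
      have -> : (fun k => cos (dotp u (e_ k *: y))) = (fun k => cos (e_ k * dotp u y)).
        by apply/funext => k; rewrite dotpZr.
      rewrite -[X in _ --> X]cos0; apply: (cvg_comp (fun k => e_ k * dotp u y) (@cos R)); last first.
        exact: continuous_cos.
      suff : e_ k * dotp u y @[k --> \oo] --> (0 * dotp u y) by rewrite mul0r.
      apply: cvgMr_tmp.
      by rewrite (cvg_shiftn N (fun k => k.+1%:R^-1 : R)); exact: cvg_harmonic.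
    * exact: Ki.
    * by move=> k u; apply: le_trans (mulr_cos_le _ _) _; rewrite ger0_norm.
  + move=> k y; rewrite /FC (swap cos y k mcos (@cos_max R)).
    have -> : rint mu (fun x => psi x * cos (dotp x y)) * rint mu (fun x => rho x * cos (dotp x (e_ k *: y))) =
       FC psi y * FC rho (e_ k *: y) - FS psi y * FS rho (e_ k *: y).
      by rewrite FSK mulr0 subr0.
    rewrite -rintZ; last exact: intg_cos.
    rewrite -rintZ; last exact: intg_sin.
    rewrite -rintB; [|by apply: intgZ; exact: intg_cos|by apply: intgZ; exact: intg_sin].
    apply: eq_rint => u; have pi := cc_intg pc.
    have -> : rint mu (fun x => psi x * cos (dotp x y + dotp u (e_ k *: y))) =
       cos (dotp u (e_ k *: y)) * FC psi y - sin (dotp u (e_ k *: y)) * FS psi y.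
      rewrite -rintZ; last exact: intg_cos.
      rewrite -rintZ; last exact: intg_sin.
      rewrite -rintB; [|by apply: intgZ; exact: intg_cos|by apply: intgZ; exact: intg_sin].
      by apply: eq_rint => x; rewrite cosD; ring.
    ring.
  + move=> k y; rewrite /FS (swap sin y k msin (@sin_max R)).
    have -> : rint mu (fun x => psi x * sin (dotp x y)) * FC rho (e_ k *: y) =
       FS psi y * FC rho (e_ k *: y) + FC psi y * FS rho (e_ k *: y).
      by rewrite FSK mulr0 addr0.
    rewrite -rintZ; last exact: intg_cos.
    rewrite -rintZ; last exact: intg_sin.
    rewrite -rintD; [|by apply: intgZ; exact: intg_cos|by apply: intgZ; exact: intg_sin].
    apply: eq_rint => u; have pi := cc_intg pc.
    have -> : rint mu (fun x => psi x * sin (dotp x y + dotp u (e_ k *: y))) =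
       cos (dotp u (e_ k *: y)) * FS psi y + sin (dotp u (e_ k *: y)) * FC psi y.
      rewrite -rintZ; last exact: intg_sin.
      rewrite -rintZ; last exact: intg_cos.
      rewrite -rintD; [|by apply: intgZ; exact: intg_sin|by apply: intgZ; exact: intg_cos].
      by apply: eq_rint => x; rewrite sinD; ring.
    ring.
Qed.

End mollification.

(** * Identities that survive the default value of the integral *)

Section junk_integrals.
Context d (T : measurableType d) (R : realType) (mu : {measure set T -> \bar R}).
Implicit Types (f : T -> R).

(* [rint] vanishes on functions that are not integrable, so that it is
   homogeneous without any integrability hypothesis. *)
Lemma rint_nonintg f : measurable_fun setT f -> ~ intg mu f -> rint mu f = 0.
Proof.
move=> mf nf; rewrite /rint /Rintegral.
have mf' : measurable_fun setT (EFin \o f) by exact/measurable_EFinP.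
rewrite integralE.
have [fp|fp] := ltP (\int[mu]_x (EFin \o f)^\+ x)%E +oo%E; last first.
  by move: fp; rewrite leye_eq => /eqP ->; case: (\int[mu]_x (EFin \o f)^\- x)%E.
have [fn|fn] := ltP (\int[mu]_x (EFin \o f)^\- x)%E +oo%E; last first.
  by move: fn; rewrite leye_eq => /eqP ->; case: (\int[mu]_x (EFin \o f)^\+ x)%E.
exfalso; apply: nf; apply/integrableP; split=> //.
rewrite (_ : (fun x => _) = ((EFin \o f)^\+ \+ (EFin \o f)^\-)%E); last first.
  by rewrite -fune_abse.
rewrite ge0_integralD//; first exact: lte_add_pinfty.
- exact: measurable_funepos.
- exact: measurable_funeneg.
Qed.

Lemma rintZ_measurable k f : measurable_fun setT f ->
  rint mu (fun x => k * f x) = k * rint mu f.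
Proof.
move=> mf; have [fi|nf] := pselect (intg mu f); first exact: rintZ.
have [->|k0] := eqVneq k 0.
  by rewrite mul0r (@eq_rint _ _ _ mu _ (fun=> 0)) ?rint0// => x; rewrite mul0r.
rewrite (rint_nonintg mf nf) mulr0 rint_nonintg//; first exact: measurable_funM.
move=> ki; apply: nf; rewrite (_ : f = fun x => k^-1 * (k * f x)); first exact: intgZ.
by apply/funext => x; rewrite mulKf.
Qed.

End junk_integrals.

Lemma rint_shift_measurable (R : realType) n (a : 'rV[R]_n) (f : 'rV[R]_n -> R) :
  measurable_fun setT f ->
  rint (leb R n) (fun x => f (x + a)) = rint (leb R n) f.
Proof.
move=> mf; have [fi|nf] := pselect (intg (leb R n) f); first exact: rint_shift.
rewrite (rint_nonintg mf nf) rint_nonintg//.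
  by apply: measurableT_comp => //; apply: measurable_rVD => //; exact: measurable_id.
move=> /(intg_shift (- a)) h; apply: nf.
by rewrite (_ : f = fun x => f (x - a + a))//; apply/funext => x; rewrite subrK.
Qed.

(** * Multiplier relations tested on continuous functions *)

Section transfer.
Context (R : realType) (n : nat).
Notation mu := (leb R n).
Notation fct := ('rV[R]_n -> R).
Implicit Types (f g phi psi eta : fct) (x y xi : 'rV[R]_n) (c a r d : R) (N : nat).

Definition wint N f : Prop :=
  measurable_fun setT f /\ intg mu (fun x => (1 + enorm x) ^- N * f x).

Lemma weight_gt0 N x : 0 < (1 + enorm x) ^- N.
Proof. by rewrite invr_gt0 exprn_gt0// ltr_wpDr ?enorm_ge0. Qed.

Lemma fourier_decay_weight c phi N : tf c phi -> exists2 C, 0 <= C & forall xi,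
  `|FC phi xi| <= C * (1 + enorm xi) ^- N /\ `|FS phi xi| <= C * (1 + enorm xi) ^- N.
Proof.
move=> /(fourier_decay N)[C C0 h]; exists C => // xi.
have w0 : 0 < (1 + enorm xi) ^+ N by rewrite exprn_gt0// ltr_wpDr ?enorm_ge0.
by rewrite !ler_pdivlMr// !(mulrC `|_|); exact: h.
Qed.

Lemma wint_mul N f (h : fct) (C : R) : wint N f -> measurable_fun setT h ->
  (forall x, `|h x| <= C * (1 + enorm x) ^- N) -> intg mu (fun x => f x * h x).
Proof.
move=> [mf fi] mh hC; apply: (intg_dom _ _ (intgZ C (intg_norm fi))).
  exact: measurable_funM.
move=> x; rewrite !normrM mulrC (ger0_norm (ltW (weight_gt0 N x))) mulrA.
by apply: ler_wpM2r.
Qed.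

Lemma wint_FC N f c phi : wint N f -> tf c phi -> intg mu (fun x => f x * FC phi x).
Proof.
move=> fi tp; have [C _ h] := fourier_decay_weight N tp.
apply: (wint_mul fi (C := C)); first by apply: measurable_FC; exact: cc_measurable (tf_cc tp).
by move=> x; exact: (h x).1.
Qed.

Lemma wint_FS N f c phi : wint N f -> tf c phi -> intg mu (fun x => f x * FS phi x).
Proof.
move=> fi tp; have [C _ h] := fourier_decay_weight N tp.
apply: (wint_mul fi (C := C)); first by apply: measurable_FS; exact: cc_measurable (tf_cc tp).
by move=> x; exact: (h x).2.
Qed.

(* The Fourier transform of [g1 + i g2] is [reg c `^ a] times that of
   [f1 + i f2], tested on the functions supported in [region c]. *)
Definition rmult c a f1 f2 g1 g2 : Prop := forall phi, tf c phi ->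
  pairRe g1 g2 phi = pairRe f1 f2 (fun x => reg c x `^ a * phi x) /\
  pairIm g1 g2 phi = pairIm f1 f2 (fun x => reg c x `^ a * phi x).

Lemma box_bounded c r d f : 0 < d -> (forall x, region c x -> {for x, continuous f}) ->
  exists2 B, 0 <= B & forall x, supp_box c r d x -> `|f x| <= B.
Proof.
move=> d0 cf.
have /compact_bounded[M [_ MK]] : compact (f @` supp_box c r d).
  apply: continuous_compact; last exact: compact_supp_box.
  apply: continuous_in_subspaceT => x /set_mem [_ dx]; apply: cf.
  exact: lt_le_trans dx.
exists (`|M| + 1); first by rewrite addr_ge0.
move=> x hx; apply: (MK (`|M| + 1)); first by rewrite (le_lt_trans (ler_norm _))// ltrDl.
by exists x.
Qed.

Lemma cvg_mul1 (b : R) (w : nat -> R) : w k @[k --> \oo] --> (1 : R) ->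
  b * w k @[k --> \oo] --> b.
Proof.
move=> h; suff : b * w k @[k --> \oo] --> b * 1 by rewrite mulr1.
exact: cvgMl_tmp.
Qed.

(* Square-integrable functions pair continuously with the transforms, by
   Cauchy-Schwarz and Plancherel. *)
Lemma cvg_pair g (eta_ : nat -> fct) eta r B : sqintg mu g ->
  (forall k, cc (eta_ k)) -> cc eta ->
  (forall k x, eta_ k x != 0 -> enorm x <= r) -> (forall k x, `|eta_ k x| <= B) ->
  (forall x, eta_ k x @[k --> \oo] --> eta x) ->
  (rint mu (fun x => g x * FC (eta_ k) x) @[k --> \oo] --> rint mu (fun x => g x * FC eta x)) /\
  (rint mu (fun x => g x * FS (eta_ k) x) @[k --> \oo] --> rint mu (fun x => g x * FS eta x)).
Proof.
move=> gi ck ce supp bd cv.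
pose dk k x := -1 * eta x + eta_ k x.
have cd k : cc (dk k) by apply: cc_lin.
have lim : rint mu (fun x => dk k x ^+ 2) @[k --> \oo] --> (0 : R).
  rewrite -(rint0 mu); apply: (@rint_dct _ _ _ mu _ _
    (fun x => 2 * eta x ^+ 2 + 2 * B ^+ 2 * \1_[set x : 'rV[R]_n | enorm x <= r] x) _ _ _ _).2.
  - by move=> k; apply: measurable_funX; exact: cc_measurable.
  - move=> x; have : dk k x @[k --> \oo] --> (-1 * eta x + eta x).
      by apply: cvgD; [exact: cvg_cst|exact: cv].
    rewrite mulN1r addNr => h; rewrite -[X in _ --> X](mulr0 (0 : R)).
    by under eq_fun do rewrite expr2; exact: cvgM.
  - by apply: intgD; apply: intgZ; [exact: (cc_sqintg ce).2|exact: intg_indic_eball].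
  - move=> k x; rewrite ger0_norm ?sqr_ge0// /dk mulN1r.
    have h : eta_ k x ^+ 2 <= B ^+ 2 * \1_[set x : 'rV[R]_n | enorm x <= r] x.
      rewrite indicE; have [->|ex] := eqVneq (eta_ k x) 0.
        by rewrite expr0n mulr_ge0// sqr_ge0.
      rewrite mem_set ?mulr1; last exact: supp ex.
      rewrite -(real_normK (num_real (eta_ k x))); apply: lerXn2r; rewrite ?nnegrE//.
      exact: le_trans (bd k x).
    move: h; rewrite -mulrA; move: (B ^+ 2 * _) => b h.
    by have := sqr_ge0 (eta x + eta_ k x); nra.
have [G2 G20 bound] : exists2 G2, 0 <= G2 & forall k F, F = @FC R n \/ F = @FS R n ->
   (rint mu (fun x => g x * F (dk k) x)) ^+ 2 <= G2 * rint mu (fun x => dk k x ^+ 2).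
  exists (rint mu (fun x => g x ^+ 2) * plancherelC R n).
    by rewrite mulr_ge0 ?(ltW (plancherelC_gt0 _ _))// rint_ge0// => x; exact: sqr_ge0.
  move=> k F hF; have [Pi PE] := plancherel (cd k).
  have Fs : sqintg mu (F (dk k)) by case: hF => ->; [exact: sqintg_FC|exact: sqintg_FS].
  apply: le_trans (cauchy_schwarz gi Fs) _; rewrite -mulrA -PE ler_wpM2l//.
    by apply: rint_ge0 => x; exact: sqr_ge0.
  apply: rint_le => //; first exact: Fs.2.
  by move=> x; rewrite /FP; case: hF => ->; rewrite ?lerDl ?lerDr sqr_ge0.
have concl F : F = @FC R n \/ F = @FS R n ->
    rint mu (fun x => g x * F (eta_ k) x) @[k --> \oo] --> rint mu (fun x => g x * F eta x).
  move=> hF.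
  have Fs psi : cc psi -> sqintg mu (F psi).
    by move=> cp; case: hF => ->; [exact: sqintg_FC|exact: sqintg_FS].
  have Fl k : rint mu (fun x => g x * F (dk k) x) =
      rint mu (fun x => g x * F (eta_ k) x) - rint mu (fun x => g x * F eta x).
    rewrite -rintB; [|exact: sqintgM (Fs _ (ck k))|exact: sqintgM (Fs _ ce)].
    apply: eq_rint => x; rewrite /dk.
    have -> : F (fun x => -1 * eta x + eta_ k x) x = -1 * F eta x + F (eta_ k) x.
      by case: hF => ->; rewrite ?FC_lin ?FS_lin//; exact: cc_intg.
    ring.
  apply/cvgrPdist_lt => e e0.
  have e20 : 0 < e ^+ 2 / (G2 + 1) by rewrite divr_gt0 ?exprn_gt0 ?ltr_wpDl.
  move: lim => /cvgrPdist_lt/(_ _ e20); apply: filterS => k.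
  rewrite sub0r normrN ger0_norm; last by apply: rint_ge0 => x; exact: sqr_ge0.
  rewrite ltr_pdivlMr ?ltr_wpDl// distrC -Fl => hk.
  rewrite -(@ltr_pXn2r _ 2)// ?nnegrE ?(ltW e0)// real_normK ?num_real//.
  apply: le_lt_trans (bound k F hF) _; apply: le_lt_trans hk.
  rewrite mulrC ler_wpM2l// ?lerDl//.
  by apply: rint_ge0 => x; exact: sqr_ge0.
by split; apply: concl; [left|right].
Qed.

Lemma powRmulN (t a b : R) : 0 < t -> t `^ a * (t `^ (- a) * b) = b.
Proof. by move=> t0; rewrite powRN mulVKf// gt_eqF// powR_gt0. Qed.

Lemma suppin_region c phi x : suppin c phi -> phi x != 0 -> region c x.
Proof. by move=> [r [d [d0 h]]] /h [_]; exact: lt_le_trans. Qed.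

(* The pairing is extended from test functions to merely continuous ones. *)
Lemma rmult_extend (chi : R -> R) c a f1 f2 g1 g2 psi : cutoff chi ->
  sqintg mu g1 -> sqintg mu g2 -> measurable_fun setT f1 -> measurable_fun setT f2 ->
  rmult c a f1 f2 g1 g2 -> continuous psi -> suppin c psi ->
  (forall f, f = f1 \/ f = f2 -> intg mu (fun x => f x * FC psi x) /\ intg mu (fun x => f x * FS psi x)) ->
  pairRe g1 g2 (fun x => reg c x `^ (- a) * psi x) = pairRe f1 f2 psi /\
  pairIm g1 g2 (fun x => reg c x `^ (- a) * psi x) = pairIm f1 f2 psi.
Proof.
move=> hchi g1i g2i mf1 mf2 hm cpsi spsi fi.
have [psi_ [w_ [r [d [M [tk [d0 sk] Mk cvk [w1 wc wC wS]]]]]]] := mollification hchi cpsi spsi.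
have [B B0 hB] := box_bounded r d0 (@continuous_reg_powR R n c (- a)).
have M0 : 0 <= M by exact: le_trans (normr_ge0 _) (Mk 0%N 0).
pose eta_ k x := reg c x `^ (- a) * psi_ k x.
pose eta x := reg c x `^ (- a) * psi x.
have tek k : tf c (eta_ k) by exact: tf_reg_powR.
have ce : cc eta.
  apply: suppin_cc; last by apply: suppin_sub spsi _ => x; rewrite /eta => ->; rewrite mulr0.
  by apply: continuous_supp_mul spsi => //; exact: continuous_reg_powR.
have sek k x : eta_ k x != 0 -> supp_box c r d x.
  by rewrite mulf_eq0 negb_or => /andP[_]; exact: sk.
have cvG g : sqintg mu g ->
  (rint mu (fun x => g x * FC (eta_ k) x) @[k --> \oo] --> rint mu (fun x => g x * FC eta x)) /\
  (rint mu (fun x => g x * FS (eta_ k) x) @[k --> \oo] --> rint mu (fun x => g x * FS eta x)).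
  move=> gi; apply: (@cvg_pair g eta_ eta r (B * M)) => //.
  - by move=> k; exact: tf_cc (tek k).
  - by move=> k x /sek [].
  - move=> k x; have [->|/sek hx] := eqVneq (eta_ k x) 0; first by rewrite normr0 mulr_ge0.
    by rewrite normrM; apply: ler_pM => //; exact: hB.
  - by move=> x; apply: cvgMl_tmp; exact: cvk.
have cvF f : f = f1 \/ f = f2 ->
  (rint mu (fun x => f x * FC (psi_ k) x) @[k --> \oo] --> rint mu (fun x => f x * FC psi x)) /\
  (rint mu (fun x => f x * FS (psi_ k) x) @[k --> \oo] --> rint mu (fun x => f x * FS psi x)).
  move=> hf; have mf : measurable_fun setT f by case: hf => ->.
  have [Ci Si] := fi f hf.
  have mpk k := cc_measurable (tf_cc (tk k)).
  split.
  (* The majorant is the limit integrand itself, because mollification multiplies the transform by a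
     factor of modulus at most 1. *)
  - apply: (@rint_dct _ _ _ mu _ _ (fun x => `|f x * FC psi x|) _ _ _ _).2.
    + by move=> k; apply: measurable_funM => //; exact: measurable_FC.
    + move=> x; apply: cvgMl_tmp; under eq_fun do rewrite wC.
      exact: cvg_mul1.
    + exact: intg_norm.
    + by move=> k x; rewrite wC !normrM ler_wpM2l// ler_piMr.
  - apply: (@rint_dct _ _ _ mu _ _ (fun x => `|f x * FS psi x|) _ _ _ _).2.
    + by move=> k; apply: measurable_funM => //; exact: measurable_FS.
    + move=> x; apply: cvgMl_tmp; under eq_fun do rewrite wS.
      exact: cvg_mul1.
    + exact: intg_norm.
    + by move=> k x; rewrite wS !normrM ler_wpM2l// ler_piMr.
have eqk k : pairRe g1 g2 (eta_ k) = pairRe f1 f2 (psi_ k) /\ pairIm g1 g2 (eta_ k) = pairIm f1 f2 (psi_ k).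
  have [hr hi] := hm _ (tek k).
  (* The two powers cancel where [reg c] is positive, hence on the support of [psi_ k]. *)
  have e : (fun x => reg c x `^ a * eta_ k x) = psi_ k.
    apply/funext => x; rewrite /eta_.
    have [->|px] := eqVneq (psi_ k x) 0; first by rewrite !mulr0.
    by apply: powRmulN; exact: suppin_region (tk k).2 px.
  by rewrite hr hi e; split; reflexivity.
have [c1C c1S] := cvG _ g1i; have [c2C c2S] := cvG _ g2i.
have [d1C d1S] := cvF f1 (or_introl erefl); have [d2C d2S] := cvF f2 (or_intror erefl).
have u (s t : nat -> R) (p q : R) : s @ \oo --> p -> t @ \oo --> q -> s = t -> p = q.
  move=> sp tq st; rewrite st in sp; exact: (cvg_unique (@Rhausdorff R) sp tq).
split.
- apply: (u _ _ _ _ (cvgD c1C c2S) (cvgD d1C d2S)).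
  by apply/funext => k; exact: (eqk k).1.
- apply: (u _ _ _ _ (cvgB c2C c1S) (cvgB d2C d1S)).
  by apply/funext => k; exact: (eqk k).2.
Qed.

End transfer.

(** * Convolution as a Fourier multiplier *)

Section convolution_multiplier.
Context (R : realType) (n : nat).
Notation mu := (leb R n).
Notation fct := ('rV[R]_n -> R).
Implicit Types (f g phi psi eta : fct) (x y u xi : 'rV[R]_n) (c a r d : R) (N : nat).

Definition rconv (k f : fct) x : R := rint mu (fun y => k (x - y) * f y).

Variables (k f1 f2 : fct) (L : nat).
Hypotheses (mk : measurable_fun setT k).

(** The only link required between kernel and function: it makes [rconv k f] of polynomial growth in
    the mean and allows Fubini's theorem against functions decaying like [(1 + |x|)^-L]. It is
    checked differently for the two kernels. *)
Definition conv_fin f : Prop :=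
  (\int[mu]_x \int[mu]_y `|(1 + enorm x) ^- L * (k (x - y) * f y)|%:E < +oo)%E.

Lemma measurable_conv_kernel f (h : fct) : measurable_fun setT f -> measurable_fun setT h ->
  measurable_fun setT (fun z : 'rV[R]_n * 'rV[R]_n => h z.1 * (k (z.1 - z.2) * f z.2)).
Proof.
move=> mf mh; apply: measurable_funM; first exact: (measurableT_comp mh measurable_fst).
apply: measurable_funM; last exact: (measurableT_comp mf measurable_snd).
by apply: (measurableT_comp mk); apply: measurable_rVB; [exact: measurable_fst|exact: measurable_snd].
Qed.

Lemma measurable_conv_slice f x : measurable_fun setT f ->
  measurable_fun setT (fun y => k (x - y) * f y).
Proof.
move=> mf; apply: measurable_funM => //; apply: (measurableT_comp mk).
by apply: measurable_rVB; [exact: measurable_cst|exact: measurable_id].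
Qed.

Lemma measurable_rconv f : measurable_fun setT f -> measurable_fun setT (rconv k f).
Proof.
move=> mf; apply: (@measurable_rint _ _ _ _ _ mu (fun z : 'rV[R]_n * 'rV[R]_n => k (z.1 - z.2) * f z.2)).
have := measurable_conv_kernel mf (@measurable_cst _ _ _ _ setT (1 : R)).
by under eq_fun do rewrite mul1r.
Qed.

Lemma wint_rconv f : measurable_fun setT f -> conv_fin f -> wint L (rconv k f).
Proof.
move=> mf hf; split; first exact: measurable_rconv.
have mF := measurable_conv_kernel mf (@measurable_weight R n L).
have := intg_rint mF hf; rewrite /intg; congr (mu.-integrable _ _).
apply/funext => x /=; congr EFin.
by rewrite rintZ_measurable//; exact: measurable_conv_slice.
Qed.

Lemma conv_fin_dom f (h : fct) C : measurable_fun setT f -> measurable_fun setT h ->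
  (forall x, `|h x| <= C * (1 + enorm x) ^- L) -> conv_fin f ->
  (\int[mu]_x \int[mu]_y `|h x * (k (x - y) * f y)|%:E < +oo)%E.
Proof.
move=> mf mh hC hf.
have C0 : 0 <= C.
  have := le_trans (normr_ge0 _) (hC 0); rewrite pmulr_lge0//; exact: weight_gt0.
have mw := @measurable_weight R n L.
have mG (h' : fct) : measurable_fun setT h' -> measurable_fun setT
    (fun z : 'rV[R]_n * 'rV[R]_n => `|h' z.1 * (k (z.1 - z.2) * f z.2)|%:E).
  by move=> mh'; apply/measurable_EFinP; apply: measurableT_comp => //; exact: measurable_conv_kernel.
have mGx (h' : fct) x : measurable_fun setT (fun y => `|h' x * (k (x - y) * f y)|%:E).
  apply/measurable_EFinP; apply: measurableT_comp => //; apply: measurable_funM => //.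
  exact: measurable_conv_slice.
apply: (@le_lt_trans _ _ (C%:E * \int[mu]_x \int[mu]_y `|(1 + enorm x) ^- L * (k (x - y) * f y)|%:E)%E).
  rewrite -ge0_integralZl//.
  - apply: ge0_le_integral => //.
    + by move=> x _; apply: integral_ge0.
    + by have := @measurable_tonelli _ _ _ _ _ mu _ (mG h mh); apply => z; rewrite lee_fin.
    + apply: measurable_funeM.
      by have := @measurable_tonelli _ _ _ _ _ mu _ (mG _ mw); apply => z; rewrite lee_fin.
    + move=> x _; rewrite -ge0_integralZl//; last exact: (mGx (fun x => (1 + enorm x) ^- L)).
      apply: ge0_le_integral => //.
      * by apply: measurable_funeM; exact: (mGx (fun x => (1 + enorm x) ^- L)).
      * move=> y _; rewrite -EFinM lee_fin normrM [X in _ <= _ * X]normrM mulrA.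
        by rewrite ler_wpM2r// (ger0_norm (ltW (weight_gt0 L x))).
  - by have := @measurable_tonelli _ _ _ _ _ mu _ (mG _ mw); apply => z; rewrite lee_fin.
  - by move=> x _; apply: integral_ge0.
by rewrite lte_mul_pinfty// ?lee_fin.
Qed.

(** The convolution is transposed onto [h]. The first conclusion matters as much as the identity: it
    supplies the absolute convergence that [rmult_extend] assumes. *)
Lemma rint_rconv f (h : fct) C : measurable_fun setT f -> measurable_fun setT h ->
  (forall x, `|h x| <= C * (1 + enorm x) ^- L) -> conv_fin f ->
  intg mu (fun y => f y * rint mu (fun u => k u * h (u + y))) /\
  rint mu (fun x => rconv k f x * h x) =
  rint mu (fun y => f y * rint mu (fun u => k u * h (u + y))).
Proof.
move=> mf mh hC hf; have hfin := conv_fin_dom mf mh hC hf.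
pose F := fun z : 'rV[R]_n * 'rV[R]_n => h z.1 * (k (z.1 - z.2) * f z.2).
have mF : measurable_fun setT F by exact: measurable_conv_kernel.
have inner y : rint mu (fun x => F (x, y)) = f y * rint mu (fun u => k u * h (u + y)).
  have m1 : measurable_fun setT (fun u => k u * h (u + y)).
    apply: measurable_funM => //; apply: (measurableT_comp mh).
    by apply: measurable_rVD; [exact: measurable_id|exact: measurable_cst].
  (* The substitution [x = u + y]. For a given [y] the integral may diverge, hence the versions that
     assume measurability alone. *)
  rewrite -(rint_shift_measurable (- y) m1) -rintZ_measurable.
    by apply: eq_rint => x; rewrite /F /= subrK; ring.
  apply: measurable_funM.
    by apply: (measurableT_comp mk); apply: measurable_rVD; [exact: measurable_id|exact: measurable_cst].
  by under eq_fun do rewrite subrK.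
split.
  under eq_fun do rewrite -inner.
  apply: (@intg_rint _ _ _ _ _ mu mu (fun z => F (z.2, z.1))).
    apply: (measurableT_comp mF); apply/measurable_fun_pairP; split.
      exact: measurable_snd.
    exact: measurable_fst.
  rewrite -(@tonelli_swap _ _ _ _ _ mu mu (fun z => `|F z|%:E))//.
  by apply/measurable_EFinP; apply: measurableT_comp.
transitivity (rint mu (fun x => rint mu (fun y => F (x, y)))).
  apply: eq_rint => x; rewrite mulrC -rintZ_measurable//.
  exact: measurable_conv_slice.
rewrite rint_swap//; apply: eq_rint => y; exact: inner.
Qed.

Variables (chi : R -> R) (c a1 a2 B : R) (m : fct) (g1 g2 : fct).
Hypotheses (hchi : cutoff chi)
  (mf1 : measurable_fun setT f1) (mf2 : measurable_fun setT f2)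
  (h1 : conv_fin f1) (h2 : conv_fin f2)
  (cm : forall x, region c x -> {for x, continuous m})
  (mC : forall psi, tf c psi -> forall y,
     FC (fun x => m x * psi x) y = rint mu (fun u => k u * FS psi (u + y)))
  (mS : forall psi, tf c psi -> forall y,
     FS (fun x => m x * psi x) y = - rint mu (fun u => k u * FC psi (u + y)))
  (mB : forall x, region c x -> `|m x| * reg c x `^ a2 <= B * reg c x `^ a1)
  (g1i : sqintg mu g1) (g2i : sqintg mu g2) (fg : rmult c a1 f1 f2 g1 g2).

(* The symbol of the convolution with [k] is [-i m], so that [- i G0] is the
   required function when [G0 = (m reg^a2 / reg^a1)(D) g]. *)
Theorem convolution_multiplier : exists G1 G2,
  [/\ sqintg mu G1, sqintg mu G2,
     rint mu (fun xi => G1 xi ^+ 2) + rint mu (fun xi => G2 xi ^+ 2) <=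
     B ^+ 2 * (rint mu (fun xi => g1 xi ^+ 2) + rint mu (fun xi => g2 xi ^+ 2)) &
     rmult c a2 (rconv k f1) (rconv k f2) G1 G2].
Proof.
(* The symbol that takes [reg^a1 f] to [m reg^a2 f]; by [mB] it is bounded by [B] on the region. *)
pose M x := reg c x `^ (- a1) * (m x * reg c x `^ a2).
have cM x : region c x -> {for x, continuous M}.
  move=> rx; apply: continuous_at_mul; first exact: continuous_reg_powR.
  apply: continuous_at_mul; first exact: cm.
  exact: continuous_reg_powR.
have MB phi x : tf c phi -> `|M x * phi x| <= B * `|phi x|.
  move=> tp; rewrite normrM; have [->|px] := eqVneq (phi x) 0; first by rewrite normr0 !mulr0.
  have rx := suppin_region tp.2 px; have q0 : 0 < reg c x `^ a1 by exact: powR_gt0.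
  apply: ler_wpM2r => //; rewrite /M powRN !normrM normfV (gtr0_norm q0).
  rewrite (ger0_norm (powR_ge0 _ _)) mulrC ler_pdivrMr//.
  exact: mB.
have spM phi : tf c phi -> cc (fun x => M x * phi x).
  move=> tp; apply: suppin_cc.
    apply: continuous_supp_mul tp.2; first exact: cM.
    exact: Ck_continuous (tp.1 0%N).
  by apply: suppin_sub tp.2 _ => x ->; rewrite mulr0.
have [G1 [G2 [G1i G2i GB GM]]] := @multiplier_exists R n (tf c) M B (@tf0 R n c)
  (fun a phi psi => @tf_lin R n c a phi psi) (fun phi => @tf_cc R n c phi) spM MB g1 g2 g1i g2i.
(* Multiplication by [-i]: [- i (G1 + i G2) = G2 - i G1]. *)
exists G2, (fun x => - G1 x).
have sqN : (fun xi => (- G1 xi) ^+ 2) = (fun xi => G1 xi ^+ 2).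
  by apply/funext => x; rewrite sqrrN.
split.
- exact: G2i.
- have := sqintgZ (-1) G1i; by under eq_fun do rewrite mulN1r.
- by rewrite sqN addrC.
move=> phi tp.
pose psi x := reg c x `^ a2 * phi x; have tpsi : tf c psi by exact: tf_reg_powR.
have [CF CF0 dec] := fourier_decay_weight L tpsi.
have mpsi := cc_measurable (tf_cc tpsi).
have decC x := (dec x).1; have decS x := (dec x).2.
have mFC := measurable_FC mpsi; have mFS := measurable_FS mpsi.
have [i1C e1C] := rint_rconv mf1 mFC decC h1.
have [i1S e1S] := rint_rconv mf1 mFS decS h1.
have [i2C e2C] := rint_rconv mf2 mFC decC h2.
have [i2S e2S] := rint_rconv mf2 mFS decS h2.
pose mp x := m x * psi x.
have FCm y : FC mp y = rint mu (fun u => k u * FS psi (u + y)) := mC tpsi y.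
have FSm y : FS mp y = - rint mu (fun u => k u * FC psi (u + y)) := mS tpsi y.
have eC f : (fun y => f y * rint mu (fun u => k u * FS psi (u + y))) = (fun y => f y * FC mp y).
  by apply/funext => y; rewrite FCm.
have eS f : (fun y => f y * rint mu (fun u => k u * FC psi (u + y))) = (fun y => - 1 * (f y * FS mp y)).
  by apply/funext => y; rewrite FSm mulrN mulN1r opprK.
rewrite eS in i1C e1C; rewrite eS in i2C e2C; rewrite eC in i1S e1S; rewrite eC in i2S e2S.
have iS f : intg mu (fun y => -1 * (f y * FS mp y)) -> intg mu (fun y => f y * FS mp y).
  move=> /(intgZ (-1)); by under eq_fun do rewrite !mulN1r opprK.
have cmp : continuous mp.
  apply: continuous_supp_mul tpsi.2; first exact: cm.
  exact: Ck_continuous (tpsi.1 0%N).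
have smp : suppin c mp by apply: suppin_sub tpsi.2 _ => x; rewrite /mp => ->; rewrite mulr0.
(* No decay is known for the transform of the merely continuous [m psi]; its absolute convergence
   against [f] is the one found in [rint_rconv]. *)
have [|eR eI] := rmult_extend hchi g1i g2i mf1 mf2 fg cmp smp.
  move=> f [->|->].
    by split; [exact: i1S|exact: iS].
  by split; [exact: i2S|exact: iS].
have Mphi : (fun x => reg c x `^ (- a1) * mp x) = (fun x => M x * phi x).
  by apply/funext => x; rewrite /mp /psi /M; ring.
have [gR gI] := GM phi tp; rewrite -Mphi in gR gI.
split.
- have -> : pairRe G2 (fun x => - G1 x) phi = pairIm G1 G2 phi.
    rewrite /pairRe /pairIm; congr (_ + _); rewrite -rintN; last first.
      exact: sqintgM G1i (sqintg_FS (tf_cc tp)).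
    by apply: eq_rint => x; rewrite mulNr.
  rewrite gI eI -/psi /pairRe /pairIm e1C e2S rintZ; last exact: iS.
  rewrite mulN1r; exact: addrC.
- have -> : pairIm G2 (fun x => - G1 x) phi = - pairRe G1 G2 phi.
    rewrite /pairRe /pairIm opprD; congr (_ - _); rewrite -rintN; last first.
      exact: sqintgM G1i (sqintg_FC (tf_cc tp)).
    by apply: eq_rint => x; rewrite mulNr.
  rewrite gR eR -/psi /pairRe /pairIm e2C e1S rintZ; last exact: iS.
  rewrite mulN1r opprD; exact: addrC.
Qed.

End convolution_multiplier.

(** * Elementary inequalities *)

Section real_lemmas.
Context (R : realType).
Implicit Types (a b p r s t : R).

Lemma deriv_lipschitz (f df : R -> R) M : (forall t, is_derive t (1 : R) f (df t)) ->
  (forall t, `|df t| <= M) -> forall a b, `|f a - f b| <= M * `|a - b|.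
Proof.
move=> dfd dfM; have cf : continuous f.
  by move=> t; apply/differentiable_continuous/derivable1_diffP; exact: ex_derive.
suff h a b : a <= b -> `|f b - f a| <= M * `|b - a|.
  move=> a b; have [ab|/ltW ba] := leP a b; last exact: h.
  by rewrite distrC (distrC a); exact: h.
move=> ab; have [t _ ->] := MVT_segment ab (fun t _ => dfd t) (continuous_subspaceT cf).
by rewrite normrM ler_wpM2r.
Qed.

Lemma sin_le_id t : `|sin t| <= `|t|.
Proof.
have := @deriv_lipschitz (@sin R) (@cos R) 1 (fun t => is_derive_sin t) (@cos_max R) t 0.
by rewrite sin0 !subr0 mul1r.
Qed.

(** With [b = a (1 + u)], one has [(1 + u)^(-p) = exp(- p ln(1 + u)) >= 1 - p u]. *)
Lemma powRN_diff a b p : 0 < a -> a <= b -> 0 <= p ->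
  0 <= a `^ (- p) - b `^ (- p) <= p * ((b - a) / a) * a `^ (- p).
Proof.
move=> a0 ab p0; have b0 : 0 < b by exact: lt_le_trans ab.
have ba0 : 0 < b / a by rewrite divr_gt0.
have bE : b `^ (- p) = a `^ (- p) * (b / a) `^ (- p).
  by rewrite -powRM ?ltW// mulrCA mulfV ?mulr1// gt_eqF.
have l1 : 1 - p * ((b - a) / a) <= (b / a) `^ (- p).
  rewrite {1}/powR gt_eqF// mulNr; apply: le_trans (expR_ge1Dx _); rewrite lerD2l lerN2.
  apply: ler_wpM2l => //; have -> : b / a = 1 + (b - a) / a.
    by rewrite mulrBl mulfV ?gt_eqF// addrC subrK.
  have u0 : 0 <= (b - a) / a by rewrite divr_ge0 ?subr_ge0// ltW.
  by apply: le_ln1Dx; exact: lt_le_trans (ltrN10 _) u0.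
have l2 : (b / a) `^ (- p) <= 1.
  rewrite powRN invf_le1 ?powR_gt0//.
  have := @ler_powR _ (b / a); rewrite ler_pdivlMr// mul1r => /(_ ab _ _ p0).
  by rewrite powRr0.
have A0 : 0 < a `^ (- p) by exact: powR_gt0.
rewrite bE; apply/andP; split.
  by rewrite subr_ge0 -[leRHS]mulr1 ler_pM2l.
rewrite -[X in X - _]mulr1 -mulrBr mulrC ler_pM2r//; lra.
Qed.

(** From [ln x <= x] at [x = 1 / b]. This bound and the next keep the constants uniform as [b] tends
    to 0. *)
Lemma powR_selfN_le b : 0 < b -> b `^ (- b) <= expR 1.
Proof.
move=> b0; rewrite /powR gt_eqF// ler_expR mulNr -mulrN -lnV ?posrE//.
apply: le_trans (_ : b * b^-1 <= 1); last by rewrite mulfV ?gt_eqF.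
by rewrite ler_wpM2l ?ltW// ln_sublinear// invr_gt0.
Qed.

Lemma powR_div_self_le b : 0 < b -> (2 / b) `^ b <= expR 2.
Proof.
move=> b0; have b2 : 0 < 2 / b by rewrite divr_gt0.
rewrite /powR gt_eqF// ler_expR.
apply: le_trans (_ : b * (2 / b) <= 2); last by rewrite mulrCA mulfV ?gt_eqF// mulr1.
by rewrite ler_wpM2l ?ltW// ln_sublinear.
Qed.

End real_lemmas.

(** * Radial kernels and the half-period translation *)

Section radial_kernels.
Context (R : realType) (n : nat).
Notation mu := (leb R n).
Implicit Types (x y z xi : 'rV[R]_n) (i : 'I_n) (h : R -> R) (p r s : R).

(** The Lipschitz condition is relative to the radius and so invariant under dilation: [chi(lam r)]
    satisfies it with a constant independent of [lam]. The constants 4 and 8 allow for the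
    difference of two such cutoffs. *)
Definition profile h : Prop := [/\ measurable_fun [set: R] h,
  forall r, 0 <= r -> `|h r| <= 4 &
  forall r s, 0 < r -> r <= s -> `|h r - h s| <= 8 * ((s - r) / r)].

Definition rker h p i x : R := h (enorm x) * ((enorm x `^ p)^-1 * x ord0 i).

Lemma measurable_rker h p i : measurable_fun [set: R] h -> measurable_fun setT (rker h p i).
Proof.
move=> mh; have mid : measurable_fun setT (fun x : 'rV[R]_n => x) by exact: measurable_id.
apply: measurable_funM; first exact: (measurableT_comp mh (measurable_enorm mid)).
apply: measurable_funM; last exact: measurable_coord.
by under eq_fun do rewrite -powRN; exact: measurable_enorm_powR.
Qed.

Lemma rker_odd h p i x : rker h p i (- x) = - rker h p i x.
Proof. by rewrite /rker enormN mxE !mulrN. Qed.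

Lemma rker0 h p i : rker h p i 0 = 0.
Proof. by rewrite /rker mxE !mulr0. Qed.

Lemma rker_le h p i x : `|rker h p i x| <= `|h (enorm x)| * enorm x `^ (1 - p).
Proof.
have [->|x0] := eqVneq x 0.
  by rewrite rker0 normr0 mulr_ge0// powR_ge0.
have e0 : 0 < enorm x by rewrite enorm_gt0.
rewrite /rker !normrM ler_wpM2l// (ger0_norm (_ : 0 <= (enorm x `^ p)^-1)) ?invr_ge0 ?powR_ge0//.
rewrite powRB; last by rewrite (gt_eqF e0) implybT.
rewrite powRr1 ?enorm_ge0// mulrC.
by rewrite ler_wpM2r ?invr_ge0 ?powR_ge0// coord_le_enorm.
Qed.

(** The summands stem from the variation of the profile, [8 * 2 * 3/2], of the power, [4 * 2 * 3/2],
    and of the coordinate, 4. The factor [2^P] is the cost of replacing the radius by one at least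
    half as large. *)
Definition diffC (P : R) : R := 24 * 2 `^ P + 12 * P * 2 `^ P + 4.

(** The difference of the products is telescoped into three terms, each varying one factor. As
    [|z| <= |x| / 2], the radii stay between [|x| / 2] and [3 |x| / 2]. The gain over the size
    [|x|^(1 - p)] of the kernel is [|z| / |x|]. *)
Lemma rker_diff h p P i x z : profile h -> 0 < p <= P -> x != 0 ->
  enorm z *+ 2 <= enorm x ->
  `|rker h p i x - rker h p i (x + z)| <= diffC P * (enorm z * enorm x `^ (- p)).
Proof.
move=> [_ hb hl] /andP[p0 pP] x0 zx.
have r0 : 0 < enorm x by rewrite enorm_gt0.
have := ler_enorm_dist (x + z) x; rewrite [x + z - x]addrC addKr.
have := coord_le_enorm (x + z) i; have := coord_le_enorm z i; rewrite /rker mxE.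
have z0 := enorm_ge0 z.
move: zx z0 r0 (enorm_ge0 (x + z)).
move: (enorm x) (enorm (x + z)) (enorm z) (x ord0 i) (z ord0 i) => r r' w xi zi.
rewrite mulr2n => wr w0 r0 r'0 ziw xzi rr'.
have [rr1 rr2] : r - w <= r' /\ r' <= r + w.
  by move: rr'; rewrite ler_norml => /andP[]; split; lra.
have r'r : r / 2 <= r' by lra.
have r'p : 0 < r' by apply: lt_le_trans r'r; rewrite divr_gt0.
(* The one-sided estimates are relative to the smaller radius, and either of the two may be the
   smaller. *)
pose m := Num.min r r'; have m0 : 0 < m by rewrite lt_min r0.
have mr : r / 2 <= m by rewrite le_min r'r andbT; lra.
pose q := r `^ (- p); pose q' := r' `^ (- p).
have q0 : 0 < q by exact: powR_gt0.
have q'0 : 0 < q' by exact: powR_gt0.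
have P2 : 1 <= 2 `^ P.
  have := @ler_powR R 2 (ler1n _ 2) 0 P; rewrite powRr0; apply.
  exact: le_trans (ltW p0) pP.
have mq s : r / 2 <= s -> s `^ (- p) <= 2 `^ P * q.
  move=> rs; have s0 : 0 < s by apply: lt_le_trans rs; rewrite divr_gt0.
  rewrite /q !powRN -[leRHS]invrK lef_pV2 ?posrE ?invr_gt0 ?mulr_gt0 ?invr_gt0 ?powR_gt0//.
  rewrite invfM invrK ler_pdivrMl ?powR_gt0//.
  have h1 : r `^ p <= (2 * s) `^ p by apply: ge0_ler_powR; rewrite ?nnegrE ?(ltW p0)//; lra.
  apply: le_trans h1 _; rewrite (powRM _ (ler0n R 2) (ltW s0)) ler_pM2r ?powR_gt0//.
  by apply: ler_powR; rewrite ?ler1n.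
have q'q : q' <= 2 `^ P * q by exact: mq.
have mqq : m `^ (- p) <= 2 `^ P * q by exact: mq.
have dm : `|r - r'| / m <= 2 * w / r.
  have rw : `|r - r'| <= w by rewrite distrC.
  apply: le_trans (_ : w / (r / 2) <= _); last by rewrite le_eqVlt; apply/orP; left; apply/eqP; field; rewrite gt_eqF.
  by apply: ler_pM => //; rewrite ?invr_ge0 ?(ltW m0)// lef_pV2 ?posrE ?divr_gt0.
have T1 : `|h r - h r'| <= 8 * (2 * w / r).
  apply: le_trans (_ : 8 * (`|r - r'| / m) <= _); last by rewrite ler_wpM2l.
  have [le|/ltW le] := leP r r'.
    rewrite /m min_l// (distrC r) (ger0_norm (_ : 0 <= r' - r)) ?subr_ge0//; exact: hl.
  rewrite /m min_r// (distrC (h r)) (ger0_norm (_ : 0 <= r - r')) ?subr_ge0//; exact: hl.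
have T2 : `|q - q'| <= P * (2 * w / r) * (2 `^ P * q).
  apply: le_trans (_ : p * (`|r - r'| / m) * m `^ (- p) <= _); last first.
    have d0 : 0 <= `|r - r'| / m by rewrite divr_ge0 ?normr_ge0 ?(ltW m0).
    apply: ler_pM; [exact: mulr_ge0 (ltW p0) d0|exact: powR_ge0| |exact: mqq].
    by apply: ler_pM; [exact: ltW|exact: d0|exact: pP|exact: dm].
  have [le|/ltW le] := leP r r'.
    have /andP[d1 d2] := powRN_diff r0 le (ltW p0).
    by rewrite /m min_l// (ger0_norm d1) (distrC r) (ger0_norm (_ : 0 <= r' - r)) ?subr_ge0.
  have /andP[d1 d2] := powRN_diff r'p le (ltW p0).
  by rewrite /m min_r// (distrC q) (ger0_norm d1) (ger0_norm (_ : 0 <= r - r')) ?subr_ge0.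
have xz32 : `|xi + zi| <= 3 / 2 * r by lra.
rewrite -!powRN -/q -/q'.
have -> : h r * (q * xi) - h r' * (q' * (xi + zi)) =
  (h r - h r') * (q' * (xi + zi)) + h r * ((q - q') * (xi + zi)) - h r * (q * zi) by ring.
have hr4 := hb r (ltW r0).
apply: le_trans (ler_normB _ _) _; apply: le_trans (lerD (ler_normD _ _) (lexx _)) _.
rewrite !normrM (gtr0_norm q0) (gtr0_norm q'0).
have B1 : `|h r - h r'| * (q' * `|xi + zi|) <= 8 * (2 * w / r) * (2 `^ P * q * (3 / 2 * r)).
  by apply: ler_pM => //; [rewrite mulr_ge0// ltW|apply: ler_pM => //; exact: ltW].
have B2 : `|h r| * (`|q - q'| * `|xi + zi|) <= 4 * (P * (2 * w / r) * (2 `^ P * q) * (3 / 2 * r)).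
  by apply: ler_pM => //; exact: ler_pM.
have B3 : `|h r| * (q * `|zi|) <= 4 * (q * w).
  by apply: ler_pM => //; [rewrite mulr_ge0// ltW|rewrite ler_wpM2l// ltW].
have e1 : 8 * (2 * w / r) * (2 `^ P * q * (3 / 2 * r)) = 24 * 2 `^ P * (w * q).
  by field; rewrite gt_eqF.
have e2 : 4 * (P * (2 * w / r) * (2 `^ P * q) * (3 / 2 * r)) = 12 * P * 2 `^ P * (w * q).
  by field; rewrite gt_eqF.
have -> : diffC P * (w * q) = 24 * 2 `^ P * (w * q) + 12 * P * 2 `^ P * (w * q) + 4 * (q * w).
  by rewrite /diffC; ring.
rewrite -e1 -e2.
by apply: lerD => //; apply: lerD.
Qed.

Lemma FS_oscillation (k : 'rV[R]_n -> R) xi : intg mu k -> xi != 0 ->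
  let z := (pi / enorm xi ^+ 2) *: xi in
  2 * FS k xi = rint mu (fun x => (k x - k (x + z)) * sin (dotp x xi)).
Proof.
move=> ki x0 z; have e0 : 0 < enorm xi by rewrite enorm_gt0.
have zx : dotp z xi = pi.
  by rewrite dotpZl -sqr_enorm -mulrA mulVf ?mulr1// expf_neq0// gt_eqF.
have kzi : intg mu (fun x => k (x + z)) by exact: intg_shift.
have e : rint mu (fun x => k (x + z) * sin (dotp x xi)) = - FS k xi.
  have := rint_shift z (intgZ (-1) (intg_sin xi ki)); rewrite (rintZ (-1) (intg_sin xi ki)).
  rewrite mulN1r => <-; apply: eq_rint => x.
  by rewrite dotpDl zx sinDpi mulrN mulN1r opprK.
under eq_rint do rewrite mulrBl.
rewrite rintB; [|exact: intg_sin|exact: intg_sin].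
by rewrite e opprK mulr2n mulrDl mul1r.
Qed.

(** For [|x| <= 2 w] the two terms of the difference are bounded separately by [|sin t| <= |t|]; as
    [|x + z| <= 3 w], the majorant [a] is needed up to [3 w]. Beyond [2 w] the difference is bounded
    by [b]. *)
Lemma FS_oscillation_bound (k a b : 'rV[R]_n -> R) xi : intg mu k -> xi != 0 ->
  intg mu a -> intg mu b -> (forall x, 0 <= a x) -> (forall x, 0 <= b x) ->
  let w := pi / enorm xi in
  (forall y, enorm y <= 3 * w -> `|k y| * enorm y <= a y) ->
  (forall x z, enorm z = w -> 2 * w < enorm x -> `|k x - k (x + z)| <= b x) ->
  2 * `|FS k xi| <= 2 * enorm xi * rint mu a + rint mu b.
Proof.
move=> ki x0 ai bi a0 b0 w ha hb; have e0 : 0 < enorm xi by rewrite enorm_gt0.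
pose z := (pi / enorm xi ^+ 2) *: xi.
have ez : enorm z = w.
  rewrite enormZ ger0_norm; last by rewrite divr_ge0 ?pi_ge0// exprn_ge0// ltW.
  by rewrite /w; field; rewrite gt_eqF.
have w0 : 0 <= w by rewrite -ez enorm_ge0.
have zx : dotp z xi = pi.
  by rewrite dotpZl -sqr_enorm -mulrA mulVf ?mulr1// expf_neq0// gt_eqF.
(* Thanks to this the term [k (x + z)] gains the factor [|x + z|] and not [|x|], so a translation
   brings it back to [a]. *)
have sD x : `|sin (dotp x xi)| = `|sin (dotp (x + z) xi)|.
  by rewrite dotpDl zx sinDpi normrN.
have sB x : `|sin (dotp x xi)| <= enorm xi * enorm x.
  by apply: le_trans (sin_le_id _) _; rewrite mulrC; exact: dotp_cs.
have azi : intg mu (fun x => a (x + z)) by exact: intg_shift.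
rewrite -[X in X * `|_|](ger0_norm (ler0n R 2)) -normrM (FS_oscillation ki x0).
have -> : 2 * enorm xi * rint mu a + rint mu b =
   rint mu (fun x => enorm xi * (a x + a (x + z)) + b x).
  rewrite rintD//; last by apply: intgZ; exact: intgD.
  rewrite rintZ; last exact: intgD.
  by rewrite rintD// rint_shift//; congr (_ + _); ring.
apply: rint_norm_le.
- rewrite -/z; under eq_fun do rewrite mulrBl.
  by apply: intgB; apply: intg_sin => //; exact: intg_shift.
- by apply: intgD => //; apply: intgZ; exact: intgD.
- move=> x; rewrite -/z; have [xw|xw] := leP (enorm x) (2 * w); last first.
    apply: ler_wpDl; first by rewrite mulr_ge0 ?addr_ge0 ?(ltW e0).
    by rewrite normrM; apply: le_trans (_ : b x * 1 <= _); [apply: ler_pM => //; [exact: hb|exact: sin_max]|rewrite mulr1].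
  apply: ler_wpDr => //; rewrite mulrBl.
  apply: le_trans (ler_normB _ _) _; rewrite !normrM mulrDr; apply: lerD.
    apply: le_trans (ler_wpM2l (normr_ge0 _) (sB x)) _.
    by rewrite mulrCA ler_wpM2l ?(ltW e0)//; apply: ha; lra.
  rewrite sD; apply: le_trans (ler_wpM2l (normr_ge0 _) (sB _)) _.
  rewrite mulrCA ler_wpM2l ?(ltW e0)//; apply: ha.
  by apply: le_trans (enormD _ _) _; rewrite ez; lra.
Qed.

End radial_kernels.

(** * Profiles built from the cutoff *)

Section cutoff_profiles.
Context (R : realType) (chi : R -> R).
Hypothesis hchi : cutoff chi.
Implicit Types (r s t lam m : R).

Lemma cutoff_lipschitz r s : `|chi r - chi s| <= 2 * `|r - s|.
Proof.
have [dchi _ _ chi'] := hchi.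
apply: (@deriv_lipschitz R chi (derive1 chi) 2) => // t.
by rewrite derive1E; apply: derivableP; exact: (dchi 0%N).
Qed.

Lemma cutoff_continuous : continuous chi.
Proof.
have [dchi _ _ _] := hchi; move=> t.
by apply/differentiable_continuous/derivable1_diffP; exact: (dchi 0%N).
Qed.

(** Between 1 and 2, compare with [chi 2 = 0] through the Lipschitz bound. *)
Lemma cutoff_le2 r : 0 <= r -> `|chi r| <= 2.
Proof.
move=> r0; have [_ chi1 chi2 _] := hchi.
have [r1|r1] := leP r 1; first by rewrite chi1; [rewrite normr1 ler1n|rewrite ger0_norm].
have [r2|r2] := leP 2 r; first by rewrite chi2 ?ger0_norm// normr0.
have c2 : chi 2 = 0 by apply: chi2; rewrite ger0_norm.
have := cutoff_lipschitz r 2; rewrite c2 subr0 => /le_trans; apply.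
by rewrite ltr0_norm; lra.
Qed.

(** If [lam r >= 2] both values vanish. Otherwise [2 lam (s - r)] equals [2 (lam r)] times
    [(s - r) / r], and [lam r < 2] removes the dependence on [lam]. *)
Lemma cutoff_scaled_diff lam r s : 0 < lam -> 0 < r -> r <= s ->
  `|chi (lam * r) - chi (lam * s)| <= 4 * ((s - r) / r).
Proof.
move=> l0 r0 rs; have [_ _ chi2 _] := hchi; have s0 : 0 < s by exact: lt_le_trans rs.
have d0 : 0 <= (s - r) / r by rewrite divr_ge0 ?subr_ge0 ?(ltW r0).
have [lr|lr] := leP 2 (lam * r).
  have ls : 2 <= lam * s by apply: le_trans lr _; rewrite ler_pM2l.
  rewrite (chi2 _ (le_trans lr (ler_norm _))) (chi2 _ (le_trans ls (ler_norm _))).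
  by rewrite subrr normr0 mulr_ge0.
apply: le_trans (cutoff_lipschitz _ _) _.
rewrite -mulrBr normrM (gtr0_norm l0) distrC (ger0_norm (_ : 0 <= s - r)) ?subr_ge0//.
have -> : lam * (s - r) = lam * r * ((s - r) / r) by field; rewrite gt_eqF.
rewrite (mulrA 2) ler_wpM2r//; lra.
Qed.

Lemma cutoff_scaled_measurable lam : measurable_fun [set: R] (fun r => chi (lam * r)).
Proof.
apply: (measurableT_comp (continuous_measurable_fun cutoff_continuous)).
by apply: measurable_funM => //; exact: measurable_id.
Qed.

Lemma profile_cutoff lam : 0 < lam -> profile (fun r => chi (lam * r)).
Proof.
move=> l0; split; first exact: cutoff_scaled_measurable.
  move=> r r0; apply: le_trans (cutoff_le2 _) _; first by rewrite mulr_ge0// ltW.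
  by rewrite ler_nat.
move=> r s r0 rs; apply: le_trans (cutoff_scaled_diff l0 r0 rs) _.
by rewrite ler_wpM2r ?ler_nat// divr_ge0 ?subr_ge0 ?(ltW r0).
Qed.

Lemma profile_annulus lam m : 0 < lam -> 0 < m ->
  profile (fun r => chi (lam * r) - chi (m * r)).
Proof.
move=> l0 m0; split.
- by apply: measurable_funB; exact: cutoff_scaled_measurable.
- move=> r r0; apply: le_trans (ler_normB _ _) _.
  have := cutoff_le2 (mulr_ge0 (ltW l0) r0); have := cutoff_le2 (mulr_ge0 (ltW m0) r0).
  lra.
- move=> r s r0 rs.
  have := cutoff_scaled_diff l0 r0 rs; have := cutoff_scaled_diff m0 r0 rs.
  rewrite (_ : chi (lam * r) - chi (m * r) - _ =
    (chi (lam * r) - chi (lam * s)) - (chi (m * r) - chi (m * s))); last by ring.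
  by move=> h1 h2; apply: le_trans (ler_normB _ _) _; lra.
Qed.

Lemma annulus_inner lam m r : 0 < lam -> lam <= m -> 0 <= r -> r <= m^-1 ->
  chi (lam * r) - chi (m * r) = 0.
Proof.
move=> l0 lm r0 rm; have m0 : 0 < m by exact: lt_le_trans lm.
have [_ chi1 _ _] := hchi.
have mr1 : m * r <= 1 by rewrite -(mulfV (lt0r_neq0 m0)) ler_pM2l.
have lr1 : lam * r <= 1 by apply: le_trans mr1; rewrite ler_wpM2r.
by rewrite !chi1 ?subrr// ger0_norm// mulr_ge0// ltW.
Qed.

Lemma cutoff_outer lam r : 0 < lam -> 2 / lam <= r -> chi (lam * r) = 0.
Proof.
move=> l0; rewrite ler_pdivrMr// mulrC => h; have [_ _ chi2 _] := hchi.
by rewrite chi2// (le_trans h)// ler_norm.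
Qed.

End cutoff_profiles.

(** * Symbols of truncations to annuli *)

Section kernel_bounds.
Context (R : realType) (n : nat).
Notation mu := (leb R n).
Implicit Types (x y z xi : 'rV[R]_n) (i : 'I_n) (h : R -> R) (b p r s m lam : R).

Definition kexp b : R := n%:R + 1 - b.

Lemma powRN_le (a m y : R) : 0 < m -> m^-1 <= y -> 0 <= a -> y `^ (- a) <= m `^ a.
Proof.
move=> m0 my a0; have y0 : 0 < y by apply: lt_le_trans my; rewrite invr_gt0.
have my1 : 1 <= m * y by rewrite -(mulfV (lt0r_neq0 m0)) ler_pM2l.
rewrite powRN -[leLHS]mulr1 ler_pdivrMl ?powR_gt0// mulrC -powRM ?(ltW m0) ?(ltW y0)//.
by have := ler_powR my1 a0; rewrite powRr0.
Qed.

Lemma rker_le_profile h b i x : (forall r, 0 <= r -> `|h r| <= 4) ->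
  `|rker h (kexp b) i x| <= 4 * enorm x `^ (b - n%:R).
Proof.
move=> hb; apply: le_trans (rker_le _ _ _ _) _.
have -> : 1 - kexp b = b - n%:R by rewrite /kexp; ring.
by rewrite ler_wpM2r ?powR_ge0// hb// enorm_ge0.
Qed.

Lemma rker_dom_inside h b i rho x : (forall r, 0 <= r -> `|h r| <= 4) ->
  (forall r, rho < r -> h r = 0) ->
  `|rker h (kexp b) i x| <= 4 * (if enorm x <= rho then enorm x `^ (b - n%:R) else 0).
Proof.
move=> hb h0; case: ifPn => [_|]; first exact: rker_le_profile.
by rewrite -ltNge => /h0 e; rewrite /rker e mul0r normr0 mulr0.
Qed.

Lemma intg_rker h b i rho : measurable_fun [set: R] h -> 0 < b -> 0 < rho ->
  (forall r, 0 <= r -> `|h r| <= 4) -> (forall r, rho < r -> h r = 0) ->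
  intg mu (rker h (kexp b) i).
Proof.
move=> mh b0 r0 hb h0; have gi := intgZ 4 (@intg_inside R n b rho b0 r0); apply: (intg_dom _ _ gi).
  exact: measurable_rker.
by move=> x; exact: rker_dom_inside.
Qed.

Lemma rint_norm_rker_le h b A i rho : measurable_fun [set: R] h -> 0 < b <= A -> 0 < rho ->
  (forall r, 0 <= r -> `|h r| <= 4) -> (forall r, rho < r -> h r = 0) ->
  rint mu (fun x => `|rker h (kexp b) i x|) <= 4 * (radC n A * (rho `^ b / b)).
Proof.
move=> mh bA r0 hb h0; have /andP[b0 _] := bA.
apply: le_trans (_ : rint mu (fun x => 4 * (if enorm x <= rho then enorm x `^ (b - n%:R) else 0)) <= _).
  apply: rint_le => [||x]; [|apply: intgZ; exact: (@intg_inside R n b rho b0 r0)|exact: rker_dom_inside].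
  exact: intg_norm (intg_rker i mh b0 r0 hb h0).
rewrite rintZ; last exact: intg_inside.
by rewrite ler_pM2l//; exact: rint_inside.
Qed.

Lemma rker_mul_enorm h b i x : (forall r, 0 <= r -> `|h r| <= 4) ->
  `|rker h (kexp b) i x| * enorm x <= 4 * enorm x `^ (b + 1 - n%:R).
Proof.
move=> hb; have [->|x0] := eqVneq x 0.
  by rewrite enorm0 mulr0 mulr_ge0// powR_ge0.
have e0 : 0 < enorm x by rewrite enorm_gt0.
have -> : enorm x `^ (b + 1 - n%:R) = enorm x `^ (b - n%:R) * enorm x.
  rewrite -[X in _ * X](powRr1 (ltW e0)) -powRD; last by rewrite (gt_eqF e0) implybT.
  by congr (_ `^ _); ring.
by rewrite mulrA ler_wpM2r ?(ltW e0)// rker_le_profile.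
Qed.

(** The two terms come from the regions near and far from the origin in [FS_oscillation_bound]; [18]
    is half of [2 * 4 * 3^2 / 2 *] the leading 2, that is half of 36. *)
Definition annC : R := 18 * pi ^+ 2 * radC n 2 + diffC (n%:R + 1) * pi * radC n 1.

Lemma diffC_ge0 (P : R) : 0 <= P -> 0 <= diffC P.
Proof. by move=> P0; rewrite /diffC !addr_ge0// !mulr_ge0// powR_ge0. Qed.

Lemma annC_ge0 : 0 <= annC.
Proof.
rewrite /annC addr_ge0// !mulr_ge0 ?sqr_ge0 ?pi_ge0 ?(ltW (radC_gt0 _ _))// diffC_ge0//.
Qed.

Lemma annulus_arith (A1 A2 A3 A4 : R) : 2 * A1 <= 36 * A2 + 3 / 2 * A4 -> A2 <= A3 ->
  0 <= A4 -> A1 <= 18 * A3 + A4.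
Proof. by lra. Qed.

(** The kernel lives between the radii [1 / m] and [2 / lam]. Vanishing below [1 / m] yields the
    powers of [m]. The far difference decays like [|x|^(-(1 - b) - n)], which is integrable at
    infinity because [b < 1], so the bound does not involve [lam]. *)
Lemma annulus_bound chi b lam m i xi : cutoff chi -> 0 < b < 1 -> 0 < lam -> lam <= m ->
  xi != 0 ->
  enorm xi * `|FS (rker (fun r => chi (lam * r) - chi (m * r)) (kexp b) i) xi| <=
  annC * (m `^ (1 - b) / (1 - b)).
Proof.
move=> hchi /andP[b0 b1] l0 lm xi0.
have m0 : 0 < m by exact: lt_le_trans lm.
have e0 : 0 < enorm xi by rewrite enorm_gt0.
have b10 : 0 < 1 - b by rewrite subr_gt0.
set h := fun r => _; set k := rker h (kexp b) i.
have ph : profile h by exact: profile_annulus.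
have [mh hb _] := ph.
have hin r : 0 <= r -> r <= m^-1 -> h r = 0 by exact: annulus_inner.
have hout r : 2 / lam < r -> h r = 0.
  move=> /ltW lr; rewrite /h !(cutoff_outer hchi)// ?subrr//.
  by apply: le_trans lr; rewrite ler_pM2l// lef_pV2.
have ki : intg mu k by apply: (@intg_rker h b i (2 / lam)) => //; rewrite divr_gt0.
pose w := pi / enorm xi; have w0 : 0 < w by rewrite divr_gt0// pi_gt0.
pose M := m `^ (1 - b); have M0 : 0 <= M by exact: powR_ge0.
pose P : R := n%:R + 1; have P0 : 0 <= P by rewrite addr_ge0.
have pP : 0 < kexp b <= P.
  by rewrite /kexp /P; apply/andP; split; have := ler0n R n; lra.
pose a y := 4 * M * (if enorm y <= 3 * w then enorm y `^ (2 - n%:R) else 0).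
(* If [|x| < rho] and [|z| < |x| / 2], then [|x + z| <= 3/2 |x| <= 1 / m], so the kernel vanishes at
   both points. *)
pose rho := (3 / 2 * m)^-1; have rho0 : 0 < rho by rewrite invr_gt0 mulr_gt0// divr_gt0.
pose bb x := diffC P * w * (if rho <= enorm x then enorm x `^ (- (1 - b) - n%:R) else 0).
have w30 : 0 < 3 * w by rewrite mulr_gt0.
have dP := diffC_ge0 P0.
have ai : intg mu a by apply: intgZ; exact: intg_inside.
have bi : intg mu bb by apply: intgZ; exact: intg_outside.
have a0 x : 0 <= a x by rewrite /a; case: ifP => _; rewrite !mulr_ge0// powR_ge0.
have bb0 x : 0 <= bb x.
  apply: mulr_ge0; first exact: mulr_ge0 dP (ltW w0).
  by case: ifP => // _; exact: powR_ge0.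
have [ha [hbb _]] : (forall y, enorm y <= 3 * w -> `|k y| * enorm y <= a y) /\
    (forall x z, enorm z = w -> 2 * w < enorm x -> `|k x - k (x + z)| <= bb x) /\ True.
  split; [|split=> //].
  - move=> y yw; have [ym|ym] := leP (enorm y) m^-1.
      by rewrite /k /rker hin ?enorm_ge0// mul0r normr0 mul0r.
    rewrite /a yw; apply: le_trans (rker_mul_enorm b i y hb) _; rewrite -mulrA ler_pM2l//.
    have y0 : 0 < enorm y by apply: lt_trans ym; rewrite invr_gt0.
    (* Since [|y| >= 1 / m] here, the factor [|y|^(-(1 - b))] is traded for [m^(1 - b)], leaving a
       power with a fixed exponent. *)
    have -> : b + 1 - n%:R = - (1 - b) + (2 - n%:R) by ring.
    rewrite powRD; last by rewrite (gt_eqF y0) implybT.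
    by rewrite ler_wpM2r ?powR_ge0//; apply: powRN_le => //; exact: ltW.
  - move=> x z zw xw; have x0 : x != 0.
      by rewrite -enorm_gt0; apply: lt_trans xw; rewrite mulr_gt0.
    rewrite /bb; case: ifPn => [_|].
      have -> : - (1 - b) - n%:R = - kexp b by rewrite /kexp; ring.
      rewrite -mulrA -zw; apply: rker_diff => //.
      by rewrite zw -mulr_natl ltW.
    rewrite -ltNge => xr; have xz : enorm (x + z) <= m^-1.
      apply: le_trans (enormD _ _) _; rewrite zw.
      apply: le_trans (_ : 3 / 2 * enorm x <= _); first by lra.
      have -> : m^-1 = 3 / 2 * rho by rewrite /rho; field; rewrite gt_eqF.
      by rewrite ler_pM2l ?divr_gt0// ltW.
    have xm : enorm x <= m^-1.
      apply: le_trans (ltW xr) _; rewrite lef_pV2 ?posrE ?mulr_gt0 ?divr_gt0//.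
      by rewrite ler_peMl ?ltW//; lra.
    by rewrite /k /rker !hin ?enorm_ge0// !mul0r subr0 normr0 mulr0.
have H := @FS_oscillation_bound R n k a bb xi ki xi0 ai bi a0 bb0 ha hbb.
have Ia : rint mu a <= 4 * M * (radC n 2 * ((3 * w) ^+ 2 / 2)).
  rewrite /a rintZ; last exact: intg_inside.
  apply: ler_wpM2l; first by rewrite mulr_ge0.
  have := @rint_inside R n 2 2 (3 * w); rewrite lexx ltr0n /= => /(_ isT w30).
  by rewrite powR_mulrn// ltW.
have Ib : rint mu bb <= diffC P * w * (radC n 1 * (3 / 2 * M / (1 - b))).
  rewrite /bb rintZ; last exact: intg_outside.
  apply: ler_wpM2l; first by rewrite mulr_ge0// ltW.
  apply: le_trans (@rint_outside R n (1 - b) 1 rho _ rho0) _.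
    by rewrite b10 /= gerBl ltW.
  rewrite ler_pM2l ?radC_gt0// ler_pM2r ?invr_gt0//.
  apply: le_trans (powRN_le (m := 3 / 2 * m) _ _ _) _; rewrite ?mulr_gt0 ?divr_gt0 ?(ltW b10)//.
  have h32 : 1 <= 3 / 2 :> R by rewrite ler_pdivlMr// mul1r ler_nat.
  have hb1 : 1 - b <= 1 by rewrite gerBl ltW.
  have h3 : 0 <= 3 / 2 :> R by rewrite divr_ge0.
  rewrite (powRM _ h3 (ltW m0)); apply: ler_wpM2r => //; exact: ler1_powR.
have Ew : enorm xi * w = pi by rewrite /w mulrCA mulfV ?mulr1// gt_eqF.
(* The near part comes without the denominator [1 - b]; this brings both parts to the same form. *)
have Mb : M <= M / (1 - b).
  by rewrite -[leLHS]mulr1 ler_wpM2l// invf_ge1// lerBlDr lerDl ltW.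
have S1 : 2 * enorm xi * rint mu a <= 2 * enorm xi * (4 * M * (radC n 2 * ((3 * w) ^+ 2 / 2))).
  by rewrite ler_wpM2l// mulr_ge0// ltW.
have H2 : enorm xi * (2 * `|FS k xi|) <= enorm xi *
   (2 * enorm xi * (4 * M * (radC n 2 * ((3 * w) ^+ 2 / 2))) +
    diffC P * w * (radC n 1 * (3 / 2 * M / (1 - b)))).
  by rewrite ler_pM2l//; apply: le_trans H _; exact: lerD.
have E2 : enorm xi *
   (2 * enorm xi * (4 * M * (radC n 2 * ((3 * w) ^+ 2 / 2))) +
    diffC P * w * (radC n 1 * (3 / 2 * M / (1 - b)))) =
   36 * (enorm xi * w) ^+ 2 * radC n 2 * M +
   3 / 2 * (diffC P * (enorm xi * w) * radC n 1) * (M / (1 - b)).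
  by field; rewrite gt_eqF.
rewrite E2 Ew in H2.
have c1 : 0 <= (pi : R) ^+ 2 * radC n 2 by apply: mulr_ge0 (sqr_ge0 _) (ltW (radC_gt0 _ _)).
have c2 : 0 <= diffC P * pi * radC n 1.
  by apply: mulr_ge0 (mulr_ge0 dP (pi_ge0 _)) (ltW (radC_gt0 _ _)).
have c3 : pi ^+ 2 * radC n 2 * M <= pi ^+ 2 * radC n 2 * (M / (1 - b)) by exact: ler_wpM2l.
have c4 : 0 <= diffC P * pi * radC n 1 * (M / (1 - b)) by apply: mulr_ge0 c2 (le_trans M0 Mb).
have -> : annC * (M / (1 - b)) = 18 * (pi ^+ 2 * radC n 2 * (M / (1 - b))) +
   diffC P * pi * radC n 1 * (M / (1 - b)) by rewrite /annC -/P; ring.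
have e2 : 36 * pi ^+ 2 * radC n 2 * M = 36 * (pi ^+ 2 * radC n 2 * M) by ring.
have e3 : 3 / 2 * (diffC P * pi * radC n 1) * (M / (1 - b)) =
  3 / 2 * (diffC P * pi * radC n 1 * (M / (1 - b))) by ring.
rewrite e2 e3 mulrCA in H2; exact: annulus_arith H2 c3 c4.
Qed.

End kernel_bounds.

(** * Uniform bound on the symbol of the truncated kernel *)

Lemma half_sub (R : realType) (b : R) : b <= 2^-1 -> 2^-1 <= 1 - b.
Proof. by lra. Qed.

Lemma high_arith (R : realType) (F A B : R) : 2 * F <= A + B -> 0 <= B -> F <= 2^-1 * A + B.
Proof. by lra. Qed.

Section cutoff_kernel.
Context (R : realType) (n : nat).
Notation mu := (leb R n).
Implicit Types (x y z xi : 'rV[R]_n) (i : 'I_n) (b : R).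

(** A bound for [(3 pi / |xi|)^b] when [b <= |xi|] and [b <= 1]: it is at most
    [(2 / b)^b * (3 pi / 2)^b]. *)
Definition oscC : R := expR 2 * (3 * pi / 2).

(** The sum of the bounds in the three regimes: high frequencies with [b <= 1/2], frequencies below
    [b <= 1], and [b >= 1/2]. *)
Definition cutC : R :=
  oscC * (12 * pi * radC n 2 + diffC (n%:R + 1) * radC n 1) +
  8 * radC n 2 * expR 2 + 8 * radC n n%:R * expR 2.

Let e2_gt0 : 0 < expR 2 :> R. Proof. exact: expR_gt0. Qed.

Let T1_ge0 : 0 <= oscC * (12 * pi * radC n 2 + diffC (n%:R + 1) * radC n 1).
Proof.
have P0 : 0 <= n%:R + 1 :> R by rewrite addr_ge0.
have o0 : 0 <= oscC by rewrite mulr_ge0 ?(ltW e2_gt0)// divr_ge0// mulr_ge0// pi_ge0.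
apply: mulr_ge0 o0 _; apply: addr_ge0; last first.
  exact: mulr_ge0 (diffC_ge0 P0) (ltW (radC_gt0 _ _)).
by apply: mulr_ge0 (ltW (radC_gt0 _ _)); rewrite mulr_ge0// pi_ge0.
Qed.

Let T2_ge0 (A : R) : 0 <= 8 * radC n A * expR 2.
Proof. by rewrite mulr_ge0 ?(ltW e2_gt0)// mulr_ge0// ltW// radC_gt0. Qed.

Lemma cutC_ge0 : 0 <= cutC.
Proof. by rewrite /cutC !addr_ge0. Qed.

Variables (chi : R -> R) (b : R) (i : 'I_n).
Hypotheses (hchi : cutoff chi) (b0 : 0 < b).
Let h := fun r => chi (b * r).
Let k := rker h (kexp n b) i.

Let ph : profile h. Proof. exact: profile_cutoff. Qed.
Let hb r : 0 <= r -> `|h r| <= 4. Proof. by case: ph => _ + _; apply. Qed.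
Let mh : measurable_fun [set: R] h. Proof. by case: ph. Qed.
Let hout r : 2 / b < r -> h r = 0. Proof. by move=> /ltW; exact: cutoff_outer. Qed.
Let rb0 : 0 < 2 / b. Proof. by rewrite divr_gt0. Qed.

Lemma intg_cutoff_kernel : intg mu k.
Proof. exact: (intg_rker i mh b0 rb0 hb hout). Qed.

(** The [L^1] norm of the kernel is of order [(2 / b)^b / b], and here [1 / b <= 2]. *)
Lemma cutoff_bound_large xi : 2^-1 <= b -> b <= n%:R ->
  `|FS k xi| <= 8 * radC n n%:R * expR 2.
Proof.
move=> b2 bn; apply: le_trans (FS_le xi intg_cutoff_kernel) _.
have bb : 0 < b <= n%:R by rewrite b0.
apply: le_trans (rint_norm_rker_le i mh bb rb0 hb hout) _.
have ib : b^-1 <= 2 by rewrite -[leRHS]invrK lef_pV2 ?posrE.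
have -> : 8 * radC n n%:R * expR 2 = 4 * (radC n n%:R * (expR 2 * 2)) :> R by ring.
rewrite ler_pM2l// ler_pM2l ?radC_gt0//.
apply: ler_pM; [exact: powR_ge0|by rewrite invr_ge0 ltW|exact: powR_div_self_le|exact: ib].
Qed.

(** Here [|sin(x.xi)| <= b |x|]. The factor [b] cancels the radius [2 / b] of the support, leaving
    the bounded quantity [(2 / b)^b]. *)
Lemma cutoff_bound_low xi : b <= 1 -> enorm xi <= b -> `|FS k xi| <= 8 * radC n 2 * expR 2.
Proof.
move=> b1 xb; have b10 : 0 < b + 1 by rewrite addr_gt0.
have gi := @intg_inside R n (b + 1) (2 / b) b10 rb0.
apply: le_trans (_ : rint mu (fun x => b * (4 * (if enorm x <= 2 / b then enorm x `^ (b + 1 - n%:R) else 0))) <= _).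
  apply: rint_norm_le; [exact: intg_sin intg_cutoff_kernel|by apply: intgZ; exact: intgZ|].
  move=> x; have sx : `|sin (dotp x xi)| <= enorm x * b.
    apply: le_trans (sin_le_id _) _; apply: le_trans (dotp_cs _ _) _.
    by rewrite ler_wpM2l ?enorm_ge0.
  rewrite normrM; apply: le_trans (ler_wpM2l (normr_ge0 _) sx) _.
  rewrite (mulrA `|k x|) mulrC ler_pM2l//; case: ifPn => [_|].
    exact: rker_mul_enorm.
  by rewrite -ltNge => /hout e; rewrite /k /rker e mul0r normr0 mul0r mulr0.
rewrite rintZ; last exact: intgZ.
rewrite rintZ//.
have b12 : 0 < b + 1 <= 2 by rewrite b10 /= -[leRHS]/(1 + 1) lerD2r.
apply: le_trans (_ : b * (4 * (radC n 2 * ((2 / b) `^ (b + 1) / (b + 1)))) <= _).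
  by rewrite ler_pM2l// ler_pM2l//; exact: rint_inside.
have e1 : (2 / b) `^ (b + 1) = (2 / b) `^ b * (2 / b).
  rewrite powRD; last by rewrite (gt_eqF rb0) implybT.
  by rewrite powRr1// ltW.
have i1 : (b + 1)^-1 <= 1 by rewrite invf_le1// lerDr ltW.
have q := powR_div_self_le b0.
have -> : b * (4 * (radC n 2 * ((2 / b) `^ (b + 1) / (b + 1)))) =
   8 * radC n 2 * ((2 / b) `^ b * (b + 1)^-1).
  by rewrite e1; field; rewrite !gt_eqF.
apply: ler_wpM2l; first by rewrite mulr_ge0// ltW// radC_gt0.
rewrite -[leRHS]mulr1; apply: ler_pM; [exact: powR_ge0|by rewrite invr_ge0 ltW|exact: q|exact: i1].
Qed.

(** Both parts of [FS_oscillation_bound] scale like [w^b] with [w = pi / |xi|], which [b <= |xi|]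
    keeps bounded; [b <= 1/2] controls the factor [1 / (1 - b)] of the far part. *)
Lemma cutoff_bound_high xi : b <= 2^-1 -> b <= enorm xi ->
  `|FS k xi| <= oscC * (12 * pi * radC n 2 + diffC (n%:R + 1) * radC n 1).
Proof.
move=> b2 bx; have x0 : 0 < enorm xi by exact: lt_le_trans bx.
have xi0 : xi != 0 by rewrite -enorm_gt0.
have b1 : b <= 1 by apply: le_trans b2 _; rewrite invf_le1// ler1n.
have b10 : 0 < 1 - b by rewrite subr_gt0; apply: le_lt_trans b2 _; rewrite invf_lt1// ltr1n.
have bp1 : 0 < b + 1 by rewrite addr_gt0.
pose w := pi / enorm xi; have w0 : 0 < w by rewrite divr_gt0// pi_gt0.
have w30 : 0 < 3 * w by rewrite mulr_gt0.
have w20 : 0 < 2 * w by rewrite mulr_gt0.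
pose P : R := n%:R + 1; have P0 : 0 <= P by rewrite addr_ge0.
have dP := diffC_ge0 P0.
have pP : 0 < kexp n b <= P.
  rewrite /kexp /P gerBl (ltW b0) andbT subr_gt0; apply: le_lt_trans b2 _.
  by apply: lt_le_trans (_ : 1 <= _); [rewrite invf_lt1// ltr1n|rewrite lerDr].
pose a y := 4 * (if enorm y <= 3 * w then enorm y `^ (b + 1 - n%:R) else 0).
pose bb x := diffC P * w * (if 2 * w <= enorm x then enorm x `^ (- (1 - b) - n%:R) else 0).
have ai : intg mu a by apply: intgZ; exact: intg_inside.
have bi : intg mu bb by apply: intgZ; exact: intg_outside.
have a0 x : 0 <= a x by apply: mulr_ge0 => //; case: ifP => // _; exact: powR_ge0.
have bb0 x : 0 <= bb x.
  apply: mulr_ge0; first exact: mulr_ge0 dP (ltW w0).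
  by case: ifP => // _; exact: powR_ge0.
have ha y : enorm y <= 3 * w -> `|k y| * enorm y <= a y.
  by move=> yw; rewrite /a yw; exact: rker_mul_enorm.
have hbb x z : enorm z = w -> 2 * w < enorm x -> `|k x - k (x + z)| <= bb x.
  move=> zw xw; rewrite /bb (ltW xw).
  have -> : - (1 - b) - n%:R = - kexp n b by rewrite /kexp; ring.
  rewrite -mulrA -zw; apply: rker_diff => //.
    by rewrite -enorm_gt0; exact: lt_trans xw.
  by rewrite zw -mulr_natl ltW.
have H := @FS_oscillation_bound R n k a bb xi intg_cutoff_kernel xi0 ai bi a0 bb0 ha hbb.
pose Q := (3 * w) `^ b; have Q0 : 0 <= Q by exact: powR_ge0.
have Qe : Q <= oscC.
  have p32 : 1 <= 3 * pi / 2 :> R.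
    have p2 : 2 <= pi :> R by exact: pi_ge2.
    by rewrite ler_pdivlMr// mul1r; apply: le_trans p2 _; rewrite ler_peMl ?pi_ge0// ler1n.
  apply: le_trans (_ : ((2 / b) * (3 * pi / 2)) `^ b <= _).
    apply: ge0_ler_powR; rewrite ?nnegrE ?(ltW b0) ?(ltW w30)//.
      by rewrite mulr_ge0 ?(ltW rb0)// (le_trans ler01).
    have -> : 2 / b * (3 * pi / 2) = 3 * (pi / b) by field; rewrite gt_eqF.
    by rewrite ler_pM2l// /w ler_pM2l ?pi_gt0// lef_pV2 ?posrE.
  rewrite powRM ?(ltW rb0) ?(le_trans ler01 p32)//.
  apply: ler_pM; [exact: powR_ge0|exact: powR_ge0|exact: powR_div_self_le|exact: ler1_powR].
have Ia : rint mu a <= 4 * (radC n 2 * (Q * (3 * w))).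
  rewrite /a rintZ; last exact: intg_inside.
  rewrite ler_pM2l//; have b12 : 0 < b + 1 <= 2 by rewrite bp1 /= -[leRHS]/(1 + 1) lerD2r.
  apply: le_trans (rint_inside n b12 w30) _; rewrite ler_pM2l ?radC_gt0//.
  rewrite powRD ?(gt_eqF w30) ?implybT// powRr1 ?(ltW w30)//.
  apply: ler_piMr; first exact: mulr_ge0 Q0 (ltW w30).
  by rewrite invf_le1// lerDr ltW.
have Ib : rint mu bb <= diffC P * radC n 1 * Q.
  rewrite /bb rintZ; last exact: intg_outside.
  have b11 : 0 < 1 - b <= 1 by rewrite b10 /= gerBl ltW.
  apply: le_trans (ler_wpM2l (mulr_ge0 dP (ltW w0)) (rint_outside n b11 w20)) _.
  have i2 : (1 - b)^-1 <= 2.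
    rewrite -[leRHS]invrK lef_pV2 ?posrE//; exact: half_sub.
  have wq : (2 * w) `^ (- (1 - b)) * (2 * w) = (2 * w) `^ b.
    rewrite -[X in _ * X](powRr1 (ltW w20)) -powRD ?(gt_eqF w20) ?implybT//.
    by congr (_ `^ _); ring.
  have wQ : (2 * w) `^ b <= Q.
    by apply: ge0_ler_powR; rewrite ?nnegrE ?(ltW b0) ?(ltW w20) ?(ltW w30)// ler_pM2r// ler_nat.
  have -> : diffC P * w * (radC n 1 * ((2 * w) `^ (- (1 - b)) / (1 - b))) =
     diffC P * radC n 1 * ((2 * w) `^ b * ((1 - b)^-1 / 2)).
    by rewrite -wq; field; rewrite gt_eqF.
  apply: ler_wpM2l; first exact: mulr_ge0 dP (ltW (radC_gt0 _ _)).
  rewrite -[leRHS]mulr1; apply: ler_pM => //; first exact: powR_ge0.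
    by rewrite divr_ge0// invr_ge0 ltW.
  by rewrite ler_pdivrMr// mul1r.
have Ew : enorm xi * w = pi by rewrite /w mulrCA mulfV ?mulr1// gt_eqF.
have S1 : 2 * enorm xi * rint mu a <= 24 * pi * radC n 2 * Q.
  apply: le_trans (_ : 2 * enorm xi * (4 * (radC n 2 * (Q * (3 * w)))) <= _).
    by rewrite ler_wpM2l// mulr_ge0// ltW.
  by rewrite -Ew le_eqVlt; apply/orP; left; apply/eqP; ring.
rewrite -/P.
have r1 := ltW (radC_gt0 n (1 : R)); have r2 := ltW (radC_gt0 n (2 : R)).
have G1 : 24 * pi * radC n 2 * Q <= 24 * pi * radC n 2 * oscC.
  by apply: ler_wpM2l Qe; rewrite !mulr_ge0// pi_ge0.
have G2 : diffC P * radC n 1 * Q <= diffC P * radC n 1 * oscC.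
  by apply: ler_wpM2l Qe; exact: mulr_ge0.
have G3 : 0 <= diffC P * radC n 1 * oscC.
  by apply: mulr_ge0 (mulr_ge0 dP r1) (le_trans Q0 Qe).
have -> : oscC * (12 * pi * radC n 2 + diffC P * radC n 1) =
  2^-1 * (24 * pi * radC n 2 * oscC) + diffC P * radC n 1 * oscC by field.
have HH := le_trans H (lerD (le_trans S1 G1) (le_trans Ib G2)).
exact: (high_arith HH G3).
Qed.

Lemma cutoff_bound xi : b < n%:R -> `|FS k xi| <= cutC.
Proof.
move=> bn; rewrite /cutC; have t1 := T1_ge0; have t2 := T2_ge0 2; have t3 := T2_ge0 n%:R.
have [b2|b2] := leP 2^-1 b.
  apply: le_trans (cutoff_bound_large xi b2 (ltW bn)) _.
  by apply: ler_wpDl => //; exact: addr_ge0.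
have b1 : b <= 1 by apply: le_trans (ltW b2) _; rewrite invf_le1// ler1n.
apply: ler_wpDr => //; have [bx|xb] := leP b (enorm xi).
  by apply: ler_wpDr => //; exact: cutoff_bound_high (ltW b2) bx.
by apply: ler_wpDl => //; exact: cutoff_bound_low b1 (ltW xb).
Qed.

End cutoff_kernel.

(** * Transform of a product with the symbol of an odd integrable kernel *)

Section integrable_kernel.
Context (R : realType) (n : nat).
Notation mu := (leb R n).
Implicit Types (k psi : 'rV[R]_n -> R) (x y u xi : 'rV[R]_n).

Lemma continuous_FS k : intg mu k -> continuous (FS k).
Proof.
move=> ki xi; apply: (@continuous_rint _ _ _ _ mu (fun v x => k x * sin (dotp x v)) (fun x => `|k x|)).
- by move=> v; exact: intg_measurable (intg_sin v ki).
- exact: intg_norm.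
- by move=> v t; exact: mulr_sin_le.
- move=> x; have ct := continuous_cstM (a := k x) (Ck_continuous (Ck_sin_dotp 0 x)).
  have e : (fun v => k x * sin (dotp x v)) = (fun v => k x * sin (dotp v x)).
    by apply/funext => v; rewrite dotpC.
  by rewrite e (dotpC x); exact: ct xi.
Qed.

(** With [s] and [t] ranging over sine and cosine, one argument covers the four products of the
    addition formulas. *)
Let trig (s t : R -> R) psi u y := rint mu (fun x => psi x * (s (dotp u x) * t (dotp x y))).

Section trig_pairing.
Variables (k psi : 'rV[R]_n -> R) (s t : R -> R).
Hypotheses (ki : intg mu k) (pi_ : intg mu psi) (cs : continuous s) (ct : continuous t)
  (s1 : forall a, `|s a| <= 1) (t1 : forall a, `|t a| <= 1).

Let F y := fun z : 'rV[R]_n * 'rV[R]_n => psi z.1 * t (dotp z.1 y) * (k z.2 * s (dotp z.2 z.1)).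

Let mF y : measurable_fun setT (F y).
Proof.
have [mk mp] := (intg_measurable ki, intg_measurable pi_).
apply: measurable_funM; apply: measurable_funM.
- exact: (measurableT_comp mp measurable_fst).
- apply: (measurableT_comp (continuous_measurable_fun ct)).
  by apply: measurable_dotpl; [exact: measurable_fst|exact: measurable_cst].
- exact: (measurableT_comp mk measurable_snd).
- apply: (measurableT_comp (continuous_measurable_fun cs)).
  by apply: measurable_dotpl; [exact: measurable_snd|exact: measurable_fst].
Qed.

Let F_le y x u : `|F y (x, u)| <= `|psi x| * `|k u|.
Proof.
by rewrite /F /= !normrM; apply: ler_pM; rewrite ?mulr_ge0//; apply: ler_piMr.
Qed.

Lemma trig_swap y :
  rint mu (fun x => rint mu (fun u => k u * s (dotp u x)) * psi x * t (dotp x y)) =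
  rint mu (fun u => k u * trig s t psi u y).
Proof.
have [mk mp] := (intg_measurable ki, intg_measurable pi_).
transitivity (rint mu (fun x => rint mu (fun u => F y (x, u)))).
  apply: eq_rint => x; rewrite -mulrA mulrC -rintZ_measurable//.
  apply: measurable_funM => //; apply: (measurableT_comp (continuous_measurable_fun cs)).
  by apply: measurable_dotpl; [exact: measurable_id|exact: measurable_cst].
rewrite (rint_swap_dom (mF y) (intg_norm pi_) (intg_norm ki) (F_le y)).
apply: eq_rint => u; rewrite /trig -rintZ_measurable.
  by apply: eq_rint => x; rewrite /F /=; ring.
apply: measurable_funM => //; apply: measurable_funM.
- apply: (measurableT_comp (continuous_measurable_fun cs)).
  by apply: measurable_dotpl; [exact: measurable_cst|exact: measurable_id].
- apply: (measurableT_comp (continuous_measurable_fun ct)).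
  by apply: measurable_dotpl; [exact: measurable_id|exact: measurable_cst].
Qed.

Lemma intg_trig_slice u y : intg mu (fun x => psi x * (s (dotp u x) * t (dotp x y))).
Proof.
under eq_fun do rewrite mulrC.
apply: (@intgM_bounded _ _ _ _ (fun x => s (dotp u x) * t (dotp x y)) _ 1) => //.
- apply: measurable_funM.
  + apply: (measurableT_comp (continuous_measurable_fun cs)).
    by apply: measurable_dotpl; [exact: measurable_cst|exact: measurable_id].
  + apply: (measurableT_comp (continuous_measurable_fun ct)).
    by apply: measurable_dotpl; [exact: measurable_id|exact: measurable_cst].
- by move=> x; rewrite normrM mulr_ile1.
Qed.

Lemma intg_trig y : intg mu (fun u => k u * trig s t psi u y).
Proof.
under eq_fun do rewrite mulrC.
apply: (@intgM_bounded _ _ _ _ (fun u => trig s t psi u y) _ (rint mu (fun x => `|psi x|))) => //.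
- apply: (measurable_rint mu (F := fun z : 'rV[R]_n * 'rV[R]_n => psi z.2 * (s (dotp z.1 z.2) * t (dotp z.2 y)))).
  apply: measurable_funM; first exact: (measurableT_comp (intg_measurable pi_) measurable_snd).
  apply: measurable_funM.
  + apply: (measurableT_comp (continuous_measurable_fun cs)).
    by apply: measurable_dotpl; [exact: measurable_fst|exact: measurable_snd].
  + apply: (measurableT_comp (continuous_measurable_fun ct)).
    by apply: measurable_dotpl; [exact: measurable_snd|exact: measurable_cst].
- move=> u; apply: rint_norm_le; [exact: intg_trig_slice|exact: intg_norm|].
  by move=> x; rewrite normrM ler_piMr// normrM mulr_ile1.
Qed.

End trig_pairing.

Lemma rint_odd_trig_cos k psi (t : R -> R) y : intg mu k -> intg mu psi -> continuous t ->
  (forall a, `|t a| <= 1) -> (forall x, k (- x) = - k x) ->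
  rint mu (fun u => k u * trig (@cos R) t psi u y) = 0.
Proof.
move=> ki pi ct t1 ko; apply: rint_odd.
  by apply: intg_trig => //; [exact: continuous_cos|exact: cos_max].
move=> u; rewrite ko mulNr; congr (- (_ * _)); apply: eq_rint => x.
by rewrite dotpNl cosN.
Qed.

(** The addition formula splits the transform of [psi] at [u + y] into two products. The one with
    the cosine of [u.x] is even in [u] and drops out against the odd [k]; Fubini's theorem handles
    the other. *)
Lemma FC_FS_mul k psi y : intg mu k -> intg mu psi -> (forall x, k (- x) = - k x) ->
  FC (fun x => FS k x * psi x) y = rint mu (fun u => k u * FS psi (u + y)).
Proof.
move=> ki pi ko.
have [cs cc_] := (@continuous_sin R, @continuous_cos R).
have [sm cm] := (@sin_max R, @cos_max R).
have -> : rint mu (fun u => k u * FS psi (u + y)) =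
   rint mu (fun u => k u * trig (@sin R) (@cos R) psi u y) +
   rint mu (fun u => k u * trig (@cos R) (@sin R) psi u y).
  rewrite -rintD; [|exact: intg_trig|exact: intg_trig].
  apply: eq_rint => u; rewrite -mulrDr; congr (_ * _).
  rewrite /trig -rintD; [|exact: intg_trig_slice|exact: intg_trig_slice].
  by apply: eq_rint => x; rewrite dotpDr sinD (dotpC x u); ring.
by rewrite rint_odd_trig_cos// addr0 -trig_swap.
Qed.

Lemma FS_FS_mul k psi y : intg mu k -> intg mu psi -> (forall x, k (- x) = - k x) ->
  FS (fun x => FS k x * psi x) y = - rint mu (fun u => k u * FC psi (u + y)).
Proof.
move=> ki pi ko.
have [cs cc_] := (@continuous_sin R, @continuous_cos R).
have [sm cm] := (@sin_max R, @cos_max R).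
have -> : rint mu (fun u => k u * FC psi (u + y)) =
   rint mu (fun u => k u * trig (@cos R) (@cos R) psi u y) -
   rint mu (fun u => k u * trig (@sin R) (@sin R) psi u y).
  rewrite -rintB; [|exact: intg_trig|exact: intg_trig].
  apply: eq_rint => u; rewrite -mulrBr; congr (_ * _).
  rewrite /trig -rintB; [|exact: intg_trig_slice|exact: intg_trig_slice].
  by apply: eq_rint => x; rewrite dotpDr cosD (dotpC x u); ring.
by rewrite rint_odd_trig_cos// sub0r opprK -trig_swap.
Qed.

End integrable_kernel.

(** * The symbol of the outer kernel as a limit *)

Lemma half_lt (R : realType) (a b : R) : a - b < a / 2 -> a / 2 < b.
Proof. by lra. Qed.

Lemma double_le (R : realType) (a b : R) : a / 2 < b -> a <= 2 * b.
Proof. by lra. Qed.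

Lemma three_eps (R : realType) (a b c d e : R) : `|b - c| < e / 2 ->
  `|a - b| < e / 8 -> `|d - c| < e / 4 -> `|a - d| < e.
Proof. by rewrite !ltr_norml => /andP[? ?] /andP[? ?] /andP[? ?]; apply/andP; split; lra. Qed.

Lemma continuous_at_eps (R : realType) (T : topologicalType) (f : T -> R) (x : T) :
  (forall e, 0 < e -> \forall v \near x, `|f x - f v| < e) -> {for x, continuous f}.
Proof. by move=> h; apply/cvgrPdist_lt => e; exact: h. Qed.

Lemma continuous_at_near_lt (R : realType) (T : topologicalType) (f : T -> R) (x : T) e :
  {for x, continuous f} -> 0 < e -> \forall v \near x, `|f x - f v| < e.
Proof. by move=> cf e0; move: cf => /cvgrPdist_lt /(_ _ e0). Qed.

Section outer_kernel.
Context (R : realType) (n : nat).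
Notation mu := (leb R n).
Implicit Types (psi : 'rV[R]_n -> R) (x y u xi : 'rV[R]_n).

Lemma intg_FS_decay c psi : tf c psi -> intg mu (FC psi) /\ intg mu (FS psi).
Proof.
move=> tp; have [C C0 h] := fourier_decay_weight n.+1 tp.
have mp := cc_measurable (tf_cc tp).
have gi := intgZ C (intg_weight R (ltnSn n)).
split; apply: (intg_dom _ _ gi).
- exact: measurable_FC.
- by move=> x; exact: (h x).1.
- exact: measurable_FS.
- by move=> x; exact: (h x).2.
Qed.

Variables (chi : R -> R) (b : R) (i : 'I_n).
Hypotheses (hchi : cutoff chi) (b0 : 0 < b) (b1 : b < 1) (bn : b <= n%:R).

(* The exponent makes [lam j `^ (1 - b)] proportional to [1 / (j + 1)]. *)
Let lam (j : nat) : R := b * j.+1%:R^-1 `^ (1 - b)^-1.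

Let b10 : 0 < 1 - b. Proof. by rewrite subr_gt0. Qed.
Let j0 (j : nat) : 0 < j.+1%:R^-1 :> R. Proof. by rewrite invr_gt0. Qed.
Let j1 (j : nat) : j.+1%:R^-1 <= 1 :> R. Proof. by rewrite invf_le1 ?ler1n. Qed.

Let lam_gt0 j : 0 < lam j.
Proof. by rewrite mulr_gt0// powR_gt0. Qed.

Let lam_le j : lam j <= b * j.+1%:R^-1.
Proof.
rewrite ler_pM2l//; apply: ge1r_powR; first by rewrite j0 j1.
by rewrite invf_ge1// gerBl ltW.
Qed.

Let lam_leb j : lam j <= b.
Proof. by apply: le_trans (lam_le j) _; rewrite ler_piMr// ltW. Qed.

Let lam_mono j l : (j <= l)%N -> lam l <= lam j.
Proof.
move=> jl; rewrite ler_pM2l//; apply: ge0_ler_powR; rewrite ?nnegrE ?invr_ge0 ?(ltW b10) ?ler0n//.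
by rewrite lef_pV2 ?posrE// ler_nat ltnS.
Qed.

Let lam_pow j : lam j `^ (1 - b) = b `^ (1 - b) * j.+1%:R^-1.
Proof.
rewrite powRM ?(ltW b0) ?powR_ge0//; congr (_ * _).
by rewrite -powRrM mulVf ?gt_eqF// powRr1 ?(ltW (j0 _)).
Qed.

Let kann (l m : R) := rker (n := n) (fun r => chi (l * r) - chi (m * r)) (kexp n b) i.
Let kj j := kann (lam j) b.
Let mj j := FS (kj j).

Definition outer_kernel := rker (n := n) (fun r => 1 - chi (b * r)) (kexp n b) i.

Let A : R := annC R n * (b `^ (1 - b) / (1 - b)).

Let A_ge0 : 0 <= A.
Proof. by rewrite mulr_ge0 ?annC_ge0// divr_ge0 ?powR_ge0 ?(ltW b10). Qed.

Let intg_kann l m : 0 < l -> l <= m -> intg mu (kann l m).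
Proof.
move=> l0 lm; have m0 : 0 < m by exact: lt_le_trans lm.
have [mh hb _] := profile_annulus hchi l0 m0.
have l2 : 0 < 2 / l by rewrite divr_gt0.
apply: (@intg_rker R n _ b i (2 / l) mh b0 l2 hb) => r /ltW lr.
rewrite !(cutoff_outer hchi)// ?subrr//.
by apply: le_trans lr; rewrite ler_pM2l// lef_pV2.
Qed.

Let kji j : intg mu (kj j).
Proof. exact: intg_kann. Qed.

Let mjB j l xi : (j <= l)%N -> mj l xi - mj j xi = FS (kann (lam l) (lam j)) xi.
Proof.
move=> jl; rewrite /mj /FS -rintB; [|exact: intg_sin|exact: intg_sin].
by apply: eq_rint => x; rewrite /kj /kann /rker; ring.
Qed.

(** The difference of two truncations is again an annular kernel, with inner radius [1 / lam j], so
    [annulus_bound] gives the rate [lam j ^ (1 - b)]. *)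
Let mj_cauchy j l xi : (j <= l)%N -> xi != 0 ->
  enorm xi * `|mj l xi - mj j xi| <= A * j.+1%:R^-1.
Proof.
move=> jl x0; rewrite mjB//.
have bb : 0 < b < 1 by rewrite b0.
apply: le_trans (annulus_bound i hchi bb (lam_gt0 l) (lam_mono jl) x0) _.
by rewrite lam_pow /A le_eqVlt; apply/orP; left; apply/eqP; ring.
Qed.

Let mj_bound j xi : enorm xi * `|mj j xi| <= A.
Proof.
have [->|x0] := eqVneq xi 0; first by rewrite enorm0 mul0r.
have bb : 0 < b < 1 by rewrite b0.
rewrite /mj /kj /kann /A; exact: (annulus_bound i hchi bb (lam_gt0 j) (lam_leb j) x0).
Qed.

Let mj0 j : mj j 0 = 0.
Proof.
rewrite /mj /FS (@eq_rint _ _ _ mu _ (fun=> 0)) ?rint0// => x.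
by rewrite -(scale0r (0 : 'rV[R]_n)) dotpZr mul0r sin0 mulr0.
Qed.

Let small (e : R) : 0 < e -> exists j : nat, A * j.+1%:R^-1 < e.
Proof.
move=> e0; have A1 : 0 < A + 1 by rewrite ltr_wpDl.
have eA : 0 < e / (A + 1) by rewrite divr_gt0.
have [N _ hN] := near_infty_natSinv_lt (PosNum eA).
exists N; have := hN N (leqnn N); rewrite /= ltr_pdivlMr// => h.
by apply: le_lt_trans h; rewrite mulrC; apply: ler_wpM2l; [exact: ltW (j0 N)|rewrite lerDl].
Qed.

(** The limit exists at every point: by the Cauchy estimate for [xi != 0], and at 0 because every
    sine transform vanishes there. *)
Definition outer_symbol xi : R := lim (mj j xi @[j --> \oo]).
Let m := outer_symbol.

Let mj_cvg xi : mj j xi @[j --> \oo] --> m xi.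
Proof.
have [->|x0] := eqVneq xi 0.
  rewrite /m /outer_symbol (_ : (fun j => mj j 0) = fun=> 0); last by apply/funext => j; exact: mj0.
  by rewrite lim_cst; [exact: cvg_cst|exact: Rhausdorff].
have e0 : 0 < enorm xi by rewrite enorm_gt0.
suff : cvg (mj j xi @[j --> \oo]) by [].
apply/cauchy_cvgP; apply: cauchy_exP => e ee0.
have [j hj] := small (mulr_gt0 e0 ee0).
exists (mj j xi); exists j => // l /= jl.
rewrite /ball /= distrC.
have := le_lt_trans (mj_cauchy jl x0) hj.
by rewrite ltr_pM2l.
Qed.

Let m_err j xi : xi != 0 -> enorm xi * `|m xi - mj j xi| <= A * j.+1%:R^-1.
Proof.
move=> x0; have cv : enorm xi * `|mj l xi - mj j xi| @[l --> \oo] --> enorm xi * `|m xi - mj j xi|.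
  by apply: cvgMl_tmp; apply: cvg_norm; apply: cvgB; [exact: mj_cvg|exact: cvg_cst].
rewrite -(cvg_lim (@Rhausdorff R) cv); apply: limr_le; first exact: cvgP cv.
by exists j => // l /= jl; exact: mj_cauchy.
Qed.

Lemma outer_symbol_bound xi : enorm xi * `|outer_symbol xi| <= annC R n * (b `^ (1 - b) / (1 - b)).
Proof.
have cv : enorm xi * `|mj l xi| @[l --> \oo] --> enorm xi * `|m xi|.
  by apply: cvgMl_tmp; apply: cvg_norm; exact: mj_cvg.
rewrite -(cvg_lim (@Rhausdorff R) cv); apply: limr_le; first exact: cvgP cv.
by exists 0%N => // l /= _; exact: mj_bound.
Qed.

(** The error [A / (|xi| (j + 1))] is uniform away from the origin, and the truncated symbols are
    continuous. *)
Lemma outer_symbol_continuous xi : xi != 0 -> {for xi, continuous outer_symbol}.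
Proof.
move=> x0; have e0 : 0 < enorm xi by rewrite enorm_gt0.
apply: continuous_at_eps => e ee0.
(* The error is below [e / 8] at [xi] and below [e / 4] at a neighbour [v] with [|v| > |xi| / 2];
   the truncated symbol varies by less than [e / 2]. *)
have e80 : 0 < enorm xi * e / 8 by rewrite divr_gt0// mulr_gt0.
have [j hj] := small e80.
have n1 : \forall v \near xi, enorm xi / 2 < enorm v.
  have e2 : 0 < enorm xi / 2 by rewrite divr_gt0.
  apply: filterS (continuous_at_near_lt (@continuous_enorm R n xi) e2) => v; rewrite ltr_norml => /andP[_]; exact: half_lt.
have n2 : \forall v \near xi, `|mj j xi - mj j v| < e / 2.
  have e2 : 0 < e / 2 by rewrite divr_gt0.
  have cj : {for xi, continuous (mj j)} by exact: (@continuous_FS R n _ (kji j) xi).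
  exact: (continuous_at_near_lt cj e2).
apply: filterS2 n1 n2 => v v1 v2.
have v0 : v != 0 by rewrite -enorm_gt0; apply: lt_trans v1; rewrite divr_gt0.
have h1 := le_lt_trans (m_err j x0) hj; have h2 := le_lt_trans (m_err j v0) hj.
rewrite -/m.
have h1' : `|m xi - mj j xi| < e / 8 by move: h1; rewrite -mulrA ltr_pM2l.
have h2' : `|m v - mj j v| < e / 4.
  rewrite -(ltr_pM2l e0); apply: le_lt_trans (_ : 2 * (enorm v * `|m v - mj j v|) < _).
    by rewrite mulrA ler_wpM2r//; exact: double_le.
  have -> : enorm xi * (e / 4) = 2 * (enorm xi * e / 8) by field.
  by rewrite ltr_pM2l.
exact: three_eps v2 h1' h2'.
Qed.

(** All truncations vanish for [|u| <= 1 / b], so [b <= n] gives one bound for them all. Against the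
    integrable transform of [psi] it serves as a majorant. *)
Let kj_le j u : `|kj j u| <= 4 * b `^ (n%:R - b).
Proof.
have [mh hb _] := profile_annulus hchi (lam_gt0 j) b0.
have [ub|ub] := leP (enorm u) b^-1.
  rewrite /kj /kann /rker (annulus_inner hchi)// ?enorm_ge0// mul0r normr0 mulr_ge0//.
  exact: powR_ge0.
apply: le_trans (rker_le_profile b i u hb) _; rewrite ler_pM2l//.
have -> : b - n%:R = - (n%:R - b) by ring.
by apply: powRN_le => //; [exact: ltW|rewrite subr_ge0].
Qed.

Let kj_cvg u : kj j u @[j --> \oo] --> outer_kernel u.
Proof.
have [_ chi1 _ _] := hchi.
apply: cvgMr_tmp; apply: cvgB; last exact: cvg_cst.
have [u0|u0] := leP (b * enorm u) 0.
  have -> : enorm u = 0 by apply: le_anti; rewrite enorm_ge0 andbT -(pmulr_rle0 _ b0).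
  have -> : (fun j => chi (lam j * 0)) = fun=> 1 by apply/funext => j; rewrite mulr0 chi1// normr0.
  exact: cvg_cst.
have ui : 0 < (b * enorm u)^-1 by rewrite invr_gt0.
have [N _ hN] := near_infty_natSinv_lt (PosNum ui).
apply/cvgrPdist_lt => e e0; exists N => // j Nj /=.
rewrite chi1 ?subrr ?normr0// (ger0_norm (mulr_ge0 (ltW (lam_gt0 j)) (enorm_ge0 u))).
apply: le_trans (_ : j.+1%:R^-1 * (b * enorm u) <= 1).
  by rewrite mulrCA mulrA ler_wpM2r ?enorm_ge0.
have := hN j Nj; rewrite /= => /ltW; rewrite -[X in _ <= X]div1r ler_pdivlMr//.
Qed.

Lemma measurable_outer_kernel : measurable_fun setT outer_kernel.
Proof.
apply: measurable_rker; apply: measurable_funB => //.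
exact: cutoff_scaled_measurable hchi b.
Qed.

Section identities.
Variables (psi : 'rV[R]_n -> R).
Hypothesis tp : tf 0 psi.

Let mpsi : measurable_fun setT psi. Proof. exact: cc_measurable (tf_cc tp). Qed.
Let pi_ : intg mu psi. Proof. exact: cc_intg (tf_cc tp). Qed.

(** The symbols are bounded by [A / |x|] uniformly in [j], and [psi] is supported at distance at
    least [sqrt d] from the origin. *)
Let dom : exists2 C, 0 <= C & forall j x, `|mj j x * psi x| <= C * `|psi x|.
Proof.
have [r [d [d0 h]]] := tp.2; have s0 : 0 < Num.sqrt d by rewrite sqrtr_gt0.
exists (A / Num.sqrt d); first by rewrite divr_ge0 ?(ltW s0).
move=> j x; rewrite normrM; have [->|px] := eqVneq (psi x) 0; first by rewrite normr0 !mulr0.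
apply: ler_wpM2r => //; have [_ dx] := h x px.
have ex : Num.sqrt d <= enorm x by apply: ler_wsqrtr; move: dx; rewrite /reg add0r.
rewrite ler_pdivlMr//; apply: le_trans (mj_bound j x); rewrite mulrC.
by rewrite ler_wpM2r.
Qed.

Let lhs_cvg (t : R -> R) y : continuous t -> (forall a, `|t a| <= 1) ->
  rint mu (fun x => mj j x * psi x * t (dotp x y)) @[j --> \oo] -->
  rint mu (fun x => m x * psi x * t (dotp x y)).
Proof.
move=> ct t1; have [C C0 hC] := dom.
apply: (@rint_dct _ _ _ mu _ _ (fun x => C * `|psi x|) _ _ _ _).2.
- move=> j; apply: measurable_funM; first apply: measurable_funM => //.
    by apply: measurable_FS; exact: intg_measurable (kji j).
  apply: (measurableT_comp (continuous_measurable_fun ct)).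
  by apply: measurable_dotpl; [exact: measurable_id|exact: measurable_cst].
- by move=> x; apply: cvgMr_tmp; apply: cvgMr_tmp; exact: mj_cvg.
- by apply: intgZ; exact: intg_norm.
- move=> j x; rewrite normrM; apply: le_trans (_ : `|mj j x * psi x| * 1 <= _).
    by rewrite ler_wpM2l.
  by rewrite mulr1.
Qed.

Let rhs_cvg (g : 'rV[R]_n -> R) y : intg mu g ->
  rint mu (fun u => kj j u * g (u + y)) @[j --> \oo] -->
  rint mu (fun u => outer_kernel u * g (u + y)).
Proof.
move=> gi; have gyi := intg_shift y gi.
apply: (@rint_dct _ _ _ mu _ _ (fun u => 4 * b `^ (n%:R - b) * `|g (u + y)|) _ _ _ _).2.
- by move=> j; apply: measurable_funM; [exact: intg_measurable (kji j)|exact: intg_measurable gyi].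
- by move=> u; apply: cvgMr_tmp; exact: kj_cvg.
- by apply: intgZ; exact: intg_norm.
- by move=> j u; rewrite normrM ler_wpM2r.
Qed.

Lemma FC_outer_symbol y : FC (fun x => outer_symbol x * psi x) y =
  rint mu (fun u => outer_kernel u * FS psi (u + y)).
Proof.
have L := @lhs_cvg (@cos R) y (@continuous_cos R) (@cos_max R).
have Rr := @rhs_cvg (FS psi) y (intg_FS_decay tp).2.
have e : (fun j => rint mu (fun x => mj j x * psi x * cos (dotp x y))) =
    (fun j => rint mu (fun u => kj j u * FS psi (u + y))).
  by apply/funext => j; exact: (FC_FS_mul y (kji j) pi_ (@rker_odd _ _ _ _ _)).
rewrite e in L; exact: (cvg_unique (@Rhausdorff R) L Rr).
Qed.

Lemma FS_outer_symbol y : FS (fun x => outer_symbol x * psi x) y =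
  - rint mu (fun u => outer_kernel u * FC psi (u + y)).
Proof.
have L := @lhs_cvg (@sin R) y (@continuous_sin R) (@sin_max R).
have Rr : - rint mu (fun u => kj j u * FC psi (u + y)) @[j --> \oo] -->
    - rint mu (fun u => outer_kernel u * FC psi (u + y)).
  by apply: cvgN; exact: (@rhs_cvg (FC psi) y (intg_FS_decay tp).1).
have e : (fun j => rint mu (fun x => mj j x * psi x * sin (dotp x y))) =
    (fun j => - rint mu (fun u => kj j u * FC psi (u + y))).
  by apply/funext => j; exact: (FS_FS_mul y (kji j) pi_ (@rker_odd _ _ _ _ _)).
rewrite e in L; exact: (cvg_unique (@Rhausdorff R) L Rr).
Qed.

End identities.
End outer_kernel.

(** * Convolution estimates *)

Section double_integrals.
Context (R : realType) (n : nat).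
Notation mu := (leb R n).
Notation fct := ('rV[R]_n -> R).
Implicit Types (k f g : fct) (x y u : 'rV[R]_n) (N : nat).

Lemma double_integral_le (F G : 'rV[R]_n * 'rV[R]_n -> R) :
  measurable_fun setT F -> measurable_fun setT G -> (forall z, `|F z| <= `|G z|) ->
  (\int[mu]_x \int[mu]_y `|G (x, y)|%:E < +oo)%E ->
  (\int[mu]_x \int[mu]_y `|F (x, y)|%:E < +oo)%E.
Proof.
move=> mF mG FG; apply: le_lt_trans.
have mA (H : 'rV[R]_n * 'rV[R]_n -> R) : measurable_fun setT H -> measurable_fun setT (fun z => `|H z|%:E).
  by move=> mH; apply/measurable_EFinP; exact: measurableT_comp.
have mT (H : 'rV[R]_n * 'rV[R]_n -> R) : measurable_fun setT H ->
    measurable_fun setT (fun x => \int[mu]_y `|H (x, y)|%:E)%E.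
  by move=> mH; apply: (@measurable_tonelli _ _ _ _ _ mu _ (mA H mH)) => z; rewrite lee_fin.
have mS (H : 'rV[R]_n * 'rV[R]_n -> R) x : measurable_fun setT H ->
    measurable_fun setT (fun y => `|H (x, y)|%:E).
  move=> mH; apply: (measurableT_comp (mA H mH)); exact: pair1_measurable.
apply: ge0_le_integral => //; [|exact: mT|exact: mT|].
  by move=> x _; exact: integral_ge0.
move=> x _; apply: ge0_le_integral => //; [exact: mS|exact: mS|].
by move=> y _; rewrite lee_fin.
Qed.

Lemma measurable_conv_integrand k g : measurable_fun setT k -> measurable_fun setT g ->
  measurable_fun setT (fun z : 'rV[R]_n * 'rV[R]_n => k (z.1 - z.2) * g z.2).
Proof.
move=> mk mg; apply: measurable_funM; last exact: (measurableT_comp mg measurable_snd).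
by apply: (measurableT_comp mk); apply: measurable_rVB; [exact: measurable_fst|exact: measurable_snd].
Qed.

Lemma young_finite k g : intg mu k -> intg mu g ->
  (\int[mu]_x \int[mu]_y `|k (x - y) * g y|%:E < +oo)%E.
Proof.
move=> ki gi; have [mk mg] := (intg_measurable ki, intg_measurable gi).
have mF := measurable_conv_integrand mk mg.
have mA : measurable_fun setT (fun z : 'rV[R]_n * 'rV[R]_n => `|k (z.1 - z.2) * g z.2|%:E).
  by apply/measurable_EFinP; exact: measurableT_comp mF.
have -> : (\int[mu]_x \int[mu]_y `|k (x - y) * g y|%:E =
    \int[mu]_y \int[mu]_x `|k (x - y) * g y|%:E)%E.
  by apply: (@tonelli_swap _ _ _ _ _ mu mu _ mA) => z; rewrite lee_fin.
have inner y : (\int[mu]_x `|k (x - y) * g y|%:E = (`|g y| * rint mu (fun x => `|k x|))%:E)%E.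
  have gk : intg mu (fun x => `|g y| * `|k (x - y)|).
    by apply: intgZ; apply: (@intg_shift _ _ (- y) (fun x => `|k x|)); exact: intg_norm.
  under eq_integral do rewrite normrM mulrC.
  rewrite (rintE gk) rintZ; last by apply: (@intg_shift _ _ (- y) (fun x => `|k x|)); exact: intg_norm.
  by rewrite (@rint_shift _ _ (- y) (fun x => `|k x|)) //; exact: intg_norm.
under eq_integral do rewrite inner mulrC.
have gi' := intgZ (rint mu (fun x => `|k x|)) (intg_norm gi).
by rewrite (rintE gi') ltry.
Qed.

(** If [|x - y| <= rho], then [1 + |y| <= (1 + rho) (1 + |x|)], so the weight can be moved from [x]
    to [y] at the cost of a constant. *)
Lemma conv_fin_compact k f N (rho : R) : intg mu k -> 0 <= rho ->
  (forall u, k u != 0 -> enorm u <= rho) -> wint N f -> conv_fin k N f.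
Proof.
move=> ki r0 ks [mf fi]; have mk := intg_measurable ki.
have mw := @measurable_weight R n N.
apply: (@double_integral_le (fun z => (1 + enorm z.1) ^- N * (k (z.1 - z.2) * f z.2))
  (fun z => ((1 + rho) ^+ N * k (z.1 - z.2)) * ((1 + enorm z.2) ^- N * f z.2))).
- exact: (measurable_conv_kernel mk mf mw).
- apply: (@measurable_conv_integrand (fun u => (1 + rho) ^+ N * k u)
    (fun y => (1 + enorm y) ^- N * f y)); exact: measurable_funM.
- move=> [x y] /=; have [->|kxy] := eqVneq (k (x - y)) 0; first by rewrite mul0r !mulr0 mul0r.
  have w0 (z : 'rV[R]_n) : 0 < (1 + enorm z) ^+ N by rewrite exprn_gt0// ltr_wpDr ?enorm_ge0.
  have -> : (1 + rho) ^+ N * k (x - y) * ((1 + enorm y) ^- N * f y) =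
     (1 + rho) ^+ N / (1 + enorm y) ^+ N * (k (x - y) * f y) by ring.
  rewrite !normrM; apply: ler_wpM2r; first by rewrite mulr_ge0.
  rewrite !ger0_norm ?invr_ge0 ?exprn_ge0 ?addr_ge0 ?enorm_ge0//.
  rewrite (ler_pdivlMr _ _ (w0 y)) (ler_pdivrMl _ _ (w0 x)) -exprMn; apply: lerXn2r; rewrite ?nnegrE.
  + by rewrite addr_ge0 ?enorm_ge0.
  + by rewrite mulr_ge0 ?addr_ge0 ?enorm_ge0.
  + have := ks _ kxy; have := ler_enorm_dist y x; rewrite enormB ler_norml => /andP[_].
    have := enorm_ge0 x; move: (enorm x) (enorm y) (enorm (x - y)) => X Y Z; nra.
- exact: (young_finite (intgZ ((1 + rho) ^+ N) ki) fi).
Qed.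

(** Cauchy-Schwarz for [k sqrt(f)] and [sqrt(f)] gives [(k * f)^2 <= (k^2 * f)] times the integral
    of [f]; then integrate. The bound [M] makes the convolution converge at every point. *)
Lemma young_L2 k f M : measurable_fun setT k -> (forall u, 0 <= k u <= M) ->
  intg mu (fun u => k u ^+ 2) -> intg mu f -> (forall y, 0 <= f y) ->
  [/\ forall x, intg mu (fun y => k (x - y) * f y), sqintg mu (rconv k f) &
    rint mu (fun x => rconv k f x ^+ 2) <= rint mu (fun u => k u ^+ 2) * rint mu f ^+ 2].
Proof.
move=> mk kM k2 fi f0; have mf := intg_measurable fi.
have M0 : 0 <= M by have /andP[] := kM 0; exact: le_trans.
have mkx x : measurable_fun setT (fun y => k (x - y)).
  by apply: (measurableT_comp mk); apply: measurable_rVB; [exact: measurable_cst|exact: measurable_id].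
have kn x : `|k x| <= M by have /andP[k0 km] := kM x; rewrite ger0_norm.
have si x : intg mu (fun y => k (x - y) * f y) by exact: intgM_bounded (mkx x) _ fi.
have k2n x : `|k x ^+ 2| <= M ^+ 2.
  by rewrite normrX; apply: lerXn2r; rewrite ?nnegrE.
have s2 x : intg mu (fun y => k (x - y) ^+ 2 * f y).
  by apply: (intgM_bounded _ _ fi) => [|y]; [exact: measurable_funX|exact: k2n].
have cs x : rconv k f x ^+ 2 <= rint mu (fun y => k (x - y) ^+ 2 * f y) * rint mu f.
  have ms : measurable_fun setT (fun y => Num.sqrt (f y)) := measurableT_comp (@measurable_sqrt R) mf.
  have q1 : sqintg mu (fun y => k (x - y) * Num.sqrt (f y)).
    split; first exact: measurable_funM (mkx x) ms.
    rewrite (_ : (fun y => _) = (fun y => k (x - y) ^+ 2 * f y)); first exact: s2.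
    by apply/funext => y; rewrite exprMn sqr_sqrtr.
  have q2 : sqintg mu (fun y => Num.sqrt (f y)).
    split; first exact: ms.
    rewrite (_ : (fun y => _) = f)//.
    by apply/funext => y; rewrite sqr_sqrtr.
  have := cauchy_schwarz q1 q2.
  rewrite (@eq_rint _ _ _ mu (fun y => k (x - y) * Num.sqrt (f y) * Num.sqrt (f y)) (fun y => k (x - y) * f y)); last first.
    by move=> y; rewrite -mulrA -expr2 sqr_sqrtr.
  rewrite (@eq_rint _ _ _ mu (fun y => (k (x - y) * Num.sqrt (f y)) ^+ 2) (fun y => k (x - y) ^+ 2 * f y)); last first.
    by move=> y; rewrite exprMn sqr_sqrtr.
  rewrite (@eq_rint _ _ _ mu (fun y => Num.sqrt (f y) ^+ 2) f)//.
  by move=> y; rewrite sqr_sqrtr.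
have mF := measurable_conv_integrand (measurable_funX 2 mk) mf.
have Foo := young_finite k2 fi.
have Gi : intg mu (fun x => rint mu (fun y => k (x - y) ^+ 2 * f y)) := intg_rint mF Foo.
have GE : rint mu (fun x => rint mu (fun y => k (x - y) ^+ 2 * f y)) = rint mu (fun u => k u ^+ 2) * rint mu f.
  rewrite (rint_swap mF Foo) /=.
  have -> : (fun y => rint mu (fun x => k (x - y) ^+ 2 * f y)) = fun y => rint mu (fun u => k u ^+ 2) * f y.
    apply/funext => y; under eq_rint do rewrite mulrC.
    have k2y : intg mu (fun x => k (x - y) ^+ 2) by exact: (@intg_shift _ _ (- y) (fun x => k x ^+ 2)).
    by rewrite rintZ// (@rint_shift _ _ (- y) (fun x => k x ^+ 2))// mulrC.
  by rewrite rintZ.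
have mr : measurable_fun setT (rconv k f).
  exact: (measurable_rint mu (F := fun z : 'rV[R]_n * 'rV[R]_n => k (z.1 - z.2) * f z.2) (measurable_conv_integrand mk mf)).
have Gi' := intgZ (rint mu f) Gi.
have r2 : intg mu (fun x => rconv k f x ^+ 2).
  apply: (intg_dom _ _ Gi'); first exact: measurable_funX.
  by move=> x; rewrite ger0_norm ?sqr_ge0// mulrC.
split=> //.
apply: le_trans (_ : rint mu (fun x => rint mu f * rint mu (fun y => k (x - y) ^+ 2 * f y)) <= _).
  by apply: rint_le => // x; rewrite mulrC.
by rewrite rintZ// GE expr2 mulrCA mulrA.
Qed.

End double_integrals.

(** * Size and integrability of the outer kernel *)

Section outer_kernel_weights.
Context (R : realType) (n : nat).
Notation mu := (leb R n).
Notation fct := ('rV[R]_n -> R).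
Implicit Types (f : fct) (x y u : 'rV[R]_n) (N : nat).
Variables (chi : R -> R) (b : R).
Hypotheses (hchi : cutoff chi) (b0 : 0 < b) (bn : b <= n%:R).

Let a : R := n%:R - b.
Let a0 : 0 <= a. Proof. by rewrite subr_ge0. Qed.
Let e1 x : 1 <= 1 + enorm x. Proof. by rewrite lerDl enorm_ge0. Qed.
Let ep x : 0 < 1 + enorm x. Proof. by exact: lt_le_trans ltr01 (e1 x). Qed.

Definition outer_profile (r : R) : R := 1 - chi (b * r).

Lemma outer_profile_le4 r : 0 <= r -> `|outer_profile r| <= 4.
Proof.
move=> r0; apply: le_trans (ler_normB _ _) _; rewrite normr1.
have := cutoff_le2 hchi (mulr_ge0 (ltW b0) r0); move: (`|chi _|) => t; lra.
Qed.

Lemma outer_profile_inner r : 0 <= r -> r <= b^-1 -> outer_profile r = 0.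
Proof.
move=> r0 rb; have [_ chi1 _ _] := hchi; rewrite /outer_profile chi1 ?subrr//.
rewrite ger0_norm; last by rewrite mulr_ge0// ltW.
by rewrite -(mulfV (lt0r_neq0 b0)) ler_pM2l.
Qed.

Lemma outer_profile_outer r : 2 / b <= r -> outer_profile r = 1.
Proof. by move=> h; rewrite /outer_profile (cutoff_outer hchi b0 h) subr0. Qed.

(** Peetre's inequality, from [1 + |y| <= (1 + |x|) (1 + |x - y|)]. *)
Let peetre x y : (1 + enorm y) `^ a <= (1 + enorm x) `^ a * (1 + enorm (x - y)) `^ a.
Proof.
rewrite -powRM ?(ltW (ep _))//; apply: ge0_ler_powR; rewrite ?nnegrE ?mulr_ge0 ?(ltW (ep _))//.
have := ler_enorm_dist y x; rewrite enormB ler_norml => /andP[_].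
have := enorm_ge0 x; have := enorm_ge0 (x - y).
move: (enorm x) (enorm y) (enorm (x - y)) => X Y Z; nra.
Qed.

(** Where the kernel does not vanish, [1 <= b |u|], so [1 + |u| <= (1 + b) |u|]. *)
Lemma outer_kernel_le i u :
  `|outer_kernel chi b i u| <= 4 * (1 + b) `^ a * (1 + enorm u) `^ (- a).
Proof.
have rhs0 : 0 <= 4 * (1 + b) `^ a * (1 + enorm u) `^ (- a) by rewrite !mulr_ge0// powR_ge0.
have [ub|ub] := leP (enorm u) b^-1.
  have e := outer_profile_inner (enorm_ge0 u) ub; rewrite /outer_profile in e.
  by rewrite /outer_kernel /rker e mul0r normr0.
have u0 : 0 < enorm u by apply: lt_trans ub; rewrite invr_gt0.
apply: le_trans (rker_le_profile b i u outer_profile_le4) _.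
rewrite -mulrA ler_pM2l//; have -> : b - n%:R = - a by rewrite /a; ring.
rewrite !powRN ler_pdivlMr ?powR_gt0// ler_pdivrMl ?powR_gt0// mulrC.
have b1 : 0 <= 1 + b by rewrite addr_ge0// ltW.
rewrite -powRM ?(ltW u0)//; apply: ge0_ler_powR; rewrite ?nnegrE ?mulr_ge0 ?(ltW (ep _)) ?(ltW u0)//.
rewrite mulrDl mul1r addrC lerD2l.
by rewrite -(mulfV (lt0r_neq0 b0)) ler_pM2l// ltW.
Qed.

(** Of the weight exponent, [n] absorbs the growth [(1 + |x|)^a] from Peetre's inequality, as
    [a <= n], and [n + 1] makes the rest integrable in [x]. *)
Lemma conv_fin_outer i f : measurable_fun setT f ->
  intg mu (fun y => (1 + enorm y) `^ (- a) * f y) ->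
  conv_fin (outer_kernel chi b i) (n + n.+1) f.
Proof.
move=> mf fi; have mk := @measurable_outer_kernel R n chi b i hchi.
pose C := 4 * (1 + b) `^ a; have C0 : 0 <= C by rewrite mulr_ge0// powR_ge0.
apply: (@product_dom _ _ _ _ R mu mu
  (fun z => (1 + enorm z.1) ^- (n + n.+1) * (outer_kernel chi b i (z.1 - z.2) * f z.2))
  (fun x => C * (1 + enorm x) ^- n.+1) (fun y => `|(1 + enorm y) `^ (- a) * f y|)).
- exact: (measurable_conv_kernel mk mf (@measurable_weight R n (n + n.+1))).
- by apply: intgZ; exact: intg_weight.
- exact: intg_norm.
- move=> x y /=; have := outer_kernel_le i (x - y).
  move: (outer_kernel chi b i (x - y)) => K hK.
  rewrite !normrM (ger0_norm (powR_ge0 _ _)) mulrA mulrA.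
  apply: ler_wpM2r; first exact: normr_ge0.
  rewrite (ger0_norm (ltW (weight_gt0 _ x))).
  have xn : (1 + enorm x) `^ a <= (1 + enorm x) ^+ n.
    by rewrite -powR_mulrn ?(ltW (ep x))// ler_powR// /a gerBl ltW.
  have px : 0 < (1 + enorm x) ^+ n by rewrite exprn_gt0.
  have pn : 0 < (1 + enorm x) ^+ n.+1 by rewrite exprn_gt0.
  have ux : (1 + enorm (x - y)) `^ (- a) <= (1 + enorm x) ^+ n * (1 + enorm y) `^ (- a).
    rewrite !powRN ler_pdivlMr ?powR_gt0// ler_pdivrMl ?powR_gt0// mulrC.
    by apply: le_trans (peetre x y) _; rewrite ler_wpM2r ?powR_ge0.
  have hK2 : `|K| <= C * ((1 + enorm x) ^+ n * (1 + enorm y) `^ (- a)).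
    by apply: le_trans hK _; exact: ler_wpM2l.
  apply: le_trans (ler_wpM2l (ltW (weight_gt0 _ x)) hK2) _.
  rewrite exprD; move: px pn; move: ((1 + enorm x) ^+ n) ((1 + enorm x) ^+ n.+1) => X X' px pn.
  rewrite le_eqVlt; apply/orP; left; apply/eqP.
  by field; rewrite !gt_eqF.
Qed.

(** Absolute convergence at the single point [x0] controls [F] far away: for [|x0 - y| >= 2 / b] the
    profile is 1 and [|x0 - y| <= (1 + |x0|) (1 + |y|)]. The remaining [y] lie in a ball of radius
    [r], where the polynomial weight is bounded below. *)
Lemma intg_outer_weight N (F : fct) x0 : wint N F -> (forall y, 0 <= F y) ->
  intg mu (fun y => `|outer_profile (enorm (x0 - y))| * enorm (x0 - y) `^ (b - n%:R) * F y) ->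
  intg mu (fun y => (1 + enorm y) `^ (- a) * F y).
Proof.
move=> [mF Fi] F0 ki.
pose r := enorm x0 + 2 / b; have r0 : 0 <= r by rewrite addr_ge0 ?enorm_ge0// divr_ge0// ltW.
have gi := intgD (intgZ ((1 + enorm x0) `^ a) ki) (intgZ ((1 + r) ^+ N) Fi).
apply: (intg_dom _ _ gi).
  apply: measurable_funM => //.
  have m1 : measurable_fun setT (fun x : 'rV[R]_n => 1 + enorm x).
    by apply: measurable_funD => //; apply: measurable_enorm; exact: measurable_id.
  exact: (measurableT_comp (@measurable_powR R (- a)) m1).
move=> y; rewrite ger0_norm; last by rewrite mulr_ge0// powR_ge0.
have t1 : 0 <= (1 + enorm x0) `^ a * (`|outer_profile (enorm (x0 - y))| * enorm (x0 - y) `^ (b - n%:R) * F y).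
  by rewrite !mulr_ge0// powR_ge0.
have t2 : 0 <= (1 + r) ^+ N * ((1 + enorm y) ^- N * F y).
  apply: mulr_ge0; last exact: mulr_ge0 (ltW (weight_gt0 N y)) (F0 y).
  by rewrite exprn_ge0// addr_ge0.
have [h|h] := leP (2 / b) (enorm (x0 - y)).
  apply: ler_wpDr => //; rewrite (outer_profile_outer h) normr1 mul1r mulrA.
  apply: ler_wpM2r => //; have -> : b - n%:R = - a by rewrite /a; ring.
  have u0 : 0 < enorm (x0 - y) by apply: lt_le_trans h; rewrite divr_gt0.
  rewrite !powRN ler_pdivlMr ?powR_gt0// ler_pdivrMl ?powR_gt0// mulrC.
  rewrite -powRM ?(ltW (ep _))//; apply: ge0_ler_powR; rewrite ?nnegrE ?mulr_ge0 ?(ltW (ep _)) ?(ltW u0)//.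
  have := enormD x0 (- y); rewrite enormN.
  have := enorm_ge0 x0; have := enorm_ge0 y.
  move: (enorm x0) (enorm y) (enorm (x0 - y)) => X Y Z; nra.
apply: ler_wpDl => //; rewrite mulrA; apply: ler_wpM2r => //.
have yr : enorm y <= r.
  have := ler_enorm_dist y x0; rewrite enormB ler_norml => /andP[_ ].
  by move: h; rewrite /r; move: (enorm _) (enorm _) (enorm _) (2 / b) => *; lra.
apply: le_trans (_ : 1 <= _).
  rewrite powRN invf_le1 ?powR_gt0//.
  by have := ler_powR (e1 y) a0; rewrite powRr0.
have r1 : 0 <= 1 + r by exact: addr_ge0.
rewrite ler_pdivlMr ?exprn_gt0// mul1r; apply: lerXn2r; rewrite ?nnegrE ?(ltW (ep _))//.
by rewrite lerD2l.
Qed.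

Definition outer_norm u : R := `|outer_profile (enorm u)| * enorm u `^ (b - n%:R).

Lemma measurable_outer_norm : measurable_fun setT outer_norm.
Proof.
have mid : measurable_fun setT (fun x : 'rV[R]_n => x) by exact: measurable_id.
apply: measurable_funM; last exact: measurable_enorm_powR.
apply: measurableT_comp => //.
have mh : measurable_fun [set: R] outer_profile.
  by apply: measurable_funB => //; exact: cutoff_scaled_measurable hchi b.
exact: (measurableT_comp mh (measurable_enorm mid)).
Qed.

Lemma outer_norm_bounded u : 0 <= outer_norm u <= 4 * b `^ a.
Proof.
rewrite /outer_norm mulr_ge0 ?powR_ge0//=.
have [ub|ub] := leP (enorm u) b^-1.
  by rewrite (outer_profile_inner (enorm_ge0 u) ub) normr0 mul0r mulr_ge0// powR_ge0.
apply: ler_pM => //; [exact: powR_ge0|by apply: outer_profile_le4; exact: enorm_ge0|].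
have -> : b - n%:R = - a by rewrite /a; ring.
by apply: powRN_le => //; exact: ltW.
Qed.

(** The square decays like [|u|^(-c - n)] with [c = n - 2 b]; it is integrable at infinity because
    [c > 0], with a bound proportional to [1 / c]. The factor 16 is the square of the bound 4 on the
    profile. *)
Lemma outer_norm_sqr (n2b : 0 < n%:R - 2 * b) : intg mu (fun u => outer_norm u ^+ 2) /\
  rint mu (fun u => outer_norm u ^+ 2) <= 16 * (radC n n%:R * (b `^ (n%:R - 2 * b) / (n%:R - 2 * b))).
Proof.
pose c := n%:R - 2 * b; have bi0 : 0 < b^-1 by rewrite invr_gt0.
have gi := intgZ 16 (@intg_outside R n c b^-1 n2b bi0).
have dom u : `|outer_norm u ^+ 2| <= 16 * (if b^-1 <= enorm u then enorm u `^ (- c - n%:R) else 0).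
  rewrite ger0_norm ?sqr_ge0// /outer_norm; case: ifPn => [ub|].
    have u0 : 0 < enorm u by exact: lt_le_trans ub.
    rewrite exprMn; apply: ler_pM; rewrite ?sqr_ge0//.
      have -> : 16 = 4 ^+ 2 :> R by rewrite -natrX.
      by apply: lerXn2r; rewrite ?nnegrE//; apply: outer_profile_le4; exact: enorm_ge0.
    rewrite -powR_mulrn ?powR_ge0// -powRrM le_eqVlt; apply/orP; left; apply/eqP.
    by congr (_ `^ _); rewrite /c; ring.
  rewrite -ltNge => /ltW ub; rewrite (outer_profile_inner (enorm_ge0 u) ub).
  by rewrite normr0 mul0r expr0n mulr0.
have ii : intg mu (fun u => outer_norm u ^+ 2).
  by apply: (intg_dom _ dom gi); apply: measurable_funX; exact: measurable_outer_norm.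
split=> //.
apply: le_trans (_ : rint mu (fun u => 16 * (if b^-1 <= enorm u then enorm u `^ (- c - n%:R) else 0)) <= _).
  by apply: rint_le => // u; apply: le_trans (dom u); exact: ler_norm.
rewrite rintZ; last exact: intg_outside.
rewrite ler_pM2l//; have cn : 0 < c <= n%:R by rewrite n2b gerBl mulr_ge0// ltW.
apply: le_trans (rint_outside n cn bi0) _; rewrite ler_pM2l ?radC_gt0// ler_pM2r ?invr_gt0//.
by apply: powRN_le => //; exact: ltW.
Qed.

End outer_kernel_weights.

(** * From complex-valued functions and norms to real pairings *)

Notation normc := ComplexField.Normc.normc.

Section complex_functions.
Context (R : realType) (n : nat).
Notation mu := (leb R n).
Implicit Types (f g : 'rV[R]_n -> R[i]) (phi : 'rV[R]_n -> R) (x y xi : 'rV[R]_n).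

Definition ReF f : 'rV[R]_n -> R := fun x => complex.Re (f x).
Definition ImF f : 'rV[R]_n -> R := fun x => complex.Im (f x).

Lemma normc_sqr (z : R[i]) : normc z ^+ 2 = complex.Re z ^+ 2 + complex.Im z ^+ 2.
Proof. by case: z => a b /=; rewrite sqr_sqrtr// addr_ge0 ?sqr_ge0. Qed.

Lemma normc_ge0 (z : R[i]) : 0 <= normc z.
Proof. by case: z => a b /=; exact: sqrtr_ge0. Qed.

Lemma Re_le_normc (z : R[i]) : `|complex.Re z| <= normc z.
Proof. by case: z => a b /=; rewrite -sqrtr_sqr ler_wsqrtr// lerDl sqr_ge0. Qed.

Lemma Im_le_normc (z : R[i]) : `|complex.Im z| <= normc z.
Proof. by case: z => a b /=; rewrite -sqrtr_sqr ler_wsqrtr// lerDr sqr_ge0. Qed.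

Lemma normc_le_ReIm (z : R[i]) : normc z <= `|complex.Re z| + `|complex.Im z|.
Proof.
rewrite -(@ler_pXn2r _ 2)// ?nnegrE ?normc_ge0 ?addr_ge0// normc_sqr sqrrD.
rewrite !real_normK ?num_real// -addrA lerD2l -[leLHS]add0r lerD2r.
by rewrite mulrn_wge0// mulr_ge0.
Qed.

Lemma measurable_normc f : cmeasurable f -> measurable_fun setT (fun x => normc (f x)).
Proof.
move=> [m1 m2].
have e : (fun x => normc (f x)) = (fun x => Num.sqrt (ReF f x ^+ 2 + ImF f x ^+ 2)).
  by apply/funext => x; rewrite -normc_sqr sqrtr_sqr ger0_norm// normc_ge0.
rewrite e; apply: (measurableT_comp (@measurable_sqrt R)).
by apply: measurable_funD; exact: measurable_funX.
Qed.

Lemma tempered_wint f : tempered f -> exists N,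
  [/\ wint N (ReF f), wint N (ImF f) & wint N (fun x => normc (f x))].
Proof.
move=> [mf [N fN]]; exists N; have [m1 m2] := mf; have mn := measurable_normc mf.
have ni : intg mu (fun x => (1 + enorm x) ^- N * normc (f x)).
  by under eq_fun do rewrite mulrC; exact: fN.
have mw := @measurable_weight R n N.
have w0 (x : 'rV[R]_n) : 0 <= (1 + enorm x) ^- N by exact: ltW (weight_gt0 N x).
split; split=> //; apply: (intg_dom _ _ ni).
- exact: measurable_funM.
- by move=> x; rewrite normrM (ger0_norm (w0 x)) ler_wpM2l//; exact: Re_le_normc.
- exact: measurable_funM.
- by move=> x; rewrite normrM (ger0_norm (w0 x)) ler_wpM2l//; exact: Im_le_normc.
Qed.

Lemma wint_tempered N f : wint N (ReF f) -> wint N (ImF f) -> tempered f.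
Proof.
move=> [m1 i1] [m2 i2]; have mf : cmeasurable f by split.
split=> //; exists N; have mn := measurable_normc mf.
have gi := intgD (intg_norm i1) (intg_norm i2).
have mw := @measurable_weight R n N.
apply: (intg_dom _ _ gi); first by apply: measurable_funM.
move=> x; have w0 : 0 <= (1 + enorm x) ^- N by exact: ltW (weight_gt0 N x).
rewrite !normrM (ger0_norm w0) (ger0_norm (normc_ge0 _)) -mulrDr mulrC.
by rewrite ler_wpM2l// normc_le_ReIm.
Qed.

Lemma fourierE phi xi : intg mu phi -> fourier phi xi = Complex (FC phi xi) (- FS phi xi).
Proof.
move=> pi; rewrite /fourier /cintegral; congr Complex.
by rewrite /FS -rintN//; exact: intg_sin.
Qed.

Lemma cintegral_pair N c g phi : wint N (ReF g) -> wint N (ImF g) -> tf c phi ->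
  cintegral (fun xi => g xi * fourier phi xi) =
  Complex (pairRe (ReF g) (ImF g) phi) (pairIm (ReF g) (ImF g) phi).
Proof.
move=> w1 w2 tp; have pi := cc_intg (tf_cc tp).
have [c1 s1] := (wint_FC w1 tp, wint_FS w1 tp).
have [c2 s2] := (wint_FC w2 tp, wint_FS w2 tp).
rewrite /cintegral; congr Complex.
- rewrite /pairRe -rintD//; apply: eq_rint => xi; rewrite fourierE// /ReF /ImF.
  by case: (g xi) => a b /=; ring.
- rewrite /pairIm -rintB//; apply: eq_rint => xi; rewrite fourierE// /ReF /ImF.
  by case: (g xi) => a b /=; ring.
Qed.

(** For tempered functions all integrals converge, so the complex identity splits into [pairRe] and
    [pairIm]. This is the bridge from the definition by duality to the real-variable results. *)
Lemma is_multiplierP c a f g :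
  is_multiplier (region c) (fun x => reg c x `^ a) f g <->
  [/\ tempered f, tempered g & rmult c a (ReF f) (ImF f) (ReF g) (ImF g)].
Proof.
have E phi : tempered f -> tempered g -> tf c phi ->
    (cintegral (fun xi => g xi * fourier phi xi) =
     cintegral (fun xi => f xi * fourier (fun x => reg c x `^ a * phi x) xi)) <->
    (pairRe (ReF g) (ImF g) phi = pairRe (ReF f) (ImF f) (fun x => reg c x `^ a * phi x) /\
     pairIm (ReF g) (ImF g) phi = pairIm (ReF f) (ImF f) (fun x => reg c x `^ a * phi x)).
  move=> /tempered_wint[N [f1 f2 _]] /tempered_wint[N' [g1 g2 _]] tp.
  have tap := tf_reg_powR a tp.
  rewrite (cintegral_pair g1 g2 tp) (cintegral_pair f1 f2 tap).
  split=> [e|[e1 e2]]; last by rewrite e1 e2; reflexivity.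
  by split; [exact: (congr1 (@complex.Re R) e)|exact: (congr1 (@complex.Im R) e)].
split=> [[tfm tg h]|[tfm tg h]]; (split; [exact: tfm|exact: tg|move=> phi]).
- by move=> tp; apply/(E phi tfm tg tp); apply: h; exact/test_funP.
- by move=> /test_funP tp; apply/(E phi tfm tg tp); exact: h.
Qed.

Lemma rint_sum (I : Type) (s : seq I) (F : I -> 'rV[R]_n -> R) : (forall j, intg mu (F j)) ->
  intg mu (fun x => \sum_(j <- s) F j x) /\
  rint mu (fun x => \sum_(j <- s) F j x) = \sum_(j <- s) rint mu (F j).
Proof.
move=> Fi; elim: s => [|j s [IH1 IH2]].
  rewrite big_nil; under eq_fun do rewrite big_nil.
  by rewrite rint0; split=> //; exact: intg0.
rewrite big_cons; under eq_fun do rewrite big_cons.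
by rewrite rintD// IH2; split=> //; exact: intgD.
Qed.

Definition sqnorm f : R := rint mu (fun x => ReF f x ^+ 2) + rint mu (fun x => ImF f x ^+ 2).

Lemma sqnorm_ge0 f : 0 <= sqnorm f.
Proof. by rewrite addr_ge0//; apply: rint_ge0 => x; exact: sqr_ge0. Qed.

Section vector_valued.
Variables (d : nat) (F : 'rV[R]_n -> 'rV[R[i]]_d).
Let Fi (i : 'I_d) := fun x => F x ord0 i.

Lemma cvnorm_sqr x : cvnorm (F x) ^+ 2 = \sum_i (ReF (Fi i) x ^+ 2 + ImF (Fi i) x ^+ 2).
Proof.
rewrite /cvnorm sqr_sqrtr; last by apply: sumr_ge0 => i _; exact: sqr_ge0.
by apply: eq_bigr => i _; rewrite normc_sqr.
Qed.

Lemma vL2normE : vL2norm F = poweR (\int[mu]_x (cvnorm (F x) ^+ 2)%:E) (2^-1).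
Proof.
rewrite /vL2norm unlock /=; congr poweR; apply: eq_integral => x _ /=.
by rewrite ger0_norm ?sqrtr_ge0// powR_mulrn// sqrtr_ge0.
Qed.

Lemma vL2norm_sqintg : (forall i, sqintg mu (ReF (Fi i)) /\ sqintg mu (ImF (Fi i))) ->
  vL2norm F = (Num.sqrt (\sum_i sqnorm (Fi i)))%:E.
Proof.
move=> si; rewrite vL2normE; under eq_integral do rewrite cvnorm_sqr.
have sj i : intg mu (fun x => ReF (Fi i) x ^+ 2 + ImF (Fi i) x ^+ 2).
  by apply: intgD; [exact: (si i).1.2|exact: (si i).2.2].
have [ii ie] := rint_sum (index_enum 'I_d) sj.
rewrite (rintE ii) ie poweR_EFin powR12_sqrt; last first.
  by apply: sumr_ge0 => i _; apply: rint_ge0 => x; rewrite addr_ge0 ?sqr_ge0.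
congr (Num.sqrt _)%:E; apply: eq_bigr => i _.
by rewrite rintD//; [exact: (si i).1.2|exact: (si i).2.2].
Qed.

Lemma vL2norm_lty : (forall i, cmeasurable (Fi i)) -> (vL2norm F < +oo)%E ->
  forall i, sqintg mu (ReF (Fi i)) /\ sqintg mu (ImF (Fi i)).
Proof.
move=> mF; rewrite vL2normE => Foo.
have mi i := (mF i).1; have mi' i := (mF i).2.
have ms : measurable_fun setT (fun x => cvnorm (F x) ^+ 2).
  under eq_fun do rewrite cvnorm_sqr; apply: measurable_sum => i.
  by apply: measurable_funD; apply: measurable_funX; [exact: mi|exact: mi'].
have si : intg mu (fun x => cvnorm (F x) ^+ 2).
  apply: intg_ge0 => //; first by move=> x; exact: sqr_ge0.
  rewrite ltNge leye_eq; apply/negP => /eqP e; move: Foo; rewrite e poweRyr ?invr_neq0//.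
have le i x : ReF (Fi i) x ^+ 2 + ImF (Fi i) x ^+ 2 <= cvnorm (F x) ^+ 2.
  rewrite cvnorm_sqr (bigD1 i)//= lerDl; apply: sumr_ge0 => j _.
  by rewrite addr_ge0 ?sqr_ge0.
move=> i; split; split.
- exact: mi.
- apply: (intg_dom _ _ si); first by apply: measurable_funX; exact: mi.
  by move=> x; rewrite ger0_norm ?sqr_ge0//; apply: le_trans (le i x); rewrite lerDl sqr_ge0.
- exact: mi'.
- apply: (intg_dom _ _ si); first by apply: measurable_funX; exact: mi'.
  by move=> x; rewrite ger0_norm ?sqr_ge0//; apply: le_trans (le i x); rewrite lerDr sqr_ge0.
Qed.

End vector_valued.

Lemma scalar_funE f : (fun x => scalar_fun f x ord0 ord0) = f.
Proof. by apply/funext => x; rewrite mxE. Qed.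

Lemma region1 : [set: 'rV[R]_n] = region 1.
Proof. by apply/seteqP; split=> x _ //; rewrite /region /reg /= ltr_pwDl// dotp_ge0. Qed.

Lemma region0 : [set~ (0 : 'rV[R]_n)] = region 0.
Proof.
apply/seteqP; split=> x; rewrite /region /reg /= add0r -sqr_enorm.
  by move=> /eqP x0; rewrite exprn_gt0// enorm_gt0.
by move=> h x0; move: h; rewrite x0 enorm0 expr0n ltxx.
Qed.

Lemma Hs_symbol (s : R) :
  (fun xi : 'rV[R]_n => (1 + enorm xi ^+ 2) `^ (s / 2)) = (fun xi => reg 1 xi `^ (s / 2)).
Proof. by apply/funext => x; rewrite sqr_enorm. Qed.

Lemma dHs_symbol (s : R) :
  (fun xi : 'rV[R]_n => enorm xi `^ s) = (fun xi => reg 0 xi `^ (s / 2)).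
Proof.
apply/funext => x; rewrite /reg add0r -sqr_enorm -powR_mulrn ?enorm_ge0// -powRrM.
by rewrite mulrC divfK.
Qed.

Definition cconv d (k : 'I_d -> 'rV[R]_n -> R) f : 'rV[R]_n -> 'rV[R[i]]_d :=
  fun x => \row_i Complex (rconv (k i) (ReF f) x) (rconv (k i) (ImF f) x).

Lemma convE d (k : 'rV[R]_n -> 'rV[R]_d) f :
  Defs.conv k f = cconv (fun i u => k u ord0 i) f.
Proof.
apply/funext => x; apply/rowP => i; rewrite !mxE /cintegral; congr Complex; apply: eq_rint => y.
  by rewrite /ReF; case: (f y) => a b /=; ring.
by rewrite /ImF; case: (f y) => a b /=; ring.
Qed.

(* Reduction of a bound between multiplier norms to the symbols of the
   components of the kernel. *)
Theorem multiplier_norm_cconv (chi : R -> R) c a1 a2 (k m : 'I_n -> 'rV[R]_n -> R) f (B D : R) :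
  cutoff chi -> 0 <= B -> Num.sqrt n%:R * B <= D -> 0 < D ->
  (forall i, measurable_fun setT (k i)) ->
  (tempered f -> exists L, forall i, conv_fin (k i) L (ReF f) /\ conv_fin (k i) L (ImF f)) ->
  (forall i x, region c x -> {for x, continuous (m i)}) ->
  (forall i psi, tf c psi -> forall y,
     FC (fun x => m i x * psi x) y = rint mu (fun u => k i u * FS psi (u + y))) ->
  (forall i psi, tf c psi -> forall y,
     FS (fun x => m i x * psi x) y = - rint mu (fun u => k i u * FC psi (u + y))) ->
  (forall i x, region c x -> `|m i x| * reg c x `^ a2 <= B * reg c x `^ a1) ->
  (multiplier_norm (region c) (fun x => reg c x `^ a2)%R (cconv k f) <=
   D%:E * multiplier_norm (region c) (fun x => reg c x `^ a1)%R (scalar_fun f))%E.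
Proof.
(* Dividing by [D] leaves an infimum alone on the right, so it suffices to bound the left-hand side
   for each candidate [g]; then [D] is put back. *)
move=> hchi B0 BD D0 mk hL cm mC mS mB; rewrite -lee_pdivrMl//.
apply: le_ereal_inf_tmp => _ [g gm <-]; rewrite lee_pdivrMl//.
have := gm ord0; rewrite scalar_funE => /is_multiplierP[tempf tempg rm].
have [goo|] := ltP (vL2norm g) +oo%E; last first.
  by rewrite leye_eq => /eqP ->; rewrite gt0_muley ?lte_fin// leey.
have gmeas (i : 'I_1) : cmeasurable (fun x => g x ord0 i) by rewrite (ord1 i); exact: tempg.1.
have gs := vL2norm_lty gmeas goo; have [g1i g2i] := gs ord0.
have [L hLi] := hL tempf; have [mf1 mf2] := tempf.1.
have /choice[G hG] (i : 'I_n) : exists G : 'rV[R]_n -> R[i],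
    [/\ sqintg mu (ReF G), sqintg mu (ImF G), sqnorm G <= B ^+ 2 * sqnorm (fun x => g x ord0 ord0) &
     rmult c a2 (rconv (k i) (ReF f)) (rconv (k i) (ImF f)) (ReF G) (ImF G)].
  have [G1 [G2 [G1i G2i GB GM]]] := @convolution_multiplier R n (k i) (ReF f) (ImF f) L (mk i)
    chi c a1 a2 B (m i) _ _ hchi mf1 mf2 (hLi i).1 (hLi i).2 (cm i) (mC i) (mS i) (mB i) g1i g2i rm.
  by exists (fun x => Complex (G1 x) (G2 x)).
pose GG : 'rV[R]_n -> 'rV[R[i]]_n := fun x => \row_i G i x.
have GGi i : (fun x => GG x ord0 i) = G i by apply/funext => x; rewrite mxE.
(* The left-hand side is an infimum as well, so a single candidate, assembled from the components,
   is enough. *)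
apply: ge_ereal_inf; exists (vL2norm GG).
  exists GG; last reflexivity.
  move=> i; rewrite GGi; apply/is_multiplierP.
  have [G1 G2 _ GM] := hG i.
  have RE : ReF (fun x => cconv k f x ord0 i) = rconv (k i) (ReF f).
    by apply/funext => x; rewrite /ReF mxE.
  have IE : ImF (fun x => cconv k f x ord0 i) = rconv (k i) (ImF f).
    by apply/funext => x; rewrite /ImF mxE.
  split.
  - apply: (@wint_tempered L).
      by rewrite RE; exact: (@wint_rconv R n (k i) L (mk i) (ReF f) mf1 (hLi i).1).
    by rewrite IE; exact: (@wint_rconv R n (k i) L (mk i) (ImF f) mf2 (hLi i).2).
  (* A square-integrable function is tempered: its product with the square-integrable weight
     [(1 + |x|)^-(n+1)] is integrable. *)
  - have mw := @measurable_weight R n n.+1.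
    have sw : sqintg mu (fun x : 'rV[R]_n => (1 + enorm x) ^- n.+1).
      split=> //; apply: (intg_dom _ _ (intg_weight R (ltnSn n))).
        exact: measurable_funX.
      move=> x; rewrite ger0_norm ?sqr_ge0// expr2 ler_piMr ?(ltW (weight_gt0 _ _))//.
      by rewrite invf_le1 ?exprn_ege1 ?exprn_gt0 ?ltr_wpDr ?lerDl ?enorm_ge0.
    by apply: (@wint_tempered n.+1); split; [exact: G1.1|exact: sqintgM|exact: G2.1|exact: sqintgM].
  - by rewrite RE IE.
have GGs i : sqintg mu (ReF (fun x => GG x ord0 i)) /\ sqintg mu (ImF (fun x => GG x ord0 i)).
  by rewrite GGi; have [G1 G2 _ _] := hG i.
rewrite (vL2norm_sqintg GGs) (vL2norm_sqintg gs) -EFinM lee_fin big_ord1.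
set q := sqnorm _; have q0 : 0 <= q by exact: sqnorm_ge0.
(* The factor [sqrt n] in the bound on [D] comes from summing the squares of [n] components. *)
apply: le_trans (_ : Num.sqrt (n%:R * (B ^+ 2 * q)) <= _).
  apply: ler_wsqrtr; apply: le_trans (_ : \sum_(i < n) (B ^+ 2 * q) <= _); last first.
    by rewrite sumr_const card_ord mulr_natl.
  by apply: ler_sum => i _; rewrite GGi; have [_ _ h _] := hG i.
rewrite sqrtrM ?ler0n// sqrtrM ?sqr_ge0// sqrtr_sqr (ger0_norm B0) mulrA.
by rewrite ler_wpM2r ?sqrtr_ge0.
Qed.

End complex_functions.

(** * The three estimates *)

Section bounds.
Context (R : realType) (n : nat).
Notation mu := (leb R n).
Implicit Types (f : 'rV[R]_n -> R[i]) (x y u xi : 'rV[R]_n) (b s D : R).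

Lemma kerK1E (chi : R -> R) b : (fun (i : 'I_n) (u : 'rV[R]_n) => kerK1 chi b u ord0 i) =
  (fun i => rker (fun r => chi (b * r)) (kexp n b) i).
Proof. by apply/funext => i; apply/funext => u; rewrite !mxE. Qed.

Lemma kerK2E (chi : R -> R) b : (fun (i : 'I_n) (u : 'rV[R]_n) => kerK2 chi b u ord0 i) =
  (fun i => outer_kernel chi b i).
Proof. by apply/funext => i; apply/funext => u; rewrite !mxE. Qed.

Lemma Hs_norm_T1 (chi : R -> R) b s f D : cutoff chi -> 0 < b < n%:R ->
  Num.sqrt n%:R * cutC R n <= D -> 0 < D ->
  (Hs_norm s (T1 chi b f) <= D%:E * Hs_norm s (scalar_fun f))%E.
Proof.
move=> hchi /andP[b0 bn] BD D0.
have ki i := intg_cutoff_kernel (n := n) i hchi b0.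
rewrite /Hs_norm region1 Hs_symbol /T1 convE kerK1E.
apply: (@multiplier_norm_cconv R n chi 1 (s / 2) (s / 2)
  (fun i => rker (fun r => chi (b * r)) (kexp n b) i)
  (fun i => FS (rker (fun r => chi (b * r)) (kexp n b) i)) f (cutC R n) D hchi (cutC_ge0 R n) BD D0).
- by move=> i; exact: intg_measurable (ki i).
- move=> /tempered_wint[N [w1 w2 _]]; exists N => i.
  have r0 : 0 <= 2 / b by rewrite divr_ge0// ltW.
  have ks u : rker (fun r => chi (b * r)) (kexp n b) i u != 0 -> enorm u <= 2 / b.
    move=> ku; rewrite leNgt; apply/negP => /ltW h; move: ku.
    by rewrite /rker (cutoff_outer hchi b0 h) mul0r eqxx.
  by split; [exact: conv_fin_compact (ki i) r0 ks w1|exact: conv_fin_compact (ki i) r0 ks w2].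
- by move=> i x _; exact: (@continuous_FS R n _ (ki i) x).
- move=> i psi tp y; apply: FC_FS_mul; [exact: ki|exact: cc_intg (tf_cc tp)|exact: rker_odd].
- move=> i psi tp y; apply: FS_FS_mul; [exact: ki|exact: cc_intg (tf_cc tp)|exact: rker_odd].
- by move=> i x _; apply: ler_wpM2r; [exact: powR_ge0|exact: cutoff_bound].
Qed.

(** The space contains a box of positive measure, so it is not negligible. *)
Lemma ae_exists (P : 'rV[R]_n -> Prop) : {ae mu, forall x, P x} -> exists x, P x.
Proof.
move=> [A [mA A0 PA]]; apply: contrapT => /forallNP nP.
have AT : A = setT by apply/seteqP; split=> // x _; apply: PA; exact: nP.
have := lebesgue_box_gt0 n (@ltr01 R); rewrite ltNge => /negP; apply.
rewrite -A0 AT; apply: le_measure; rewrite ?inE//.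
exact: measurable_box.
Qed.

Lemma enorm_kerK2 (chi : R -> R) b u : cutoff chi -> 0 < b ->
  enorm (kerK2 chi b u) = outer_norm chi b u.
Proof.
move=> hchi b0; rewrite /kerK2 /kerK /outer_norm !enormZ.
have [->|u0] := eqVneq u 0.
  rewrite enorm0 !mulr0; have /(_ b b0 0) := outer_profile_inner hchi.
  by rewrite lexx invr_ge0 (ltW b0) => /(_ isT isT) ->; rewrite normr0 mul0r.
have e0 : 0 < enorm u by rewrite enorm_gt0.
congr (_ * _); rewrite ger0_norm ?invr_ge0 ?powR_ge0//.
rewrite -powRN -[X in _ * X](powRr1 (ltW e0)) -powRD; last by rewrite (gt_eqF e0) implybT.
by congr (_ `^ _); ring.
Qed.

(** One point of absolute convergence yields the integrability of [f] against [(1 + |y|)^(b - n)],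
    and Peetre's inequality spreads it to a weighted bound over all points. *)
Lemma conv_fin_T2 (chi : R -> R) b f : cutoff chi -> 0 < b -> b <= n%:R ->
  conv_defined (kerK2 chi b) f -> tempered f -> exists L, forall i : 'I_n,
  conv_fin (outer_kernel chi b i) L (ReF f) /\ conv_fin (outer_kernel chi b i) L (ImF f).
Proof.
move=> hchi b0 bn cd tempf; have [N [w1 w2 wn]] := tempered_wint tempf.
have [x0 hx0] := ae_exists cd; have [m1 _] := w1; have [m2 _] := w2; have [mn _] := wn.
have mo := @measurable_outer_norm R n chi b hchi.
have ki : intg mu (fun y => outer_norm chi b (x0 - y) * normc (f y)).
  apply: intg_ge0.
  - have mx : measurable_fun setT (fun y => outer_norm chi b (x0 - y)).
      by apply: (measurableT_comp mo); apply: measurable_rVB; [exact: measurable_cst|exact: measurable_id].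
    exact: measurable_funM mx mn.
  - move=> y; rewrite mulr_ge0 ?normc_ge0//.
    by have /andP[] := outer_norm_bounded hchi b0 bn (x0 - y).
  - have -> : (fun y => (outer_norm chi b (x0 - y) * normc (f y))%:E) =
        (fun y => (enorm (kerK2 chi b (x0 - y)) * normc (f y))%:E).
      by apply/funext => y; rewrite enorm_kerK2.
    exact: hx0.
have wi := intg_outer_weight hchi b0 bn wn (fun y => normc_ge0 (f y)) ki.
have dom (h : 'rV[R]_n -> R) : measurable_fun setT h -> (forall y, `|h y| <= normc (f y)) ->
    intg mu (fun y => (1 + enorm y) `^ (- (n%:R - b)) * h y).
  move=> mh hh; apply: (intg_dom _ _ wi).
    apply: measurable_funM => //.
    have mid : measurable_fun setT (fun x : 'rV[R]_n => x) by exact: measurable_id.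
    have m1' : measurable_fun setT (fun x : 'rV[R]_n => 1 + enorm x).
      by apply: measurable_funD => //; exact: measurable_enorm.
    exact: (measurableT_comp (@measurable_powR R (- (n%:R - b))) m1').
  by move=> y; rewrite normrM (ger0_norm (powR_ge0 _ _)) ler_wpM2l ?powR_ge0.
exists (n + n.+1)%N => i; split; apply: conv_fin_outer => //; apply: dom => // y.
  exact: Re_le_normc.
exact: Im_le_normc.
Qed.

(** Writing [|xi|^s = |xi| |xi|^(s-1)], the bound on [|xi|] times the symbol is the gain of one
    derivative. *)
Lemma dHs_norm_T2 (chi : R -> R) b s f D : cutoff chi -> 0 < b < 1 -> b <= n%:R ->
  conv_defined (kerK2 chi b) f ->
  Num.sqrt n%:R * (annC R n * (b `^ (1 - b) / (1 - b))) <= D -> 0 < D ->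
  (dHs_norm s (T2 chi b f) <= D%:E * dHs_norm (s - 1) (scalar_fun f))%E.
Proof.
move=> hchi /andP[b0 b1] bn cd BD D0.
rewrite /dHs_norm region0 !dHs_symbol /T2 convE kerK2E.
have B0 : 0 <= annC R n * (b `^ (1 - b) / (1 - b)).
  by rewrite mulr_ge0 ?annC_ge0// divr_ge0 ?powR_ge0// subr_ge0 ltW.
have r0 x : region 0 x -> x != 0.
  by rewrite -region0 /= => /eqP.
apply: (@multiplier_norm_cconv R n chi 0 ((s - 1) / 2) (s / 2)
  (fun i => outer_kernel chi b i) (fun i => outer_symbol chi b i) f _ D hchi B0 BD D0).
- by move=> i; exact: measurable_outer_kernel.
- exact: conv_fin_T2.
- by move=> i x /r0 x0; exact: outer_symbol_continuous.
- by move=> i psi tp y; exact: FC_outer_symbol.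
- by move=> i psi tp y; exact: FS_outer_symbol.
- move=> i x /r0 x0; have e0 : 0 < enorm x by rewrite enorm_gt0.
  have sE t : reg 0 x `^ (t / 2) = enorm x `^ t.
    by have /(congr1 (fun h => h x)) := dHs_symbol n t.
  rewrite !sE; have -> : enorm x `^ s = enorm x * enorm x `^ (s - 1).
    rewrite -[X in X * _](powRr1 (ltW e0)) -powRD; last by rewrite (gt_eqF e0) implybT.
    by congr (_ `^ _); ring.
  rewrite (mulrA `|_|); apply: ler_wpM2r; first exact: powR_ge0.
  by rewrite mulrC; exact: outer_symbol_bound.
Qed.

(** Under the root, 32 is 16 from the squared profile times 2 for the real and imaginary parts, and
    [n] counts the components; [e] bounds [b^(-b)]. *)
Definition youngC : R := Num.sqrt (32 * n%:R * radC n n%:R) * expR 1.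

(** The square root of [b^(n - 2 b)] is [b^(n/2) b^(-b)]. *)
Lemma sqrt_powR_div_le b : 0 < b -> 0 < n%:R - 2 * b ->
  Num.sqrt (b `^ (n%:R - 2 * b) / (n%:R - 2 * b)) <=
  expR 1 * (b `^ (n%:R / 2) / Num.sqrt (n%:R - 2 * b)).
Proof.
move=> b0 n2b; rewrite (sqrtrM _ (powR_ge0 _ _)) (sqrtrV (ltW n2b)) mulrA.
apply: ler_wpM2r; first by rewrite invr_ge0 sqrtr_ge0.
rewrite -powR12_sqrt ?powR_ge0// -powRrM.
have -> : (n%:R - 2 * b) * 2^-1 = - b + n%:R / 2 by field.
rewrite powRD; last by rewrite (gt_eqF b0) implybT.
by apply: ler_wpM2r; [exact: powR_ge0|exact: powR_selfN_le].
Qed.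

(** The real and imaginary parts of every component are dominated pointwise by [H], the convolution
    of the Euclidean norm of the kernel with [|f|], so the scalar inequality is applied once. *)
Lemma vL2norm_T2 (chi : R -> R) b f : cutoff chi -> 0 < b -> 0 < n%:R - 2 * b ->
  cmeasurable f -> (L1norm f < +oo)%E ->
  (vL2norm (T2 chi b f) <= (youngC * (b `^ (n%:R / 2) / Num.sqrt (n%:R - 2 * b)))%:E * L1norm f)%E.
Proof.
move=> hchi b0 n2b mf f1; have [m1 m2] := mf; have mn := measurable_normc mf.
have bn : b <= n%:R by move: n2b; have := b0; move: (n%:R : R) => t; lra.
have L1 : L1norm f = (\int[mu]_x (normc (f x))%:E)%E.
  by rewrite /L1norm Lnorm1; apply: eq_integral => x _ /=; rewrite ger0_norm// normc_ge0.
have fi : intg mu (fun x => normc (f x)).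
  by apply: intg_ge0 => //; [move=> x; exact: normc_ge0|rewrite -L1].
rewrite L1 (rintE fi); set S := rint mu _.
have S0 : 0 <= S by apply: rint_ge0 => x; exact: normc_ge0.
have mo := @measurable_outer_norm R n chi b hchi.
have ob := @outer_norm_bounded R n chi b hchi b0 bn.
have [ons onb] := outer_norm_sqr hchi b0 n2b.
have [si sH bH] := young_L2 mo ob ons fi (fun y => normc_ge0 (f y)).
pose H := rconv (outer_norm chi b) (fun x => normc (f x)).
have kle i u : `|outer_kernel chi b i u| <= outer_norm (n := n) chi b u.
  apply: le_trans (rker_le _ _ _ _) _; rewrite /outer_norm /outer_profile.
  by rewrite (_ : 1 - kexp n b = b - n%:R)//; rewrite /kexp; ring.
have mk i := @measurable_outer_kernel R n chi b i hchi.
have comp (h : 'rV[R]_n -> R) i : measurable_fun setT h -> (forall y, `|h y| <= normc (f y)) ->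
    sqintg mu (rconv (outer_kernel chi b i) h) /\
    rint mu (fun x => rconv (outer_kernel chi b i) h x ^+ 2) <= rint mu (fun x => H x ^+ 2).
  move=> mh hh; have mr := measurable_rconv (mk i) mh.
  have slice x : intg mu (fun y => outer_kernel chi b i (x - y) * h y).
    apply: (intg_dom _ _ (si x)); first exact: measurable_conv_slice.
    by move=> y; rewrite normrM ler_pM.
  have le x : rconv (outer_kernel chi b i) h x ^+ 2 <= H x ^+ 2.
    rewrite -(real_normK (num_real (rconv _ h x))); apply: lerXn2r; rewrite ?nnegrE//.
      apply: rint_ge0 => y; rewrite mulr_ge0 ?normc_ge0//.
      by have /andP[] := ob (x - y).
    apply: rint_norm_le; [exact: slice|exact: si|].
    by move=> y; rewrite normrM ler_pM.
  have ri : intg mu (fun x => rconv (outer_kernel chi b i) h x ^+ 2).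
    apply: (intg_dom _ _ sH.2); first exact: measurable_funX.
    by move=> x; rewrite ger0_norm ?sqr_ge0.
  by split; [split|apply: rint_le => //; exact: sH.2].
have cR i := comp _ i m1 (fun y => Re_le_normc (f y)).
have cI i := comp _ i m2 (fun y => Im_le_normc (f y)).
rewrite /T2 convE kerK2E.
have RE i : ReF (fun x => cconv (fun i => outer_kernel chi b i) f x ord0 i) = rconv (outer_kernel chi b i) (ReF f).
  by apply/funext => x; rewrite /ReF mxE.
have IE i : ImF (fun x => cconv (fun i => outer_kernel chi b i) f x ord0 i) = rconv (outer_kernel chi b i) (ImF f).
  by apply/funext => x; rewrite /ImF mxE.
rewrite vL2norm_sqintg; last first.
  by move=> i; rewrite RE IE; split; [exact: (cR i).1|exact: (cI i).1].
rewrite -EFinM lee_fin.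
pose c := n%:R - 2 * b.
apply: le_trans (_ : Num.sqrt (n%:R * (2 * (16 * (radC n n%:R * (b `^ c / c)) * S ^+ 2))) <= _).
  apply: ler_wsqrtr; apply: le_trans (_ : \sum_(i < n) (2 * rint mu (fun x => H x ^+ 2)) <= _).
    apply: ler_sum => i _; rewrite /sqnorm RE IE mulr2n mulrDl mul1r.
    by apply: lerD; [exact: (cR i).2|exact: (cI i).2].
  rewrite sumr_const card_ord -[leLHS]mulr_natl ler_wpM2l// ler_pM2l//.
  by apply: le_trans bH _; apply: ler_wpM2r => //; exact: sqr_ge0.
have rC := radC_gt0 n (n%:R : R).
have -> : n%:R * (2 * (16 * (radC n n%:R * (b `^ c / c)) * S ^+ 2)) =
   (32 * n%:R * radC n n%:R) * (b `^ c / c) * S ^+ 2 by ring.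
have k0 : 0 <= 32 * n%:R * radC n (n%:R : R) by apply: mulr_ge0 (ltW rC); rewrite mulr_ge0.
have bc0 : 0 <= b `^ c by exact: powR_ge0.
rewrite sqrtrM; last by rewrite mulr_ge0// divr_ge0// ltW.
rewrite sqrtr_sqr (ger0_norm S0); apply: ler_wpM2r; first exact: S0.
rewrite (sqrtrM _ k0) /youngC -(mulrA (Num.sqrt (32 * n%:R * radC n n%:R))).
by apply: ler_wpM2l; [exact: sqrtr_ge0|exact: sqrt_powR_div_le].
Qed.

End bounds.

Theorem proposition3p1 (R : realType) (n : nat) (n_ge1 : (1 <= n)%N)
    (s : R) (s_gt0 : 0 < s) :
  exists C : R, forall (chi : R -> R), cutoff chi ->
  [/\ forall (beta : R) (f : 'rV[R]_n -> R[i]),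
        0 < beta < n%:R ->
        cmeasurable f -> conv_defined (kerK1 chi beta) f ->
        (Hs_norm s (scalar_fun f) < +oo)%E ->
        (Hs_norm s (T1 chi beta f) <= C%:E * Hs_norm s (scalar_fun f))%E,
      forall (beta : R) (f : 'rV[R]_n -> R[i]),
        0 < beta < n%:R / 2 ->
        cmeasurable f -> conv_defined (kerK2 chi beta) f ->
        (L1norm f < +oo)%E ->
        (vL2norm (T2 chi beta f) <=
         (C * (beta `^ (n%:R / 2) / Num.sqrt (n%:R - 2 * beta)))%:E
         * L1norm f)%E &
      1 <= s ->
      forall (beta : R) (f : 'rV[R]_n -> R[i]),
        0 < beta < 1 ->
        cmeasurable f -> conv_defined (kerK2 chi beta) f ->
        (dHs_norm (s - 1) (scalar_fun f) < +oo)%E ->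
        (dHs_norm s (T2 chi beta f) <=
         (C * (beta / (1 - beta) + (2 `^ beta - 1) / beta * beta `^ (- beta)))%:E
         * dHs_norm (s - 1) (scalar_fun f))%E].
Proof.
pose q := Num.sqrt (n%:R : R); have q0 : 0 <= q by exact: sqrtr_ge0.
have c1 : 0 <= q * cutC R n by rewrite mulr_ge0// cutC_ge0.
have c3 : 0 <= q * annC R n * expR 1 by rewrite !mulr_ge0 ?annC_ge0 ?expR_ge0.
have c2 : 0 <= youngC R n by rewrite mulr_ge0 ?sqrtr_ge0 ?expR_ge0.
(* One summand for each of the three estimates; the 1 makes the constant positive, as division by it
   requires. *)
pose C := q * cutC R n + q * annC R n * expR 1 + youngC R n + 1.
have C0 : 0 < C by rewrite ltr_wpDl// !addr_ge0.
(* The constant precedes [chi]: the cutoff entered only through bounds shared by all cutoffs, such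
   as [|chi'| <= 2] and [|chi| <= 2] on nonnegative arguments. *)
exists C => chi hchi; split.
- move=> b f bn _ _ _; apply: Hs_norm_T1 => //.
  by rewrite /C -/q -!addrA lerDl !addr_ge0.
- move=> b f /andP[b0 bn] mf _ f1.
  have n2b : 0 < n%:R - 2 * b.
    by move: bn; rewrite ltr_pdivlMr// => bn; rewrite subr_gt0 mulrC.
  apply: le_trans (vL2norm_T2 hchi b0 n2b mf f1) _.
  apply: lee_wpmul2r; first exact: Lnorm_ge0.
  rewrite lee_fin; apply: ler_wpM2r.
    by rewrite divr_ge0 ?powR_ge0 ?sqrtr_ge0.
  by rewrite /C -addrA addrCA lerDl !addr_ge0.
- move=> _ b f bb mf cd _; have /andP[b0 b1] := bb.
  have bn : b <= n%:R by apply: le_trans (ltW b1) _; rewrite ler1n.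
  have b10 : 0 < 1 - b by rewrite subr_gt0.
  have x0 : 0 < b / (1 - b) by rewrite divr_gt0.
  have y0 : 0 <= (2 `^ b - 1) / b * b `^ (- b).
    rewrite mulr_ge0 ?powR_ge0// divr_ge0 ?(ltW b0)// subr_ge0.
    have := @ler_powR R 2 _ 0 b; rewrite ler1n powRr0; apply=> //.
    exact: ltW.
  have D0 : 0 < C * (b / (1 - b) + (2 `^ b - 1) / b * b `^ (- b)).
    by rewrite mulr_gt0// ltr_wpDr.
  apply: dHs_norm_T2 => //; rewrite -/q.
  (* As [b^(1-b) = b b^(-b)], the bound on the outer symbol is at most [e b / (1 - b)], a multiple
     of the first summand of the claimed factor. *)
  have bE : b `^ (1 - b) <= b * expR 1.
    rewrite powRD; last by rewrite (gt_eqF b0) implybT.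
    by rewrite powRr1 ?(ltW b0)// ler_wpM2l ?(ltW b0)// powR_selfN_le.
  apply: le_trans (_ : q * annC R n * expR 1 * (b / (1 - b)) <= _).
    have -> : q * annC R n * expR 1 * (b / (1 - b)) = q * (annC R n * (b * expR 1 / (1 - b))) by ring.
    apply: ler_wpM2l => //; apply: ler_wpM2l; first exact: annC_ge0.
    by rewrite ler_wpM2r// invr_ge0 ltW.
  apply: ler_pM => //; first exact: ltW.
    by rewrite /C -!addrA addrCA lerDl !addr_ge0.
  by rewrite lerDl.
Qed.
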